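(* There exists an operator $\boldsymbol E_h:\boldsymbol V^h\to[H^1_0(\Omega_h)]^2$ and a constant $C$ independent of the mesh size such that for all $\boldsymbol v\in\boldsymbol V^h$, $$\|\boldsymbol v-\boldsymbol E_h\boldsymbol v\|_{L^2(T)}+h_T\|\nabla(\boldsymbol v-\boldsymbol E_h\boldsymbol v)\|_{L^2(T)}\le Ch_T^2\|\nabla\boldsymbol v\|_{L^2(T)}\qquad\forall T\in\mathcal T_h.$$
   Context: Mesh. $\Omega\subset\mathbb R^2$ is a sufficiently smooth domain (boundary given by finitely many local charts). $\tilde{\mathcal T}_h$ is a member of a shape-regular family of affine (straight-sided) triangulations with mesh size $h=\max_{\tilde T}\mathrm{diam}(\tilde T)$ sufficiently small, whose boundary vertices lie on $\partial\Omega$, each triangle having at most two boundary vertices; $\tilde\Omega_h=\mathrm{int}\big(\bigcup_{\tilde T\in\tilde{\mathcal T}_h}\overline{\tilde T}\big)$ is an $O(h^2)$ polygonal approximation of $\Omega$. $G:\tilde\Omega_h\to\Omega$ is a bijection with $\|G\|_{W^{1,\infty}(\tilde\Omega_h)}\le C$, $G(x)=x$ at all vertices, and $G$ the identity on every triangle with three interior vertices. $G_h$ is the piecewise quadratic nodal (vertices and edge midpoints) interpolant of $G$, with $\|DG_h\|_{W^{1,\infty}(\tilde T)}\le C$ and $\|DG_h^{-1}\|_{W^{1,\infty}(\tilde T)}\le C$ for all $\tilde T$. $\mathcal T_h=\{G_h(\tilde T):\tilde T\in\tilde{\mathcal T}_h\}$ is the isoparametric mesh and $\Omega_h=\mathrm{int}\big(\bigcup_{T\in\mathcal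 T_h}\overline T\big)$. $\hat T$ is the reference triangle with vertices $(1,0),(0,1),(0,0)$; for $T=G_h(\tilde T)$, $F_{\tilde T}:\hat T\to\tilde T$ is an affine bijection with $|F_{\tilde T}|_{W^{1,\infty}(\hat T)}\le Ch_T$, $|F_{\tilde T}^{-1}|_{W^{1,\infty}(\tilde T)}\le Ch_T^{-1}$, $F_T=G_h\circ F_{\tilde T}:\hat T\to T$, $h_T=\mathrm{diam}(\tilde T)$, and $|F_T|_{W^{m,\infty}(\hat T)}\le Ch_T^m$ ($0\le m\le2$), $|F_T^{-1}|_{W^{m,\infty}(T)}\le Ch_T^{-m}$ ($0\le m\le 3$), $c_1h_T^2\le\det(DF_T)\le c_2h_T^2$. Interior edges of $\mathcal T_h$ are straight and are edges of $\tilde{\mathcal T}_h$; if $e=F_T(\hat e)$ is a straight edge then $F_T|_{\hat e}$ is affine; if all edges of $T$ are straight then $F_T$ is affine and $T=\tilde T$. All constants are independent of the mesh size. Spaces. $\hat T^{ct}$ is the Clough–Tocher split of $\hat T$ into three triangles obtained by joining the vertices to the barycenter; $\hat{\boldsymbol V}=\{\hat{\boldsymbol v}\in [H^1(\hat T)]^2:\hat{\boldsymbol v}|_{\hat K}\in[\mathcal P_2(\hat K)]^2\ \forall\hat K\in\hat T^{ct}\}$ ($\mathcal P_k$: polynomials of degree $\le k$). With $A_T=DF_T/\det(DF_T)$: $\tilde{\boldsymbol V}(\tilde T)=\{\tilde{\boldsymbol v}:\tilde{\boldsymbol v}(F_{\tilde T}(\hat x))=\hat{\boldsymbol v}(\hat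 x),\ \hat{\boldsymbol v}\in\hat{\boldsymbol V}\}$, $\boldsymbol V(T)=\{\boldsymbol v:\boldsymbol v(F_T(\hat x))=A_T(\hat x)\hat{\boldsymbol v}(\hat x),\ \hat{\boldsymbol v}\in\hat{\boldsymbol V}\}$. $\mathcal N_{\hat T}$ is the set of the 4 vertices and 6 edge midpoints of $\hat T^{ct}$, $\mathcal N_{\tilde T}=F_{\tilde T}(\mathcal N_{\hat T})$. $\tilde{\boldsymbol V}^h=\{\tilde{\boldsymbol v}\in[H^1_0(\tilde\Omega_h)]^2:\tilde{\boldsymbol v}|_{\tilde T}\in\tilde{\boldsymbol V}(\tilde T)\ \forall\tilde T\}$. $\Psi$ is defined elementwise by: $(\Psi\tilde{\boldsymbol v})|_T\in\boldsymbol V(T)$ is the unique function with $(\Psi\tilde{\boldsymbol v})|_T(a)=\tilde{\boldsymbol v}|_{\tilde T}(\tilde a)$ for all $\tilde a\in\mathcal N_{\tilde T}$, $a=G_h(\tilde a)$. $\boldsymbol V^h=\Psi(\tilde{\boldsymbol V}^h)$. *)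

(* Defs.v *)
From HB Require Import structures.
From mathcomp Require Import all_boot all_order all_algebra.
From mathcomp Require Import all_classical all_reals all_analysis.

Set Implicit Arguments.
Unset Strict Implicit.
Unset Printing Implicit Defensive.

Import Order.TTheory GRing.Theory Num.Theory.
Import numFieldNormedType.Exports.

Local Open Scope classical_set_scope.
Local Open Scope ring_scope.

Section Plane.
Variable R : realType.

Definition pt : Type := (R * R)%type.

Definition co (i : 'I_2) (x : pt) : R := if i == 0 then x.1 else x.2.

Definition e_ (j : 'I_2) : pt := if j == 0 then (1, 0) else (0, 1).

(* Euclidean; the canonical norm of R * R is the max norm. *)
Definition enorm (x : pt) : R := Num.sqrt (x.1 ^+ 2 + x.2 ^+ 2).

Definition frob (A : 'M[R]_2) : R := Num.sqrt (\sum_i \sum_j A i j ^+ 2).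

Definition mxact (A : 'M[R]_2) (x : pt) : pt :=
  (A 0 0 * x.1 + A 0 1 * x.2, A 1 0 * x.1 + A 1 1 * x.2).

Definition bnd (A : set pt) : set pt := closure A `\` interior A.

Definition diam (A : set pt) : R :=
  sup [set d | exists x y, [/\ A x, A y & d = enorm (x - y)]].

Definition ctri (v : 'I_3 -> pt) : set pt :=
  [set x | exists l : 'I_3 -> R,
     [/\ forall k, 0 <= l k, \sum_k l k = 1 & x = \sum_k l k *: v k]].

Definition otri (v : 'I_3 -> pt) : set pt :=
  [set x | exists l : 'I_3 -> R,
     [/\ forall k, 0 < l k, \sum_k l k = 1 & x = \sum_k l k *: v k]].

Definition seg (a b : pt) : set pt :=
  [set x | exists t : R, [/\ 0 <= t, t <= 1 & x = (1 - t) *: a + t *: b]].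

Definition straight (S : set pt) : Prop := exists a b, S = seg a b.

Definition mid (a b : pt) : pt := (2^-1 : R) *: (a + b).

(* P_d (total degree at most d), scalar and vector valued *)
Definition polyP (d : nat) (p : pt -> R) : Prop :=
  exists c : nat -> nat -> R, forall x : pt,
    p x = \sum_(i < d.+1) \sum_(j < (d - i).+1) c i j * x.1 ^+ i * x.2 ^+ j.

Definition vpolyP (d : nat) (p : pt -> pt) : Prop :=
  forall i, polyP d (fun x => co i (p x)).

Definition pd (j : 'I_2) (f : pt -> R) : pt -> R := fun x => 'D_(e_ j) f x.

Definition pds (s : seq 'I_2) (f : pt -> R) : pt -> R := foldr pd f s.

Definition Jac (F : pt -> pt) (x : pt) : 'M[R]_2 :=
  \matrix_(i, j) pd j (fun y => co i (F y)) x.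

Definition smooth (f : pt -> R) : Prop :=
  forall s : seq 'I_2,
    continuous (pds s f) /\ forall j x, derivable (pds s f) x (e_ j).

Definition testfun (U : set pt) (phi : pt -> R) : Prop :=
  smooth phi /\
  exists K : set pt, [/\ compact K, K `<=` U & forall x, ~ K x -> phi x = 0].

Definition mpt := (measurableTypeR R * measurableTypeR R)%type.

Definition mu2 : {measure set mpt -> \bar R} :=
  (@lebesgue_measure R \x @lebesgue_measure R)%E.

Definition L2n (U : set pt) (f : pt -> R) : \bar R :=
  'N[mu2]_2%:E[(fun x : mpt => (f x)%:E) \_ (U : set mpt)]%E.

Definition memL2 (U : set pt) (f : pt -> R) : Prop :=
  measurable_fun (U : set mpt) (f : mpt -> R) /\ (L2n U f < +oo)%E.

Definition loc_int (U : set pt) (f : pt -> R) : Prop :=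
  forall K : set pt, compact K -> K `<=` U ->
    mu2.-integrable (K : set mpt) (fun x : mpt => (f x)%:E).

(* g is the weak derivative of f on U along the multi-index listed by s. *)
Definition weak_deriv (U : set pt) (s : seq 'I_2) (f g : pt -> R) : Prop :=
  [/\ loc_int U f, loc_int U g &
      forall phi, testfun U phi ->
        (\int[mu2]_(x in (U : set mpt)) (f x * pds s phi x)%:E =
         ((-1) ^+ size s)%:E *
           \int[mu2]_(x in (U : set mpt)) (g x * phi x)%:E)%E].

(* |f|_{W^{m,oo}(U)} <= B, the seminorm being the maximum of the essential
   suprema of the weak derivatives of order exactly m. *)
Definition Winf_le (U : set pt) (m : nat) (f : pt -> R) (B : R) : Prop :=
  forall s : seq 'I_2, size s = m -> exists g, weak_deriv U s f g /\
    {ae mu2, forall x : mpt, (U : set mpt) x -> `|g x| <= B}.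

Definition vWinf_le (U : set pt) (m : nat) (u : pt -> pt) (B : R) : Prop :=
  forall i, Winf_le U m (fun x => co i (u x)) B.

Definition mWinf_le (U : set pt) (m : nat) (A : pt -> 'M[R]_2) (B : R) : Prop :=
  forall i j, Winf_le U m (fun x => A x i j) B.

Definition weak_grad (U : set pt) (u : pt -> pt) (J : pt -> 'M[R]_2) : Prop :=
  forall i j, weak_deriv U [:: j] (fun x => co i (u x)) (fun x => J x i j).

Definition vL2n (U : set pt) (u : pt -> pt) : \bar R :=
  L2n U (fun x => enorm (u x)).

Definition mL2n (U : set pt) (J : pt -> 'M[R]_2) : \bar R :=
  L2n U (fun x => frob (J x)).

(* ||grad u||_{L^2(U)} : weak gradients agree almost everywhere, so the
   infimum ranges over a single value (and is +oo without weak gradient). *)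
Definition gradL2n (U : set pt) (u : pt -> pt) : \bar R :=
  ereal_inf [set r | exists2 J, weak_grad U u J & r = mL2n U J].

Definition is_H1_grad (U : set pt) (u : pt -> pt) (J : pt -> 'M[R]_2) : Prop :=
  [/\ forall i, memL2 U (fun x => co i (u x)),
      forall i j, memL2 U (fun x => J x i j) & weak_grad U u J].

(* [H^1(U)]^2 *)
Definition H1 (U : set pt) (u : pt -> pt) : Prop := exists J, is_H1_grad U u J.

(* [H^1_0(U)]^2 : closure of the test functions in [H^1(U)]^2 *)
Definition H10 (U : set pt) (u : pt -> pt) : Prop :=
  exists2 J, is_H1_grad U u J &
  exists phi : nat -> pt -> pt,
    [/\ forall n i, testfun U (fun x => co i (phi n x)),
        vL2n U (fun x => u x - phi n x) @[n --> \oo] --> (0 : \bar R) &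
        mL2n U (fun x => J x - Jac (phi n) x) @[n --> \oo] --> (0 : \bar R)].

Definition Ck (k : nat) (g : R -> R) : Prop :=
  (forall j, (j < k)%N -> forall t : R, derivable (derive1n j g) t 1) /\
  continuous (derive1n k g).

(* In each of the N charts the domain is, after the rotation (c n, s n), the
   part of the open set U n strictly above the graph of gam n. *)
Definition smooth_domain (k : nat) (Omega : set pt) : Prop :=
  [/\ open Omega, Omega !=set0, connected Omega, bounded_set Omega &
  exists (N : nat) (U : 'I_N -> set pt) (c s : 'I_N -> R)
         (gam : 'I_N -> R -> R),
    [/\ bnd Omega `<=` \bigcup_n U n,
        forall n, open (U n),
        forall n, c n ^+ 2 + s n ^+ 2 = 1,
        forall n, Ck k (gam n) &
        forall n x, U n x ->
          (Omega x <->
           gam n (c n * x.1 + s n * x.2) < - s n * x.1 + c n * x.2)]].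

Definition refv (k : 'I_3) : pt :=
  if k == 0 then (1, 0) else if k == 1 then (0, 1) else (0, 0).

Definition bary (k : 'I_3) (x : pt) : R :=
  if k == 0 then x.1 else if k == 1 then x.2 else 1 - x.1 - x.2.

Definition refT : set pt := otri refv.

Definition refTc : set pt := ctri refv.

Definition ctcenter : pt := (3^-1, 3^-1).

Definition ctsub (m : 'I_3) : 'I_3 -> pt :=
  fun k => if k == m then ctcenter else refv k.

(* N_hat : any two of the four vertices of the split are joined by an edge, so
   the edge midpoints are those of distinct vertices a, b (and a = b gives the
   vertices). *)
Definition ctvertices : set pt := range refv `|` [set ctcenter].

Definition ctnodes : set pt :=
  [set x | exists a b, [/\ ctvertices a, ctvertices b & x = mid a b]].

(* Prescribing the values on the closed subtriangles selects the continuous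
   representative on the closed reference triangle, hence nodal values. *)
Definition hatV (vh : pt -> pt) : Prop :=
  H1 refT vh /\
  forall m, exists2 p, vpolyP 2 p & {in ctri (ctsub m), vh =1 p}.

(* The triangles are given by their ordered vertices.  gh i is the polynomial
   that coincides with the interpolant G_h on the closed i-th triangle; being
   defined on the plane, it has derivatives up to the boundary. *)
Record isomesh := Isomesh {
  ntri : nat;
  vert : 'I_ntri -> 'I_3 -> pt;
  gmap : pt -> pt;
  gh : 'I_ntri -> pt -> pt }.

Section Mesh.
Variable M : isomesh.
Implicit Types i : 'I_(ntri M).

(* T~ and T, as open sets *)
Definition tT i : set pt := otri (vert i).
Definition eT i : set pt := gh i @` tT i.

Definition tOmega : set pt := interior (\bigcup_i closure (tT i)).
Definition Omegah : set pt := interior (\bigcup_i closure (eT i)).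

Definition hT i : R := diam (tT i).
Definition hmesh : R := \big[Num.max/0]_i hT i.

Definition tF i (x : pt) : pt := \sum_k bary k x *: vert i k.
Definition eF i (x : pt) : pt := gh i (tF i x).

Definition bnd_vertex i k : Prop := bnd tOmega (vert i k).

Definition tedge i (k l : 'I_3) : set pt := seg (vert i k) (vert i l).
Definition eedge i (k l : 'I_3) : set pt := gh i @` tedge i k l.
Definition interior_edge i (k l : 'I_3) : Prop :=
  exists j k' l', [/\ j != i, k' != l' & eedge i k l = eedge j k' l'].

Definition A_T i (x : pt) : 'M[R]_2 := (\det (Jac (eF i) x))^-1 *: Jac (eF i) x.

(* the local spaces V~(T~) and V(T), of functions on the closed elements *)
Definition tVT i (vt : pt -> pt) : Prop :=
  exists2 vh, hatV vh & forall x, refTc x -> vt (tF i x) = vh x.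

Definition VT i (v : pt -> pt) : Prop :=
  exists2 vh, hatV vh & forall x, refTc x -> v (eF i x) = mxact (A_T i x) (vh x).

Definition tVh (vt : pt -> pt) : Prop := H10 tOmega vt /\ forall i, tVT i vt.

(* v = Psi vt.  Functions of V^h may jump across edges; they are represented
   by the function that is zero off the (open) elements. *)
Definition is_Psi (vt v : pt -> pt) : Prop :=
  (forall i, exists vT, [/\ VT i vT,
     forall a, ctnodes a -> vT (eF i a) = vt (tF i a) &
     {in eT i, v =1 vT}]) /\
  (forall x, (forall i, ~ eT i x) -> v x = 0).

Definition Vh (v : pt -> pt) : Prop := exists2 vt, tVh vt & is_Psi vt v.

End Mesh.

Record affine_mesh (Omega : set pt) (C0 sigma : R) (M : isomesh) : Prop := {
  am_shape : forall i : 'I_(ntri M), exists x r,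
    [/\ 0 < r, [set y | enorm (y - x) < r] `<=` tT i & hT i <= sigma * r] ;
  am_conforming : forall i j : 'I_(ntri M), i != j ->
    [\/ ctri (vert i) `&` ctri (vert j) = set0,
        exists k l, vert i k = vert j l /\
          ctri (vert i) `&` ctri (vert j) = [set vert i k] |
        exists k k' l l', [/\ k != k', l != l', tedge i k k' = tedge j l l' &
          ctri (vert i) `&` ctri (vert j) = tedge i k k'] ] ;
  am_bnd_vertex : forall (i : 'I_(ntri M)) k, bnd_vertex i k -> bnd Omega (vert i k) ;
  am_two_bnd : forall i : 'I_(ntri M), exists k, ~ bnd_vertex i k ;
  am_approx :
    (forall x, bnd (tOmega M) x ->
       exists2 y, bnd Omega y & enorm (x - y) <= C0 * hmesh M ^+ 2) /\
    (forall y, bnd Omega y ->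
       exists2 x, bnd (tOmega M) x & enorm (x - y) <= C0 * hmesh M ^+ 2) }.

(* Point values of gmap on the boundary are those of the continuous extension.
   gh_inj: the curved elements form a mesh, i.e. they do not overlap. *)
Record isoparametric_map (Omega : set pt) (C0 : R) (M : isomesh) : Prop := {
  g_bij : set_bij (tOmega M) Omega (gmap M) ;
  g_cont : {within closure (tOmega M), continuous (gmap M)} ;
  g_W1inf : forall m, (m <= 1)%N -> vWinf_le (tOmega M) m (gmap M) C0 ;
  g_vertex : forall (i : 'I_(ntri M)) k, gmap M (vert i k) = vert i k ;
  g_interior : forall i : 'I_(ntri M), (forall k, ~ bnd_vertex i k) ->
    forall x, ctri (vert i) x -> gmap M x = x ;
  gh_poly : forall i : 'I_(ntri M), vpolyP 2 (gh i) ;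
  gh_nodes : forall (i : 'I_(ntri M)) k l,
    gh i (mid (vert i k) (vert i l)) = gmap M (mid (vert i k) (vert i l)) ;
  gh_inj : forall (i j : 'I_(ntri M)) x y,
    ctri (vert i) x -> ctri (vert j) y -> gh i x = gh j y -> x = y ;
  gh_D : forall (i : 'I_(ntri M)) m, (m <= 1)%N ->
    mWinf_le (tT i) m (Jac (gh i)) C0 ;
  gh_unit : forall (i : 'I_(ntri M)) x, tT i x -> Jac (gh i) x \in unitmx ;
  gh_Dinv : forall (i : 'I_(ntri M)) m, (m <= 1)%N ->
    mWinf_le (tT i) m (fun x => invmx (Jac (gh i) x)) C0 }.

Record element_maps (C0 c1 c2 : R) (M : isomesh) : Prop := {
  tF_W1inf : forall i : 'I_(ntri M), vWinf_le refT 1 (tF i) (C0 * hT i) ;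
  tFinv_W1inf : forall i : 'I_(ntri M), exists2 Finv : pt -> pt,
    {in refT, cancel (tF i) Finv} & vWinf_le (tT i) 1 Finv (C0 * (hT i)^-1) ;
  eF_Winf : forall (i : 'I_(ntri M)) m, (m <= 2)%N ->
    vWinf_le refT m (eF i) (C0 * hT i ^+ m) ;
  eFinv_Winf : forall i : 'I_(ntri M), exists2 Finv : pt -> pt,
    {in refT, cancel (eF i) Finv} &
    forall m, (m <= 3)%N -> vWinf_le (eT i) m Finv (C0 * hT i ^- m) ;
  eF_det : forall (i : 'I_(ntri M)) x, refT x ->
    c1 * hT i ^+ 2 <= \det (Jac (eF i) x) <= c2 * hT i ^+ 2 ;
  interior_edges : forall (i : 'I_(ntri M)) k l, k != l ->
    interior_edge i k l ->
    straight (eedge i k l) /\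
    exists (j : 'I_(ntri M)) k' l', k' != l' /\ eedge i k l = tedge j k' l' ;
  straight_edge_affine : forall (i : 'I_(ntri M)) k l, k != l ->
    straight (eedge i k l) -> forall t : R, 0 <= t <= 1 ->
    eF i ((1 - t) *: refv k + t *: refv l) =
    (1 - t) *: eF i (refv k) + t *: eF i (refv l) ;
  straight_affine : forall i : 'I_(ntri M),
    (forall k l, k != l -> straight (eedge i k l)) ->
    vpolyP 1 (eF i) /\ eT i = tT i }.

(* C0 is the generic constant C of the mesh assumptions. *)
Definition isoparametric_mesh (Omega : set pt) (C0 sigma c1 c2 : R)
    (M : isomesh) : Prop :=
  [/\ affine_mesh Omega C0 sigma M, isoparametric_map Omega C0 M &
      element_maps C0 c1 c2 M].

End Plane.

(* Main.v *)
(** E v is the function equal to vt o G_h^-1 on every element, where v = Psi vt, and zero off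
    the mesh; it agrees with v at the nodes.

    The Piola matrix A_T and its derivative are bounded by C / h_T and C after pulling back to
    the reference triangle. Write vh for the pull-back of v and u for A_T times vh, so that u
    is v seen on the reference triangle; let c be its value at the barycenter. Replacing
    vh by p = vh - A_T^-1 c, which is again piecewise quadratic because A_T^-1 is the adjugate
    of DF_T and hence affine, changes u only by the constant c. As p vanishes at the barycenter,
    it is controlled by the largest of its slopes at three points of each subtriangle; this
    slope persists near that point, which bounds the L^2 norm of the gradient of v from below.
    On the other hand u minus its nodal interpolant is bounded, with its Lipschitz constant, by
    h_T times the size of u - c.

    E v is in H^1_0: it is Lipschitz on every element and it vanishes on the boundary of the
    mesh, hence it is Lipschitz on the plane, and Lipschitz functions supported in a closed set
    are handled by shrinking their values towards zero and mollifying. The vanishing of vt on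
    boundary edges is recovered from vt being in H^1_0 by testing with functions concentrated
    near a boundary point. Weak derivatives of Lipschitz functions are limits of difference
    quotients, by discrete integration by parts and dominated convergence. *)

(* No integral is pulled back to the reference triangle. From above, an element lies in a square of
   side comparable to [hT i], so an L^2 norm there is at most that side times a supremum; from
   below, the image of a small ball contains a square, on which a bump is tested. Norm equivalences
   on finite-dimensional spaces are replaced by explicit bounds on the six coefficients of a
   quadratic, so the constants depend on [Kc C0] and [c1] only. The right-hand side is an infimum
   over weak gradients of [v], and none is constructed: the lower bound is shown for each of them.
   For [v - E v] one must be produced; Rademacher's theorem is bypassed because the functions at
   hand are strictly differentiable off finitely many curves. The smallness of the mesh has two
   origins: the bound c1 / (128 K^2) keeps every F_T close to its affine part (injectivity, local
   surjectivity, orientation at the edges), and the bound by a multiple of c1^3 / K^6 lets the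
   variation of the Piola matrix be absorbed by the slope of the field. *)
Require Import Defs.
From HB Require Import structures.
From mathcomp Require Import all_boot all_order all_algebra.
From mathcomp Require Import all_classical all_reals all_analysis.
From mathcomp Require Import measurable_realfun ring lra.

Set Implicit Arguments.
Unset Strict Implicit.
Unset Printing Implicit Defensive.

Import Order.TTheory GRing.Theory Num.Theory.
Import numFieldNormedType.Exports.

Local Open Scope classical_set_scope.
Local Open Scope ring_scope.

(** * Integration in the plane *)

Section MeasurePlane.
Variable R : realType.
Local Notation pt := (pt R).
Local Notation mpt := (mpt R).
Local Notation mu2 := (mu2 R).
Implicit Types (x y : pt) (f g : pt -> R) (U A : set pt).

Lemma normptE x : `|x| = Num.max `|x.1| `|x.2|.
Proof. by []. Qed.

Lemma ler_normpt x c : (`|x| <= c) = (`|x.1| <= c) && (`|x.2| <= c).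
Proof. by rewrite normptE ge_max. Qed.

Lemma ltr_normpt x c : (`|x| < c) = (`|x.1| < c) && (`|x.2| < c).
Proof. by rewrite normptE gt_max. Qed.

Definition box (p : pt) (r : R) : set pt :=
  `]p.1 - r, p.1 + r[%classic `*` `]p.2 - r, p.2 + r[%classic.

Lemma boxP p r x : box p r x <-> `|p - x| < r.
Proof.
rewrite ltr_normpt /box /=; split.
  by move=> [/=]; rewrite !in_itv/= !ltr_norml => *; apply/andP; split; lra.
move=> /andP[]; rewrite !ltr_norml => *; split => /=; rewrite in_itv/=; lra.
Qed.

Lemma measurable_box p r : measurable (box p r : set mpt).
Proof. by apply: measurableX; exact: measurable_itv. Qed.

Lemma mu2X (A B : set (measurableTypeR R)) : measurable A -> measurable B ->
  mu2 (A `*` B) = (lebesgue_measure A * lebesgue_measure B)%E.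
Proof. exact: product_measure1E. Qed.

Lemma mu2_box p r : 0 < r -> mu2 (box p r) = (4 * r ^+ 2)%:E.
Proof.
move=> r0; rewrite mu2X //; rewrite !lebesgue_measure_itv /= !lte_fin.
have h (a : R) : (a - r < a + r) by lra.
rewrite !h -!EFinB -EFinM; congr EFin; ring.
Qed.

Lemma open_box_rat A x : open A -> A x ->
  exists q : rat * rat * rat, box (ratr q.1.1, ratr q.1.2) (ratr q.2) x /\
    box (ratr q.1.1, ratr q.1.2) (ratr q.2) `<=` A.
Proof.
move=> oA Ax.
have /nbhs_ballP[e /= e0 eA] : nbhs x A by exact: open_nbhs_nbhs.
have [q qr] := @rat_in_itvoo R (e / 4) (e / 2) ltac:(lra).
have [q1 q1r] := @rat_in_itvoo R (x.1 - e / 4) x.1 ltac:(lra).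
have [q2 q2r] := @rat_in_itvoo R (x.2 - e / 4) x.2 ltac:(lra).
move: qr q1r q2r; rewrite !in_itv /= => /andP[a1 a2] /andP[b1 b2] /andP[c1 c2].
exists ((q1, q2), q) => /=; split.
  by split => /=; rewrite in_itv /=; lra.
move=> y [] /=; rewrite !in_itv/= => /andP[? ?] /andP[? ?]; apply: eA.
by split; rewrite /ball /= ltr_norml; lra.
Qed.

(** [mpt] carries the product sigma-algebra, while [open] refers to the topology of the plane. They
    meet in the squares with rational data: those contained in an open set are countably many and
    cover it. *)
Lemma measurable_openpt A : open A -> measurable (A : set mpt).
Proof.
move=> oA.
pose F (q : rat * rat * rat) : set mpt :=
  if `[< box (ratr q.1.1, ratr q.1.2) (ratr q.2) `<=` A >]
  then box (ratr q.1.1, ratr q.1.2) (ratr q.2) else set0.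
have -> : (A : set mpt) = \bigcup_q F q.
  apply/seteqP; split => [x Ax|x [q _]].
    have [q [qx qA]] := open_box_rat oA Ax.
    by exists q => //; rewrite /F; case: asboolP.
  by rewrite /F; case: asboolP => // + ; apply.
apply: countable_bigcupT_measurable => [|q]; first exact: countableP.
rewrite /F; case: asboolP => // _; exact: measurable_box.
Qed.

Lemma measurable_closedpt A : closed A -> measurable (A : set mpt).
Proof.
move=> cA; rewrite -[A]setCK; apply: measurableC.
by apply: measurable_openpt; exact: closed_openC.
Qed.

Lemma continuous_measurable_funpt f : continuous f ->
  measurable_fun setT (f : mpt -> R).
Proof.
move=> cf; apply: (measurability _ (RGenOInfty.measurableE R)).
move=> _ [_ [a ->] <-]; rewrite setTI.
by apply: measurable_openpt; apply: open_comp => //; exact: interval_open.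
Qed.

Definition shiftpt (a : pt) : mpt -> mpt := fun x => (a.1 + x.1, a.2 + x.2).

Lemma measurable_shift1 (a : R) :
  measurable_fun setT ((fun t => a + t) : measurableTypeR R -> measurableTypeR R).
Proof. by apply: measurable_funD; [exact: measurable_cst|exact: measurable_id]. Qed.

Lemma measurable_shift a : measurable_fun setT (shiftpt a).
Proof.
apply/measurable_fun_pairP; split.
  by apply: measurable_funD; [exact: measurable_cst|exact: measurable_fst].
by apply: measurable_funD; [exact: measurable_cst|exact: measurable_snd].
Qed.

(** By uniqueness of Lebesgue measure: the push-forward by a translation has the same values on
    half-open intervals. Uniqueness of the product measure then gives [mu2_shift]. *)
Lemma lebesgue_shift (a : R) (A : set (measurableTypeR R)) : measurable A ->
  lebesgue_measure ((fun t => a + t) @^-1` A) = lebesgue_measure A.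
Proof.
move=> mA; apply/esym.
pose mm : {mfun (measurableTypeR R) >-> (measurableTypeR R)} := HB.pack (fun t : measurableTypeR R => a + t : measurableTypeR R) (isMeasurableFun.Build _ _ _ _ _ (measurable_shift1 a)).
pose nu : {measure set (measurableTypeR R) -> \bar R} := pushforward lebesgue_measure mm.
rewrite (@lebesgue_measure_unique R (nu (measurable_shift1 a)))// => X /ocitvP[->|[[b c] /= bc ->]].
  by rewrite !measure0.
rewrite /nu /= /pushforward /=.
have -> : mm @^-1` `]b, c]%classic = `](b - a), (c - a)]%classic.
  by apply/seteqP; split => x /=; rewrite !in_itv /= => /andP[? ?]; apply/andP; split; lra.
rewrite !lebesgue_measure_itv /= !lte_fin ltrD2r; case: ifP => // _.
by rewrite -!EFinB; congr EFin; ring.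
Qed.

Lemma mu2_shift a (A : set mpt) : measurable A -> mu2 (shiftpt a @^-1` A) = mu2 A.
Proof.
move=> mA; apply/esym.
pose mm : {mfun mpt >-> mpt} := HB.pack (shiftpt a) (isMeasurableFun.Build _ _ _ _ _ (measurable_shift a)).
pose nu : {measure set mpt -> \bar R} := pushforward mu2 mm.
transitivity (nu (measurable_shift a) A); last by [].
apply: (@product_measure_unique _ _ _ _ _ _ _ (nu (measurable_shift a)))=> // X Y mX mY.
rewrite /nu /= /pushforward /=.
have -> : shiftpt a @^-1` (X `*` Y) =
   ((fun t => a.1 + t) @^-1` X) `*` ((fun t => a.2 + t) @^-1` Y).
  by apply/seteqP; split => x.
rewrite mu2X; last 2 first.
- by rewrite -[X in measurable X]setTI; exact: measurable_shift1.
- by rewrite -[X in measurable X]setTI; exact: measurable_shift1.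
by rewrite !lebesgue_shift.
Qed.

Lemma ge0_integral_shift a (f : mpt -> \bar R) : measurable_fun setT f ->
  (forall x, 0 <= f x)%E ->
  (\int[mu2]_x f (shiftpt a x) = \int[mu2]_x f x)%E.
Proof.
move=> mf f0.
have := @ge0_integral_pushforward _ _ _ _ R _ (measurable_shift a) mu2 setT f measurableT mf (fun x _ => f0 x).
rewrite preimage_setT => <-.
by apply: eq_measure_integral => [|mf' A mA _]; [exact: measurable_shift|exact: mu2_shift].
Qed.

Lemma integral_shift a (f : mpt -> \bar R) : measurable_fun setT f ->
  (\int[mu2]_x f (shiftpt a x) = \int[mu2]_x f x)%E.
Proof.
move=> mf; rewrite integralE [RHS]integralE.
rewrite (funepos_comp f (shiftpt a)) (funeneg_comp f (shiftpt a)).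
congr (_ - _)%E.
  by apply: (ge0_integral_shift a (measurable_funepos mf)) => x; exact: funepos_ge0.
by apply: (ge0_integral_shift a (measurable_funeneg mf)) => x; exact: funeneg_ge0.
Qed.

End MeasurePlane.

(** * Real-valued integrals of bounded functions with bounded support, and L^2 norms *)

Section BoundedSupport.
Variable R : realType.
Local Notation pt := (pt R).
Local Notation mpt := (mpt R).
Local Notation mu2 := (mu2 R).
Implicit Types (x y : pt) (f g : pt -> R) (U A : set pt).

Import HBNNSimple.

(** The integral of a nonnegative function is a supremum over the simple functions below it, so
    monotonicity needs no measurability. This lets [L2n] be compared for arbitrary functions. *)
Lemma le_integral_nomeas (f g : mpt -> \bar R) :
  (forall x, 0 <= f x)%E -> (forall x, f x <= g x)%E ->
  (\int[mu2]_x f x <= \int[mu2]_x g x)%E.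
Proof.
move=> f0 fg.
have g0 x : (0 <= g x)%E by exact: le_trans (fg x).
rewrite !ge0_integralE//; apply: ereal_sup_le => _ [h /= hf <-].
exists h => //= x; apply: le_trans (hf x) _.
by rewrite !patch_setT.
Qed.

(** One constant bounds both the values and the support. Such functions have finite integrals, on
    which [I2] is linear with values in [R]; a bounded measurable function times a test function is
    of this kind. *)
Definition bsf f := measurable_fun setT (f : mpt -> R) /\
  exists C, forall x, `|f x| <= C /\ (C < `|x| -> f x = 0).

Definition I2 f : R := fine (\int[mu2]_x (f x)%:E).

Definition dominated_by (C : R) f := forall x, `|f x| <= C /\ (C < `|x| -> f x = 0).

Lemma bounded_support_integrable f C : measurable_fun setT (f : mpt -> R) ->
  dominated_by C f -> mu2.-integrable setT (EFin \o (f : mpt -> R)).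
Proof.
move=> mf dC; pose D := Num.max C 0 + 1.
have D0 : 0 < D by rewrite /D ltr_wpDl// le_max lexx orbT.
have CD : C < D by rewrite /D; apply: (le_lt_trans (y := Num.max C 0)); rewrite ?le_max ?lexx// ltrDl.
have mb : measurable (box (0 : pt) D : set mpt) by exact: measurable_box.
have foff x : ~ box (0 : pt) D x -> f x = 0.
  move=> nb; apply: (dC x).2; rewrite (lt_le_trans CD)// leNgt; apply/negP => xD.
  by apply: nb; apply/boxP; rewrite sub0r normrN.
have -> : (EFin \o (f : mpt -> R)) = (EFin \o (f : mpt -> R)) \_ (box 0 D : set mpt).
  apply/funext => x /=; rewrite /patch; case: ifPn => //.
  by rewrite notin_setE => /foff ->.
apply/integrable_restrict => //; rewrite setTI.
apply: measurable_bounded_integrable => //.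
- by rewrite mu2_box// ltry.
- exact: measurable_funS mf.
- exists D; split; first exact: gtr0_real.
  move=> M /ltW DM x _; apply: le_trans DM; apply: le_trans (dC x).1 _; exact: ltW.
Qed.

Lemma bsf_integrable f : bsf f -> mu2.-integrable setT (EFin \o (f : mpt -> R)).
Proof. by move=> [mf [C fC]]; exact: (bounded_support_integrable mf fC). Qed.

Lemma I2E f : bsf f -> (\int[mu2]_x (f x)%:E)%E = (I2 f)%:E.
Proof. by move=> /bsf_integrable h; rewrite /I2 fineK//; exact: integrable_fin_num. Qed.

Lemma bsf_dom f : bsf f -> exists C, 0 < C /\ dominated_by C f.
Proof.
move=> [_ [C h]]; exists (Num.max C 0 + 1); split.
  by rewrite ltr_wpDl// le_max lexx orbT.
have CD : C <= Num.max C 0 + 1 by rewrite ler_wpDr// le_max lexx.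
move=> x; split; first by apply: le_trans (h x).1 _.
by move=> /(le_lt_trans CD); exact: (h x).2.
Qed.

Lemma bsfD f g : bsf f -> bsf g -> bsf (fun x => f x + g x).
Proof.
move=> bf bg; split; first by apply: measurable_funD; [exact: bf.1|exact: bg.1].
have [C [C0 fC]] := bsf_dom bf; have [D [D0 gD]] := bsf_dom bg.
exists (C + D) => x; split.
  by rewrite (le_trans (ler_normD _ _))// lerD ?(fC x).1 ?(gD x).1.
by move=> h; rewrite (fC x).2 ?(gD x).2 ?addr0//; lra.
Qed.

Lemma bsfMr f g C : measurable_fun setT (f : mpt -> R) -> (forall x, `|f x| <= C) ->
  bsf g -> bsf (fun x => f x * g x).
Proof.
move=> mf fC bg; split; first by apply: measurable_funM; [exact: mf|exact: bg.1].
have [D [D0 gD]] := bsf_dom bg.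
have C0 : 0 <= C by apply: le_trans (fC 0).
exists (C * D + D) => x; split.
  rewrite normrM (@le_trans _ _ (C * D))// ?ler_pM//; last by rewrite lerDl ltW.
  exact: (gD x).1.
by move=> h; rewrite (gD x).2 ?mulr0//; apply: le_lt_trans h; rewrite lerDr mulr_ge0// ltW.
Qed.

Lemma bsfM f g : bsf f -> bsf g -> bsf (fun x => f x * g x).
Proof.
by move=> bf; have [C [_ fC]] := bsf_dom bf; apply: (bsfMr bf.1 (fun x => (fC x).1)).
Qed.

Lemma bsfZ c f : bsf f -> bsf (fun x => c * f x).
Proof. by apply: (bsfMr (f := fun=> c) (C := `|c|)) => //; exact: measurable_cst. Qed.

Lemma bsfN f : bsf f -> bsf (fun x => - f x).
Proof. by move=> /(bsfZ (-1)); under eq_fun do rewrite mulN1r. Qed.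

Lemma bsfB f g : bsf f -> bsf g -> bsf (fun x => f x - g x).
Proof. by move=> bf /bsfN; exact: bsfD. Qed.

Lemma bsf_norm f : bsf f -> bsf (fun x => `|f x|).
Proof.
move=> [mf [C fC]]; split; first exact: measurableT_comp.
by exists C => x; rewrite normr_id; split; [exact: (fC x).1|move=> /(fC x).2 ->; rewrite normr0].
Qed.

Lemma bsf_shift a f : bsf f -> bsf (fun x => f (a + x)).
Proof.
move=> [mf [C fC]]; split.
  exact: (measurableT_comp mf (measurable_shift a)).
exists (C + `|a|) => x; split; first by rewrite (le_trans (fC _).1)// lerDl.
move=> h; apply: (fC _).2.
have : `|x| <= `|a + x| + `|a|.
  by rewrite -{1}[x](addKr a) addrC (le_trans (ler_normD _ _))// normrN.
by move: h; lra.
Qed.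

Lemma I2_shift a f : measurable_fun setT (f : mpt -> R) -> I2 (fun x => f (a + x)) = I2 f.
Proof.
move=> mf; rewrite /I2; congr fine.
by apply: (integral_shift a (f := EFin \o f)); exact: measurableT_comp.
Qed.

Lemma I2D f g : bsf f -> bsf g -> I2 (fun x => f x + g x) = I2 f + I2 g.
Proof.
move=> bf bg; apply: EFin_inj; rewrite EFinD -!I2E//; last exact: bsfD.
rewrite -integralD//; exact: bsf_integrable.
Qed.

Lemma I2Z c f : bsf f -> I2 (fun x => c * f x) = c * I2 f.
Proof.
move=> bf; apply: EFin_inj; rewrite EFinM -!I2E//; last exact: bsfZ.
rewrite -integralZl//; exact: bsf_integrable.
Qed.

Lemma I2N f : bsf f -> I2 (fun x => - f x) = - I2 f.
Proof. by move=> /(I2Z (-1)); rewrite mulN1r => <-; congr I2; apply/funext => x; rewrite mulN1r. Qed.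

Lemma I2B f g : bsf f -> bsf g -> I2 (fun x => f x - g x) = I2 f - I2 g.
Proof. by move=> bf bg; rewrite I2D ?I2N//; exact: bsfN. Qed.

Lemma I2_ge0 f : (forall x, 0 <= f x) -> 0 <= I2 f.
Proof. by move=> f0; rewrite /I2 fine_ge0// integral_ge0// => x _; rewrite lee_fin. Qed.

Lemma I2_le f g : bsf f -> bsf g -> (forall x, f x <= g x) -> I2 f <= I2 g.
Proof.
by move=> bf bg fg; rewrite -subr_ge0 -I2B//; apply: I2_ge0 => x; rewrite subr_ge0.
Qed.

Lemma I2_abs f : bsf f -> `|I2 f| <= I2 (fun x => `|f x|).
Proof.
move=> bf; have bnf := bsf_norm bf.
rewrite ler_norml -I2N//; apply/andP; split; apply: I2_le => //; rewrite ?bsfN//.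
- exact: bsfN.
- by move=> x; rewrite lerNl ler_normr lexx orbT.
- by move=> x; rewrite ler_norm.
Qed.

Lemma bsf_indic A p r : measurable (A : set mpt) -> A `<=` box p r -> bsf (\1_A : pt -> R).
Proof.
move=> mA Ap; split; first exact: measurable_indic.
exists (`|p| + `|r| + 1) => x; split.
  by rewrite indicE; case: (_ \in _); rewrite ?normr1 ?normr0 ?lerDr ?addr_ge0.
rewrite indicE; case: (boolP (x \in A)) => //; rewrite inE => /Ap/boxP px h.
suff : `|x| <= `|p| + `|r| by lra.
have : `|x| <= `|p| + `|p - x|.
  by rewrite -{1}[x](subKr p) (le_trans (ler_normB _ _)).
have : r <= `|r| by exact: ler_norm.
lra.
Qed.

Lemma I2_indic A : measurable (A : set mpt) -> (mu2 A < +oo)%E ->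
  (I2 (\1_A : pt -> R))%:E = mu2 A.
Proof.
move=> mA fA; rewrite /I2 integral_indic// setIT fineK//.
by rewrite ge0_fin_numE.
Qed.

Lemma I2_box p r : 0 < r -> I2 (\1_(box p r) : pt -> R) = 4 * r ^+ 2.
Proof.
by move=> r0; apply: EFin_inj; rewrite I2_indic ?mu2_box ?ltry//; exact: measurable_box.
Qed.

Lemma I2_le_box f p r M : 0 < r -> bsf f -> (forall x, box p r x -> f x <= M) ->
  (forall x, ~ box p r x -> f x <= 0) -> I2 f <= M * (4 * r ^+ 2).
Proof.
move=> r0 bf fM f0; have bi := bsf_indic (@measurable_box R p r) (@subset_refl _ _).
rewrite -(I2_box p r0) -I2Z//; apply: I2_le => // [|x]; first exact: bsfZ.
rewrite indicE; case: (boolP (x \in _)); first by rewrite inE mulr1 => /fM.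
by rewrite notin_setE mulr0 => /f0.
Qed.

Lemma I2_ge_box f p r M : 0 < r -> bsf f -> (forall x, box p r x -> M <= f x) ->
  (forall x, ~ box p r x -> 0 <= f x) -> M * (4 * r ^+ 2) <= I2 f.
Proof.
move=> r0 bf fM f0; have bi := bsf_indic (@measurable_box R p r) (@subset_refl _ _).
rewrite -(I2_box p r0) -I2Z//; apply: I2_le => // [|x]; first exact: bsfZ.
rewrite indicE; case: (boolP (x \in _)); first by rewrite inE mulr1 => /fM.
by rewrite notin_setE mulr0 => /f0.
Qed.

(** Dominated by a multiple of the indicator of one fixed square, since [C] bounds values and
    supports at the same time. *)
Lemma I2_dct (fn : nat -> pt -> R) f C :
  (forall n, measurable_fun setT (fn n : mpt -> R)) ->
  (forall n, dominated_by C (fn n)) -> bsf f ->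
  {ae mu2, forall x : mpt, fn n x @[n --> \oo] --> f x} ->
  I2 (fn n) @[n --> \oo] --> I2 f.
Proof.
move=> mfn dfn bf cvf.
pose D := Num.max C 0 + 1.
have D0 : 0 < D by rewrite /D ltr_wpDl// le_max lexx orbT.
have CD : C < D by rewrite /D; apply: (le_lt_trans (y := Num.max C 0)); rewrite ?le_max ?lexx// ltrDl.
have bi := bsf_indic (@measurable_box R 0 D) (@subset_refl _ _).
have bg := bsfZ D bi.
have [|||||_ _] := @dominated_convergence _ mpt R mu2 setT measurableT
  (fun n x => (fn n x)%:E) (fun x => (f x)%:E) (fun x => (D * \1_(box (0 : pt) D) x)%:E).
- by move=> n; exact/measurable_EFinP.
- by apply/measurable_EFinP; exact: bf.1.
- case: cvf => N [mN N0 sN]; exists N; split => // x /= h; apply: sN => /= h'.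
  by apply: h => _; apply: cvg_EFin => //; exact: nearW.
- exact: bsf_integrable.
- apply/nearW => x n _ /=; rewrite lee_fin indicE.
  case: (boolP (x \in _)) => [_|].
    by rewrite mulr1 (le_trans (dfn n x).1)// ltW.
  rewrite notin_setE mulr0 => nb; rewrite (dfn n x).2 ?normr0//.
  rewrite (lt_le_trans CD)// leNgt; apply/negP => xD.
  by apply: nb; apply/boxP; rewrite sub0r normrN.
move=> cv; apply: fine_cvg; rewrite -I2E//; exact: cv.
Qed.

Definition sq U f x : R := if x \in U then (f x) ^+ 2 else 0.

Lemma sq_ge0 U f x : 0 <= sq U f x.
Proof. by rewrite /sq; case: ifP => // _; exact: sqr_ge0. Qed.

Lemma L2nE U f : L2n U f = sqrte (\int[mu2]_x (sq U f x)%:E).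
Proof.
rewrite /L2n unlock /Lnorm -poweR12_sqrt; last first.
  by apply: integral_ge0 => x _; rewrite lee_fin /sq; case: ifP => // _; exact: sqr_ge0.
congr (_ `^ _)%E; apply: eq_integral => x _; rewrite /patch /sq.
case: ifP => _; last by rewrite abse0 poweR0r.
by rewrite abse_EFin poweR_EFin powR_mulrn// real_normK// num_real.
Qed.

Lemma L2n_mono U V f g : U `<=` V -> (forall x, U x -> `|f x| <= `|g x|) ->
  (L2n U f <= L2n V g)%E.
Proof.
move=> UV fg; rewrite !L2nE lee_sqrt; last first.
  by apply: integral_ge0 => x _; rewrite lee_fin sq_ge0.
apply: le_integral_nomeas => x; rewrite lee_fin ?sq_ge0// /sq.
case: ifPn => xU; last by case: ifP => // _; exact: sqr_ge0.
move: xU; rewrite inE => xU; rewrite mem_set; last exact: UV.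
by rewrite -[leLHS]real_normK ?num_real// -[leRHS]real_normK ?num_real// lerXn2r ?nnegrE// fg.
Qed.

Lemma L2n_le U f p r M : 0 < r -> 0 <= M -> U `<=` box p r -> (forall x, U x -> `|f x| <= M) ->
  (L2n U f <= (M * (2 * r))%:E)%E.
Proof.
move=> r0 M0 Ur fM.
have -> : (M * (2 * r))%:E = L2n (box p r) (fun=> M).
  rewrite L2nE.
  have bi := bsf_indic (@measurable_box R p r) (@subset_refl _ _).
  have -> : (fun x => (sq (box p r) (fun=> M) x)%:E) = (fun x : mpt => (M ^+ 2 * \1_(box p r) x)%:E).
    by apply/funext => x; rewrite /sq indicE; case: (_ \in _); rewrite ?mulr1 ?mulr0.
  rewrite I2E; last exact: bsfZ.
  rewrite I2Z// I2_box// -[sqrte _]/((Num.sqrt _)%:E); congr EFin.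
  rewrite (_ : M ^+ 2 * _ = (M * (2 * r)) ^+ 2); last by ring.
  by rewrite sqrtr_sqr ger0_norm// mulr_ge0// mulr_ge0// ltW.
by apply: L2n_mono => // x /fM h; rewrite [leRHS]ger0_norm.
Qed.

Lemma L2n_cvg0 U (fn : nat -> pt -> R) C : measurable (U : set mpt) ->
  (forall n, measurable_fun (U : set mpt) (fn n : mpt -> R)) ->
  (forall n x, U x -> `|fn n x| <= C /\ `|x| <= C) ->
  {ae mu2, forall x : mpt, (U : set mpt) x -> fn n x @[n --> \oo] --> (0 : R)} ->
  L2n U (fn n) @[n --> \oo] --> (0%E : \bar R).
Proof.
move=> mU mfn fC cv0.
pose D := Num.max (C ^+ 2) C.
have dD n : dominated_by D (sq U (fn n)).
  move=> x; rewrite /sq; case: ifPn; last first.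
    by move=> _; split=> //; rewrite normr0 /D le_max sqr_ge0.
  rewrite inE => Ux; have [h1 h2] := fC n x Ux; split.
    rewrite normrX /D le_max lerXn2r// nnegrE//; exact: le_trans h1.
  by rewrite /D gt_max => /andP[_ /lt_geF]; rewrite h2.
have msq n : measurable_fun setT (sq U (fn n) : mpt -> R).
  rewrite (_ : sq U (fn n) = ((fun x => fn n x ^+ 2) : mpt -> R) \_ U)//.
  exact: (measurable_restrictT _ mU).1 (measurable_funX 2 (mfn n)).
have b0 : bsf (fun=> 0 : R).
  split; first exact: measurable_cst.
  by exists 0 => x; rewrite normr0.
have cI : I2 (sq U (fn n)) @[n --> \oo] --> (0 : R).
  have -> : (0 : R) = I2 (fun=> 0) by rewrite /I2 integral0.
  apply: I2_dct msq dD b0 _.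
  case: cv0 => N [mN N0 sN]; exists N; split => // x /= h; apply: sN => /= h'; apply: h.
  have [xU|xU] := boolP (x \in U); last first.
    by under eq_fun do rewrite /sq (negbTE xU); exact: cvg_cst.
  under eq_fun do rewrite /sq xU.
  have cx := h' (set_mem xU).
  have cc : fn n x ^+ 2 @[n --> \oo] --> (0 : R).
    by rewrite -[X in _ --> X](mulr0 (0 : R)); exact: (cvgM cx cx).
  exact: cc.
have -> : (fun n => L2n U (fn n)) = (fun n => (Num.sqrt (I2 (sq U (fn n))))%:E).
  apply/funext => n; rewrite L2nE I2E//; split => //; exists D; exact: dD.
apply: cvg_EFin; first exact: nearW.
rewrite [X in X @ _](_ : _ = (fun n => Num.sqrt (I2 (sq U (fn n))))) //.
rewrite -[X in _ --> X]sqrtr0.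
by apply: continuous_cvg => //; exact: sqrt_continuous.
Qed.

End BoundedSupport.

(** * Test functions *)

Section DirectionalDerivatives.
Variable R : realType.
Variable V : normedModType R.

(** The limit of difference quotients multiplied out by [h], so that [h = 0] needs no exclusion and
    estimates combine without division. *)
Definition dderiv (f : V -> R) (x v : V) (d : R) :=
  forall e, 0 < e -> exists2 r, 0 < r & forall h : R, `|h| < r ->
    `|f (h *: v + x) - f x - h * d| <= e * `|h|.

Lemma dderivP (f : V -> R) x v d : dderiv f x v d <-> is_derive x v f d.
Proof.
split=> [dd|[dv dd] e e0].
  have cv : h^-1 *: (f (h *: v + x) - f x) @[h --> 0^'] --> d.
    apply/cvgrPdist_le => e e0; have [r r0 dr] := dd _ e0.
    near=> h; have h0 : h != 0 by near: h; exact: nbhs_dnbhs_neq.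
    rewrite distrC -[X in `|_ - X|](mulKf h0) -[_ *: _]/(h^-1 * _) -mulrBr normrM normfV.
    rewrite mulrC ler_pdivrMr ?normr_gt0// dr//.
    by near: h; apply: dnbhs0_lt.
  by apply: DeriveDef; [apply/cvg_ex; exists d|exact: cvg_lim].
have cv : h^-1 *: (f (h *: v + x) - f x) @[h --> 0^'] --> d by rewrite -dd; exact: dv.
move/cvgrPdist_le : cv => /(_ e e0) /nbhs_ballP[r /= r0 dr]; exists r => // h hr.
have [->|h0] := eqVneq h 0.
  by rewrite scale0r add0r subrr mul0r subrr normr0 mulr0.
have := dr h; rewrite /ball /= sub0r normrN => /(_ hr h0).
rewrite distrC -[X in `|_ - X|](mulKf h0) -[_ *: _]/(h^-1 * _) -mulrBr normrM normfV.
by rewrite mulrC ler_pdivrMr ?normr_gt0.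
Unshelve. all: by end_near. Qed.

End DirectionalDerivatives.

(** * Smooth functions of one variable built from exp(-1/t) *)

Section Bump.
Variable R : realType.
Implicit Types (f g : R -> R) (t : R).

(** The functions t^-n exp(-1/t), extended by 0. The power is a parameter because differentiation
    raises it: the family is closed under derivatives up to linear combinations ([flat_deriv]). *)
Definition flat (n : nat) t : R := if 0 < t then t^-1 ^+ n * expR (- t^-1) else 0.

Lemma flat_ge0 n t : 0 <= flat n t.
Proof.
rewrite /flat; case: ifP => // t0.
by rewrite mulr_ge0 ?expR_ge0// exprn_ge0// invr_ge0 ltW.
Qed.

(** With s = 1/t, one term of the exponential series gives s^(n+1) / (n+1)! <= exp s. This is the
    decay at 0 behind [flat_deriv]. *)
Lemma flat_le n t : 0 < t -> flat n t <= n.+1`!%:R * t.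
Proof.
move=> t0; rewrite /flat t0 expRN ler_pdivrMr ?expR_gt0//.
have := expR_ge1Dxn n (ltW (eqbRL (invr_gt0 t) t0)).
have f0 : 0 < n.+1`!%:R :> R by rewrite ltr0n fact_gt0.
move=> /(le_trans _) h; have {}h : t^-1 ^+ n.+1 / n.+1`!%:R <= expR t^-1.
  by apply: h; rewrite lerDr.
rewrite ler_pdivrMr// in h.
rewrite -(@ler_pM2l _ t^-1) ?invr_gt0// -exprS (le_trans h)//.
by rewrite [leRHS](_ : _ = expR t^-1 * n.+1`!%:R)//; field; rewrite gt_eqF.
Qed.

Lemma flat_deriv n t : is_derive t 1 (flat n) (flat n.+2 t - n%:R * flat n.+1 t).
Proof.
have [t0|t0|->] := ltrgtP t 0.
- apply: (@is_derive_eq _ _ _ _ _ _ _ 0); last by rewrite /flat !ltNge ltW//= mulr0 subr0.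
  have dc : is_derive t 1 (fun=> 0 : R) (0 : R) by exact: is_derive_cst.
  apply: near_eq_is_derive dc.
  near=> s; have : s < 0 by near: s; exact: lt_nbhsl.
  by rewrite /flat =>  /ltW; rewrite ltNge => ->.
- have tN0 : t != 0 by rewrite gt_eqF.
  have d1 : is_derive t 1 (fun s : R => s^-1) (- t ^- 2).
    by have := @is_deriveV R id t 1 1 tN0 (is_derive_id _ _); rewrite -[_ *: 1]/(_ * 1) mulr1.
  have d2 : is_derive t 1 (fun s : R => expR (- s^-1)) (expR (- t^-1) * t ^- 2).
    have dN : is_derive t 1 (fun s : R => - s^-1) (t ^- 2) by rewrite -[t ^- 2]opprK; exact: is_deriveN.
    exact: (@is_derive1_comp _ expR (fun s => - s^-1)).
  have d3 : is_derive t 1 (fun s : R => s^-1 ^+ n) (n%:R * t^-1 ^+ n.-1 * (- t ^- 2)).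
    by have := @is_deriveX _ _ (fun s : R => s^-1) n t 1 _ d1; rewrite exprfctE.
  apply: (@near_eq_is_derive _ _ _ (fun s : R => s^-1 ^+ n * expR (- s^-1))).
    near=> s; have s0 : 0 < s by near: s; exact: lt_nbhsr.
    by rewrite /flat s0.
  apply: (is_derive_eq (is_deriveM d3 d2)).
  rewrite /flat t0 -![_ *: _]/(_ * _) /=.
  case: n {d3} => [|n] /=; rewrite ?exprS !exprVn ?expr0; field; rewrite ?expf_neq0 ?tN0//.
(* At 0 the difference quotient for a positive step [h] is [flat n.+1 h], which [flat_le] bounds by
   a multiple of [h]. *)
rewrite /flat ltxx mulr0 subr0; apply/dderivP => e e0.
have f0 : 0 < n.+2`!%:R :> R by rewrite ltr0n fact_gt0.
exists (e / n.+2`!%:R); first by rewrite divr_gt0.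
move=> h hr; rewrite addr0 -[h *: _]/(h * 1) mulr1 ltxx subr0 mulr0 subr0.
case: ifP => h0; last by rewrite normr0 mulr_ge0// ltW.
have := flat_le n.+1 h0; rewrite /flat h0 => fl.
rewrite gtr0_norm in hr *; last by [].
rewrite gtr0_norm; last by rewrite mulr_gt0 ?expR_gt0// exprn_gt0// invr_gt0.
rewrite -(@ler_pM2l _ h^-1) ?invr_gt0// mulrA -exprS (le_trans fl)//.
rewrite [e * h]mulrC mulKf ?gt_eqF// mulrC -ler_pdivlMr//; exact: ltW.
Unshelve. all: by end_near. Qed.

(** A syntax of functions of one variable that is closed under differentiation; a derivative inside
    the class is what the coinduction of [smooth_tensor] asks for. *)
Inductive sm1 : (R -> R) -> Prop :=
| sm1_flat n : sm1 (flat n)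
| sm1_cst c : sm1 (fun=> c)
| sm1_add f g : sm1 f -> sm1 g -> sm1 (fun t => f t + g t)
| sm1_mul f g : sm1 f -> sm1 g -> sm1 (fun t => f t * g t)
| sm1_aff a b f : sm1 f -> sm1 (fun t => f (a * t + b)).

Lemma sm1_deriv f : sm1 f -> exists2 g, sm1 g & forall t, is_derive t 1 f (g t).
Proof.
elim=> {f} [n|c|f g _ [f' sf' df] _ [g' sg' dg]|f g sf [f' sf' df] sg [g' sg' dg]|a b f _ [f' sf' df]].
- exists (fun t => flat n.+2 t + (- n%:R) * flat n.+1 t).
    by apply: sm1_add; [exact: sm1_flat|apply: sm1_mul; [exact: sm1_cst|exact: sm1_flat]].
  by move=> t; apply: is_derive_eq; [exact: flat_deriv|rewrite mulNr].
- by exists (fun=> 0); [exact: sm1_cst|move=> t; exact: is_derive_cst].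
- exists (fun t => f' t + g' t); first exact: sm1_add.
  by move=> t; exact: (is_deriveD (df t) (dg t)).
- exists (fun t => f t * g' t + g t * f' t); first by apply: sm1_add; exact: sm1_mul.
  by move=> t; exact: (is_deriveM (df t) (dg t)).
- exists (fun t => a * f' (a * t + b)); first by apply: sm1_mul; [exact: sm1_cst|exact: sm1_aff].
  move=> t; rewrite mulrC.
  have da : is_derive t 1 (fun s : R => a * s + b) a.
    apply/dderivP => e e0; exists 1 => // h _.
    rewrite -[h *: _]/(h * 1) mulr1 [X in `|X|](_ : _ = 0) ?normr0; last by ring.
    by rewrite mulr_ge0// ltW.
  exact: (is_derive1_comp (df _) da).
Qed.

Lemma sm1_continuous f : sm1 f -> continuous f.
Proof.
move=> /sm1_deriv[g _ df] t; apply: differentiable_continuous.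
by apply/derivable1_diffP; have [] := df t.
Qed.

Definition cbump t : R := flat 0 (t + 1) * flat 0 (1 - t).

Definition dbump t : R := flat 2 (t + 1) * flat 0 (1 - t) - flat 0 (t + 1) * flat 2 (1 - t).

Lemma sm1_cbump : sm1 cbump.
Proof.
have := sm1_mul (sm1_aff 1 1 (sm1_flat 0)) (sm1_aff (-1) 1 (sm1_flat 0)).
by congr sm1; apply/funext => t; rewrite /cbump mul1r mulN1r [- t + 1]addrC.
Qed.

Lemma cbump_deriv t : is_derive t 1 cbump (dbump t).
Proof.
have d1 (a b s : R) n : is_derive s 1 (fun s => flat n (a * s + b))
   ((flat n.+2 (a * s + b) - n%:R * flat n.+1 (a * s + b)) * a).
  have da : is_derive s 1 (fun s : R => a * s + b) a.
    apply/dderivP => e e0; exists 1 => // h _.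
    rewrite -[h *: _]/(h * 1) mulr1 [X in `|X|](_ : _ = 0) ?normr0; last by ring.
    by rewrite mulr_ge0// ltW.
  exact: (is_derive1_comp (flat_deriv _ _) da).
have := is_deriveM (d1 1 1 t 0%N) (d1 (-1) 1 t 0%N).
rewrite (_ : (fun s : R => flat 0 (1 * s + 1)) * (fun s : R => flat 0 (-1 * s + 1)) = cbump); last first.
  by apply/funext => s; rewrite /cbump -[LHS]/(flat 0 _ * flat 0 _) mul1r mulN1r [- s + 1]addrC.
move=> h; apply: (is_derive_eq h).
rewrite /dbump mul1r mulN1r [- t + 1]addrC -![_ *: _]/(_ * _); ring.
Qed.

Lemma cbump_ge0 t : 0 <= cbump t.
Proof. by rewrite mulr_ge0 ?flat_ge0. Qed.

Lemma cbump_off t : 1 <= `|t| -> cbump t = 0.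
Proof.
rewrite ler_normr => /orP[] h; rewrite /cbump /flat.
  by rewrite [0 < 1 - t]ltNge subr_le0 h mulr0.
by rewrite [0 < t + 1]ltNge -lerBrDr sub0r lerNr h mul0r.
Qed.

Lemma dbump_off t : 1 <= `|t| -> dbump t = 0.
Proof.
rewrite ler_normr => /orP[] h; rewrite /dbump /flat.
  by rewrite [0 < 1 - t]ltNge subr_le0 h !mulr0 subr0.
by rewrite [0 < t + 1]ltNge -lerBrDr sub0r lerNr h !mul0r subr0.
Qed.

Lemma flat0_le1 t : flat 0 t <= 1.
Proof.
rewrite /flat; case: ifP => // t0; rewrite mul1r -expR0 ler_expR.
by rewrite oppr_le0 invr_ge0 ltW.
Qed.

Lemma flat0_mono s t : s <= t -> flat 0 s <= flat 0 t.
Proof.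
move=> st; rewrite {1}/flat; case: ifP => s0; last exact: flat_ge0.
have t0 : 0 < t by exact: lt_le_trans st.
by rewrite /flat t0 !mul1r ler_expR lerN2 lef_pV2.
Qed.

Lemma cbump_le1 t : cbump t <= 1.
Proof. by rewrite -[1]mulr1 ler_pM ?flat_ge0 ?flat0_le1. Qed.

(** Lower bound of [cbump] for |t| <= 3/4, where both t + 1 and 1 - t are at least 1/4, and also of
    [dbump] between -3/4 and -1/2. *)
Definition bump0 : R := flat 0 (1 / 4) ^+ 2.

Lemma bump0_gt0 : 0 < bump0.
Proof.
rewrite exprn_gt0// /flat; case: ifPn => [_|]; last by rewrite -leNgt; lra.
by rewrite expr0 mul1r expR_gt0.
Qed.

Lemma cbump_ge t : `|t| <= 3 / 4 -> bump0 <= cbump t.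
Proof.
rewrite ler_norml => /andP[t1 t2].
by rewrite /bump0 expr2 ler_pM ?flat_ge0// flat0_mono//; lra.
Qed.

Lemma flat2E t : 0 < t -> flat 2 t = t^-1 ^+ 2 * flat 0 t.
Proof. by move=> t0; rewrite /flat t0 expr0 mul1r. Qed.

Lemma dbumpE t : `|t| < 1 ->
  dbump t = ((t + 1)^-1 ^+ 2 - (1 - t)^-1 ^+ 2) * cbump t.
Proof.
rewrite ltr_norml => /andP[t1 t2]; rewrite /dbump /cbump !flat2E; [|lra|lra].
ring.
Qed.

Lemma dbump_ge0 t : t <= 0 -> 0 <= dbump t.
Proof.
move=> t0; have [t1|t1] := ltP `|t| 1; last by rewrite dbump_off.
rewrite dbumpE// mulr_ge0 ?cbump_ge0// subr_ge0; move: t1; rewrite ltr_norml => /andP[t1 _].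
rewrite lerXn2r ?nnegrE ?invr_ge0 ?lef_pV2 ?posrE//; lra.
Qed.

(** In [dbumpE] the factor of [cbump t] is at least 2^2 - 1^2 on this interval. *)
Lemma dbump_ge t : - (3 / 4) <= t -> t <= - (1 / 2) -> bump0 <= dbump t.
Proof.
move=> t1 t2; rewrite dbumpE; last by rewrite ltr_norml; lra.
rewrite -[leLHS]mul1r; apply: ler_pM => //; last first.
- by apply: cbump_ge; rewrite ler_norml; lra.
2: by rewrite ltW// bump0_gt0.
have h1 : 2 <= (t + 1)^-1.
  by rewrite -[2]invrK lef_pV2 ?posrE; lra.
have h2 : (1 - t)^-1 <= 1.
  by rewrite -[X in _ <= X]invr1 lef_pV2 ?posrE; lra.
have h3 : 0 <= (1 - t)^-1 by rewrite invr_ge0; lra.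
nra.
Qed.

End Bump.

(** * Compact sets and the distance to the complement in the plane *)

Section PlaneTopology.
Variable R : realType.
Local Notation pt := (pt R).
Implicit Types (x y z : pt) (U K : set pt).

Lemma ltD1 (k a : R) : k < Num.max k a + 1.
Proof. by rewrite (@le_lt_trans _ _ (Num.max k a)) ?le_max ?lexx// ltrDl. Qed.

Lemma closed_bounded_compact U (r : R) : closed U -> (forall x, U x -> `|x| <= r) -> compact U.
Proof.
move=> cU Ur.
have cc : compact (`[- r, r]%classic `*` `[- r, r]%classic : set pt).
  by apply: compact_setX; exact: segment_compact.
apply: (subclosed_compact cU cc) => x /Ur; rewrite ler_normpt !ler_norml => /andP[h1 h2].
by split => /=; rewrite in_itv.
Qed.

Lemma compact_ptP K : compact K -> closed K /\ exists2 r, 0 < r & forall x, K x -> `|x| <= r.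
Proof.
move=> cK; split; first by apply: compact_closed => //; exact: norm_hausdorff.
have [M [Mr h]] := compact_bounded cK; exists (Num.max M 0 + 1).
  by rewrite ltr_wpDl// le_max lexx orbT.
by move=> x Kx; apply: h => //; exact: ltD1.
Qed.

Lemma open_ptP U x : open U -> U x -> exists2 r, 0 < r & forall y, `|y - x| < r -> U y.
Proof.
move=> oU Ux; have /nbhs_ballP[r /= r0 rU] : nbhs x U by exact: open_nbhs_nbhs.
by exists r => // y; rewrite distrC => h; apply: rU; rewrite -ball_normE.
Qed.

Lemma open_ptPI U : (forall x, U x -> exists2 r, 0 < r & forall y, `|y - x| < r -> U y) -> open U.
Proof.
move=> h; rewrite openE => x /h[r r0 rU]; apply/nbhs_ballP; exists r => //= y.
by rewrite -ball_normE /= distrC => /rU.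
Qed.

(** Distance to the complement of [U]. When [U] is the whole plane the infimum runs over the empty
    set, so the lemmas below take a point [z0] outside [U]. *)
Definition distC U x : R := inf [set d | exists2 z, ~ U z & d = `|x - z|].

Section Dist.
Variables (U : set pt) (z0 : pt).
Hypotheses (oU : open U) (Uz0 : ~ U z0).

Let S x := [set d : R | exists2 z, ~ U z & d = `|x - z|].

Let lbS x : has_lbound (S x).
Proof. by exists 0 => _ [z _ ->]. Qed.

Let neS x : S x !=set0.
Proof. by exists `|x - z0|; exists z0. Qed.

Lemma distC_ge0 x : 0 <= distC U x.
Proof. by apply: (lb_le_inf (neS x)) => _ [z _ ->]. Qed.

Lemma distC_le x z : ~ U z -> distC U x <= `|x - z|.
Proof. by move=> Uz; apply: (ge_inf (lbS x)); exists z. Qed.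

Lemma distC_lip x y : distC U x - distC U y <= `|x - y|.
Proof.
rewrite lerBlDr addrC -lerBlDr; apply: (lb_le_inf (neS y)) => _ [z Uz ->].
rewrite lerBlDr (le_trans (distC_le x Uz))//.
by rewrite [leRHS]addrC; exact: ler_distD.
Qed.

Lemma distC_lipn x y : `|distC U x - distC U y| <= `|x - y|.
Proof. by rewrite ler_norml distC_lip andbT lerNl opprB -(distrC y) distC_lip. Qed.

Lemma distC_gt0 x : U x -> 0 < distC U x.
Proof.
move=> /(open_ptP oU)[r r0 rU]; apply: (lt_le_trans r0); apply: (lb_le_inf (neS x)) => _ [z Uz ->].
by rewrite leNgt distrC; apply/negP => /rU.
Qed.

Lemma distC_off x : ~ U x -> distC U x = 0.
Proof.
by move=> /(distC_le x); rewrite subrr normr0 => h; apply/eqP; rewrite eq_le h distC_ge0.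
Qed.

Lemma distC_in x : 0 < distC U x -> U x.
Proof. by move=> h; apply: contrapT => /distC_off d0; rewrite d0 ltxx in h. Qed.

End Dist.

Lemma lip_continuous (f : pt -> R) (L : R) :
  (forall x y, `|f x - f y| <= L * `|x - y|) -> continuous f.
Proof.
move=> fL x; apply/cvgrPdist_lt => e e0.
have L0 : 0 < Num.max L 0 + 1 by rewrite ltr_wpDl// le_max lexx orbT.
suff : nbhs x (fun t => `|f x - f t| < e) by [].
apply/nbhs_ballP; exists (e / (Num.max L 0 + 1)); first by rewrite /= divr_gt0.
move=> y; rewrite -ball_normE /= => h; apply: le_lt_trans (fL _ _) _.
have L1 : L <= Num.max L 0 + 1 by rewrite ltW// ltD1.
by rewrite (le_lt_trans (ler_wpM2r _ L1))// mulrC -ltr_pdivlMr.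
Qed.

Lemma compact_thick U K : open U -> compact K -> K `<=` U ->
  exists2 r, 0 < r & forall x y, K x -> `|y - x| < r -> U y.
Proof.
move=> oU cK KU.
have [[z0 Uz0]|nU] := pselect (exists z, ~ U z); last first.
  by exists 1 => // x y _ _; apply: contrapT => h; apply: nU; exists y.
have [->|/set0P neK] := eqVneq K set0; first by exists 1.
have cd : continuous (distC U).
  by apply: (@lip_continuous _ 1) => x y; rewrite mul1r (distC_lipn Uz0).
have [c cKc h] := compact_EVT_min neK cK (continuous_subspaceT cd).
exists (distC U c); first by apply: (distC_gt0 oU Uz0); apply: KU; exact: set_mem.
move=> x y Kx yx; apply: (distC_in Uz0).
have := distC_lip Uz0 x y; have := h x (mem_set Kx); rewrite distrC in yx; lra.
Qed.

End PlaneTopology.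

(** * Smooth functions and test functions of two variables *)

Section Smooth.
Variable R : realType.
Local Notation pt := (pt R).
Local Notation mpt := (mpt R).
Local Notation mu2 := (mu2 R).
Implicit Types (x y : pt) (f g phi : pt -> R) (U K : set pt) (j : 'I_2).

Lemma ord2P j : j = 0 \/ j = 1.
Proof. by case: j => [[|[|//]] h]; [left|right]; apply/val_inj. Qed.

Lemma norm_e j : `|e_ R j| = 1.
Proof.
by case: (ord2P j) => ->; rewrite normptE /e_ /= normr0 normr1 ?(max_l ler01) ?(max_r ler01).
Qed.

Lemma norm_he (h : R) j : `|h *: e_ R j| = `|h|.
Proof. by rewrite normrZ norm_e mulr1. Qed.

(** Coinduction: [smooth] quantifies over all lists of derivatives, so it suffices to exhibit a
    class of functions stable under [pd]. Tensor products, multiples and mollifications are handled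
    this way. *)
Lemma smooth_coind (P : (pt -> R) -> Prop) :
  (forall f, P f -> continuous f /\ forall j, (forall x, derivable f x (e_ R j)) /\ P (pd j f)) ->
  forall f, P f -> smooth f.
Proof.
move=> h f Pf s.
have Ps : P (pds s f) by elim: s => //= j s /h[_ /(_ j)[]].
by have [c d] := h _ Ps; split => // j x; have [dj _] := d j.
Qed.

Lemma smooth_pd f j : smooth f -> smooth (pd j f).
Proof. by move=> sf s; have := sf (rcons s j); rewrite /pds foldr_rcons. Qed.

Lemma smooth_continuous f : smooth f -> continuous f.
Proof. by move=> /(_ [::])[]. Qed.

Lemma smooth_derive f j x : smooth f -> is_derive x (e_ R j) f (pd j f x).
Proof. by move=> /(_ [::])[_ h]; split => //; exact: h. Qed.

Lemma testfun_off U phi : testfun U phi -> exists2 K, compact K /\ K `<=` U &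
  forall x, ~ K x -> phi x = 0 /\ forall j, pd j phi x = 0.
Proof.
move=> [sp [K [cK KU Koff]]]; exists K => // x Kx; split; first exact: Koff.
move=> j; have oK : open (~` K) by apply: closed_openC; have [] := compact_ptP cK.
have [r r0 rK] := open_ptP oK Kx.
have dp : is_derive x (e_ R j) phi 0.
  apply/dderivP => e e0; exists r => // h hr; rewrite !Koff//.
    by rewrite mulr0 !subrr normr0 mulr_ge0// ltW.
  by apply: rK; rewrite addrK norm_he.
by rewrite /pd; have [_ ->] := dp.
Qed.

Lemma testfun_pd U phi j : testfun U phi -> testfun U (pd j phi).
Proof.
move=> tp; have [K [cK KU] h] := testfun_off tp; split; first exact: smooth_pd tp.1.
by exists K; split => // x /h[].
Qed.

Lemma compact_support_bsf phi K : continuous phi -> compact K ->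
  (forall x, ~ K x -> phi x = 0) -> bsf phi.
Proof.
move=> cp cK Koff; split; first exact: continuous_measurable_funpt.
have [_ [r r0 Kr]] := compact_ptP cK.
have : compact (phi @` K).
  by apply: continuous_compact => //; exact: continuous_subspaceT.
move=> /compact_bounded[M [Mr Mh]]; exists (Num.max (Num.max M 0 + 1) r) => x; split.
  have [Kx|/Koff ->] := pselect (K x).
    rewrite le_max; apply/orP; left; apply: (Mh (Num.max M 0 + 1)); first exact: ltD1.
    by exists x.
  by rewrite normr0 le_max; apply/orP; right; exact: ltW.
rewrite gt_max => /andP[_ rx]; apply: Koff => /Kr; rewrite leNgt.
by rewrite rx.
Qed.

Lemma testfun_bsf U phi : testfun U phi -> bsf phi.
Proof.
by move=> [sp [K [cK KU h]]]; apply: compact_support_bsf cK h; exact: smooth_continuous.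
Qed.

Lemma smooth_lip_dir phi j C : smooth phi -> (forall x, `|pd j phi x| <= C) ->
  forall x (h : R), `|phi (h *: e_ R j + x) - phi x| <= C * `|h|.
Proof.
move=> sp dC x h.
pose g (t : R) := phi ((t * h) *: e_ R j + x).
have dg (t : R) : is_derive t 1 g (h * pd j phi ((t * h) *: e_ R j + x)).
  have /dderivP d := smooth_derive j ((t * h) *: e_ R j + x) sp.
  apply/dderivP => e e0.
  have h0 : 0 < `|h| + 1 by rewrite ltr_wpDl.
  have [r r0 dr] := d (e / (`|h| + 1)) (divr_gt0 e0 h0).
  exists (r / (`|h| + 1)); first by rewrite divr_gt0.
  move=> s sr; rewrite -[s *: _]/(s * 1) mulr1 /g mulrDl scalerDl -(addrA _ _ x) mulrA.
  have shr : `|s * h| < r.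
    rewrite normrM; move: sr; rewrite ltr_pdivlMr// => /le_lt_trans; apply.
    by rewrite ler_wpM2l// lerDl.
  apply: le_trans (dr _ shr) _; rewrite normrM mulrAC ler_pdivrMr//.
  by rewrite mulrA ler_wpM2l ?lerDl// mulr_ge0// ltW.
have cg : {within `[0, 1], continuous g}.
  apply: continuous_subspaceT => t; apply: differentiable_continuous.
  by apply/derivable1_diffP; have [] := dg t.
have [c _] := MVT_segment ler01 (fun t _ => dg t) cg.
rewrite subr0 mulr1 /g mul1r mul0r scale0r add0r => ->.
by rewrite normrM mulrC ler_wpM2r.
Qed.

Lemma testfun_lip_dir U phi j : testfun U phi -> exists2 C, 0 < C &
  forall x (h : R), `|phi (h *: e_ R j + x) - phi x| <= C * `|h|.
Proof.
move=> tp; have [C [C0 dC]] := bsf_dom (testfun_bsf (testfun_pd j tp)).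
by exists C => //; apply: (smooth_lip_dir tp.1) => x; exact: (dC x).1.
Qed.

Definition tensor (a b : R -> R) : pt -> R := fun x => a x.1 * b x.2.

Lemma tensor_deriv0 a b (da : R -> R) x : is_derive x.1 1 a (da x.1) ->
  is_derive x (e_ R 0) (tensor a b) (tensor da b x).
Proof.
move=> /dderivP d; apply/dderivP => e e0.
have B0 : 0 < `|b x.2| + 1 by rewrite ltr_wpDl.
have [r r0 dr] := d (e / (`|b x.2| + 1)) (divr_gt0 e0 B0); exists r => // h hr.
have := dr h hr; rewrite -[h *: 1]/(h * 1) mulr1 /tensor /e_ eqxx /= => k.
rewrite -[h *: 1]/(h * 1) -[h *: 0]/(h * 0) mulr0 mulr1 add0r.
rewrite [X in `|X|](_ : _ = (a (h + x.1) - a x.1 - h * da x.1) * b x.2); last by ring.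
rewrite normrM (le_trans (ler_wpM2r _ k))// mulrAC ler_wpM2r//.
by rewrite mulrAC ler_pdivrMr// ler_wpM2l ?ltW// ltrDl.
Qed.

Lemma tensor_deriv1 a b (db : R -> R) x : is_derive x.2 1 b (db x.2) ->
  is_derive x (e_ R 1) (tensor a b) (tensor a db x).
Proof.
move=> /dderivP d; apply/dderivP => e e0.
have B0 : 0 < `|a x.1| + 1 by rewrite ltr_wpDl.
have [r r0 dr] := d (e / (`|a x.1| + 1)) (divr_gt0 e0 B0); exists r => // h hr.
have := dr h hr; rewrite -[h *: 1]/(h * 1) mulr1 /tensor /e_ /= => k.
rewrite -[h *: 1]/(h * 1) -[h *: 0]/(h * 0) mulr0 mulr1 add0r.
rewrite [X in `|X|](_ : _ = (b (h + x.2) - b x.2 - h * db x.2) * a x.1); last by ring.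
rewrite normrM (le_trans (ler_wpM2r _ k))// mulrAC ler_wpM2r//.
by rewrite mulrAC ler_pdivrMr// ler_wpM2l ?ltW// ltrDl.
Qed.

Lemma smooth_tensor a b : sm1 a -> sm1 b -> smooth (tensor a b).
Proof.
move=> sa sb; pose P f := exists a b, [/\ sm1 a, sm1 b & f = tensor a b].
apply: (smooth_coind (P := P)); last by exists a, b.
move=> _ [{}a [{}b [{}sa {}sb ->]]]; split.
  move=> x; apply: cvgM; first by apply: continuous_comp; [exact: cvg_fst|exact: sm1_continuous].
  by apply: continuous_comp; [exact: cvg_snd|exact: sm1_continuous].
have [da sda ha] := sm1_deriv sa; have [db sdb hb] := sm1_deriv sb.
move=> j; case: (ord2P j) => ->; split.
- by move=> x; have [] := tensor_deriv0 b (ha x.1).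
- exists da, b; split => //; apply/funext => x; rewrite /pd.
  by have [_ ->] := tensor_deriv0 b (ha x.1).
- by move=> x; have [] := tensor_deriv1 a (hb x.2).
- exists a, db; split => //; apply/funext => x; rewrite /pd.
  by have [_ ->] := tensor_deriv1 a (hb x.2).
Qed.

Definition bump1 (c r : R) (t : R) := cbump ((t - c) / r).

Definition dbump1 (c r : R) (t : R) := r^-1 * dbump ((t - c) / r).

Lemma bump1E c r : bump1 c r = (fun t => cbump (r^-1 * t + - c / r)).
Proof. by apply/funext => t; rewrite /bump1 mulrBl mulrC mulNr. Qed.

Lemma sm1_bump1 c r : sm1 (bump1 c r).
Proof. by rewrite bump1E; exact/sm1_aff/sm1_cbump. Qed.

Lemma bump1_deriv c r (t : R) : is_derive t 1 (bump1 c r) (dbump1 c r t).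
Proof.
rewrite bump1E.
have da : is_derive t 1 (fun s : R => r^-1 * s + - c / r) (r^-1).
  apply/dderivP => e e0; exists 1 => // h _.
  rewrite -[h *: _]/(h * 1) mulr1 [X in `|X|](_ : _ = 0) ?normr0; last by ring.
  by rewrite mulr_ge0// ltW.
have := @is_derive1_comp R (@cbump R) (fun s => r^-1 * s + - c / r) t _ _ (cbump_deriv _) da.
rewrite /dbump1 (_ : (t - c) / r = r^-1 * t + - c / r); last by ring.
by rewrite [r^-1 * dbump _]mulrC.
Qed.

Lemma bump1_off c r (t : R) : 0 < r -> r <= `|t - c| -> bump1 c r t = 0.
Proof.
by move=> r0 h; rewrite /bump1 cbump_off// normrM (gtr0_norm (x := r^-1)) ?invr_gt0// ler_pdivlMr// mul1r.
Qed.

Definition bump2 (p : pt) (r1 r2 : R) := tensor (bump1 p.1 r1) (bump1 p.2 r2).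

Lemma smooth_bump2 p r1 r2 : smooth (bump2 p r1 r2).
Proof. by apply: smooth_tensor; exact: sm1_bump1. Qed.

Lemma pd0_bump2 p r1 r2 x : pd 0 (bump2 p r1 r2) x = dbump1 p.1 r1 x.1 * bump1 p.2 r2 x.2.
Proof. by rewrite /pd; have [_ ->] := tensor_deriv0 (bump1 p.2 r2) (bump1_deriv p.1 r1 x.1). Qed.

Lemma pd1_bump2 p r1 r2 x : pd 1 (bump2 p r1 r2) x = bump1 p.1 r1 x.1 * dbump1 p.2 r2 x.2.
Proof. by rewrite /pd; have [_ ->] := tensor_deriv1 (bump1 p.1 r1) (bump1_deriv p.2 r2 x.2). Qed.

Lemma bump2_ge0 p r1 r2 x : 0 <= bump2 p r1 r2 x.
Proof. by rewrite mulr_ge0 ?cbump_ge0. Qed.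

Lemma bump2_le1 p r1 r2 x : bump2 p r1 r2 x <= 1.
Proof. by rewrite -[1]mulr1 ler_pM ?cbump_ge0 ?cbump_le1. Qed.

Lemma testfun_bump2 U p r1 r2 : 0 < r1 -> 0 < r2 ->
  (forall x, `|x.1 - p.1| <= r1 -> `|x.2 - p.2| <= r2 -> U x) ->
  testfun U (bump2 p r1 r2).
Proof.
move=> r10 r20 h; split; first exact: smooth_bump2.
exists (`[p.1 - r1, p.1 + r1]%classic `*` `[p.2 - r2, p.2 + r2]%classic); split.
- by apply: compact_setX; exact: segment_compact.
- by move=> x [/=]; rewrite !in_itv /= -!ler_distl => ? ?; exact: h.
move=> x nx; rewrite /bump2 /tensor.
have [h1|h1] := ltP `|x.1 - p.1| r1; last by rewrite bump1_off// mul0r.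
have [h2|h2] := ltP `|x.2 - p.2| r2; last by rewrite [bump1 p.2 _ _]bump1_off// mulr0.
by exfalso; apply: nx; split; rewrite /= in_itv /= -ler_distl ltW.
Qed.

Lemma bump2_ge p r x : 0 < r -> box p (r / 2) x -> bump0 R ^+ 2 <= bump2 p r r x.
Proof.
move=> r0 /boxP; rewrite ltr_normpt => /andP[/= h1 h2].
have B0 := ltW (bump0_gt0 R).
rewrite expr2 ler_pM//; apply: cbump_ge; rewrite normrM (gtr0_norm (x := r^-1)) ?invr_gt0// ler_pdivrMr//;
  rewrite distrC; lra.
Qed.

Lemma bump2_off p r x : 0 < r -> ~ box p r x -> bump2 p r r x = 0.
Proof.
move=> r0 nb; rewrite /bump2 /tensor.
have [h1|h1] := ltP `|x.1 - p.1| r; last by rewrite bump1_off// mul0r.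
have [h2|h2] := ltP `|x.2 - p.2| r; last by rewrite [bump1 p.2 _ _]bump1_off// mulr0.
by exfalso; apply: nb; apply/boxP; rewrite ltr_normpt /= !(distrC p.1) (distrC p.2) h1.
Qed.

End Smooth.

(** * Weak derivatives of Lipschitz functions *)

Section WeakDerivatives.
Variable R : realType.
Local Notation pt := (pt R).
Local Notation mpt := (mpt R).
Local Notation mu2 := (mu2 R).
Implicit Types (x y : pt) (f g phi : pt -> R) (U K : set pt) (j : 'I_2).

Definition bmf f := measurable_fun setT (f : mpt -> R) /\ exists C, forall x, `|f x| <= C.

Lemma bmfM f g : bmf f -> bsf g -> bsf (fun x => f x * g x).
Proof. by move=> [mf [C fC]]; exact: bsfMr mf fC. Qed.

Lemma bsf_bmf f : bsf f -> bmf f.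
Proof. by move=> [mf [C fC]]; split => //; exists C => x; exact: (fC x).1. Qed.

Definition step (n : nat) : R := n.+1%:R^-1.

Lemma step_gt0 n : 0 < step n.
Proof. by rewrite invr_gt0 ltr0n. Qed.

Lemma step_le1 n : step n <= 1.
Proof. by rewrite invf_le1 ?ltr0n// ler1n. Qed.

Lemma step_cvg0 : step n @[n --> \oo] --> (0 : R).
Proof. exact: cvg_harmonic. Qed.

Lemma step_lt (e : R) : 0 < e -> \forall n \near \oo, step n < e.
Proof. by move=> e0; apply: (cvgr_lt (0 : R) step_cvg0). Qed.

Definition dq f j (h : R) x : R := (f (h *: e_ R j + x) - f x) / h.

Lemma dq_cvg f j x d (u : nat -> R) : is_derive x (e_ R j) f d ->
  (forall n, u n != 0) -> u n @[n --> \oo] --> (0 : R) ->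
  dq f j (u n) x @[n --> \oo] --> d.
Proof.
move=> /dderivP df un0 u0; apply/cvgrPdist_le => e e0.
have [r r0 dr] := df e e0.
have : \forall n \near \oo, `|u n| < r.
  move/cvgrPdist_lt : u0 => /(_ r r0); apply: filterS => n.
  by rewrite sub0r normrN.
apply: filterS => n /dr; rewrite /dq => h.
rewrite distrC -(ler_pM2r (x := `|u n|)) ?normr_gt0// -normrM mulrBl divfK//.
by rewrite [d * _]mulrC.
Qed.

Lemma measurable_shiftpt f (a : pt) : measurable_fun setT (f : mpt -> R) ->
  measurable_fun setT ((fun x => f (a + x)) : mpt -> R).
Proof. by move=> mf; exact: (measurableT_comp mf (measurable_shift a)). Qed.

Lemma bmf_shift f a : bmf f -> bmf (fun x => f (a + x)).
Proof. by move=> [mf [C fC]]; split; [exact: measurable_shiftpt|exists C]. Qed.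

Lemma bmf_dq f j h : bmf f -> bmf (dq f j h).
Proof.
move=> [mf [C fC]]; split.
  apply: measurable_funM; last exact: measurable_cst.
  by apply: measurable_funB => //; exact: measurable_shiftpt.
exists ((C + C) * `|h^-1|) => x; rewrite normrM ler_wpM2r// (le_trans (ler_normB _ _))//.
exact: lerD.
Qed.

Lemma bsf_dq phi j h : bsf phi -> bsf (dq phi j h).
Proof.
move=> bp; rewrite /dq.
have := bsfZ h^-1 (bsfB (bsf_shift (h *: e_ R j) bp) bp).
by under eq_fun do rewrite mulrC.
Qed.

(** Translation invariance moves the shift from [phi] to [f], whence the backward step [- h]. *)
Lemma dq_parts f phi j h : bmf f -> bsf phi -> h != 0 ->
  I2 (fun x => f x * dq phi j h x) = - I2 (fun x => dq f j (- h) x * phi x).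
Proof.
move=> bf bp h0.
have b1 := bmfM bf (bsf_shift (h *: e_ R j) bp).
have b2 := bmfM bf bp.
have b3 := bmfM (bmf_shift ((- h) *: e_ R j) bf) bp.
have -> : (fun x => f x * dq phi j h x) =
    (fun x => h^-1 * (f x * phi (h *: e_ R j + x) - f x * phi x)).
  by apply/funext => x; rewrite /dq; ring.
have -> : (fun x => dq f j (- h) x * phi x) =
    (fun x => - h^-1 * (f (- h *: e_ R j + x) * phi x - f x * phi x)).
  by apply/funext => x; rewrite /dq invrN; ring.
rewrite !I2Z ?I2B//; last 2 first.
- exact: bsfB.
- exact: bsfB.
rewrite mulNr opprK; congr (_ * (_ - _)).
rewrite -(I2_shift (- h *: e_ R j)); last exact: b1.1.
by congr I2; apply/funext => x; rewrite addrA -scalerDl subrr scale0r add0r.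
Qed.

(** By [dq_parts] the left-hand side pairs [f] with difference quotients of [phi], and those
    converge whatever [f] is. The distributional derivative of a merely bounded measurable [f] is
    thus a limit of pairings with its own difference quotients. *)
Lemma parts_limit f phi U j : bmf f -> testfun U phi ->
  I2 (fun x => dq f j (- step n) x * phi x) @[n --> \oo] -->
  - I2 (fun x => f x * pd j phi x).
Proof.
move=> bf tp.
have bp := testfun_bsf tp; have bdp := testfun_bsf (testfun_pd j tp).
have -> : (fun n => I2 (fun x => dq f j (- step n) x * phi x)) =
    (fun n => - I2 (fun x => f x * dq phi j (step n) x)).
  by apply/funext => n; rewrite dq_parts ?opprK// gt_eqF// step_gt0.
apply: cvgN.
have [L L0 pL] := testfun_lip_dir j tp.
have [D [D0 pD]] := bsf_dom bp.
case: (bf) => mf [C fC].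
have C0 : 0 <= C by apply: le_trans (fC 0).
apply: (@I2_dct _ _ _ (C * L + D + 1)).
- by move=> n; apply: measurable_funM => //; exact: (bsf_dq _ _ bp).1.
- move=> n x; rewrite normrM; split.
    rewrite (@le_trans _ _ (C * L))//; last by rewrite -addrA lerDl addr_ge0// ltW.
    rewrite ler_pM// /dq normrM normfV ler_pdivrMr ?normr_gt0 ?gt_eqF ?step_gt0//.
  move=> h; rewrite /dq !(pD _).2 ?subrr ?mul0r ?mulr0//.
    have := normr_ge0 x; have : 0 <= C * L by rewrite mulr_ge0// ltW.
    lra.
  have h1 : `|x| <= `|step n *: e_ R j + x| + `|step n *: e_ R j|.
    by rewrite -{1}[x](addKr (step n *: e_ R j)) addrC (le_trans (ler_normD _ _))// normrN.
  move: h1; rewrite norm_he gtr0_norm ?step_gt0// => h1.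
  have := step_le1 n; have : 0 <= C * L by rewrite mulr_ge0// ltW.
  lra.
- exact: bmfM.
apply: nearW => x; apply: cvgM; first exact: cvg_cst.
apply: dq_cvg.
- exact: (smooth_derive j x tp.1).
- by move=> n; rewrite gt_eqF// step_gt0.
- exact: step_cvg0.
Qed.

(** A lower bound on backward difference quotients where [phi] is nonzero survives in the limit of
    [parts_limit]: a slope of [f] bounds its distributional derivative from below although [f] is
    not assumed differentiable. *)
Lemma weak_mono f phi U j (k : R) : bmf f -> testfun U phi ->
  (forall x, 0 <= phi x) ->
  (\forall n \near \oo, forall x, phi x != 0 -> k <= dq f j (- step n) x) ->
  k * I2 phi <= - I2 (fun x => f x * pd j phi x).
Proof.
move=> bf tp p0 h; have cv := parts_limit (j := j) bf tp.
suff hk : \forall n \near \oo, k * I2 phi <= I2 (fun x => dq f j (- step n) x * phi x).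
  exact: (cvgr_to_ge cv hk).
apply: filterS h => n h; rewrite -I2Z; last exact: testfun_bsf tp.
apply: I2_le.
- exact/bsfZ/(testfun_bsf tp).
- by apply: bmfM; [exact: bmf_dq|exact: testfun_bsf tp].
- move=> x; have [->|px] := eqVneq (phi x) 0; first by rewrite !mulr0.
  by rewrite ler_wpM2r// h.
Qed.

Lemma integral_restr U f phi : bmf (f \_ U) -> bsf phi ->
  (\int[mu2]_(x in (U : set mpt)) (f x * phi x)%:E)%E = (I2 (fun x => (f \_ U) x * phi x))%:E.
Proof.
move=> bf bp; rewrite integral_mkcond -I2E; last exact: bmfM.
apply: eq_integral => x _; rewrite /patch; case: ifP => //.
by rewrite mul0r.
Qed.

Lemma measurable_restr U f : measurable (U : set mpt) ->
  (measurable_fun setT ((f \_ U) : mpt -> R) <-> measurable_fun (U : set mpt) (f : mpt -> R)).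
Proof. by move=> mU; split => /(measurable_restrictT (f : mpt -> R) mU). Qed.

Lemma bmf_loc_int U f : open U -> bmf (f \_ U) -> loc_int U f.
Proof.
move=> oU [mf [C fC]] K cK KU.
have [clK [r r0 Kr]] := compact_ptP cK.
have mK : measurable (K : set mpt) by exact: measurable_closedpt.
have mU : measurable (U : set mpt) by exact: measurable_openpt.
apply: (@measurable_bounded_integrable _ mpt _ mu2 f) => //.
- have /le_lt_trans : (mu2 K <= mu2 (box (0%R : pt) (r + 1)%R))%E.
    apply: le_measure; rewrite ?inE//; first exact: measurable_box.
    by move=> x /Kr xr; apply/boxP; rewrite sub0r normrN; lra.
  by apply; rewrite mu2_box ?ltry//; lra.
- by apply: measurable_funS ((measurable_restr f mU).1 mf) => //.
- exists C; split; first by rewrite num_real.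
  move=> M /ltW CM x Kx; apply: le_trans CM; apply: le_trans (fC x).
  by rewrite /patch mem_set//; exact: KU.
Qed.

Lemma weak_derivE U f g j : open U -> bmf (f \_ U) -> bmf (g \_ U) ->
  (forall phi, testfun U phi ->
    - I2 (fun x => (f \_ U) x * pd j phi x) = I2 (fun x => (g \_ U) x * phi x)) ->
  weak_deriv U [:: j] f g.
Proof.
move=> oU bf bg h; split; [exact: bmf_loc_int|exact: bmf_loc_int|].
move=> phi tp /=; rewrite integral_restr//; last exact: testfun_bsf (testfun_pd j tp).
rewrite integral_restr//; last exact: testfun_bsf tp.
by rewrite -h// expr1 -EFinM mulN1r opprK.
Qed.

Definition clamp (L t : R) := Num.max (- L) (Num.min L t).

Lemma clamp_le L t : 0 <= L -> `|clamp L t| <= L.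
Proof.
move=> L0; rewrite /clamp ler_norml le_max lexx /= ge_max ge_min lexx /= andbT.
by rewrite (le_trans _ L0)// oppr_le0.
Qed.

Lemma clamp_id L t : `|t| <= L -> clamp L t = t.
Proof. by rewrite ler_norml => /andP[h1 h2]; rewrite /clamp (min_r h2) (max_r h1). Qed.

Lemma measurable_clamp L f : measurable_fun setT (f : mpt -> R) ->
  measurable_fun setT ((fun x => clamp L (f x)) : mpt -> R).
Proof.
move=> mf; apply: measurable_maxr; first exact: measurable_cst.
by apply: measurable_minr => //; exact: measurable_cst.
Qed.

(** Candidate for the weak derivative. The inner clamp keeps the sequence bounded, so that the upper
    limit is finite and measurable; the outer one bounds the result by [L] at every point, including
    those without a limit. *)
Definition wd f j L x : R := clamp L (limn_sup (fun n => clamp L (dq f j (- step n) x))).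

Lemma wd_le f j L x : 0 <= L -> `|wd f j L x| <= L.
Proof. exact: clamp_le. Qed.

Lemma measurable_wd f j L : 0 <= L -> bmf f -> measurable_fun setT (wd f j L : mpt -> R).
Proof.
move=> L0 bf; apply: measurable_clamp; apply: measurable_fun_limn_sup.
- by move=> x _; exists L => _ [n _ <-]; have := clamp_le (dq f j (- step n) x) L0; rewrite ler_norml => /andP[].
- by move=> x _; exists (- L) => _ [n _ <-]; have := clamp_le (dq f j (- step n) x) L0; rewrite ler_norml => /andP[].
- by move=> n; apply: measurable_clamp; exact: (bmf_dq _ _ bf).1.
Qed.

Lemma bmf_wd f j L : 0 <= L -> bmf f -> bmf (wd f j L).
Proof. by move=> L0 bf; split; [exact: measurable_wd|exists L => x; exact: wd_le]. Qed.

Lemma wd_cvg f j L x d : (\forall n \near \oo, `|dq f j (- step n) x| <= L) ->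
  dq f j (- step n) x @[n --> \oo] --> d -> wd f j L x = d.
Proof.
move=> hL cd.
have dL : `|d| <= L by apply: (cvgr_to_le (cvg_norm cd)).
have cc : clamp L (dq f j (- step n) x) @[n --> \oo] --> d.
  apply: cvg_trans cd; apply: near_eq_cvg; apply: filterS hL => n hn.
  by rewrite clamp_id.
have [_ sE] := cvg_limn_inf_sup cc.
by rewrite /wd sE clamp_id.
Qed.

Lemma bmfS U f : measurable (U : set mpt) -> bmf f -> bmf (f \_ U).
Proof.
move=> mU [mf [C fC]]; split.
  exact: (measurable_restr f mU).2 (measurable_funTS mf).
exists C => x; rewrite /patch; case: ifP => // _; rewrite normr0; exact: le_trans (fC 0).
Qed.

Lemma dq_near f U j x : open U -> U x ->
  \forall n \near \oo, dq (f \_ U) j (- step n) x = dq f j (- step n) x.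
Proof.
move=> oU Ux; have [r r0 rU] := open_ptP oU Ux.
apply: filterS (step_lt r0) => n nr; rewrite /dq /patch !mem_set//.
by apply: rU; rewrite addrK norm_he normrN gtr0_norm// step_gt0.
Qed.

Lemma dq_lip f U L j x h : 0 < `|h| -> (forall x y, U x -> U y -> `|f x - f y| <= L * `|x - y|) ->
  U x -> U (h *: e_ R j + x) -> `|dq f j h x| <= L.
Proof.
move=> h0 fL Ux Uhx; rewrite /dq normrM normfV ler_pdivrMr//.
by apply: le_trans (fL _ _ Uhx Ux) _; rewrite addrK norm_he.
Qed.

(** Almost everywhere convergence of difference quotients is a hypothesis, in the place of
    Rademacher's theorem. Given it, [parts_limit] and dominated convergence identify the weak
    derivative as [wd]. *)
Lemma weak_deriv_lip U f j L : open U -> 0 <= L -> bmf (f \_ U) ->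
  (forall x y, U x -> U y -> `|f x - f y| <= L * `|x - y|) ->
  {ae mu2, forall x : mpt, (U : set mpt) x -> exists d, dq f j (- step n) x @[n --> \oo] --> (d : R)} ->
  weak_deriv U [:: j] f (wd (f \_ U) j L).
Proof.
move=> oU L0 bf fL aec.
have mU : measurable (U : set mpt) by exact: measurable_openpt.
have bw := bmf_wd j L0 bf.
have bwU := bmfS mU bw.
apply: weak_derivE => // phi tp.
rewrite -(cvg_lim (@Rhausdorff R) (parts_limit (j := j) bf tp)).
apply: cvg_lim; first exact: Rhausdorff.
have [K [cK KU] Koff] := testfun_off tp.
have [r r0 Kr] := compact_thick oU cK KU.
have bp := testfun_bsf tp; have [D [D0 pD]] := bsf_dom bp.
have hn : \forall n \near \oo, step n < r by exact: step_lt.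
case: hn => N _ hN.
(* From rank [N] on, a point of the support shifted by [step n] is still in [U], where [f] is
   Lipschitz; earlier quotients may see the jump of the restriction and need not be bounded by
   [L]. *)
rewrite -(cvg_shiftn N).
apply: (@I2_dct _ _ _ (L * D + D)).
- by move=> n; apply: measurable_funM; [exact: (bmf_dq _ _ bf).1|exact: bp.1].
- move=> n x; split; last first.
    move=> h; rewrite (pD x).2 ?mulr0//; apply: le_lt_trans h.
    by rewrite lerDr mulr_ge0// ltW.
  have [Kx|/Koff[-> _]] := pselect (K x); last first.
    by rewrite mulr0 normr0 addr_ge0 ?mulr_ge0// ltW.
  rewrite normrM (@le_trans _ _ (L * D))//; last by rewrite lerDl ltW.
  rewrite ler_pM ?(pD x).1//.
  have Ux := KU _ Kx.
  have sr : step (n + N) < r by apply: hN; rewrite /= leq_addl.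
  have Uh : U (- step (n + N) *: e_ R j + x).
    by apply: (Kr _ _ Kx); rewrite addrK norm_he normrN gtr0_norm// step_gt0.
  rewrite [X in `|X|](_ : _ = dq f j (- step (n + N)) x); last by rewrite /dq /patch !mem_set.
  by apply: dq_lip fL Ux Uh; rewrite normrN normr_gt0 gt_eqF// step_gt0.
- exact: bmfM.
case: aec => A [mA A0 sA]; exists A; split => // x /= nc; apply: sA => /= h; apply: nc.
have [Kx|/Koff[-> _]] := pselect (K x); last first.
  by rewrite mulr0; under eq_fun do rewrite mulr0; exact: cvg_cst.
have Ux := KU _ Kx; have [d cd] := h Ux.
have cdU : dq (f \_ U) j (- step n) x @[n --> \oo] --> d.
  by apply: cvg_trans cd; apply: near_eq_cvg; apply: filterS (dq_near f j oU Ux) => n ->.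
have -> : ((wd (f \_ U) j L) \_ U) x = d; last first.
  have cc : dq (f \_ U) j (- step n) x * phi x @[n --> \oo] --> d * phi x.
    by apply: cvgM; [exact: cdU|exact: cvg_cst].
  by rewrite -(cvg_shiftn N) in cc.
rewrite {1}/patch mem_set//; apply: (wd_cvg _ cdU).
have [s s0 sU] := open_ptP oU Ux.
near=> n; rewrite [X in `|X|](_ : _ = dq f j (- step n) x); last by near: n; exact: dq_near.
apply: (dq_lip _ fL Ux); first by rewrite normrN normr_gt0 gt_eqF// step_gt0.
apply: sU; rewrite addrK norm_he normrN gtr0_norm ?step_gt0//.
by near: n; exact: step_lt.
Unshelve. all: by end_near. Qed.

End WeakDerivatives.

Lemma ptP (R : realType) (x y : pt R) : x.1 = y.1 -> x.2 = y.2 -> x = y.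
Proof. by case: x y => [a b] [c d] /= -> ->. Qed.

Lemma scale1E (R : realType) (a : R) (x : pt R) : (a *: x).1 = a * x.1.
Proof. by []. Qed.

Lemma scale2E (R : realType) (a : R) (x : pt R) : (a *: x).2 = a * x.2.
Proof. by []. Qed.

Ltac pt_ring := apply: ptP; rewrite /= ?scale1E ?scale2E /=; ring.

(** * Approximation of Lipschitz functions by test functions *)

Section Mollification.
Variable R : realType.
Local Notation pt := (pt R).
Local Notation mpt := (mpt R).
Local Notation mu2 := (mu2 R).
Implicit Types (x y : pt) (f g w phi psi : pt -> R) (U K : set pt) (j : 'I_2).

Definition lip (L : R) f := forall x y, `|f x - f y| <= L * `|x - y|.

Lemma lipW L M f : L <= M -> lip L f -> lip M f.
Proof. by move=> LM fL x y; apply: le_trans (fL x y) _; rewrite ler_wpM2r. Qed.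

Lemma lipN L f : lip L f -> lip L (fun x => - f x).
Proof. by move=> fL x y; rewrite -opprD normrN. Qed.

Lemma lip_max L f g : lip L f -> lip L g -> lip L (fun x => Num.max (f x) (g x)).
Proof.
move=> fL gL x y; have := fL x y; have := gL x y; rewrite !ler_norml.
move=> /andP[g1 g2] /andP[f1 f2].
by case: (leP (f x) (g x)) => h1; case: (leP (f y) (g y)) => h2; apply/andP; split; lra.
Qed.

Lemma lip_min L f g : lip L f -> lip L g -> lip L (fun x => Num.min (f x) (g x)).
Proof.
move=> fL gL x y; have := fL x y; have := gL x y; rewrite !ler_norml.
move=> /andP[g1 g2] /andP[f1 f2].
by case: (leP (f x) (g x)) => h1; case: (leP (f y) (g y)) => h2; apply/andP; split; lra.
Qed.

Lemma smoothZ c psi : smooth psi -> smooth (fun x => c * psi x).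
Proof.
move=> sp; pose P f := exists2 q, smooth q & f = (fun x => c * q x).
apply: (smooth_coind (P := P)); last by exists psi.
move=> _ [q sq ->].
have dq j x : is_derive x (e_ R j) (fun x => c * q x) (c * pd j q x).
  exact: (is_deriveZ c (smooth_derive j x sq)).
split; first by move=> x; apply: cvgM; [exact: cvg_cst|exact: smooth_continuous].
move=> j; split; first by move=> x; have [] := dq j x.
exists (pd j q); first exact: smooth_pd.
by apply/funext => x; rewrite {1}/pd; have [_ ->] := dq j x.
Qed.

Lemma testfunZ U c psi : testfun U psi -> testfun U (fun x => c * psi x).
Proof.
move=> [sp [K [cK KU h]]]; split; first exact: smoothZ.
by exists K; split => // x /h ->; rewrite mulr0.
Qed.

Lemma testfun_lip U psi : testfun U psi -> exists2 L, 0 < L & lip L psi.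
Proof.
move=> tp; have [C C0 hC] := testfun_lip_dir 0 tp; have [D D0 hD] := testfun_lip_dir 1 tp.
exists (C + D); first exact: addr_gt0.
move=> x y.
have e1 : x = (x.1 - y.1) *: e_ R 0 + (y.1, x.2).
  by case: x => a b; apply/eqP; rewrite xpair_eqE /e_ /= -![_ *: _ : R]/(_ * _) mulr1 mulr0 subrK add0r !eqxx.
have e2 : (y.1, x.2) = (x.2 - y.2) *: e_ R 1 + y.
  by apply/eqP; rewrite xpair_eqE /e_ /= -![_ *: _ : R]/(_ * _) mulr1 mulr0 subrK add0r !eqxx.
have -> : psi x - psi y = (psi x - psi (y.1, x.2)) + (psi (y.1, x.2) - psi y) by ring.
have /andP[h1 h2] : (`|(x - y).1| <= `|x - y|) && (`|(x - y).2| <= `|x - y|) by rewrite -ler_normpt.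
rewrite (le_trans (ler_normD _ _))// mulrDl lerD//.
  by rewrite {1}e1 (le_trans (hC _ _))// ler_wpM2l// ltW.
by rewrite {1}e2 (le_trans (hD _ _))// ler_wpM2l// ltW.
Qed.

(** The kernel is not reflected, so this is a correlation: a derivative in [x] falls on [psi] with a
    minus sign, which [conv_derive] keeps inside the kernel. *)
Definition conv f psi x : R := I2 (fun y => f y * psi (y - x)).

Section Conv.
Variables (f psi : pt -> R).
Hypotheses (bf : bsf f) (tp : testfun setT psi).

Lemma bsf_conv x : bsf (fun y => f y * psi (y - x)).
Proof.
have := bsf_shift (- x) (testfun_bsf tp); under eq_fun do rewrite addrC.
exact: bsfM.
Qed.

Lemma conv_shift x : conv f psi x = I2 (fun y => f (x + y) * psi y).
Proof.
rewrite /conv -(I2_shift x); last exact: (bsf_conv x).1.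
by congr I2; apply/funext => y; rewrite addrAC subrr add0r.
Qed.

Lemma conv_continuous : continuous (conv f psi).
Proof.
have [L L0 pL] := testfun_lip tp; have [D [D0 fD]] := bsf_dom bf.
apply: (@lip_continuous _ _ (D * L * (4 * (D + 1) ^+ 2))) => x y.
rewrite -I2B; [|exact: bsf_conv|exact: bsf_conv].
apply: le_trans (I2_abs _) _; first by apply: bsfB; exact: bsf_conv.
rewrite -[leRHS]mulrAC; apply: (@I2_le_box _ _ 0); first by rewrite addr_gt0.
- by apply/bsf_norm/bsfB; exact: bsf_conv.
- move=> z _; rewrite -mulrBr normrM -mulrA ler_pM ?(fD z).1//.
  apply: le_trans (pL _ _) _; rewrite [X in `|X|](_ : _ = - (x - y)) ?normrN//.
  pt_ring.
move=> z nb; rewrite (fD z).2 ?mul0r ?subrr ?normr0//.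
have [h|h] := ltP `|z| (D + 1); last by apply: lt_le_trans h; rewrite ltrDl.
by exfalso; apply: nb; apply/boxP; rewrite sub0r normrN.
Qed.

Lemma conv_derive j x :
  is_derive x (e_ R j) (conv f psi) (conv f (fun y => - 1 * pd j psi y) x).
Proof.
have cv : h^-1 *: (conv f psi (h *: e_ R j + x) - conv f psi x) @[h --> 0^'] -->
    conv f (fun y => - 1 * pd j psi y) x.
  apply/cvgr_dnbhsP => u [un0 u0].
  have [L L0 pL] := testfun_lip_dir j tp; have [D [D0 fD]] := bsf_dom bf.
  have bdp : bsf (fun y => f y * ((fun y => -1 * pd j psi y) (y - x))).
    have := bsf_shift (- x) (bsfZ (-1) (testfun_bsf (testfun_pd j tp))).
    by under eq_fun do rewrite addrC; exact: bsfM.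
  rewrite (_ : (fun n => _) = fun n => I2 (fun y => f y * (-1 * dq psi j (- u n) (y - x)))); last first.
    apply/funext => n; rewrite -I2B; [|exact: bsf_conv|exact: bsf_conv].
    rewrite -[LHS]/(_ * _) -I2Z; last by apply: bsfB; exact: bsf_conv.
    congr I2; apply/funext => y; rewrite /dq opprD addrA invrN.
    rewrite (_ : - u n *: e_ R j + (y - x) = y - u n *: e_ R j - x); first by ring.
    by rewrite scaleNr addrA [_ + y]addrC.
  apply: (@I2_dct _ _ _ (D * L + D)) => //.
  - move=> n; apply: measurable_funM; first exact: bf.1.
    have := bsf_shift (- x) (bsfZ (-1) (bsf_dq j (- u n) (testfun_bsf tp))).
    by move=> [+ _]; under eq_fun do rewrite addrC.
  - move=> n y; split; last first.
      by move=> h; rewrite (fD y).2 ?mul0r//; apply: le_lt_trans h; rewrite lerDr mulr_ge0// ltW.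
    rewrite normrM (@le_trans _ _ (D * L))//; last by rewrite lerDl ltW.
    rewrite ler_pM ?(fD y).1// mulN1r normrN /dq normrM normfV ler_pdivrMr ?pL// normr_gt0.
    by rewrite oppr_eq0.
  apply: nearW => y; apply: cvgM; first exact: cvg_cst.
  apply: cvgM; first exact: cvg_cst.
  apply: dq_cvg; first exact: (smooth_derive j _ tp.1).
    by move=> n; rewrite oppr_eq0.
  by rewrite -oppr0; apply: cvgN.
by apply: DeriveDef; [apply/cvg_ex; eexists; exact: cv|exact: cvg_lim].
Qed.

End Conv.

Lemma smooth_conv f psi : bsf f -> testfun setT psi -> smooth (conv f psi).
Proof.
move=> bf tp; pose P g := exists2 q, testfun setT q & g = conv f q.
apply: (smooth_coind (P := P)); last by exists psi.
move=> _ [q tq ->]; split; first exact: conv_continuous.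
move=> j; split; first by move=> x; have [] := conv_derive bf tq j x.
exists (fun y => - 1 * pd j q y); first exact/testfunZ/testfun_pd.
by apply/funext => x; rewrite /pd; have [_ ->] := conv_derive bf tq j x.
Qed.

(** Compares a derivative with a slope known only up to [e]. Applied to [conv], it estimates the
    derivative of a mollification by averaged increments, without differentiating the function
    itself. *)
Lemma derive_close f j x p d (r e : R) : 0 < r -> is_derive x (e_ R j) f p ->
  (forall h, `|h| < r -> `|f (h *: e_ R j + x) - f x - h * d| <= e * `|h|) ->
  `|p - d| <= e.
Proof.
move=> r0 /dderivP dp hd; apply/ler_addgt0Pr => k k0.
have [s s0 hs] := dp k k0.
pose h := Num.min r s / 2.
have m0 : 0 < Num.min r s by rewrite lt_min r0.
have h0 : 0 < h by rewrite divr_gt0.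
have hm : h < Num.min r s by rewrite ltr_pdivrMr// mulr_natr mulr2n ltrDl.
have [hr hs'] : h < r /\ h < s by apply/andP; rewrite -lt_min.
rewrite -(ler_pM2r h0) -{1}(gtr0_norm h0) -normrM.
have a1 := hd h; have a2 := hs h; rewrite gtr0_norm// in a1 a2.
rewrite (_ : (p - d) * h = (f (h *: e_ R j + x) - f x - h * d) - (f (h *: e_ R j + x) - f x - h * p)); last by ring.
by rewrite (le_trans (ler_normB _ _))// mulrDl lerD ?a1 ?a2.
Qed.

Section Kernel.
Variables (eta : pt -> R) (eps : R).
Hypotheses (eps0 : 0 < eps) (te : testfun setT eta) (eta0 : forall y, 0 <= eta y)
  (eta1 : I2 eta = 1) (etaoff : forall y, eps <= `|y| -> eta y = 0).

Lemma bsf_conv_shift f x : bsf f -> bsf (fun y => f (x + y) * eta y).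
Proof. by move=> bf; apply: bsfM; [exact: bsf_shift|exact: testfun_bsf te]. Qed.

Lemma conv_avg f x c e : bsf f -> 0 <= e -> (forall y, `|y| < eps -> `|f (x + y) - c| <= e) ->
  `|conv f eta x - c| <= e.
Proof.
move=> bf e0 h; rewrite conv_shift//; have be := testfun_bsf te.
rewrite -[c]mulr1 -eta1 -I2Z// -I2B//; [|exact: bsf_conv_shift|exact: bsfZ].
rewrite (le_trans (I2_abs _))//; first by apply: bsfB; [exact: bsf_conv_shift|exact: bsfZ].
rewrite -[leRHS]mulr1 -eta1 -I2Z//; apply: I2_le.
- by apply/bsf_norm/bsfB; [exact: bsf_conv_shift|exact: bsfZ].
- exact: bsfZ.
move=> y; rewrite -mulrBl normrM (ger0_norm (eta0 y)).
have [/h hy|/etaoff ->] := ltP `|y| eps; last by rewrite !mulr0.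
by rewrite ler_wpM2r.
Qed.

Lemma conv_dq f j x h d e : bsf f -> 0 <= e ->
  (forall y, `|y| < eps -> `|f (h *: e_ R j + (x + y)) - f (x + y) - h * d| <= e * `|h|) ->
  `|conv f eta (h *: e_ R j + x) - conv f eta x - h * d| <= e * `|h|.
Proof.
move=> bf e0 H.
pose g y := f (h *: e_ R j + y) - f y.
have bg : bsf g by apply: bsfB => //; exact: bsf_shift.
have -> : conv f eta (h *: e_ R j + x) - conv f eta x = conv g eta x.
  rewrite !conv_shift//.
  rewrite -I2B; [|exact: bsf_conv_shift|exact: bsf_conv_shift].
  by congr I2; apply/funext => y; rewrite /g -addrA mulrBl.
by apply: conv_avg => //; rewrite mulr_ge0.
Qed.

Lemma conv_pd_close f j x d r e : bsf f -> 0 <= e -> 0 < r ->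
  (forall y h, `|y| < eps -> `|h| < r -> `|f (h *: e_ R j + (x + y)) - f (x + y) - h * d| <= e * `|h|) ->
  `|pd j (conv f eta) x - d| <= e.
Proof.
move=> bf e0 r0 H; apply: (derive_close r0).
  exact: (smooth_derive j x (smooth_conv bf te)).
by move=> h hr; apply: conv_dq => // y yr; exact: H.
Qed.

End Kernel.

Lemma kernel_exists (eps : R) : 0 < eps -> exists eta : pt -> R,
  [/\ testfun setT eta, forall y, 0 <= eta y, I2 eta = 1 & forall y, eps <= `|y| -> eta y = 0].
Proof.
move=> e0; pose b := bump2 (0 : pt) eps eps.
have tb : testfun setT b by apply: testfun_bump2.
have e20 : 0 < eps / 2 by rewrite divr_gt0.
have c0 : 0 < I2 b.
  apply: (@lt_le_trans _ _ (bump0 R ^+ 2 * (4 * (eps / 2) ^+ 2))).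
    by apply: mulr_gt0; [rewrite exprn_gt0// bump0_gt0|rewrite mulr_gt0// exprn_gt0].
  apply: (@I2_ge_box _ _ 0) => //; first exact: testfun_bsf tb.
    by move=> x; exact: bump2_ge.
  by move=> x _; exact: bump2_ge0.
exists (fun x => (I2 b)^-1 * b x); split.
- exact: testfunZ.
- by move=> y; rewrite mulr_ge0 ?bump2_ge0// invr_ge0 ltW.
- by rewrite I2Z ?mulVf ?gt_eqF//; exact: testfun_bsf tb.
move=> y ye; rewrite /b bump2_off ?mulr0// => /boxP; rewrite sub0r normrN.
by rewrite ltNge ye.
Qed.

(** Differentiability in direction [j], uniform in the base point [y] near [x]. Mollification
    averages increments over base points, hence this uniformity. *)
Definition sdiff f j x (d : R) := forall e, 0 < e -> exists2 r, 0 < r &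
  forall y h, `|y - x| < r -> `|h| < r -> `|f (h *: e_ R j + y) - f y - h * d| <= e * `|h|.

Lemma sdiff_is_derive f j x d : sdiff f j x d -> is_derive x (e_ R j) f d.
Proof.
move=> sd; apply/dderivP => e e0; have [r r0 h] := sd e e0.
by exists r => // t tr; apply: h; rewrite ?subrr ?normr0.
Qed.

(** Since [w] vanishes off [U], |w| <= L d with d the distance to the complement. Truncating [w]
    between -m and m, where m = max(0, K d - step n), gives a [K]-Lipschitz function that vanishes
    where K d <= step n and equals [w] where d >= step n; mollifying at radius [eps n] keeps the
    support inside [U]. Near each point of [U] the truncation is eventually inactive, whence both
    limits. *)
Lemma mollify U w (L D : R) : open U -> (forall x, U x -> `|x| <= D) -> 0 < L ->
  lip L w -> (forall x, ~ U x -> w x = 0) ->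
  exists phi : nat -> pt -> R, exists C, [/\ forall n, testfun U (phi n),
    forall n x, `|phi n x| <= C, forall n j x, `|pd j (phi n) x| <= C,
    forall x, U x -> phi n x @[n --> \oo] --> w x &
    forall x j d, U x -> sdiff w j x d -> pd j (phi n) x @[n --> \oo] --> d].
Proof.
move=> oU UD L0 wL woff.
have D0 : 0 <= `|D| by [].
have UD' x : U x -> `|x| <= `|D| by move=> /UD h; apply: le_trans h (ler_norm _).
have [z0 Uz0] : exists z, ~ U z.
  exists (`|D| + 1, 0) => /UD' /=; rewrite normptE /= normr0 max_l// ger0_norm ?addr_ge0//.
  by apply/negP; rewrite -ltNge ltrDl.
pose d := distC U.
have dl : lip 1 d by move=> x y; rewrite mul1r; exact: distC_lipn Uz0 _ _.
(* The slope exceeds [L] by 1, so that K d - step n >= L d as soon as d >= step n. *)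
pose K := L + 1.
have K0 : 0 < K by rewrite addr_gt0.
pose m n x := Num.max 0 (K * d x - step R n).
have ml n : lip K (m n).
  apply: lip_max; first by move=> x y; rewrite subrr normr0 mulr_ge0// ltW.
  move=> x y; rewrite opprB addrACA -opprB opprK [X in `|X|](_ : _ = K * (d x - d y)); last by ring.
  rewrite normrM (gtr0_norm K0); apply: ler_wpM2l; [exact: ltW|exact: distC_lipn Uz0 _ _].
have wd x : `|w x| <= L * d x.
  rewrite -ler_pdivrMl//; apply: lb_le_inf; first by exists `|x - z0|; exists z0.
  move=> _ [z Uz ->]; rewrite ler_pdivrMl//; have := wL x z.
  by rewrite (woff z Uz) subr0.
pose v n x := Num.max (- m n x) (Num.min (m n x) (w x)).
have m0 n x : 0 <= m n x by rewrite le_max lexx.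
have vl n : lip K (v n).
  apply: lip_max; first exact: lipN.
  by apply: lip_min => //; apply: lipW wL; rewrite lerDl.
have vm n x : `|v n x| <= m n x.
  rewrite ler_norml le_max lexx /= ge_max ge_min lexx /= andbT.
  by have := m0 n x; lra.
have voff n x : K * d x <= step R n -> v n x = 0.
  move=> h; apply/eqP; rewrite -normr_le0 (le_trans (vm n x))// /m ge_max lexx /=.
  by rewrite subr_le0.
have vw n x : step R n <= d x -> v n x = w x.
  move=> h; have := wd x; rewrite ler_norml => /andP[w1 w2].
  have hm : L * d x <= m n x by rewrite le_max /K; apply/orP; right; lra.
  by rewrite /v min_r ?max_r//; lra.
have st n := step_gt0 R n.
(* Half the distance step n / K up to which [v n] vanishes: after mollification the function still
   vanishes where d < step n / (2 K). *)
pose eps n := step R n / (2 * K).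
have ep n : 0 < eps n by rewrite divr_gt0// mulr_gt0.
have [eta eP] := choice (fun n => kernel_exists (ep n)).
have bv n : bsf (v n).
  apply: (@compact_support_bsf _ _ [set x | step R n <= K * d x]).
  - exact: lip_continuous (vl n).
  - apply: (@closed_bounded_compact _ _ `|D|).
      rewrite (_ : mkset _ = (fun x => K * d x) @^-1` [set t | step R n <= t])//.
      apply: closed_comp; last exact: closed_ge.
      by move=> x _; apply: cvgM; [exact: cvg_cst|exact: lip_continuous dl x].
    move=> x /= h; apply: UD'; apply: (distC_in Uz0).
    by rewrite -(pmulr_rgt0 _ K0); apply: lt_le_trans h.
  - by move=> x /= /negP; rewrite -ltNge => /ltW; exact: voff.
pose phi n := conv (v n) (eta n).
have dsup n x : phi n x != 0 -> step R n / (2 * K) <= d x.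
  move=> h; rewrite leNgt; apply/negP => hd; move/negP: h; apply; apply/eqP.
  have [te e0 e1 eoff] := eP n.
  apply/eqP; rewrite -normr_le0 -[X in `|X|]subr0; apply: (conv_avg te e0 e1 eoff) => // y ye.
  rewrite subr0 voff ?normr0//.
  have := dl (x + y) x; rewrite mul1r addrAC subrr add0r ler_norml => /andP[_ h2].
  rewrite -ler_pdivlMl//; apply: ltW.
  have : d (x + y) < step R n / (2 * K) + step R n / (2 * K).
    by move: ye; rewrite /eps; lra.
  by rewrite (_ : _ + _ = K^-1 * step R n); [|field; rewrite gt_eqF].
have pb n x : `|phi n x - v n x| <= K * eps n.
  have [te e0 e1 eoff] := eP n.
  apply: (conv_avg te e0 e1 eoff) => //; first by rewrite mulr_ge0// ltW.
  move=> y ye; apply: le_trans (vl n _ _) _; rewrite addrAC subrr add0r.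
  by rewrite ler_wpM2l// ltW.
have epK n : K * eps n = step R n / 2 by rewrite /eps; field; rewrite gt_eqF.
pose B := `|D| + `|z0|.
have B0 : 0 <= B by rewrite addr_ge0.
have dB x : d x <= B.
  have [Ux|nU] := pselect (U x); last by rewrite /d (distC_off Uz0).
  by apply: le_trans (distC_le x Uz0) _; rewrite (le_trans (ler_normB _ _))// lerD2r UD'.
have K0' := ltW K0.
have vB n x : `|v n x| <= K * B.
  apply: le_trans (vm n x) _; rewrite /m ge_max mulr_ge0//= lerBlDr.
  by apply: ler_wpDr; [exact/ltW/st|exact: ler_wpM2l].
exists phi, (K * B + K); split.
- move=> n; have [te e0 e1 eoff] := eP n; split; first exact: smooth_conv.
  exists [set x | step R n / (2 * K) <= d x]; split.
  + apply: (@closed_bounded_compact _ _ `|D|).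
      rewrite (_ : mkset _ = d @^-1` [set t | step R n / (2 * K) <= t])//.
      by apply: closed_comp; [move=> x _; exact: lip_continuous dl x|exact: closed_ge].
    by move=> x /= h; apply: UD'; apply: (distC_in Uz0); apply: lt_le_trans h; exact: ep.
  + by move=> x /= h; apply: (distC_in Uz0); apply: lt_le_trans h; exact: ep.
  + by move=> x /= h; apply/eqP/negPn/negP => /dsup.
- move=> n x; have [te e0 e1 eoff] := eP n.
  rewrite -[X in `|X|]subr0 (@le_trans _ _ (K * B))//; last by rewrite lerDl.
  by apply: (conv_avg te e0 e1 eoff) => // [|y _]; [exact: mulr_ge0|rewrite subr0].
- move=> n j x; have [te e0 e1 eoff] := eP n.
  rewrite -[X in `|X|]subr0 (@le_trans _ _ K)//; last by rewrite lerDr mulr_ge0.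
  apply: (conv_pd_close te e0 e1 eoff _ _ ltr01) => // y h _ _.
  by rewrite mulr0 subr0; apply: le_trans (vl n _ _) _; rewrite addrK norm_he.
- move=> x Ux; have dx : 0 < d x by exact: distC_gt0 oU Uz0 _ Ux.
  apply/cvgrPdist_le => e e0; near=> n.
  have h1 : step R n < d x by near: n; exact: step_lt.
  have h2 : step R n < e by near: n; exact: step_lt.
  rewrite distrC -(vw n x (ltW h1)) (le_trans (pb n x))// epK.
  by have := st n; lra.
move=> x j p Ux sd; have dx : 0 < d x by exact: distC_gt0 oU Uz0 _ Ux.
apply/cvgrPdist_le => e e0; have [r r0 hr] := sd e e0; near=> n.
have h1 : step R n < d x / 4 by near: n; apply: step_lt; rewrite divr_gt0.
have h2 : step R n < r by near: n; exact: step_lt.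
have h3 : eps n <= step R n / 2.
  rewrite /eps ler_pdivrMr ?mulr_gt0// -mulrA ler_peMr ?(ltW (st n))//.
  by rewrite /K; lra.
have [te e0' e1 eoff] := eP n.
rewrite distrC; pose s := Num.min r (d x / 4).
have s0 : 0 < s by rewrite lt_min r0 divr_gt0.
apply: (conv_pd_close te e0' e1 eoff (bv n) (ltW e0) s0) => y h ye hs.
have [hr' hd] : `|h| < r /\ `|h| < d x / 4 by apply/andP; rewrite -lt_min.
have sn := st n.
have d1 : d x / 2 <= d (x + y).
  by have := dl (x + y) x; rewrite mul1r addrAC subrr add0r ler_norml => /andP[]; lra.
have d2 : d x / 4 <= d (h *: e_ R j + (x + y)).
  by have := dl (h *: e_ R j + (x + y)) (x + y); rewrite mul1r addrK norm_he ler_norml => /andP[]; lra.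
rewrite !vw; [|lra|lra].
by apply: hr => //; rewrite addrAC subrr add0r; lra.
Unshelve. all: by end_near. Qed.

End Mollification.

(** * Lipschitz functions in H^1_0 and null curves *)

Section SobolevTools.
Variable R : realType.
Local Notation pt := (pt R).
Local Notation mpt := (mpt R).
Local Notation mu2 := (mu2 R).
Implicit Types (x y : pt) (f g w phi psi : pt -> R) (U K : set pt) (i j : 'I_2).

Lemma sum_I2 (F : 'I_2 -> R) : \sum_i F i = F 0 + F 1.
Proof. by rewrite !big_ord_recl big_ord0 addr0; congr (_ + F _); apply/val_inj. Qed.

Lemma ler_sqrt_sqr (a b : R) : 0 <= b -> a <= b ^+ 2 -> Num.sqrt a <= b.
Proof. by move=> b0 h; rewrite -(ger0_norm b0) -sqrtr_sqr ler_wsqrtr. Qed.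

Lemma norm_le_sqrt (a b : R) : a ^+ 2 <= b -> `|a| <= Num.sqrt b.
Proof. by move=> h; rewrite -sqrtr_sqr ler_wsqrtr. Qed.

Lemma enorm_ge0 x : 0 <= enorm x.
Proof. exact: sqrtr_ge0. Qed.

Lemma enorm_co i x : `|co i x| <= enorm x.
Proof.
by apply: norm_le_sqrt; case: (ord2P i) => -> /=; rewrite /co /= ?lerDl ?lerDr sqr_ge0.
Qed.

Lemma enorm_le x (M : R) : `|x| <= M -> enorm x <= 2 * M.
Proof.
move=> h; have M0 : 0 <= M by apply: le_trans h.
move: h; rewrite ler_normpt => /andP[h1 h2].
apply: ler_sqrt_sqr; first by rewrite mulr_ge0.
have k1 : x.1 ^+ 2 <= M ^+ 2 by rewrite -[leLHS]real_normK ?num_real// lerXn2r ?nnegrE.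
have k2 : x.2 ^+ 2 <= M ^+ 2 by rewrite -[leLHS]real_normK ?num_real// lerXn2r ?nnegrE.
nra.
Qed.

Lemma frob_co (A : 'M[R]_2) i j : `|A i j| <= frob A.
Proof.
apply: norm_le_sqrt; rewrite !sum_I2.
have h k l : 0 <= A k l ^+ 2 by exact: sqr_ge0.
by case: (ord2P i) => ->; case: (ord2P j) => ->;
  have := h 0 0; have := h 0 1; have := h 1 0; have := h 1 1; lra.
Qed.

Lemma frob_le (A : 'M[R]_2) (M : R) : 0 <= M -> (forall i j, `|A i j| <= M) -> frob A <= 2 * M.
Proof.
move=> M0 AM; apply: ler_sqrt_sqr; first by rewrite mulr_ge0.
have h k l : A k l ^+ 2 <= M ^+ 2 by rewrite -[leLHS]real_normK ?num_real// lerXn2r ?nnegrE.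
rewrite !sum_I2; have := h 0 0; have := h 0 1; have := h 1 0; have := h 1 1.
rewrite exprMn; lra.
Qed.

Lemma frob_ge0 (A : 'M[R]_2) : 0 <= frob A.
Proof. exact: sqrtr_ge0. Qed.

Lemma measurable_enorm U (u : pt -> pt) :
  (forall i, measurable_fun (U : set mpt) ((fun x => co i (u x)) : mpt -> R)) ->
  measurable_fun (U : set mpt) ((fun x => enorm (u x)) : mpt -> R).
Proof.
move=> h; apply: (@measurableT_comp _ _ _ _ _ _ (@Num.sqrt R)).
  by apply: continuous_measurable_fun; exact: sqrt_continuous.
by apply: measurable_funD; apply: measurable_funX; [exact: (h 0)|exact: (h 1)].
Qed.

Lemma measurable_frob U (A : pt -> 'M[R]_2) :
  (forall i j, measurable_fun (U : set mpt) ((fun x => A x i j) : mpt -> R)) ->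
  measurable_fun (U : set mpt) ((fun x => frob (A x)) : mpt -> R).
Proof.
move=> h; apply: (@measurableT_comp _ _ _ _ _ _ (@Num.sqrt R)).
  by apply: continuous_measurable_fun; exact: sqrt_continuous.
under eq_fun do rewrite !sum_I2.
by apply: measurable_funD; apply: measurable_funD; apply: measurable_funX; exact: h.
Qed.

Definition unco (f : 'I_2 -> R) : pt := (f 0, f 1).

Lemma co_unco i (f : 'I_2 -> R) : co i (unco f) = f i.
Proof. by case: (ord2P i) => ->. Qed.

Lemma coB i x y : co i (x - y) = co i x - co i y.
Proof. by rewrite /co; case: ifP. Qed.

Lemma restr_id U f : (forall x, ~ U x -> f x = 0) -> f \_ U = f.
Proof.
move=> h; apply/funext => x; rewrite /patch; case: ifPn => //.
by rewrite notin_setE => /h ->.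
Qed.

Lemma box_cover U (D : R) : (forall x, U x -> `|x| <= D) -> U `<=` box (0 : pt) (`|D| + 1).
Proof.
move=> h x /h xD; apply/boxP; rewrite sub0r normrN.
by apply: le_lt_trans xD _; rewrite (le_lt_trans (ler_norm D))// ltrDl.
Qed.

Lemma memL2_bounded U f (D M : R) : measurable (U : set mpt) -> (forall x, U x -> `|x| <= D) ->
  measurable_fun (U : set mpt) (f : mpt -> R) -> (forall x, U x -> `|f x| <= M) -> memL2 U f.
Proof.
move=> mU UD mf fM; split => //.
apply: (@le_lt_trans _ _ ((`|M| * (2 * (`|D| + 1)))%:E)); last exact: ltry.
apply: (@L2n_le _ _ _ 0); first by rewrite ltr_wpDl.
- by [].
- exact: box_cover UD.
- by move=> x /fM h; apply: le_trans h (ler_norm _).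
Qed.

Lemma bmf_lip U f (L D : R) : measurable (U : set mpt) -> (forall x, U x -> `|x| <= D) ->
  lip L f -> bmf (f \_ U).
Proof.
move=> mU UD fL; split.
  apply: (measurable_restr f mU).2; apply: measurable_funTS.
  exact: continuous_measurable_funpt (lip_continuous fL).
exists (`|f 0| + `|L| * `|D|) => x; rewrite /patch; case: ifPn => [|_]; last first.
  by rewrite normr0 addr_ge0// mulr_ge0.
rewrite inE => /UD xD; rewrite -[f x](subrK (f 0)) addrC.
rewrite (le_trans (ler_normD _ _))// lerD2l (le_trans (fL _ _))// subr0.
rewrite (@le_trans _ _ (`|L| * `|x|))//; first by rewrite ler_wpM2r// ler_norm.
by rewrite ler_wpM2l// (le_trans xD)// ler_norm.
Qed.

(** The weak gradient is made of [wd], the approximating test functions come from [mollify]; their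
    gradients stay bounded and converge at every point of strict differentiability, so dominated
    convergence gives the L^2 limits. *)
Lemma H10_lip U (u : pt -> pt) (L D : R) : open U -> (forall x, U x -> `|x| <= D) ->
  0 < L -> (forall i, lip L (fun x => co i (u x))) -> (forall x, ~ U x -> u x = 0) ->
  {ae mu2, forall x : mpt, (U : set mpt) x -> forall i j, exists d, sdiff (fun x => co i (u x)) j x d} ->
  H10 U u.
Proof.
move=> oU UD L0 uL uoff aes.
have mU : measurable (U : set mpt) by exact: measurable_openpt.
pose c i x := co i (u x).
have coff i x : ~ U x -> c i x = 0 by move=> /uoff h; rewrite /c h /co; case: ifP.
have cE i : (c i) \_ U = c i by apply: restr_id; exact: coff.
have bc i : bmf (c i) by rewrite -cE; apply: bmf_lip mU UD (uL i).
pose J x : 'M[R]_2 := \matrix_(i, j) wd (c i) j L x.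
have L0' := ltW L0.
have mJ i j : measurable_fun setT ((fun x => J x i j) : mpt -> R).
  rewrite (_ : (fun x => _) = wd (c i) j L); first exact: measurable_wd.
  by apply/funext => x; rewrite mxE.
have JL x i j : `|J x i j| <= L by rewrite mxE wd_le.
have wdE x i j d : U x -> sdiff (c i) j x d -> J x i j = d.
  move=> Ux /sdiff_is_derive sd; rewrite mxE; apply: wd_cvg.
    apply: nearW => n; rewrite /dq normrM normfV ler_pdivrMr ?normrN ?normr_gt0 ?gt_eqF ?step_gt0//.
    by apply: le_trans (uL i _ _) _; rewrite addrK norm_he normrN.
  apply: dq_cvg => //; first by move=> n; rewrite oppr_eq0 gt_eqF// step_gt0.
  by rewrite -oppr0; apply: cvgN; exact: step_cvg0.
have mc i : measurable_fun (U : set mpt) (c i : mpt -> R) by apply: measurable_funTS; exact: (bc i).1.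
exists J.
  split.
  - move=> i; have [_ [C cC]] := bc i.
    by apply: (memL2_bounded mU UD (mc i) (M := C)) => x _; exact: cC.
  - by move=> i j; apply: (memL2_bounded mU UD (measurable_funTS (mJ i j)) (M := L)).
  - move=> i j; rewrite (_ : (fun x => J x i j) = wd (c i \_ U) j L); last first.
      by apply/funext => x; rewrite mxE cE.
    apply: weak_deriv_lip => //.
    + by rewrite cE.
    + by move=> x y _ _; exact: uL.
    case: aes => N [mN N0 sN]; exists N; split => // x /= h; apply: sN => /= h'; apply: h => Ux.
    have [d sd] := h' Ux i j; exists d.
    apply: dq_cvg; first exact: sdiff_is_derive sd.
      by move=> n; rewrite oppr_eq0 gt_eqF// step_gt0.
    by rewrite -oppr0; apply: cvgN; exact: step_cvg0.
have mo i := mollify oU UD L0 (uL i) (coff i).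
have [ph mo'] := choice mo.
pose phi n x : pt := unco (fun i => ph i n x).
have pE n i : (fun x => co i (phi n x)) = ph i n.
  by apply/funext => x; rewrite co_unco.
have tph n i : testfun U (ph i n) by have [C [h _ _ _ _]] := mo' i; exact: h.
have [C [C0 hC1 hC2]] : exists C, [/\ 0 <= C, forall i n x, `|ph i n x| <= C &
    forall i j n x, `|pd j (ph i n) x| <= C].
  have [C0' [_ a1 a2 _ _]] := mo' 0; have [C1' [_ b1 b2 _ _]] := mo' 1.
  exists (Num.max 0 (Num.max C0' C1')); split; first by rewrite le_max lexx.
    move=> i n x; case: (ord2P i) => ->; [apply: le_trans (a1 n x) _|apply: le_trans (b1 n x) _];
      by rewrite !le_max lexx ?orbT.
  move=> i j n x; case: (ord2P i) => ->; [apply: le_trans (a2 n j x) _|apply: le_trans (b2 n j x) _];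
    by rewrite !le_max lexx ?orbT.
have cph i x : U x -> ph i n x @[n --> \oo] --> c i x.
  by have [? [_ _ _ h _]] := mo' i; exact: h.
have cpd i x j d : U x -> sdiff (c i) j x d -> pd j (ph i n) x @[n --> \oo] --> d.
  by have [? [_ _ _ _ h]] := mo' i; exact: h.
have [Cc cC] : exists Cc, forall i x, `|c i x| <= Cc.
  have [_ [a ha]] := bc 0; have [_ [b hb]] := bc 1; exists (Num.max a b) => i x.
  by rewrite le_max; case: (ord2P i) => ->; rewrite ?ha ?hb ?orbT.
have Cc0 : 0 <= Cc by apply: le_trans (cC 0 0).
exists phi; split.
- by move=> n i; rewrite pE.
- apply: (@L2n_cvg0 _ _ _ (Num.max (2 * (Cc + C)) D)) => //.
  + move=> n; apply: measurable_enorm => i.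
    under eq_fun do rewrite coB; apply: measurable_funB; first exact: mc.
    by rewrite pE; apply: measurable_funTS; exact: (testfun_bsf (tph n i)).1.
  + move=> n x Ux; rewrite !le_max UD// orbT; split => //.
    rewrite ger0_norm ?enorm_ge0// enorm_le// ler_normpt.
    have h i : `|co i (u x - phi n x)| <= Cc + C.
      rewrite coB co_unco (le_trans (ler_normB _ _))// lerD//; exact: cC.
    by rewrite (h 0) (h 1).
  apply: nearW => x Ux.
  apply/cvgrPdist_le => e e0; have e20 : 0 < e / 2 by rewrite divr_gt0.
  have n0 i : \forall n \near \oo, `|c i x - ph i n x| <= e / 2.
    by have /cvgrPdist_le := cph i x Ux; apply.
  apply: filterS (filterI (n0 0) (n0 1)) => n [h0 h1].
  rewrite sub0r normrN ger0_norm ?enorm_ge0// (_ : e = 2 * (e / 2)); last by field.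
  have hc i : `|co i (u x - phi n x)| <= e / 2.
    rewrite coB co_unco.
    by case: (ord2P i) => ->.
  by rewrite enorm_le// ler_normpt (hc 0) (hc 1).
- apply: (@L2n_cvg0 _ _ _ (Num.max (2 * (L + C)) D)) => //.
  + move=> n; apply: measurable_frob => i j.
    under eq_fun do rewrite !mxE; apply: measurable_funB.
      by apply: measurable_funTS; exact: measurable_wd.
    by rewrite pE; apply: measurable_funTS; exact: (testfun_bsf (testfun_pd j (tph n i))).1.
  + move=> n x Ux; rewrite !le_max UD// orbT; split => //.
    rewrite ger0_norm ?frob_ge0// frob_le ?addr_ge0// => i j.
    by rewrite !mxE pE (le_trans (ler_normB _ _))// lerD// wd_le.
  case: aes => N [mN N0 sN]; exists N; split => // x /= h; apply: sN => /= h'; apply: h => Ux.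
  have hd i j : pd j (ph i n) x @[n --> \oo] --> J x i j.
    by have [d sd] := h' Ux i j; rewrite (wdE x i j d)//; exact: cpd.
  apply/cvgrPdist_le => e e0; have e20 : 0 < e / 2 by rewrite divr_gt0.
  have n0 i j : \forall n \near \oo, `|J x i j - pd j (ph i n) x| <= e / 2.
    by have /cvgrPdist_le := hd i j; apply.
  apply: filterS (filterI (filterI (n0 0 0) (n0 0 1)) (filterI (n0 1 0) (n0 1 1))) => n [[a1 a2] [b1 b2]].
  rewrite sub0r normrN ger0_norm ?frob_ge0// (_ : e = 2 * (e / 2)); last by field.
  have hh i j : `|J x i j - pd j (ph i n) x| <= e / 2.
    by case: (ord2P i) => ->; case: (ord2P j) => ->.
  by apply: frob_le => [|i j]; [exact: ltW|rewrite mxE [X in _ + X]mxE [X in _ + - X]mxE pE].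
Qed.

(** n + 2 squares of half-side (L + 1) / (n + 1) cover the curve, with total area O(1/n). The
    squares are open, hence L + 1 instead of L; the index n + 1 is needed for t = 1. *)
Lemma lip_curve_null (gam : R -> pt) (L : R) : 0 <= L ->
  (forall s t, 0 <= s <= 1 -> 0 <= t <= 1 -> `|gam s - gam t| <= L * `|s - t|) ->
  mu2.-negligible (gam @` [set t | 0 <= t <= 1] : set mpt).
Proof.
move=> L0 gL.
pose P n k : set mpt := box (gam (k%:R / n.+1%:R)) ((L + 1) / n.+1%:R).
have n0 n : 0 < n.+1%:R :> R by rewrite ltr0n.
have cov n : (gam @` [set t | 0 <= t <= 1] : set mpt) `<=` \bigcup_(k < n.+2) P n k.
  move=> _ [t /andP[t0 t1] <-].
  pose k := Num.truncn (t * n.+1%:R).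
  have tn0 : 0 <= t * n.+1%:R by rewrite mulr_ge0// ltW.
  have /andP[k1 k2] := truncn_itv tn0.
  have kn : (k <= n.+1)%N.
    rewrite -(ler_nat R) (le_trans k1)// -[leRHS]mul1r ler_wpM2r// ltW//.
  exists k; first by rewrite /= ltnS.
  apply/boxP; apply: le_lt_trans (gL _ _ _ _) _.
  - rewrite divr_ge0//= ler_pdivrMr// mul1r ler_nat//.
  - by rewrite t0.
  have hk : `|k%:R / n.+1%:R - t| <= 1 / n.+1%:R.
    rewrite distrC ger0_norm; last by rewrite subr_ge0 ler_pdivrMr.
    rewrite lerBlDr -mulrDl ler_pdivlMr// addrC natr1; exact: ltW.
  rewrite (le_lt_trans (ler_wpM2l L0 hk))// mulrA mulr1 ltr_pM2r ?invr_gt0// ltrDl//.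
pose N : set mpt := \bigcap_n \bigcup_(k < n.+2) P n k.
have mP n k : measurable (P n k) by exact: measurable_box.
have mN : measurable N.
  apply: bigcapT_measurable => n; apply: bigcup_measurable => k _; exact: mP.
exists N; split => //; last by move=> x h n _; exact: cov.
apply/eqP; rewrite eq_le measure_ge0 andbT; apply/lee_addgt0Pr => e e0; rewrite add0e.
have hN n : (mu2 N <= ((8 * (L + 1) ^+ 2) * step R n)%:E)%E.
  have Lp : 0 < (L + 1) / n.+1%:R by rewrite divr_gt0// ltr_wpDl.
  apply: (@le_trans _ _ (\sum_(k < n.+2) mu2 (P n k))%E).
    apply: content_subadditive => //.
    by move=> x /(_ n I); rewrite bigcup_mkord.
  rewrite (eq_bigr (fun=> (4 * ((L + 1) / n.+1%:R) ^+ 2)%:E)); last first.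
    by move=> k _; exact: mu2_box.
  rewrite sumEFin lee_fin sumr_const card_ord -[_ *+ n.+2]mulr_natr /step.
  have h2 : n.+2%:R <= 2 * n.+1%:R :> R by rewrite -natrM ler_nat mul2n -addnn addSn ltnS leq_addl.
  rewrite (@le_trans _ _ (4 * ((L + 1) / n.+1%:R) ^+ 2 * (2 * n.+1%:R)))//.
    by rewrite ler_wpM2l// mulr_ge0// sqr_ge0.
  rewrite le_eqVlt; apply/orP; left; apply/eqP; field; exact: lt0r_neq0.
have A0 : 0 < 8 * (L + 1) ^+ 2 by rewrite mulr_gt0// exprn_gt0// ltr_wpDl.
have [n _ hn] := step_lt (divr_gt0 e0 A0).
apply: le_trans (hN n) _; rewrite lee_fin -ler_pdivlMl// mulrC ltW//.
exact: hn n (leqnn n).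
Qed.

End SobolevTools.

(** * Traces of H^1_0 functions and lower bounds by duality *)

Section TraceAndDuality.
Variable R : realType.
Local Notation pt := (pt R).
Local Notation mpt := (mpt R).
Local Notation mu2 := (mu2 R).
Implicit Types (x y : pt) (f g w q phi psi : pt -> R) (U K : set pt) (i j : 'I_2).

Lemma L2_holder U f q : measurable (U : set mpt) -> measurable_fun (U : set mpt) (f : mpt -> R) ->
  measurable_fun setT (q : mpt -> R) ->
  (\int[mu2]_(x in (U : set mpt)) `|(f x * q x)%:E| <= L2n U f * L2n setT q)%E.
Proof.
move=> mU mf mq.
have mfU : measurable_fun setT ((f \_ U) : mpt -> R) by exact: (measurable_restr f mU).2 mf.
have p20 : 0 < 2 :> R by [].
have pq : (2^-1 + 2^-1 = 1 :> R) by field.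
have := hoelder mu2 mfU mq p20 p20 pq.
rewrite Lnorm1 /L2n.
have -> : (EFin \o (f \_ U)) = ((fun x : mpt => (f x)%:E) \_ (U : set mpt)).
  by apply/funext => x; rewrite /= /patch; case: ifP.
have -> : ((fun x : mpt => (q x)%:E) \_ (setT : set mpt)) = EFin \o q by rewrite patch_setT.
move=> /(le_trans _); apply.
rewrite [leLHS]integral_mkcond; apply: le_integral_nomeas => x.
  by rewrite /patch; case: ifP.
by rewrite /patch /=; case: ifP => _ //=; rewrite mul0r normr0.
Qed.

Lemma L2n_supp U (V : set pt) q : (forall x, U x -> ~ V x -> q x = 0) -> (L2n U q <= L2n V q)%E.
Proof.
move=> off; rewrite !L2nE lee_sqrt; last by apply: integral_ge0 => x _; rewrite lee_fin sq_ge0.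
apply: le_integral_nomeas => x; rewrite lee_fin ?sq_ge0// /sq.
case: (boolP (x \in V)) => [_|]; first by case: ifP => // _; exact: sqr_ge0.
by rewrite notin_setE => nb; case: ifPn => //; rewrite inE => Ux; rewrite (off x)// expr0n.
Qed.

Lemma bsf_L2n U q : bsf q -> (L2n U q < +oo)%E.
Proof.
move=> bq; have [D [D0 qD]] := bsf_dom bq.
have h : (L2n U q <= L2n (box (0%R : pt) (D + 1)%R) q)%E.
  apply: L2n_supp => x _ nb; rewrite (qD x).2//.
  have [h|h] := ltP `|x| (D + 1); last by apply: lt_le_trans h; rewrite ltrDl.
  by exfalso; apply: nb; apply/boxP; rewrite sub0r normrN.
apply: le_lt_trans h _; apply: (@le_lt_trans _ _ (D * (2 * (D + 1)))%:E); last exact: ltry.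
apply: (@L2n_le _ _ _ 0) => //; rewrite ?ltW ?addr_gt0//.
by move=> x _; exact: (qD x).1.
Qed.

Lemma bsf_memL2 U q : bsf q -> memL2 U q.
Proof. by move=> bq; split; [exact: measurable_funTS bq.1|exact: bsf_L2n]. Qed.

Lemma integrable_L2 U f q : measurable (U : set mpt) -> memL2 U f -> bsf q ->
  mu2.-integrable (U : set mpt) (EFin \o (fun x => f x * q x)).
Proof.
move=> mU [mf fo] bq; apply/integrableP; split.
  apply/measurable_EFinP; apply: measurable_funM => //; apply: measurable_funTS; exact: bq.1.
apply: (le_lt_trans (L2_holder mU mf bq.1)).
have q2 := bsf_L2n setT bq.
by apply: lte_mul_pinfty => //; [exact: Lnorm_ge0|rewrite ge0_fin_numE//; exact: Lnorm_ge0].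
Qed.

Lemma L2_pairing_cvg U f (fn : nat -> pt -> R) q : measurable (U : set mpt) -> memL2 U f ->
  (forall n, memL2 U (fn n)) -> bsf q ->
  L2n U (fun x => f x - fn n x) @[n --> \oo] --> (0%E : \bar R) ->
  (\int[mu2]_(x in (U : set mpt)) (fn n x * q x)) @[n --> \oo] -->
  \int[mu2]_(x in (U : set mpt)) (f x * q x).
Proof.
move=> mU mf mfn bq cv.
have mi := integrable_L2 mU mf bq.
have min n := integrable_L2 mU (mfn n) bq.
have q2 : L2n setT q \is a fin_num.
  by rewrite ge0_fin_numE ?bsf_L2n//; exact: Lnorm_ge0.
have cv2 : (L2n U (fun x => f x - fn n x)%R * L2n setT q)%E @[n --> \oo] --> (0%E : \bar R).
  rewrite -(mul0e (L2n setT q)); apply: cvgeM => //; last exact: cvg_cst.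
  by rewrite mule_def_fin.
apply/cvgrPdist_le => e e0.
move/fine_cvgP : cv2 => [cfin /cvgrPdist_le/(_ e e0) ce].
apply: filterS (filterI cfin ce) => n [hfin]; rewrite sub0r normrN => hn.
rewrite -RintegralB//.
have mB : mu2.-integrable (U : set mpt) (EFin \o (fun x => f x * q x - fn n x * q x)).
  exact: (integrableB mU mi (min n)).
apply: le_trans (le_normr_Rintegral mU mB) _.
apply: le_trans hn; apply: le_trans (ler_norm _); rewrite /Rintegral.
have hh := @L2_holder U (fun x => f x - fn n x) q mU (measurable_funB mf.1 (mfn n).1) bq.1.
have -> : (\int[mu2]_(x in (U : set mpt)) `|f x * q x - fn n x * q x|%:E)%E =
   (\int[mu2]_(x in (U : set mpt)) `|((f x - fn n x) * q x)%:E|)%E.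
  by apply: eq_integral => x _; rewrite abse_EFin mulrBl.
apply: fine_le => //; rewrite ge0_fin_numE; last by apply: integral_ge0.
by apply: le_lt_trans hh _; rewrite ltey_eq hfin.
Qed.

Lemma testfun_ibp U phi q j : testfun U phi -> testfun setT q ->
  I2 (fun x => phi x * pd j q x) = - I2 (fun x => pd j phi x * q x).
Proof.
move=> tp tq; have bp := testfun_bsf tp; have bq := testfun_bsf tq.
apply/eqP; rewrite -eqr_oppLR; apply/eqP.
rewrite -(cvg_lim (@Rhausdorff R) (parts_limit (j := j) (bsf_bmf bp) tq)).
apply: cvg_lim; first exact: Rhausdorff.
have [L L0 pL] := testfun_lip_dir j tp; have [D [D0 qD]] := bsf_dom bq.
apply: (@I2_dct _ _ _ (L * D + D)).
- by move=> n; apply: measurable_funM; [exact: (bsf_dq _ _ bp).1|exact: bq.1].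
- move=> n x; split; last first.
    by move=> h; rewrite (qD x).2 ?mulr0//; apply: le_lt_trans h; rewrite lerDr mulr_ge0// ltW.
  rewrite normrM (@le_trans _ _ (L * D))//; last by rewrite lerDl ltW.
  rewrite ler_pM ?(qD x).1// /dq normrM normfV ler_pdivrMr ?pL// normr_gt0.
  by rewrite oppr_eq0 gt_eqF// step_gt0.
- by apply: bsfM => //; exact: testfun_bsf (testfun_pd j tp).
apply: nearW => x; apply: cvgM; last exact: cvg_cst.
apply: dq_cvg; first exact: (smooth_derive j x tp.1).
  by move=> n; rewrite oppr_eq0 gt_eqF// step_gt0.
by rewrite -oppr0; apply: cvgN; exact: step_cvg0.
Qed.

Lemma Rintegral_testfun U phi q : bsf phi -> (forall x, ~ U x -> phi x = 0) -> bsf q ->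
  \int[mu2]_(x in (U : set mpt)) (phi x * q x) = I2 (fun x => phi x * q x).
Proof.
move=> bp off bq; rewrite /Rintegral integral_mkcond /I2; congr fine.
apply: eq_integral => x _; rewrite /patch; case: ifPn => //.
by rewrite notin_setE => /off ->; rewrite mul0r.
Qed.

(** Here membership in H^1_0 acts: [q] is a test function of the whole plane and need not vanish on
    the boundary of [U]. The identity holds for the approximating test functions, which vanish off
    [U], and passes to the limit. *)
Lemma H10_parts U (u : pt -> pt) : open U -> H10 U u -> exists2 J : pt -> 'M[R]_2, is_H1_grad U u J &
  forall i j q, testfun setT q ->
  \int[mu2]_(x in (U : set mpt)) (co i (u x) * pd j q x) =
  - \int[mu2]_(x in (U : set mpt)) (J x i j * q x).
Proof.
move=> oU [J HJ [phi [tphi cu cJ]]]; exists J => // i j q tq.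
have mU : measurable (U : set mpt) by exact: measurable_openpt.
have [mu mJ _] := HJ.
have bq := testfun_bsf tq; have bdq := testfun_bsf (testfun_pd j tq).
have off n k x : ~ U x -> co k (phi n x) = 0 /\ pd j (fun x => co k (phi n x)) x = 0.
  move=> nU; have [K [cK KU] h] := testfun_off (tphi n k).
  by have [|-> ->] := h x; first by move=> /KU.
have c1 : (\int[mu2]_(x in (U : set mpt)) (co i (phi n x) * pd j q x)) @[n --> \oo] -->
    \int[mu2]_(x in (U : set mpt)) (co i (u x) * pd j q x).
  apply: L2_pairing_cvg => //; first by move=> n; apply: bsf_memL2; exact: testfun_bsf (tphi n i).
  apply: (@squeeze_cvge _ _ _ _ (fun=> 0%E) _ (fun n => vL2n U (fun x => u x - phi n x))).
  - apply: nearW => n; rewrite Lnorm_ge0 /=; apply: L2n_mono => // x _.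
    by rewrite -coB [leRHS]ger0_norm ?enorm_ge0// enorm_co.
  - exact: cvg_cst.
  - exact: cu.
have c2 : (\int[mu2]_(x in (U : set mpt)) (pd j (fun x => co i (phi n x)) x * q x)) @[n --> \oo] -->
    \int[mu2]_(x in (U : set mpt)) (J x i j * q x).
  apply: L2_pairing_cvg => //; first by move=> n; apply: bsf_memL2; exact: testfun_bsf (testfun_pd j (tphi n i)).
  apply: (@squeeze_cvge _ _ _ _ (fun=> 0%E) _ (fun n => mL2n U (fun x => J x - Jac (phi n) x))).
  - apply: nearW => n; rewrite Lnorm_ge0 /=; apply: L2n_mono => // x _.
    rewrite [leRHS]ger0_norm ?frob_ge0//; apply: le_trans (frob_co _ i j).
    by rewrite le_eqVlt !mxE eqxx.
  - exact: cvg_cst.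
  - exact: cJ.
rewrite -(cvg_lim (@Rhausdorff R) c1); apply: cvg_lim; first exact: Rhausdorff.
have -> : (fun n => \int[mu2]_(x in (U : set mpt)) (co i (phi n x) * pd j q x)) =
   (fun n => - \int[mu2]_(x in (U : set mpt)) (pd j (fun x => co i (phi n x)) x * q x)).
  apply/funext => n; rewrite Rintegral_testfun//; [|exact: testfun_bsf (tphi n i)|by move=> x /(off n i)[]].
  rewrite (testfun_ibp (phi := fun x => co i (phi n x)) j (tphi n i) tq).
  rewrite Rintegral_testfun//; [exact: testfun_bsf (testfun_pd j (tphi n i))|by move=> x /(off n i)[]].
exact: cvgN.
Qed.

Lemma dbump_odd (t : R) : dbump (- t) = - dbump t.
Proof. by rewrite /dbump opprK [- t + 1]addrC [1 + t]addrC; ring. Qed.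

(** As [x0] is not in [U], the intersections of [U] with squares around [x0] shrink to the empty
    set, and dominated convergence applies to the square of [f]. *)
Lemma L2n_small U f x0 (e : R) : measurable (U : set mpt) -> memL2 U f -> ~ U x0 -> 0 < e ->
  exists2 r, 0 < r & forall s, s <= r -> (L2n (U `&` box x0 s) f <= e%:E)%E.
Proof.
move=> mU [mf fo] nU e0.
pose V n := U `&` box x0 (step R n).
have mV n : measurable (V n : set mpt) by apply: measurableI => //; exact: measurable_box.
have msq W : measurable (W : set mpt) -> W `<=` U -> measurable_fun setT (sq W f : mpt -> R).
  move=> mW WU; rewrite (_ : sq W f = ((fun x => f x ^+ 2) : mpt -> R) \_ W)//.
  by apply: (measurable_restrictT _ mW).1 (measurable_funX 2 _); exact: measurable_funS mf.
have isq : mu2.-integrable setT (fun x : mpt => (sq U f x)%:E).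
  apply/integrableP; split; first by apply/measurable_EFinP; exact: msq.
  rewrite (eq_integral (fun x : mpt => (sq U f x)%:E)); last first.
    by move=> x _; rewrite gee0_abs// lee_fin sq_ge0.
  move: fo; rewrite L2nE -poweR12_sqrt; last by apply: integral_ge0 => x _; rewrite lee_fin sq_ge0.
  by apply: lty_poweRy; rewrite invr_neq0.
have [||||| _ _ cv] := @dominated_convergence _ mpt R mu2 setT measurableT
  (fun n x => (sq (V n) f x)%:E) (fun=> 0%E) (fun x => (sq U f x)%:E).
- by move=> n; apply/measurable_EFinP; apply: msq => // x [].
- exact: measurable_cst.
- apply: nearW => x _; apply: cvg_near_cst.
  have [Ux|nUx] := pselect (U x); last first.
    by apply: nearW => n; rewrite /sq memNset// => -[].
  have d0 : 0 < `|x0 - x|.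
    by rewrite normr_gt0 subr_eq0; apply/eqP => xx; apply: nU; rewrite xx.
  apply: filterS (step_lt d0) => n sn; rewrite /sq memNset// => -[_ /boxP].
  by rewrite ltNge (ltW sn).
- exact: isq.
- apply: nearW => x n _; rewrite gee0_abs ?lee_fin ?sq_ge0// /sq.
  case: (boolP (x \in V n)) => [|_]; last by case: ifP => // _; exact: sqr_ge0.
  by rewrite inE => -[Ux _]; rewrite mem_set.
have {}cv : (\int[mu2]_x (sq (V n) f x)%:E)%E @[n --> \oo] --> (0%E : \bar R).
  by move: cv; rewrite integral0.
have e20 : (0 < (e ^+ 2)%:E)%E by rewrite lte_fin exprn_gt0.
have hn : \forall n \near \oo, (\int[mu2]_x (sq (V n) f x)%:E < (e ^+ 2)%:E)%E.
  move/fine_cvgP : cv => [cfin cr].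
  have e2 : 0 < e ^+ 2 by rewrite exprn_gt0.
  apply: filterS (filterI cfin (cvgr_lt (0 : R) cr _ e2)) => n [hfin].
  by rewrite /= -lte_fin fineK.
have [N _ hN] := hn; exists (step R N); first exact: step_gt0.
move=> s sN; apply: (@le_trans _ _ (L2n (V N) f)).
  apply: L2n_mono => // x [Ux /boxP h]; split => //; apply/boxP; exact: lt_le_trans sN.
have -> : e%:E = sqrte ((e ^+ 2)%:E) by rewrite /sqrte sqrtr_sqr gtr0_norm.
rewrite L2nE lee_sqrt; last exact: ltW.
by apply: ltW; apply: (hN N) => /=.
Qed.

Definition oj j : 'I_2 := if j == 0 then 1 else 0.

(** Tensor bump with radius [ra] along direction [j] and [rb] along the other direction [oj j]. *)
Definition bumpj j p (ra rb : R) := if j == 0 then bump2 p ra rb else bump2 p rb ra.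

Lemma bumpjE j p ra rb x :
  bumpj j p ra rb x = bump1 (co j p) ra (co j x) * bump1 (co (oj j) p) rb (co (oj j) x).
Proof. by case: (ord2P j) => -> //=; rewrite /bumpj /= /bump2 /tensor mulrC. Qed.

Lemma pd_bumpj j p ra rb x :
  pd j (bumpj j p ra rb) x = dbump1 (co j p) ra (co j x) * bump1 (co (oj j) p) rb (co (oj j) x).
Proof.
by case: (ord2P j) => ->; rewrite /bumpj /= ?pd0_bump2 ?pd1_bump2 // mulrC.
Qed.

Lemma norm_lt_co x (r : R) j : (`|co j x| < r) -> (`|co (oj j) x| < r) -> `|x| < r.
Proof. by case: (ord2P j) => ->; rewrite /oj /co /= ltr_normpt => -> ->. Qed.

Lemma co_norm x j : `|co j x| <= `|x|.
Proof.
have : `|x| <= `|x| by [].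
by rewrite {1}ler_normpt => /andP[h1 h2]; case: (ord2P j) => ->.
Qed.

(* If [a] were not 0, testing with a bump [q] of radius [r] at [x0] would give an integral of
   [u i * pd j q] of order [r], while the gradient term is [o(r)] because the L^2 norm of the
   gradient near [x0] tends to 0. *)
Lemma trace_zero U (u : pt -> pt) i (a r0 : R) x0 (n : 'I_2 -> R) :
  open U -> H10 U u -> 0 < r0 -> (exists j, n j != 0) ->
  (forall x, `|x - x0| < r0 -> U x -> 0 <= \sum_j n j * (co j x - co j x0)) ->
  (forall x, `|x - x0| < r0 -> 0 < \sum_j n j * (co j x - co j x0) -> U x) ->
  (forall e, 0 < e -> exists2 r, 0 < r & forall x, U x -> `|x - x0| < r -> `|co i (u x) - a| <= e) ->
  a = 0.
Proof.
move=> oU hu r00 [j0 nj0] hin hout hlim.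
have mU : measurable (U : set mpt) by exact: measurable_openpt.
(* Coordinate direction along which the normal is largest. With s and t the displacements along [j]
   and [oj j], the half-plane contains the cone sg s > |t| ([nE']) and lies in the region sg s >=
   -|t| ([nE]). *)
have [j [nj nj']] : exists j, n j != 0 /\ `|n (oj j)| <= `|n j|.
  case: (leP `|n 0| `|n 1|) => h.
    exists 1; split=> //; rewrite -normr_gt0; case: (ord2P j0) nj0 => -> ; rewrite -normr_gt0//.
    by move=> h0; exact: lt_le_trans h.
  exists 0; rewrite ltW//; split=> //; rewrite -normr_gt0; apply: le_lt_trans h; exact: normr_ge0.
have sumE x : \sum_j n j * (co j x - co j x0) =
    n j * (co j x - co j x0) + n (oj j) * (co (oj j) x - co (oj j) x0).
  by rewrite sum_I2; case: (ord2P j) => ->; rewrite /oj //= addrC.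
have [sg [sgE sg1 nsg sgc]] : exists sg : R,
    [/\ n j = sg * `|n j|, sg * sg = 1, `|sg| = 1 & sg = 1 \/ sg = -1].
  exists (Num.sg (n j)); split; first by rewrite mulr_sg_norm.
  - by rewrite -expr2 sqr_sg nj.
  - by rewrite normr_sg nj.
  - by case: sgrP nj => //; [left|right].
have n0 : 0 < `|n j| by rewrite normr_gt0.
have nE (s t : R) : n j * s + n (oj j) * t <= `|n j| * (sg * s + `|t|).
  rewrite mulrDr; apply: lerD; first by rewrite {1}sgE mulrAC mulrC mulrA.
  by rewrite (le_trans (ler_norm _))// normrM ler_wpM2r.
have nE' (s t : R) : `|n j| * (sg * s - `|t|) <= n j * s + n (oj j) * t.
  rewrite mulrBr; apply: lerD; first by rewrite {2}sgE mulrCA mulrA.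
  by rewrite lerNl -mulrN (le_trans (ler_norm _))// normrM normrN ler_wpM2r.
have [//|a0] := eqVneq a 0; exfalso.
have na0 : 0 < `|a| by rewrite normr_gt0.
have [J HJ Jparts] := H10_parts oU hu.
have [hmu hmJ _] := HJ.
have nU : ~ U x0.
  move=> Ux0; have [s s0 sU] := open_ptP oU Ux0.
  pose d := Num.min s r0 / 2.
  have d0 : 0 < d by rewrite divr_gt0// lt_min s0.
  have dm : d < Num.min s r0 by rewrite ltr_pdivrMr// mulr_natr mulr2n ltrDl lt_min s0.
  have [ds dr] : d < s /\ d < r0 by apply/andP; rewrite -lt_min.
  pose y := (- sg * d) *: e_ R j + x0.
  have ny : `|y - x0| = d by rewrite addrK norm_he normrM normrN nsg mul1r gtr0_norm.
  have := hin y; rewrite ny dr => /(_ isT (sU y _)); rewrite ny => /(_ ds).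
  rewrite sumE; apply/negP; rewrite -ltNge.
  have -> : co j y - co j x0 = - sg * d.
    by rewrite -coB addrK; case: (ord2P j) => ->; rewrite /co /e_ /= -[_ *: _]/(_ * _) mulr1.
  have -> : co (oj j) y - co (oj j) x0 = 0.
    by rewrite -coB addrK; case: (ord2P j) => ->; rewrite /co /e_ /oj /= -[_ *: _]/(_ * _) mulr0.
  rewrite mulr0 addr0 {1}sgE [X in X < 0](_ : _ = - (sg * sg * (`|n j| * d))); last by ring.
  by rewrite sg1 mul1r oppr_lt0 mulr_gt0.
have b0 := bump0_gt0 R.
(* With 640 the gradient term is at most |a| bump0^2 r / 32, half of the lower bound |a| bump0^2 r /
   16 found for the other side. *)
have e10 : 0 < `|a| * bump0 R ^+ 2 / 640.
  exact: divr_gt0 (mulr_gt0 na0 (exprn_gt0 2 b0)) (ltr0n R 640).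
have [r2 r20 hr2] := L2n_small mU (hmJ i j) nU e10. clear e10.
have [r1 r10 hr1] := hlim (`|a| / 2) (divr_gt0 na0 (ltr0Sn _ 1)).
pose r := Num.min r0 (Num.min r1 r2) / 10.
have m0 : 0 < Num.min r0 (Num.min r1 r2) by rewrite !lt_min r00 r10.
have rp : 0 < r by rewrite divr_gt0.
have : 10 * r <= Num.min r0 (Num.min r1 r2) by rewrite /r mulrC divfK.
rewrite !le_min => /and3P[rr0 rr1 rr2].
(* The bump is centred at x0 - sg r e_j, with radius 8 r along [j] and r across. Inside its support
   the offset across is below r, so on [U] the offset from [p] along [j], multiplied by sg, is
   nonnegative: the derivative of the bump has a constant sign there. *)
pose p : pt := (- (- sg * r)) *: - e_ R j + x0.
have pj : co j p = co j x0 - sg * r.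
  by rewrite /p; case: (ord2P j) => ->; rewrite /co /e_ /= -[_ *: _]/(_ * _); ring.
have poj : co (oj j) p = co (oj j) x0.
  by rewrite /p; case: (ord2P j) => ->; rewrite /co /e_ /oj /= -[_ *: _]/(_ * _); ring.
have r80 : 0 < 8 * r by rewrite mulr_gt0.
pose q := bumpj j p (8 * r) r.
have tq : testfun setT q.
  by rewrite /q /bumpj; case: ifP => _; apply: testfun_bump2.
have bq := testfun_bsf tq; have bdq := testfun_bsf (testfun_pd j tq).
have qoff x : 10 * r <= `|x - x0| -> q x = 0 /\ pd j q x = 0.
  move=> hx; rewrite /q pd_bumpj bumpjE.
  have [h1|h1] := ltP `|co (oj j) x - co (oj j) p| r; last by rewrite [bump1 (co (oj j) p) _ _]bump1_off// !mulr0.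
  have [h2|h2] := ltP `|co j x - co j p| (8 * r); last first.
    by rewrite bump1_off// /dbump1 dbump_off ?mulr0 ?mul0r// normrM (gtr0_norm (x := _^-1)) ?invr_gt0// ler_pdivlMr// mul1r.
  exfalso; move: hx; apply/negP; rewrite -ltNge; apply: (@norm_lt_co _ _ j); rewrite coB.
    move: h2; rewrite pj (_ : _ - _ = (co j x - co j x0) + sg * r); last by ring.
    move=> h2; rewrite -[X in `|X|](addrK (sg * r)) (le_lt_trans (ler_normB _ _))// normrM nsg mul1r gtr0_norm//.
    by move: h2 rp; clear; lra.
  by move: h1 rp; rewrite poj; clear; lra.
have [s [sa ns]] : exists s : R, s * a = `|a| /\ `|s| = 1.
  have [ap|ap] := leP 0 a; [exists 1|exists (-1)]; rewrite ?normrN normr1.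
    by rewrite mul1r ger0_norm.
  by rewrite mulN1r ltr0_norm.
pose V x := ((fun x => co i (u x)) \_ U) x * pd j q x.
have Vin x : U x -> `|x - x0| < 10 * r -> `|a| / 2 <= s * co i (u x) /\ `|co i (u x)| <= 2 * `|a|.
  move=> Ux xr; have := hr1 x Ux (lt_le_trans xr rr1) => h; split.
    rewrite (_ : s * _ = `|a| - s * (a - co i (u x))); last by rewrite -sa; ring.
    have := ler_norm (s * (a - co i (u x))); rewrite normrM ns mul1r distrC; move: h; clear; lra.
  have := ler_normD (co i (u x) - a) a; rewrite subrK; move: h na0; clear; lra.
have bV : bsf V.
  split.
    apply: measurable_funM; last exact: bdq.1.
    by apply: (measurable_restr _ mU).2; exact: (hmu i).1.
  have [D [D0 qD]] := bsf_dom bdq.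
  have A0 : 0 <= 2 * `|a| * D by rewrite !mulr_ge0// ltW.
  exists (2 * `|a| * D + D) => x; split; last first.
    move=> h; rewrite /V (qD x).2 ?mulr0//; apply: le_lt_trans h.
    by rewrite lerDr.
  have [xr|xr] := ltP `|x - x0| (10 * r); last first.
    by rewrite /V (qoff x xr).2 mulr0 normr0 addr_ge0// ltW.
  rewrite /V normrM (@le_trans _ _ (2 * `|a| * D))//; last by rewrite lerDl ltW.
  rewrite ler_pM ?(qD x).1// /patch; case: ifPn => [|_]; last by rewrite normr0 mulr_ge0.
  by rewrite inE => Ux; exact: (Vin x Ux xr).2.
have E1 : \int[mu2]_(x in (U : set mpt)) (co i (u x) * pd j q x) = I2 V.
  rewrite /Rintegral integral_mkcond /I2; congr fine; apply: eq_integral => x _.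
  by rewrite /V /patch; case: ifP => // _; rewrite mul0r.
have lower : `|a| / 2 * ((8 * r)^-1 * bump0 R ^+ 2) * (4 * (r / 2) ^+ 2) <= I2 (fun x => s * - sg * V x).
  have r2p : 0 < r / 2 by rewrite divr_gt0.
  (* On the square of half-side r / 2 around [c], the offset from [p] divided by 8 r lies between
     4.5 / 8 and 5.5 / 8 up to the sign sg, within the range of [dbump_ge]; the square also lies in
     the cone contained in the half-plane. *)
  pose c : pt := (4 * sg * r) *: e_ R j + x0.
  have cj : co j c = co j x0 + 4 * sg * r.
    by rewrite /c; case: (ord2P j) => ->; rewrite /co /e_ /= -[_ *: _]/(_ * _); ring.
  have coj : co (oj j) c = co (oj j) x0.
    by rewrite /c; case: (ord2P j) => ->; rewrite /co /e_ /oj /= -[_ *: _]/(_ * _); ring.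
  pose t x := (co j x - co j p) / (8 * r).
  have GE x : s * - sg * V x = (s * ((fun x => co i (u x)) \_ U) x) *
      ((8 * r)^-1 * dbump (- sg * t x) * bump1 (co (oj j) p) r (co (oj j) x)).
    rewrite /V pd_bumpj /dbump1 -/(t x).
    have -> : dbump (- sg * t x) = - sg * dbump (t x).
      by case: sgc => ->; rewrite ?mulN1r ?opprK ?mul1r// dbump_odd.
    ring.
  have tE x : sg * t x = (sg * (co j x - co j x0) + r) / (8 * r).
    rewrite /t mulrA pj; congr (_ / _).
    by transitivity (sg * (co j x - co j x0) + sg * sg * r); [ring|rewrite sg1 mul1r].
  apply: (@I2_ge_box _ _ c) => //; first exact: bsfZ.
    move=> x /boxP xc.
    have := le_lt_trans (co_norm (c - x) j) xc; rewrite coB cj.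
    have := le_lt_trans (co_norm (c - x) (oj j)) xc; rewrite coB coj.
    move=> h1 h2; rewrite distrC in h1.
    have h3 : `|4 * r - sg * (co j x - co j x0)| < r / 2.
      rewrite (_ : _ - _ = sg * (co j x0 + 4 * sg * r - co j x)) ?normrM ?nsg ?mul1r//.
      by transitivity (sg * sg * (4 * r) - sg * (co j x - co j x0)); [rewrite sg1 mul1r|ring].
    have h4 : `|sg * (co j x - co j x0)| = `|co j x - co j x0| by rewrite normrM nsg mul1r.
    move: (h3); rewrite ltr_norml => /andP[h5 h6].
    have h7 : `|x - x0| < 10 * r.
      apply: (@norm_lt_co _ _ j); rewrite coB; last by move: h1 rp; clear; lra.
      by rewrite -h4 ltr_norml; apply/andP; split; move: h5 h6 rp; clear; lra.
    have Ux : U x.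
      apply: hout; first by apply: lt_le_trans h7 rr0.
      rewrite sumE; apply: lt_le_trans (nE' _ _); rewrite mulr_gt0//; move: h1 h5 h6 rp; clear; lra.
    rewrite GE /patch mem_set//; have [v1 v2] := Vin x Ux h7.
    rewrite ler_pM//.
      by apply: mulr_ge0; [rewrite invr_ge0 ltW|apply: exprn_ge0; exact: ltW].
    rewrite expr2 mulrA ler_pM//.
    - by apply: mulr_ge0; [rewrite invr_ge0|]; exact: ltW.
    - exact: ltW.
    - apply: ler_wpM2l; first by rewrite invr_ge0 ltW.
      have e1 : - sg * t x = - ((sg * (co j x - co j x0) + r) / (8 * r)).
        by rewrite mulNr tE.
      rewrite e1; apply: dbump_ge; rewrite lerN2.
        by rewrite (ler_pdivrMr _ _ r80); move: h5 h6 rp; clear; lra.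
      by rewrite (ler_pdivlMr _ _ r80); move: h5 h6 rp; clear; lra.
    apply: cbump_ge; rewrite normrM (gtr0_norm (x := r^-1)) ?invr_gt0// ler_pdivrMr// poj; move: h1 rp; clear; lra.
  move=> x _; rewrite GE.
  have [xr|xr] := ltP `|x - x0| (10 * r); last first.
    by rewrite -GE /V (qoff x xr).2 !mulr0.
  have [Ux|nUx] := pselect (U x); last by rewrite /patch memNset// mulr0 mul0r.
  have [v1 _] := Vin x Ux xr.
  apply: mulr_ge0; first by rewrite /patch mem_set//; apply: le_trans v1; rewrite divr_ge0.
  have [h1|h1] := ltP `|co (oj j) x - co (oj j) p| r; last by rewrite [bump1 (co (oj j) p) _ _]bump1_off// !mulr0.
  apply: mulr_ge0; last exact: cbump_ge0.
  apply: mulr_ge0; first by rewrite invr_ge0 ltW.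
  apply: dbump_ge0; rewrite mulNr oppr_le0 tE; apply: divr_ge0; last exact: ltW.
  have := hin x (lt_le_trans xr rr0) Ux; rewrite sumE => h0.
  have := le_trans h0 (nE _ _); rewrite pmulr_rge0//; rewrite poj in h1; move: h1; clear; lra.
have up : `|I2 V| <= `|a| * bump0 R ^+ 2 / 640 * (20 * r).
  rewrite -E1 (Jparts i j q tq) normrN.
  have iJ := integrable_L2 mU (hmJ i j) bq.
  apply: le_trans (le_normr_Rintegral mU iJ) _; rewrite /Rintegral.
  pose W := U `&` box x0 (10 * r).
  have mW : measurable (W : set mpt) by apply: measurableI => //; exact: measurable_box.
  have h1 : (\int[mu2]_(x in (U : set mpt)) `|J x i j * q x|%:E <= L2n W (fun x => J x i j) * L2n setT q)%E.
    apply: le_trans (L2_holder mW (measurable_funS mU _ (hmJ i j).1) bq.1); last by move=> x [].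
    rewrite integral_mkcond [leRHS]integral_mkcond; apply: le_integral_nomeas => x.
      by rewrite /patch; case: ifP => // _; rewrite lee_fin.
    rewrite /patch; case: ifPn => [|_]; last by case: ifP => // _; exact: abse_ge0.
    rewrite inE => Ux; case: ifPn => [_|]; first by rewrite abse_EFin.
    rewrite notin_setE => nW; rewrite (qoff x _).1 ?mulr0 ?normr0// leNgt; apply/negP => xr.
    by apply: nW; split => //; apply/boxP; rewrite distrC.
  have h2 : (L2n setT q <= (20 * r)%:E)%E.
    have h3 : (L2n setT q <= L2n (box x0 (10 * r)) q)%E.
      apply: L2n_supp => x _ nb; rewrite (qoff x _).1// leNgt; apply/negP => xr.
      by apply: nb; apply/boxP; rewrite distrC.
    apply: le_trans h3 _; rewrite (_ : 20 * r = 1 * (2 * (10 * r))); last by ring.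
    apply: (@L2n_le _ _ _ x0) => //; first by rewrite mulr_gt0.
    by move=> x _; rewrite /q /bumpj; case: ifP => _; rewrite ger0_norm ?bump2_ge0 ?bump2_le1.
  have h4 := hr2 (10 * r) rr2.
  have h5 : (\int[mu2]_(x in (U : set mpt)) `|J x i j * q x|%:E <= (`|a| * bump0 R ^+ 2 / 640 * (20 * r))%:E)%E.
    by rewrite EFinM (le_trans h1)// lee_pmul// Lnorm_ge0.
  rewrite -lee_fin fineK//; rewrite ge0_fin_numE; first by apply: le_lt_trans h5 _; rewrite ltry.
  by apply: integral_ge0 => x _; rewrite lee_fin.
rewrite I2Z// in lower.
have h6 : s * - sg * I2 V <= `|I2 V|.
  by rewrite (le_trans (ler_norm _))// !normrM normrN ns nsg !mul1r.
have := le_trans lower (le_trans h6 up).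
rewrite (_ : `|a| / 2 * _ * _ = `|a| * bump0 R ^+ 2 * r / 16); last by field; rewrite gt_eqF.
have : 0 < `|a| * bump0 R ^+ 2 * r by apply: mulr_gt0 => //; apply: mulr_gt0 => //; exact: exprn_gt0.
move=> pp; rewrite (_ : _ * (20 * r) = `|a| * bump0 R ^+ 2 * r / 32); last by field.
by move: pp; clear; lra.
Qed.

End TraceAndDuality.

(** * Pointwise bounds and L^2 lower bounds by duality *)

Section Duality.
Variable R : realType.
Local Notation pt := (pt R).
Local Notation mpt := (mpt R).
Local Notation mu2 := (mu2 R).
Implicit Types (x y : pt) (f g G w q phi psi : pt -> R) (U K : set pt) (i j k : 'I_2).

Lemma measurable_cbox x0 (r : R) : measurable ([set x | `|x - x0| <= r] : set mpt).
Proof.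
apply: measurable_closedpt.
rewrite (_ : mkset _ = (fun x => `|x - x0|) @^-1` [set t | t <= r])//.
apply: closed_comp; last exact: closed_le.
move=> x _; apply: (@lip_continuous _ _ 1) => y z; rewrite mul1r.
by apply: le_trans (ler_dist_dist _ _) _; rewrite opprB addrA subrK.
Qed.

Lemma compact_cbox x0 (r : R) : compact [set x | `|x - x0| <= r].
Proof.
apply: (@closed_bounded_compact _ _ (r + `|x0|)).
  rewrite (_ : mkset _ = (fun x => `|x - x0|) @^-1` [set t | t <= r])//.
  apply: closed_comp; last exact: closed_le.
  move=> x _; apply: (@lip_continuous _ _ 1) => y z; rewrite mul1r.
  by apply: le_trans (ler_dist_dist _ _) _; rewrite opprB addrA subrK.
move=> x /= h; rewrite -{1}[x](subrK x0) (le_trans (ler_normD _ _))// lerD2r//.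
Qed.

Lemma cbox_co x x0 (r : R) : `|x.1 - x0.1| <= r -> `|x.2 - x0.2| <= r -> `|x - x0| <= r.
Proof. by move=> h1 h2; rewrite ler_normpt /= h1 h2. Qed.

(** [g] is only locally integrable, so the pairing is restricted to a compact square containing the
    support of [q], on which [g] is measurable. *)
Lemma abse_pairing U g q x0 (r : R) : open U -> loc_int U g -> bsf q ->
  (forall x, `|x - x0| <= r -> U x) -> (forall x, ~ (`|x - x0| <= r) -> q x = 0) ->
  (`| \int[mu2]_(x in (U : set mpt)) (g x * q x)%:E | <=
    \int[mu2]_(x in ([set x | (`|x - x0| <= r)%R] : set mpt)) `|(g x * q x)%:E|)%E /\
  measurable_fun ([set x | (`|x - x0| <= r)%R] : set mpt) (g : mpt -> R).
Proof.
move=> oU lg bq KU qoff.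
have mK := measurable_cbox x0 r.
have mg : measurable_fun ([set x | (`|x - x0| <= r)%R] : set mpt) (g : mpt -> R).
  by have /integrableP[/measurable_EFinP] := lg _ (@compact_cbox x0 r) KU.
split=> //.
have -> : (\int[mu2]_(x in (U : set mpt)) (g x * q x)%:E)%E =
    (\int[mu2]_(x in ([set x | (`|x - x0| <= r)%R] : set mpt)) (g x * q x)%:E)%E.
  rewrite integral_mkcond [RHS]integral_mkcond; apply: eq_integral => x _.
  rewrite /patch; have [h|h] := pselect (`|x - x0| <= r).
    by rewrite mem_set ?mem_set//; exact: KU.
  by rewrite (qoff x h) mulr0; case: ifP; case: ifP.
apply: le_abse_integral => //; apply/measurable_EFinP; apply: measurable_funM => //.
by apply: measurable_funTS; exact: bq.1.
Qed.

(** If |G x0| exceeded |B|, it would do so near [x0] by continuity, and the pairing of [G] with a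
    bump concentrated there would be larger than the bound on [g] allows. The absolute value is
    there because the sign of [B] is unknown. *)
Lemma ae_bound_pointwise U g G (B : R) x0 : open U -> bmf (G \_ U) -> loc_int U g ->
  (forall e, 0 < e -> exists2 r, 0 < r & forall y, `|y - x0| < r -> `|G y - G x0| <= e) ->
  (forall phi, testfun U phi ->
    (\int[mu2]_(x in (U : set mpt)) (g x * phi x)%:E)%E = (I2 (fun x => (G \_ U) x * phi x))%:E) ->
  {ae mu2, forall x : mpt, (U : set mpt) x -> `|g x| <= B} -> U x0 -> `|G x0| <= `|B|.
Proof.
move=> oU bG lg cG hG aeB Ux0.
rewrite leNgt; apply/negP => hB.
pose e := (`|G x0| - `|B|) / 2.
have e0 : 0 < e by rewrite divr_gt0// subr_gt0.
have [r1 r10 hr1] := cG e e0; have [r2 r20 hr2] := open_ptP oU Ux0.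
pose r := Num.min r1 r2 / 2.
have m0 : 0 < Num.min r1 r2 by rewrite lt_min r10.
have r0 : 0 < r by rewrite divr_gt0.
have rm : r < Num.min r1 r2 by rewrite ltr_pdivrMr// mulr_natr mulr2n ltrDl.
have [rr1 rr2] : r < r1 /\ r < r2 by apply/andP; rewrite -lt_min.
pose phi := bump2 x0 r r.
have KU x : `|x - x0| <= r -> U x by move=> h; apply: hr2; exact: le_lt_trans rr2.
have tphi : testfun U phi.
  by apply: testfun_bump2 => // x h1 h2; apply: KU; exact: cbox_co.
have bphi := testfun_bsf tphi.
have phioff x : ~ (`|x - x0| <= r) -> phi x = 0.
  by move=> h; apply: bump2_off => // /boxP h'; apply: h; rewrite distrC ltW.
have [h1 mg] := abse_pairing oU lg bphi KU phioff.
rewrite hG// in h1.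
have p0 : 0 < I2 phi.
  apply: (@lt_le_trans _ _ (bump0 R ^+ 2 * (4 * (r / 2) ^+ 2))).
    apply: mulr_gt0; first by rewrite exprn_gt0// bump0_gt0.
    by apply: mulr_gt0 => //; apply: exprn_gt0; rewrite divr_gt0.
  apply: (@I2_ge_box _ _ x0) => //; first by rewrite divr_gt0.
    by move=> x; exact: bump2_ge.
  by move=> x _; exact: bump2_ge0.
have mphi : measurable_fun ([set x | (`|x - x0| <= r)%R] : set mpt) (phi : mpt -> R).
  by apply: measurable_funTS; exact: bphi.1.
have up : `|I2 (fun x => (G \_ U) x * phi x)| <= `|B| * I2 phi.
  rewrite -lee_fin -[X in (X <= _)%E]/(`|(I2 (fun x => (G \_ U) x * phi x))%:E|)%E.
  apply: le_trans h1 _; rewrite -I2Z// -I2E; last exact: bsfZ.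
  rewrite [leRHS](_ : _ = \int[mu2]_(x in ([set x | (`|x - x0| <= r)%R] : set mpt)) (`|B| * phi x)%:E)%E; last first.
    rewrite [RHS]integral_mkcond; apply: eq_integral => x _; rewrite /patch.
    case: ifPn => //; rewrite notin_setE => /phioff ->.
    by rewrite mulr0.
  apply: ae_ge0_le_integral => //.
  - exact: measurable_cbox.
  - apply: measurableT_comp => //; apply/measurable_EFinP; exact: measurable_funM.
  - by move=> x _; rewrite lee_fin mulr_ge0// bump2_ge0.
  - by apply/measurable_EFinP; apply: measurable_funM => //; exact: measurable_cst.
  case: aeB => N [mN N0 sN]; exists N; split => // x /= h; apply: sN => /= h'; apply: h => xK.
  rewrite lee_fin normrM (ger0_norm (bump2_ge0 _ _ _ _)) ler_wpM2r ?bump2_ge0//.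
  by apply: le_trans (ler_norm B); apply: h'; exact: KU.
have [s [sG ns]] : exists s : R, s * G x0 = `|G x0| /\ `|s| = 1.
  have [ap|ap] := leP 0 (G x0); [exists 1|exists (-1)]; rewrite ?normrN normr1.
    by rewrite mul1r ger0_norm.
  by rewrite mulN1r ltr0_norm.
have bI : bsf (fun x => (G \_ U) x * phi x) by exact: bmfM.
have lo : (`|B| + e) * I2 phi <= s * I2 (fun x => (G \_ U) x * phi x).
  rewrite -!I2Z//; apply: I2_le => [||x]; [exact: bsfZ|exact: bsfZ|].
  have [xK|/phioff ->] := pselect (`|x - x0| <= r); last by rewrite !mulr0.
  rewrite /patch mem_set; last exact: KU.
  rewrite mulrA ler_wpM2r ?bump2_ge0//.
  have := hr1 x (le_lt_trans xK rr1) => h.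
  have h2 : `|s * (G x - G x0)| <= e by rewrite normrM ns mul1r.
  rewrite (_ : s * G x = s * (G x - G x0) + `|G x0|); last by rewrite -sG; ring.
  have := lerNl e (s * (G x - G x0)).
  move: h2; rewrite ler_norml => /andP[h3 _] _; rewrite /e in h3 *; lra.
have := le_trans lo (le_trans (ler_norm _) _); rewrite normrM ns mul1r => /(_ _ up).
rewrite ler_pM2r//; lra.
Qed.

(** A consequence of [weak_deriv_lip]: where the classical derivative exists, it is the value of
    [wd]. *)
Lemma ibp_smooth U f G j (L : R) phi : open U -> 0 <= L -> bmf (f \_ U) -> bmf (G \_ U) ->
  (forall x y, U x -> U y -> `|f x - f y| <= L * `|x - y|) ->
  (forall x, U x -> is_derive x (e_ R j) f (G x)) -> testfun U phi ->
  I2 (fun x => (f \_ U) x * pd j phi x) = - I2 (fun x => (G \_ U) x * phi x).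
Proof.
move=> oU L0 bf bG fL dG tphi.
have mU : measurable (U : set mpt) by exact: measurable_openpt.
have cG x : U x -> dq f j (- step R n) x @[n --> \oo] --> G x.
  move=> Ux; apply: dq_cvg; first exact: dG.
    by move=> n; rewrite oppr_eq0 gt_eqF// step_gt0.
  by rewrite -oppr0; apply: cvgN; exact: step_cvg0.
have [_ _ h] : weak_deriv U [:: j] f (wd (f \_ U) j L).
  by apply: weak_deriv_lip => //; apply: nearW => x /cG h; exists (G x).
have := h phi tphi; rewrite /= integral_restr//; last exact: testfun_bsf (testfun_pd j tphi).
rewrite integral_restr//; [|exact/bmfS/bmf_wd|exact: testfun_bsf tphi].
rewrite expr1 -EFinM mulN1r => E0; have E1 := EFin_inj E0.
transitivity (- I2 (fun x => ((wd (f \_ U) j L) \_ U) x * phi x)); first exact: E1.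
congr (- I2 _).
apply/funext => x; congr (_ * _); rewrite /patch; case: ifPn => //; rewrite inE => Ux.
apply: wd_cvg; last first.
  by apply: cvg_trans (cG x Ux); apply: near_eq_cvg; apply: filterS (dq_near f j oU Ux) => n ->.
have [s s0 sU] := open_ptP oU Ux.
apply: filterS (filterI (dq_near f j oU Ux) (step_lt s0)) => n [-> sn].
apply: (dq_lip _ fL Ux); first by rewrite normrN normr_gt0 gt_eqF// step_gt0.
by apply: sU; rewrite addrK norm_he normrN gtr0_norm// step_gt0.
Qed.

(** For a bump [phi] of radius r / 2 at [x0], [weak_mono] bounds the pairing of [g] with [phi] from
    below by [k] times the integral of [phi], which is at least bump0^2 r^2 / 4; the Cauchy-Schwarz
    inequality bounds it from above by the norm of [g] times r. *)
Lemma L2_lower U f g j x0 (r k s : R) : open U -> bmf (f \_ U) -> weak_deriv U [:: j] f g ->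
  0 < r -> 0 <= k -> box x0 r `<=` U -> `|s| = 1 ->
  (forall y h, 0 < h -> box x0 r y -> box x0 r (- h *: e_ R j + y) ->
     k * h <= s * (f y - f (- h *: e_ R j + y))) ->
  ((k * r * (bump0 R ^+ 2 / 4))%:E <= L2n U g)%E.
Proof.
move=> oU bf [_ lg hg] r0 k0 bU ns hk.
have r20 : 0 < r / 2 by rewrite divr_gt0.
pose phi := bump2 x0 (r / 2) (r / 2).
have KU x : `|x - x0| <= r / 2 -> U x.
  by move=> h; apply: bU; apply/boxP; rewrite distrC; lra.
have tphi : testfun U phi.
  by apply: testfun_bump2 => // x h1 h2; apply: KU; exact: cbox_co.
have bphi := testfun_bsf tphi.
have phioff x : ~ (`|x - x0| <= r / 2) -> phi x = 0.
  by move=> h; apply: bump2_off => // /boxP h'; apply: h; rewrite distrC ltW.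
have [h1 mg] := abse_pairing oU lg bphi KU phioff.
have lo : bump0 R ^+ 2 * (4 * (r / 2 / 2) ^+ 2) <= I2 phi.
  apply: (@I2_ge_box _ _ x0) => //; first by rewrite divr_gt0.
    by move=> x; exact: bump2_ge.
  by move=> x _; exact: bump2_ge0.
pose F x := s * (f \_ U) x.
have bF : bmf F.
  case: bf => mf [C fC]; split; first by apply: measurable_funM => //; exact: measurable_cst.
  by exists C => x; rewrite normrM ns mul1r.
have mono : k * I2 phi <= - I2 (fun x => F x * pd j phi x).
  apply: (weak_mono bF tphi); first by move=> x; exact: bump2_ge0.
  apply: filterS (step_lt r20) => n sn x px.
  have xr : `|x - x0| <= r / 2 by apply: contrapT => /phioff h; rewrite h eqxx in px.
  have bx : box x0 r x by apply/boxP; rewrite distrC; lra.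
  have bx' : box x0 r (- step R n *: e_ R j + x).
    apply/boxP; rewrite distrC -addrA (le_lt_trans (ler_normD _ _))// norm_he normrN gtr0_norm ?step_gt0//; lra.
  have := hk x (step R n) (step_gt0 R n) bx bx'.
  rewrite /dq /F /patch !mem_set; [|exact: bU|exact: bU].
  rewrite -mulrBr invrN mulrN -mulNr -mulrN opprB ler_pdivlMr ?step_gt0//.
have E : (\int[mu2]_(x in (U : set mpt)) (g x * phi x)%:E)%E = (- I2 (fun x => (f \_ U) x * pd j phi x))%:E.
  have := hg phi tphi; rewrite /= integral_restr//; last exact: testfun_bsf (testfun_pd j tphi).
  move=> h0; rewrite EFinN.
  have -> : (I2 (fun x => (f \_ U) x * pd j phi x))%:E = _ := h0.
  by rewrite expr1 mulN1e oppeK.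
have FE : - I2 (fun x => F x * pd j phi x) = s * - I2 (fun x => (f \_ U) x * pd j phi x).
  rewrite mulrN -I2Z; last by apply: bmfM => //; exact: testfun_bsf (testfun_pd j tphi).
  by congr (- I2 _); apply/funext => x; rewrite /F mulrA.
have h2 : ((k * (bump0 R ^+ 2 * (4 * (r / 2 / 2) ^+ 2)))%:E <= L2n U g * r%:E)%E.
  apply: (@le_trans _ _ (k * I2 phi)%:E); first by rewrite lee_fin ler_wpM2l.
  apply: (@le_trans _ _ `|\int[mu2]_(x in (U : set mpt)) (g x * phi x)%:E|%E).
    rewrite E abse_EFin lee_fin (le_trans mono)// FE (le_trans (ler_norm _))//.
    by rewrite normrM ns mul1r.
  apply: le_trans h1 _.
  apply: le_trans (L2_holder (measurable_cbox x0 (r / 2)) mg bphi.1) _.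
  apply: lee_pmul; [exact: Lnorm_ge0|exact: Lnorm_ge0|by apply: L2n_mono => // x; exact: KU|].
  have h3 : (L2n setT phi <= L2n (box x0 (r / 2)) phi)%E.
    by apply: L2n_supp => x _; exact: bump2_off.
  apply: le_trans h3 _; rewrite [X in (_ <= X%:E)%E](_ : r = 1 * (2 * (r / 2))); last by field.
  by apply: (@L2n_le _ _ _ x0) => // x _; rewrite ger0_norm ?bump2_ge0 ?bump2_le1.
rewrite -(@lee_pmul2r _ r%:E)//= -EFinM; apply: le_trans h2.
by rewrite lee_fin le_eqVlt; apply/orP; left; apply/eqP; field.
Qed.

End Duality.

Ltac pt_simp := rewrite /= ?scale1E ?scale2E -?[_ *: _ : _]/(_ * _) /=.
Ltac pt_lra := apply: ptP; pt_simp; lra.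

(** * Quadratic maps of the reference triangle *)

Section ReferenceTriangle.
Variable R : realType.
Local Notation pt := (pt R).
Local Notation refTc := (@refTc R).
Local Notation refT := (@refT R).
Implicit Types (x y : pt) (k m : 'I_3).

Lemma sum_I3 (V : nmodType) (f : 'I_3 -> V) : \sum_i f i = f 0 + (f 1 + f 2%:R).
Proof.
rewrite !big_ord_recl big_ord0 addr0; congr (_ + (_ + _)); congr f; exact: val_inj.
Qed.

Lemma ord3P k : [\/ k = 0, k = 1 | k = 2%:R].
Proof.
case: k => [[|[|[|//]]]] hk; [apply: Or31|apply: Or32|apply: Or33]; exact: val_inj.
Qed.

Lemma bary_sum x : \sum_k bary k x = 1.
Proof. by rewrite sum_I3 /bary /=; ring. Qed.

Lemma bary_refv x : x = \sum_k bary k x *: refv R k.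
Proof. by rewrite sum_I3 /bary /refv; pt_lra. Qed.

Lemma bary_comb (l : 'I_3 -> R) k : \sum_i l i = 1 -> bary k (\sum_i l i *: refv R i) = l k.
Proof.
rewrite !sum_I3 /refv /= => h; case: (ord3P k) => ->; rewrite /bary /= ?scale1E ?scale2E -?[_ *: _ : R]/(_ * _);
  first by ring.
  by ring.
by lra.
Qed.

Lemma refTcP x : refTc x <-> forall k, 0 <= bary k x.
Proof.
split; first by move=> [l [l0 l1 ->]] k; rewrite bary_comb.
by move=> h; exists (fun k => bary k x); split => //; [exact: bary_sum|exact: bary_refv].
Qed.

Lemma refTP x : refT x <-> forall k, 0 < bary k x.
Proof.
split; first by move=> [l [l0 l1 ->]] k; rewrite bary_comb.
by move=> h; exists (fun k => bary k x); split => //; [exact: bary_sum|exact: bary_refv].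
Qed.

Lemma refTcE x : refTc x <-> [/\ 0 <= x.1, 0 <= x.2 & x.1 + x.2 <= 1].
Proof.
rewrite refTcP; split.
  move=> h; have := h 0; have := h 1; have := h 2%:R; rewrite /bary /= => h2 h1 h0.
  by split => //; lra.
by move=> [h0 h1 h2] k; case: (ord3P k) => ->; rewrite /bary //=; lra.
Qed.

Lemma refTE x : refT x <-> [/\ 0 < x.1, 0 < x.2 & x.1 + x.2 < 1].
Proof.
rewrite refTP; split.
  move=> h; have := h 0; have := h 1; have := h 2%:R; rewrite /bary /= => h2 h1 h0.
  by split => //; lra.
by move=> [h0 h1 h2] k; case: (ord3P k) => ->; rewrite /bary //=; lra.
Qed.

Lemma refTW x : refT x -> refTc x.
Proof. by rewrite refTE refTcE => -[*]; split; lra. Qed.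

Lemma bary_convex k (t : R) x y :
  bary k ((1 - t) *: x + t *: y) = (1 - t) * bary k x + t * bary k y.
Proof. by case: (ord3P k) => ->; rewrite /bary /= ?scale1E ?scale2E -?[_ *: _ : R]/(_ * _) //; ring. Qed.

Lemma refTc_convex (t : R) x y : 0 <= t <= 1 -> refTc x -> refTc y -> refTc ((1 - t) *: x + t *: y).
Proof.
move=> /andP[t0 t1] /refTcP hx /refTcP hy; apply/refTcP => k.
by rewrite bary_convex addr_ge0// mulr_ge0// subr_ge0.
Qed.

Lemma mid_convex x y : mid x y = (1 - 2^-1) *: x + 2^-1 *: y.
Proof. rewrite /mid; apply: ptP; rewrite /= ?scale1E ?scale2E -?[_ *: _ : R]/(_ * _) /=; lra. Qed.

Lemma refTc_mid x y : refTc x -> refTc y -> refTc (mid x y).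
Proof. by rewrite mid_convex; apply: refTc_convex; apply/andP; split; lra. Qed.

Lemma bary_lip k x y : `|bary k x - bary k y| <= 2 * `|x - y|.
Proof.
have := ler_normpt (x - y) `|x - y|; rewrite lexx => /esym/andP[/=]; rewrite !ler_norml => /andP[h1 h2] /andP[h3 h4].
by case: (ord3P k) => ->; rewrite /bary /=; apply/andP; split; lra.
Qed.

Lemma refTc_norm x y : refTc x -> refTc y -> `|x - y| <= 1.
Proof.
move=> /refTcE[a b c] /refTcE[d e f].
by rewrite ler_normpt /= !ler_norml; apply/andP; split; apply/andP; split; lra.
Qed.

Lemma open_refT : open refT.
Proof.
apply: open_ptPI => x /refTP h.
exists (\big[Num.min/1]_k (bary k x / 2)).
  by apply/bigmin_gtP; split => // k _; rewrite divr_gt0.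
move=> y hy; apply/refTP => k.
have : `|y - x| < bary k x / 2 by apply: lt_le_trans hy _; exact: bigmin_le_cond.
by have := bary_lip k x y; rewrite ler_norml (distrC x) => /andP[h1 h2] h3; lra.
Qed.

(* The closed subtriangle of the split opposite to the vertex m. *)
Definition subT m : set pt := [set x | 0 <= bary m x /\ forall k, bary m x <= bary k x].

Definition inT m : set pt := [set x | 0 < bary m x /\ forall k, k != m -> bary m x < bary k x].

Lemma inT_subT m x : inT m x -> subT m x.
Proof. by move=> [h0 h]; split => [|k]; [exact: ltW|case: (eqVneq k m) => [->//|/h/ltW]]. Qed.

Lemma inT_refT m x : inT m x -> refT x.
Proof.
by move=> [h0 h]; apply/refTP => k; case: (eqVneq k m) => [->//|/h]; exact: lt_trans.
Qed.

Lemma subT_ctri m x : subT m x -> ctri (ctsub R m) x.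
Proof.
move=> [h0 hk]; exists (fun k => if k == m then 3 * bary m x else bary k x - bary m x); split.
- by move=> k; case: eqP => _; [rewrite mulr_ge0|rewrite subr_ge0].
- by have := bary_sum x; rewrite !sum_I3; case: (ord3P m) => -> /=; lra.
- rewrite sum_I3 /ctsub /ctcenter; case: (ord3P m) => -> /=; rewrite /refv /bary /=;
   by apply: ptP; rewrite /= ?scale1E ?scale2E -?[_ *: _ : R]/(_ * _) /=; lra.
Qed.

Lemma subT_refTc m x : subT m x -> refTc x.
Proof. by move=> [h0 hk]; apply/refTcP => k; exact: le_trans (hk k). Qed.

Lemma subT_cover x : refTc x -> exists m, subT m x.
Proof.
move=> /refTcP h; have [m _ hm] := arg_minP (P := predT) (fun k => bary k x) (i0 := 0 : 'I_3) isT.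
by exists m; split => // k; exact: hm.
Qed.

Lemma ctcenter_refT : refT (ctcenter R).
Proof. by rewrite refTE /ctcenter /=; split; lra. Qed.

Lemma ctcenter_subT m : subT m (ctcenter R).
Proof.
split; first by have /refTcP := refTW ctcenter_refT; exact.
by move=> k; case: (ord3P m) => ->; case: (ord3P k) => ->; rewrite /bary /ctcenter /=; lra.
Qed.

Lemma refv_subT m k : k != m -> subT m (refv R k).
Proof.
move=> km; split => [|l]; move: km; case: (ord3P m) => ->; case: (ord3P k) => -> //= _;
 try (case: (ord3P l) => ->); rewrite /bary /refv /=; lra.
Qed.

Lemma subT_convex m (t : R) x y : 0 <= t <= 1 -> subT m x -> subT m y -> subT m ((1 - t) *: x + t *: y).
Proof.
move=> /andP[t0 t1] [x0 hx] [y0 hy]; split => [|k]; rewrite !bary_convex.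
  by rewrite addr_ge0// mulr_ge0// subr_ge0.
by rewrite lerD// ler_wpM2l// subr_ge0.
Qed.

Lemma subT_mid m x y : subT m x -> subT m y -> subT m (mid x y).
Proof. by rewrite mid_convex; apply: subT_convex; apply/andP; split; lra. Qed.

Lemma ctsub_subT m k : subT m (ctsub R m k).
Proof. by rewrite /ctsub; case: eqP => [_|/eqP]; [exact: ctcenter_subT|exact: refv_subT]. Qed.

Lemma ctsub_ctnodes m k l : ctnodes (mid (ctsub R m k) (ctsub R m l)).
Proof.
have h j : ctvertices (ctsub R m j).
  by rewrite /ctsub; case: eqP => _; [right|left; exists j].
by exists (ctsub R m k), (ctsub R m l).
Qed.

(** Barycentric coordinates in the subtriangle [m]: all coordinates of the centre are 1/3, so it
    takes the weight [3 * bary m x] and leaves [bary k x - bary m x] to the vertex [k]. *)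
Definition ctpar m x : pt :=
  let l k := if k == m then 3 * bary m x else bary k x - bary m x in (l 0, l 1).

Definition ctmap m x : pt :=
  ctsub R m 2%:R + (x.1 *: (ctsub R m 0 - ctsub R m 2%:R) + x.2 *: (ctsub R m 1 - ctsub R m 2%:R)).

Lemma ctparK m x : ctmap m (ctpar m x) = x.
Proof.
by rewrite /ctmap /ctpar /ctsub /ctcenter /refv /bary; case: (ord3P m) => -> /=; apply: ptP; pt_simp; field.
Qed.

Lemma ctmap_mid m k l : ctmap m (mid (refv R k) (refv R l)) = mid (ctsub R m k) (ctsub R m l).
Proof.
rewrite /ctmap; set a := ctsub R m 0; set b := ctsub R m 1; set c := ctsub R m 2%:R.
by case: (ord3P k) => ->; case: (ord3P l) => ->; rewrite -/a -/b -/c /refv /mid /=; apply: ptP; pt_simp; field.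
Qed.

Lemma ctpar_refTc m x : subT m x -> refTc (ctpar m x).
Proof.
move=> [m0 hm]; have := hm 0; have := hm 1; have := hm 2%:R; move: (bary_sum x) m0; rewrite sum_I3.
by rewrite refTcE /ctpar; case: (ord3P m) => -> /=; move=> *; split; lra.
Qed.

Lemma ctpar_lip m x y : `|ctpar m x - ctpar m y| <= 6 * `|x - y|.
Proof.
have h k : `|(if k == m then 3 * bary m x else bary k x - bary m x) -
    (if k == m then 3 * bary m y else bary k y - bary m y)| <= 6 * `|x - y|.
  have hm := bary_lip m x y; have hk := bary_lip k x y; case: ifP => _.
    by rewrite -mulrBr normrM (ger0_norm (ler0n _ 3)); lra.
  rewrite (_ : _ - _ = (bary k x - bary k y) - (bary m x - bary m y)); last by ring.
  by apply: le_trans (ler_normB _ _) _; have := normr_ge0 (x - y); lra.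
by rewrite ler_normpt; apply/andP; split; exact: h.
Qed.

Lemma ctnodes_refTc x : ctnodes x -> refTc x.
Proof.
have h a : ctvertices a -> refTc a.
  case=> [[k _ <-]|->]; last exact/refTW/ctcenter_refT.
  by apply/refTcE; case: (ord3P k) => ->; rewrite /refv /=; split; lra.
by move=> [a [b [/h ha /h hb ->]]]; exact: refTc_mid.
Qed.

Lemma refv_refTc k : refTc (refv R k).
Proof.
by apply/refTcE; case: (ord3P k) => ->; rewrite /refv /=; split; lra.
Qed.

End ReferenceTriangle.

(** * Quadratic polynomials in two variables *)

Section Quadratics.
Variable R : realType.
Local Notation pt := (pt R).
Implicit Types (x y : pt) (j : 'I_2).

Record quad := Quad {q0 : R; q1 : R; q2 : R; q11 : R; q12 : R; q22 : R}.
Implicit Types c d : quad.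

Definition qval c x : R :=
  q0 c + q1 c * x.1 + q2 c * x.2 + q11 c * x.1 ^+ 2 + q12 c * (x.1 * x.2) + q22 c * x.2 ^+ 2.

Definition qh c j (k : 'I_2) : R :=
  if j == 0 then if k == 0 then 2 * q11 c else q12 c
  else if k == 0 then q12 c else 2 * q22 c.

Definition qd c j x : R := (if j == 0 then q1 c else q2 c) + qh c j 0 * x.1 + qh c j 1 * x.2.

(** The midpoint rule is exact for quadratics. Lipschitz, injectivity and orientation arguments
    below rest on it instead of a Taylor remainder. *)
Lemma qval_sub c x y :
  qval c x - qval c y = qd c 0 (mid x y) * (x.1 - y.1) + qd c 1 (mid x y) * (x.2 - y.2).
Proof.
by rewrite /qval /qd /qh /mid /= -![_ *: _ : R]/(_ * _); field.
Qed.

Lemma qd_sub c j x y : qd c j x - qd c j y = qh c j 0 * (x.1 - y.1) + qh c j 1 * (x.2 - y.2).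
Proof. by rewrite /qd; ring. Qed.

Definition qadd c d := Quad (q0 c + q0 d) (q1 c + q1 d) (q2 c + q2 d)
  (q11 c + q11 d) (q12 c + q12 d) (q22 c + q22 d).
Definition qscale (a : R) c := Quad (a * q0 c) (a * q1 c) (a * q2 c) (a * q11 c) (a * q12 c) (a * q22 c).

Lemma qval_add c d x : qval (qadd c d) x = qval c x + qval d x.
Proof. by rewrite /qval /=; ring. Qed.

Lemma qval_scale a c x : qval (qscale a c) x = a * qval c x.
Proof. by rewrite /qval /=; ring. Qed.

Lemma polyP2_quad (f : pt -> R) : Defs.polyP 2 f -> exists c, f =1 qval c.
Proof.
move=> [c h]; exists (Quad (c 0 0) (c 1 0) (c 0 1) (c 2 0) (c 1 1) (c 0 2))%N => x.
by rewrite h !big_ord_recl !big_ord0 /bump /= /qval /= !expr0 !expr1; ring.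
Qed.

Lemma quad_affine c (b v1 v2 : pt) : exists d, forall x, qval d x = qval c (b + (x.1 *: v1 + x.2 *: v2)).
Proof.
exists (Quad (qval c b) (qd c 0 b * v1.1 + qd c 1 b * v1.2) (qd c 0 b * v2.1 + qd c 1 b * v2.2)
  (q11 c * v1.1 ^+ 2 + q12 c * (v1.1 * v1.2) + q22 c * v1.2 ^+ 2)
  (2 * q11 c * (v1.1 * v2.1) + q12 c * (v1.1 * v2.2 + v1.2 * v2.1) + 2 * q22 c * (v1.2 * v2.2))
  (q11 c * v2.1 ^+ 2 + q12 c * (v2.1 * v2.2) + q22 c * v2.2 ^+ 2)) => x.
by rewrite /qval /qd /qh /= -?[_ *: _ : R]/(_ * _); ring.
Qed.

Lemma qd_derive c j x : is_derive x (e_ R j) (qval c) (qd c j x).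
Proof.
apply/dderivP => e e0.
exists (e / (1 + `|qh c j j|)); first by rewrite divr_gt0// ltr_wpDr.
move=> h hh; rewrite qval_sub.
have -> : qd c 0 (mid (h *: e_ R j + x) x) * ((h *: e_ R j + x).1 - x.1) +
    qd c 1 (mid (h *: e_ R j + x) x) * ((h *: e_ R j + x).2 - x.2) - h * qd c j x =
    h * (h * qh c j j / 2).
  by case: (ord2P j) => ->; rewrite /qd /qh /e_ /mid; pt_simp; field.
rewrite normrM mulrC ler_wpM2r// !normrM normfV (ger0_norm (ltW (@ltr0n R 2)))//.
move: hh; rewrite ltr_pdivlMr ?ltr_wpDr// => /ltW; have := normr_ge0 h; have := normr_ge0 (qh c j j); nra.
Qed.

Lemma pd_qval c j x : pd j (qval c) x = qd c j x.
Proof. by have [_] := qd_derive c j x. Qed.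

Definition qbnd (N : R) c :=
  [/\ `|q0 c| <= N, `|q1 c| <= N & `|q2 c| <= N] /\ [/\ `|q11 c| <= N, `|q12 c| <= N & `|q22 c| <= N].

Lemma ltr_prodb (a b A B : R) : `|a| <= A -> `|b| <= B -> `|a * b| <= A * B.
Proof. by move=> h1 h2; rewrite normrM ler_pM. Qed.

Lemma ltr_sum2b (a b A B : R) : `|a| <= A -> `|b| <= B -> `|a + b| <= A + B.
Proof. by move=> h1 h2; apply: le_trans (ler_normD _ _) _; rewrite lerD. Qed.

Lemma normpt_co x : (`|x.1| <= `|x|) * (`|x.2| <= `|x|).
Proof. by have := ler_normpt x `|x|; rewrite lexx => /esym/andP[]. Qed.

Lemma refTc_co x : refTc x -> (`|x.1| <= 1) * (`|x.2| <= 1).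
Proof. by move=> /refTcE[*]; rewrite !ler_norml; split; apply/andP; split; lra. Qed.

Lemma qd_bnd N c j x : qbnd N c -> refTc x -> `|qd c j x| <= 5 * N.
Proof.
move=> [[n0 n1 n2] [n3 n4 n5]] hx; have [x1 x2] := refTc_co hx; have /refTcE[*] := hx.
have N0 := le_trans (normr_ge0 _) n0.
have h a : (if a == 0 then `|q1 c| else `|q2 c|) <= N by case: ifP.
rewrite (_ : 5 * N = N + (2 * N) * 1 + (2 * N) * 1)//; last by ring.
apply: ltr_sum2b; first apply: ltr_sum2b; first by case: ifP.
  apply: ltr_prodb => //; rewrite /qh /=; case: ifP => _; last by lra.
  by rewrite normrM ger0_norm// ler_wpM2l.
apply: ltr_prodb => //; rewrite /qh /=; case: ifP => _; first by lra.
by rewrite normrM ger0_norm// ler_wpM2l.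
Qed.

Lemma qval_lip N c x y : qbnd N c -> refTc x -> refTc y ->
  `|qval c x - qval c y| <= 10 * N * `|x - y|.
Proof.
move=> hN hx hy; rewrite qval_sub (_ : 10 * N * `|x - y| = (5 * N) * `|x - y| + (5 * N) * `|x - y|); last by ring.
have hm := refTc_mid hx hy.
by apply: ltr_sum2b; apply: ltr_prodb; rewrite ?qd_bnd//; have := normpt_co (x - y) => -[].
Qed.

Lemma qval_bnd N c x : qbnd N c -> refTc x -> `|qval c x| <= 11 * N.
Proof.
move=> hN hx; have h0 : refTc (0 : pt) by apply/refTcE; split => /=; lra.
have hq0 : qval c 0 = q0 c by rewrite /qval /=; ring.
rewrite -[qval c x](subrK (qval c 0)) (_ : 11 * N = 10 * N + N); last by ring.
apply: ltr_sum2b; last by rewrite hq0; case: hN => -[].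
have N0 : 0 <= 10 * N by case: hN => -[h _ _] _; rewrite mulr_ge0// (le_trans _ h).
by apply: le_trans (qval_lip hN hx h0) _; rewrite ler_piMr// refTc_norm.
Qed.

Lemma qd_lip (N : R) c j x y : (forall k, `|qh c j k| <= N) -> `|qd c j x - qd c j y| <= 2 * N * `|x - y|.
Proof.
move=> hN; rewrite qd_sub (_ : 2 * N * `|x - y| = N * `|x - y| + N * `|x - y|); last by ring.
by apply: ltr_sum2b; apply: ltr_prodb => //; have := normpt_co (x - y) => -[].
Qed.

Lemma qh_bnd N c j k : qbnd N c -> `|qh c j k| <= 2 * N.
Proof.
move=> [[n0 n1 n2] [n3 n4 n5]]; have N0 := le_trans (normr_ge0 _) n0.
by rewrite /qh; do !case: ifP => _; rewrite ?normrM ?(ger0_norm (ler0n _ 2)) ?ler_wpM2l//; lra.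
Qed.

(** The barycentre of the subtriangle [m] and its two shifts by 1/40 along the axes. The gradient of
    a quadratic is affine, hence determined by its values at these three points. *)
Definition gpt (m l : 'I_3) : pt :=
  (3^-1 : R) *: (\sum_k ctsub R m k) + (if l == 0 then 0 else if l == 1 then (40^-1, 0) else (0, 40^-1)).

Lemma gpt_inT m l x : `|x - gpt m l| <= 40^-1 -> inT m x.
Proof.
rewrite ler_normpt /gpt sum_I3 /ctsub /ctcenter /refv; set d := if l == 0 then _ else _.
have [d1 d2] : (0 <= d.1 <= 40^-1) /\ (0 <= d.2 <= 40^-1).
  by rewrite /d; do !case: ifP => _ /=; split; apply/andP; split; rewrite ?invr_ge0.
move: d d1 d2 => d /andP[? ?] /andP[? ?]; rewrite !ler_norml; case: (ord3P m) => ->; pt_simp;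
move=> /andP[/andP[? ?] /andP[? ?]]; (split; [|move=> k; case: (ord3P k) => -> //= _]); rewrite /bary /=; lra.
Qed.

(** Differences of the gradient over the distance 1/40 give the second derivatives, these give the
    gradient at the origin, and the zero at the centre gives the constant term. That zero stands in
    for a Poincare inequality. *)
Lemma qbnd_grad G c m : qval c (ctcenter R) = 0 -> (forall l j, `|qd c j (gpt m l)| <= G) -> qbnd (400 * G) c.
Proof.
move=> c0 h; have G0 : 0 <= G by apply: le_trans (h 0 0).
have hq j k : `|qh c j k| <= 80 * G.
  pose l : 'I_3 := if k == 0 then 1 else 2%:R.
  have -> : qh c j k = 40 * (qd c j (gpt m l) - qd c j (gpt m 0)).
    by rewrite qd_sub /gpt /l; case: (ord2P k) => -> /=; pt_simp; field.
  rewrite normrM (ger0_norm (ler0n _ 40)); have := ler_normB (qd c j (gpt m l)) (qd c j (gpt m 0)).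
  by have := h l j; have := h 0 j; lra.
have [x1 x2] : (`|(gpt m 0).1| <= 1) * (`|(gpt m 0).2| <= 1).
  by apply: refTc_co; apply: (@subT_refTc _ m); apply: inT_subT; apply: (@gpt_inT m 0); rewrite subrr normr0 invr_ge0.
have hd j : `|if j == 0 then q1 c else q2 c| <= 161 * G.
  have -> : (if j == 0 then q1 c else q2 c) =
      qd c j (gpt m 0) - (qh c j 0 * (gpt m 0).1 + qh c j 1 * (gpt m 0).2) by rewrite /qd; ring.
  apply: le_trans (ler_normB _ _) _; rewrite (_ : 161 * G = G + (80 * G * 1 + 80 * G * 1)); last by ring.
  by apply: lerD => //; apply: ltr_sum2b; apply: ltr_prodb.
have := hq 0 0; have := hq 1 1; have := hq 0 1; have := hd 0; have := hd 1; rewrite /qh /= !normrM !(ger0_norm (ler0n _ 2)).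
move=> h2 h1 h12 h22 h11.
have h0 : `|q0 c| <= 400 * G.
  move: c0; rewrite /qval /ctcenter /= => c0.
  have -> : q0 c = - (q1 c * 3^-1 + q2 c * 3^-1 + q11 c * 9^-1 + q12 c * 9^-1 + q22 c * 9^-1) by lra.
  have b22 : `|q22 c| <= 40 * G by lra.
  have b11 : `|q11 c| <= 40 * G by lra.
  move: h2 h1 h12 b22 b11; rewrite !ler_norml => /andP[? ?] /andP[? ?] /andP[? ?] /andP[? ?] /andP[? ?].
  by apply/andP; split; lra.
by do !split => //; lra.
Qed.

Lemma qbnd_nodes B c : (forall k l, `|qval c (mid (refv R k) (refv R l))| <= B) -> qbnd (20 * B) c.
Proof.
move=> h; have := h 0 0; have := h 1 1; have := h 2%:R 2%:R; have := h 0 1; have := h 0 2%:R; have := h 1 2%:R.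
pose v k l := qval c (mid (refv R k) (refv R l)).
have e0 : q0 c = v 2%:R 2%:R by rewrite /v /mid /refv /qval; pt_simp; ring.
have e1 : q1 c = 4 * v 0 2%:R - 3 * v 2%:R 2%:R - v 0 0 by rewrite /v /mid /refv /qval; pt_simp; field.
have e2 : q2 c = 4 * v 1 2%:R - 3 * v 2%:R 2%:R - v 1 1 by rewrite /v /mid /refv /qval; pt_simp; field.
have e11 : q11 c = 2 * v 0 0 + 2 * v 2%:R 2%:R - 4 * v 0 2%:R by rewrite /v /mid /refv /qval; pt_simp; field.
have e12 : q12 c = 4 * (v 0 1 + v 2%:R 2%:R - v 0 2%:R - v 1 2%:R) by rewrite /v /mid /refv /qval; pt_simp; field.
have e22 : q22 c = 2 * v 1 1 + 2 * v 2%:R 2%:R - 4 * v 1 2%:R by rewrite /v /mid /refv /qval; pt_simp; field.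
rewrite /qbnd e0 e1 e2 e11 e12 e22 -!/(v _ _) {e0 e1 e2 e11 e12 e22 h}.
move: (v 0 0) (v 1 1) (v 2%:R 2%:R) (v 0 1) (v 0 2%:R) (v 1 2%:R) => {v c} a b c d e f.
rewrite !ler_norml => /andP[? ?] /andP[? ?] /andP[? ?] /andP[? ?] /andP[? ?] /andP[? ?].
by do !split; apply/andP; split; lra.
Qed.

(** Through the affine map [ctmap] of the reference triangle onto the subtriangle: 220 = 11 * 20 and
    1200 = 10 * 20 * 6, with 20 from [qbnd_nodes] and 6 from [ctpar_lip]. *)
Lemma qval_nodes B c m : (forall k l, `|qval c (mid (ctsub R m k) (ctsub R m l))| <= B) ->
  (forall x, subT m x -> `|qval c x| <= 220 * B) /\
  (forall x y, subT m x -> subT m y -> `|qval c x - qval c y| <= 1200 * B * `|x - y|).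
Proof.
move=> h; have [d hd] := quad_affine c (ctsub R m 2%:R) (ctsub R m 0 - ctsub R m 2%:R) (ctsub R m 1 - ctsub R m 2%:R).
have {}hd x : qval d x = qval c (ctmap m x) by exact: hd.
have B0 : 0 <= B by apply: le_trans (h 0 0).
have hB : qbnd (20 * B) d by apply: qbnd_nodes => k l; rewrite hd ctmap_mid.
have hc x : qval c x = qval d (ctpar m x) by rewrite hd ctparK.
split=> [x hx|x y hx hy]; rewrite !hc.
  by apply: le_trans (qval_bnd hB (ctpar_refTc hx)) _; lra.
apply: le_trans (qval_lip hB (ctpar_refTc hx) (ctpar_refTc hy)) _.
rewrite (_ : 1200 * B * _ = 10 * (20 * B) * (6 * `|x - y|)); last by ring.
by apply: ler_wpM2l; [lra|exact: ctpar_lip].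
Qed.

End Quadratics.

(** * Quadratic maps close to affine ones: injectivity and local surjectivity *)

Section LocalInverse.
Variable R : realType.
Local Notation pt := (pt R).
Implicit Types (x y z w : pt) (a b j : 'I_2).

Lemma qval_continuous (c : quad R) : continuous (qval c).
Proof.
move=> x; have c1 : (fun y : pt => y.1) z @[z --> x] --> x.1 by exact: cvg_fst.
have c2 : (fun y : pt => y.2) z @[z --> x] --> x.2 by exact: cvg_snd.
by rewrite /qval; do !apply: cvgD; do ?[exact: cvg_cst|exact: cvgM|apply: cvgM].
Qed.

Lemma continuous_pair (f g : pt -> R) : continuous f -> continuous g -> continuous (fun x => (f x, g x) : pt).
Proof. by move=> cf cg x; exact: (cvg_pair (cf x) (cg x)). Qed.

(* The displacement |T x - x| attains its minimum, which a contraction can only do at a fixed point. *)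
Lemma ball_fixpoint (T : pt -> pt) x0 r : 0 <= r -> continuous T ->
  (forall x, `|x - x0| <= r -> `|T x - x0| <= r) ->
  (forall x y, `|x - x0| <= r -> `|y - x0| <= r -> `|T x - T y| <= 2^-1 * `|x - y|) ->
  exists2 p, `|p - x0| <= r & T p = p.
Proof.
move=> r0 cT TU Tc; pose U : set pt := [set x | `|x - x0| <= r].
have cU : closed U.
  apply: (@closed_comp _ _ (fun x : pt => `|x - x0|) [set t : R | t <= r]); last exact: closed_le.
  by move=> x _; apply: (@cvg_norm _ pt); apply: cvgB; [exact: cvg_id|exact: cvg_cst].
have kU : compact U.
  apply: (@closed_bounded_compact _ _ (r + `|x0|)) => // x hx.
  by rewrite -(subrK x0 x); apply: le_trans (ler_normD _ _) _; rewrite lerD2r.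
have cf : continuous (fun x : pt => `|T x - x|).
  by move=> x; apply: (@cvg_norm _ pt); apply: cvgB; [exact: cT|exact: cvg_id].
have U0 : U !=set0 by exists x0; rewrite /U /= subrr normr0.
have [p /set_mem Up hp] := compact_EVT_min U0 kU (continuous_subspaceT cf).
exists p => //; apply/eqP; rewrite -subr_eq0 -normr_le0.
have := hp (T p) (mem_set (TU p Up)); have := Tc _ _ (TU p Up) Up; have := normr_ge0 (T p - p); lra.
Qed.

Section Element.
Variables (F : 'I_2 -> quad R) (h K d0 : R).

Definition qmap x : pt := (qval (F 0) x, qval (F 1) x).
Definition qdet x : R := qd (F 0) 0 x * qd (F 1) 1 x - qd (F 0) 1 x * qd (F 1) 0 x.
Definition qact x w : pt :=
  (qd (F 0) 0 x * w.1 + qd (F 0) 1 x * w.2, qd (F 1) 0 x * w.1 + qd (F 1) 1 x * w.2).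
Definition qinv x w : pt :=
  ((qd (F 1) 1 x * w.1 - qd (F 0) 1 x * w.2) / qdet x, (qd (F 0) 0 x * w.2 - qd (F 1) 0 x * w.1) / qdet x).

Lemma qmap_sub x y : qmap x - qmap y = qact (mid x y) (x - y).
Proof. by apply: ptP; rewrite /= qval_sub. Qed.

Lemma qinv_sub x w z : qinv x w - qinv x z = qinv x (w - z).
Proof. by rewrite /qinv; pt_ring. Qed.

Lemma qinvK x w : qdet x != 0 -> qinv x (qact x w) = w.
Proof. by rewrite /qinv /qact /qdet => d; apply: ptP => /=; field. Qed.

Lemma qactK x w : qdet x != 0 -> qact x (qinv x w) = w.
Proof. by rewrite /qinv /qact /qdet => d; apply: ptP => /=; field. Qed.

(** The scaling of an isoparametric element as pointwise bounds. The second derivatives are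
    constants, so DF is controlled off the triangle too, where the preimages found by [qmap_surj]
    may lie; [el_small] makes Newton's map a contraction there. *)
Record elem : Prop := Elem {
  el_h : 0 < h; el_K : 1 <= K; el_d : 0 < d0; el_small : h <= d0 / (16 * K ^+ 2);
  el_J : forall a b x, refTc x -> `|qd (F a) b x| <= K * h;
  el_H : forall a b j, `|qh (F a) b j| <= K * h ^+ 2;
  el_det : forall x, refTc x -> d0 * h ^+ 2 <= qdet x }.

Hypothesis el : elem.
Let h0 := el_h el.
Let d00 := el_d el.
Let K0 : 0 < K. Proof. by apply: lt_le_trans (el_K el). Qed.

Lemma qdet_gt0 x : refTc x -> 0 < qdet x.
Proof. by move=> /(el_det el); apply: lt_le_trans; rewrite mulr_gt0// exprn_gt0. Qed.

Lemma qact_bnd x w : refTc x -> `|qact x w| <= 2 * K * h * `|w|.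
Proof.
move=> hx; have [w1 w2] := normpt_co w.
have e : 2 * K * h * `|w| = (K * h) * `|w| + (K * h) * `|w| by ring.
by rewrite ler_normpt /= e !ltr_sum2b// ltr_prodb// (el_J el).
Qed.

Lemma qact_bndB x y w : `|qact x w - qact y w| <= 4 * K * h ^+ 2 * `|x - y| * `|w|.
Proof.
have [w1 w2] := normpt_co w.
have e : 4 * K * h ^+ 2 * `|x - y| * `|w| =
  (2 * (K * h ^+ 2) * `|x - y|) * `|w| + (2 * (K * h ^+ 2) * `|x - y|) * `|w| by ring.
have hq a b : `|qd (F a) b x - qd (F a) b y| <= 2 * (K * h ^+ 2) * `|x - y|.
  by apply: qd_lip => j; exact: (el_H el).
have hs a : `|(qd (F a) 0 x - qd (F a) 0 y) * w.1 + (qd (F a) 1 x - qd (F a) 1 y) * w.2| <=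
    4 * K * h ^+ 2 * `|x - y| * `|w|.
  by rewrite e; apply: ltr_sum2b; apply: ltr_prodb.
rewrite ler_normpt; apply/andP; split; [apply: le_trans (hs 0)|apply: le_trans (hs 1)];
by rewrite le_eqVlt /=; apply/orP; left; apply/eqP; congr `|_|; ring.
Qed.

Lemma qinv_bnd x w : refTc x -> `|qinv x w| <= 2 * K / (d0 * h) * `|w|.
Proof.
move=> hx; have [w1 w2] := normpt_co w; have d0' := qdet_gt0 hx.
have e : 2 * K / (d0 * h) * `|w| = ((K * h) * `|w| + (K * h) * `|w|) / (d0 * h ^+ 2).
  by field; rewrite !gt_eqF.
have h2 : forall s : R, `|s| <= (K * h) * `|w| + (K * h) * `|w| -> `|s / qdet x| <= 2 * K / (d0 * h) * `|w|.
  move=> s hs; rewrite e; apply: ltr_prodb => //.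
  rewrite normfV (gtr0_norm d0') lef_pV2 ?posrE// ?(el_det el)//.
  by rewrite mulr_gt0// exprn_gt0.
by rewrite ler_normpt /=; apply/andP; split; apply: h2; apply: ltr_sum2b; rewrite ?normrN; apply: ltr_prodb; rewrite ?(el_J el).
Qed.

Lemma qmap_lip x y : refTc x -> refTc y -> `|qmap x - qmap y| <= 2 * K * h * `|x - y|.
Proof. by move=> hx hy; rewrite qmap_sub qact_bnd//; exact: refTc_mid. Qed.

(** By the midpoint rule the difference of the images is DF at the midpoint applied to x - y; the
    midpoint lies in the triangle by convexity, and DF is invertible there. *)
Lemma qmap_colip x y : refTc x -> refTc y -> `|x - y| <= 2 * K / (d0 * h) * `|qmap x - qmap y|.
Proof.
move=> hx hy; have hm := refTc_mid hx hy.
rewrite -[X in `|X| <= _](@qinvK (mid x y)); last by rewrite gt_eqF// qdet_gt0.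
by rewrite -qmap_sub qinv_bnd.
Qed.

Lemma qmap_inj x y : refTc x -> refTc y -> qmap x = qmap y -> x = y.
Proof.
move=> hx hy e; have := qmap_colip hx hy; rewrite e subrr normr0 mulr0 normr_le0.
by rewrite subr_eq0 => /eqP.
Qed.

(* Newton's map x -> x - DF(x0)^-1 (F x - y) contracts the ball. *)
Lemma qmap_surj x0 y r : refTc x0 -> 0 < r <= 1 -> `|y - qmap x0| <= d0 * h * r / (4 * K) ->
  exists2 x, `|x - x0| <= r & qmap x = y.
Proof.
move=> hx /andP[r0 r1] hy; have d0' := gt_eqF (qdet_gt0 hx).
pose T x := x - qinv x0 (qmap x - y).
have Tc x z : `|x - x0| <= r -> `|z - x0| <= r -> `|T x - T z| <= 2^-1 * `|x - z|.
  move=> xr zr; have hm : `|mid x z - x0| <= r.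
    rewrite (_ : mid x z - x0 = 2^-1 *: (x - x0) + 2^-1 *: (z - x0)); last first.
      by apply: ptP; rewrite /mid; pt_simp; field.
    rewrite (_ : r = 2^-1 * r + 2^-1 * r); last by field.
    have hh (v : pt) : `|v| <= r -> `|(2^-1 : R) *: v| <= 2^-1 * r.
      by move=> hv; rewrite normrZ ger0_norm ?invr_ge0// ler_wpM2l// invr_ge0.
    by apply: le_trans (ler_normD _ _) _; apply: lerD; exact: hh.
  have -> : T x - T z = qinv x0 (qact x0 (x - z) - qact (mid x z) (x - z)).
    rewrite -qinv_sub qinvK ?d0'// -qmap_sub -(_ : (qmap x - y) - (qmap z - y) = qmap x - qmap z); last by ring.
    by rewrite -[in RHS]qinv_sub /T; ring.
  apply: le_trans (qinv_bnd _ hx) _.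
  apply: (@le_trans _ _ (2 * K / (d0 * h) * (4 * K * h ^+ 2 * r * `|x - z|))).
    apply: ler_wpM2l; first by rewrite divr_ge0 ?mulr_ge0// ltW.
    apply: le_trans (qact_bndB _ _ _) _; apply: ler_wpM2r => //.
    apply: ler_wpM2l; first by rewrite mulr_ge0 ?exprn_ge0 ?mulr_ge0 ?(ltW K0) ?(ltW h0).
    by rewrite distrC.
  have -> : 2 * K / (d0 * h) * (4 * K * h ^+ 2 * r * `|x - z|) = (8 * K ^+ 2 / d0 * h) * (r * `|x - z|).
    by field; rewrite !gt_eqF.
  have hs : 8 * K ^+ 2 / d0 * h <= 2^-1.
    have := el_small el; rewrite ler_pdivlMr ?mulr_gt0 ?exprn_gt0// mulrAC ler_pdivrMr//.
    by move=> ?; lra.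
  apply: ler_pM => //; first by rewrite !mulr_ge0 ?invr_ge0 ?exprn_ge0 ?(ltW K0) ?(ltW h0) ?(ltW d00).
    by rewrite mulr_ge0// ltW.
  by rewrite ler_piMl.
have T0 : `|T x0 - x0| <= 2^-1 * r.
  have -> : T x0 - x0 = - qinv x0 (qmap x0 - y) by rewrite /T; ring.
  rewrite normrN; apply: le_trans (qinv_bnd _ hx) _.
  rewrite distrC (le_trans (ler_wpM2l _ hy))//; first by rewrite divr_ge0 ?mulr_ge0 ?(ltW K0) ?(ltW h0) ?(ltW d00).
  by rewrite le_eqVlt; apply/orP; left; apply/eqP; field; rewrite !gt_eqF.
have cT : continuous T.
  have cq : continuous qmap by apply: continuous_pair; exact: qval_continuous.
  have ci : continuous (qinv x0).
    have c1 : continuous (fun w : pt => w.1) by move=> w; exact: cvg_fst.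
    have c2 : continuous (fun w : pt => w.2) by move=> w; exact: cvg_snd.
    by apply: continuous_pair => w; (apply: cvgM; last exact: cvg_cst); apply: cvgB;
      (apply: cvgM; first exact: cvg_cst); [exact: c1|exact: c2|exact: c2|exact: c1].
  move=> x; apply: cvgB; first exact: cvg_id.
  apply: (@cvg_comp _ _ _ (fun x => qmap x - y) (qinv x0) _ (nbhs (qmap x - y))); last exact: ci.
  by apply: cvgB; [exact: cq|exact: cvg_cst].
have [||p pr pT] := @ball_fixpoint T x0 r (ltW r0) cT.
- move=> x xr; rewrite -(subrK (T x0) (T x)) -addrA.
  apply: le_trans (ler_normD _ _) _.
  have := Tc x x0 xr; rewrite subrr normr0 => /(_ (ltW r0)) h1.
  by move: h1 T0 xr; lra.
- exact: Tc.
exists p => //; have e0 : qinv x0 (qmap p - y) = 0 by rewrite -[LHS](subKr p) -/(T p) pT subrr.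
apply/eqP; rewrite -subr_eq0 -[X in X == _](@qactK x0) ?d0'// e0.
by apply/eqP; rewrite /qact; apply: ptP => /=; ring.
Qed.

End Element.
End LocalInverse.

(** * Strict differentiability and its transfer through a quadratic map *)

Section StrictDifferentiability.
Variable R : realType.
Local Notation pt := (pt R).
Implicit Types (x y z : pt) (a b j : 'I_2) (f g w : pt -> R).

(** Strict differentiability: both points vary near [x0]. It is stable under products and inverses
    and controls increments at neighbouring base points, as [sdiff] requires. *)
Definition sdg f x0 (G0 G1 : R) := forall e, 0 < e -> exists2 r, 0 < r & forall x y,
  `|x - x0| < r -> `|y - x0| < r -> `|f x - f y - (G0 * (x.1 - y.1) + G1 * (x.2 - y.2))| <= e * `|x - y|.

Definition sdf f x0 := exists G0 G1, sdg f x0 G0 G1.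

Lemma small_eps (M e : R) : 0 <= M -> 0 < e -> exists d, [/\ 0 < d, d <= 1 & d * M <= e].
Proof.
move=> M0 e0; have M1 : 0 < M + 1 by rewrite ltr_wpDl.
exists (Num.min 1 (e / (M + 1))); split; first by rewrite lt_min ltr01 divr_gt0.
  by rewrite ge_min lexx.
apply: (@le_trans _ _ (e / (M + 1) * M)); first by rewrite ler_wpM2r// ge_min lexx orbT.
by rewrite mulrAC ler_pdivrMr//; apply: ler_wpM2l; [exact: ltW|rewrite lerDl].
Qed.

Lemma sdf_lip f x0 : sdf f x0 -> exists L r, [/\ 0 <= L, 0 < r &
  forall x y, `|x - x0| < r -> `|y - x0| < r -> `|f x - f y| <= L * `|x - y|].
Proof.
move=> [G0 [G1 h]]; have [r r0 hr] := h 1 ltr01; exists (1 + (`|G0| + `|G1|)), r; split => //.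
move=> x y xr yr; rewrite -[f x - f y](subrK (G0 * (x.1 - y.1) + G1 * (x.2 - y.2))) mulrDl.
apply: ltr_sum2b; first exact: hr.
have [n1 n2] := normpt_co (x - y).
by rewrite mulrDl; apply: ltr_sum2b; apply: ltr_prodb.
Qed.

Lemma sdf_cont f x0 e : sdf f x0 -> 0 < e -> exists2 r, 0 < r & forall x, `|x - x0| < r -> `|f x - f x0| <= e.
Proof.
move=> /sdf_lip[L [r [L0 r0 h]]] e0; have [d [d0 d1 de]] := small_eps L0 e0.
exists (Num.min r d); first by rewrite lt_min r0.
move=> x; rewrite lt_min => /andP[xr xd]; apply: le_trans (h _ _ xr _) _; first by rewrite subrr normr0.
by apply: le_trans de; rewrite mulrC ler_wpM2r// ltW.
Qed.

Lemma sdg_qval (c : quad R) x0 : sdg (qval c) x0 (qd c 0 x0) (qd c 1 x0).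
Proof.
move=> e e0; pose M := \big[Num.max/0]_(p : 'I_2 * 'I_2) `|qh c p.1 p.2|.
have hM j k : `|qh c j k| <= M by apply: (le_bigmax _ (fun p : 'I_2 * 'I_2 => `|qh c p.1 p.2|) (j, k)).
have M0 : 0 <= M by apply: le_trans (hM 0 0).
have [d [d0 d1 de]] := @small_eps (4 * M) e (mulr_ge0 (ler0n _ _) M0) e0.
exists d => // x y xd yd; rewrite qval_sub.
have hm : `|mid x y - x0| <= d.
  rewrite (_ : mid x y - x0 = (2^-1 : R) *: ((x - x0) + (y - x0))); last first.
    by apply: ptP; rewrite /mid; pt_simp; field.
  rewrite normrZ ger0_norm ?invr_ge0// ler_pdivrMl//; apply: le_trans (ler_normD _ _) _; lra.
have hq j : `|qd c j (mid x y) - qd c j x0| <= 2 * M * d.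
  apply: le_trans (qd_lip _ _ (hM j)) _; apply: ler_wpM2l => //; exact: mulr_ge0.
rewrite [X in `|X|](_ : _ = (qd c 0 (mid x y) - qd c 0 x0) * (x.1 - y.1) + (qd c 1 (mid x y) - qd c 1 x0) * (x.2 - y.2)); last by ring.
apply: (@le_trans _ _ (2 * M * d * `|x - y| + 2 * M * d * `|x - y|)).
  by have [n1 n2] := normpt_co (x - y); apply: ltr_sum2b; apply: ltr_prodb.
by rewrite -mulrDl ler_wpM2r//; apply: le_trans de; lra.
Qed.

Lemma sdf_qval (c : quad R) x0 : sdf (qval c) x0.
Proof. by eexists; eexists; exact: sdg_qval. Qed.

Lemma sdf_qd (c : quad R) j x0 : sdf (qd c j) x0.
Proof.
exists (qh c j 0), (qh c j 1) => e e0; exists 1 => // x y _ _.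
by rewrite qd_sub subrr normr0 mulr_ge0// ltW.
Qed.

Lemma sdfD f g x0 : sdf f x0 -> sdf g x0 -> sdf (fun x => f x + g x) x0.
Proof.
move=> [F0 [F1 hf]] [G0 [G1 hg]]; exists (F0 + G0), (F1 + G1) => e e0.
have e2 : 0 < e / 2 by rewrite divr_gt0.
have [r r0 hr] := hf _ e2; have [s s0 hs] := hg _ e2.
exists (Num.min r s); first by rewrite lt_min r0.
move=> x y; rewrite !lt_min => /andP[xr xs] /andP[yr ys].
rewrite [X in `|X|](_ : _ = (f x - f y - (F0 * (x.1 - y.1) + F1 * (x.2 - y.2))) +
  (g x - g y - (G0 * (x.1 - y.1) + G1 * (x.2 - y.2)))); last by ring.
by rewrite (_ : e * `|x - y| = e / 2 * `|x - y| + e / 2 * `|x - y|) ?ltr_sum2b ?hr ?hs//; field.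
Qed.

Lemma sdfM f g x0 : sdf f x0 -> sdf g x0 -> sdf (fun x => f x * g x) x0.
Proof.
move=> sf sg; have [F0 [F1 hf]] := sf; have [G0 [G1 hg]] := sg.
exists (F0 * g x0 + f x0 * G0), (F1 * g x0 + f x0 * G1) => e e0.
pose M := (`|g x0| + 1) + (`|f x0| + 1) + (`|F0| + `|F1|) + (`|G0| + `|G1|).
have [d [d0 d1 de]] := @small_eps M e ltac:(by rewrite /M !addr_ge0) e0.
have [r r0 hr] := hf _ d0; have [s s0 hs] := hg _ d0.
have [t t0 ht] := sdf_cont sf d0; have [u u0 hu] := sdf_cont sg d0.
exists (Num.min (Num.min r s) (Num.min t u)); first by rewrite !lt_min r0 s0 t0.
move=> x y; rewrite !lt_min => /andP[/andP[xr xs] /andP[xt xu]] /andP[/andP[yr ys] /andP[yt yu]].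
have [n1 n2] := normpt_co (x - y).
rewrite [X in `|X|](_ : _ = (f x - f y - (F0 * (x.1 - y.1) + F1 * (x.2 - y.2))) * (g x0 + (g x - g x0)) +
  (f x0 + (f y - f x0)) * (g x - g y - (G0 * (x.1 - y.1) + G1 * (x.2 - y.2))) +
  (F0 * (x.1 - y.1) + F1 * (x.2 - y.2)) * (g x - g x0) +
  (G0 * (x.1 - y.1) + G1 * (x.2 - y.2)) * (f y - f x0)); last by ring.
apply: (@le_trans _ _ (d * `|x - y| * (`|g x0| + 1) + (`|f x0| + 1) * (d * `|x - y|) +
  (`|F0| * `|x - y| + `|F1| * `|x - y|) * d + (`|G0| * `|x - y| + `|G1| * `|x - y|) * d)).
  apply: ltr_sum2b; first apply: ltr_sum2b; first apply: ltr_sum2b; apply: ltr_prodb;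
    rewrite ?hr ?hs ?ht ?hu//; apply: ltr_sum2b => //; rewrite ?(le_trans (ht _ yt) d1) ?(le_trans (hu _ xu) d1)//;
    exact: ltr_prodb.
rewrite [leLHS](_ : _ = d * M * `|x - y|); last by rewrite /M; ring.
by rewrite ler_wpM2r.
Qed.

Lemma sdfV f x0 : f x0 != 0 -> sdf f x0 -> sdf (fun x => (f x)^-1) x0.
Proof.
move=> fn sf; have [F0 [F1 hf]] := sf; set m := (f x0)^-1.
have ci e : 0 < e -> exists2 r, 0 < r & forall x, `|x - x0| < r -> f x != 0 /\ `|(f x)^-1 - m| <= e.
  move=> e0; have f0 : 0 < `|f x0| / 2 by rewrite divr_gt0// normr_gt0.
  have [d [d0 d1 de]] := @small_eps (2 * m ^+ 2) e ltac:(by rewrite mulr_ge0// sqr_ge0) e0.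
  have [r r0 hr] := sdf_cont sf f0; have [s s0 hs] := sdf_cont sf d0.
  exists (Num.min r s); first by rewrite lt_min r0.
  move=> x; rewrite lt_min => /andP[/hr xr /hs xs].
  have fx : `|f x0| / 2 <= `|f x|.
    have := ler_normD (f x0 - f x) (f x); rewrite subrK distrC; lra.
  have fx0 : f x != 0 by rewrite -normr_gt0 (lt_le_trans f0).
  split => //; have -> : (f x)^-1 - m = (f x0 - f x) * ((f x)^-1 * m) by rewrite /m; field; apply/andP.
  apply: le_trans de; rewrite distrC in xs; apply: ltr_prodb => //.
  rewrite normrM normfV -[m ^+ 2](ger0_norm (sqr_ge0 _)) normrX expr2 mulrA ler_wpM2r//.
  rewrite /m normfV -(invrK 2%:R) -invfM; rewrite lef_pV2 ?posrE ?normr_gt0//; last by rewrite mulrC.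
  by rewrite mulrC.
exists (- F0 * m ^+ 2), (- F1 * m ^+ 2) => e e0.
pose M := (`|m| + 1) * (`|m| + 1) + (`|F0| + `|F1|) * (2 * `|m| + 1).
have [d [d0 d1 de]] := @small_eps M e ltac:(by rewrite /M !(addr_ge0, mulr_ge0)) e0.
have [r r0 hr] := hf _ d0; have [t t0 ht] := ci _ d0.
exists (Num.min r t); first by rewrite !lt_min r0 t0.
move=> x y; rewrite !lt_min => /andP[xr /ht[x0' xt]] /andP[yr /ht[y0 yt]].
have [n1 n2] := normpt_co (x - y).
rewrite [X in `|X|](_ : _ = - (f x - f y - (F0 * (x.1 - y.1) + F1 * (x.2 - y.2))) * ((m + ((f x)^-1 - m)) * (m + ((f y)^-1 - m))) +
  (F0 * (x.1 - y.1) + F1 * (x.2 - y.2)) * (- m * ((f y)^-1 - m) - ((f x)^-1 - m) * (m + ((f y)^-1 - m)))); last first.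
  by rewrite /m; field; rewrite fn x0' y0.
have hb z : `|(f z)^-1 - m| <= d -> `|m + ((f z)^-1 - m)| <= `|m| + 1.
  by move=> hz; apply: ltr_sum2b => //; apply: le_trans d1.
apply: (@le_trans _ _ (d * `|x - y| * ((`|m| + 1) * (`|m| + 1)) +
  (`|F0| * `|x - y| + `|F1| * `|x - y|) * (`|m| * d + d * (`|m| + 1)))).
  apply: ltr_sum2b; apply: ltr_prodb.
  - by rewrite normrN hr.
  - by apply: ltr_prodb; exact: hb.
  - by apply: ltr_sum2b; exact: ltr_prodb.
  apply: ltr_sum2b; first by apply: ltr_prodb; rewrite ?normrN.
  by rewrite normrN; apply: ltr_prodb; rewrite ?hb.
rewrite [leLHS](_ : _ = d * M * `|x - y|); last by rewrite /M; ring.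
by rewrite ler_wpM2r.
Qed.

Section Transfer.
Variables (F : 'I_2 -> quad R) (h K d0 : R).
Hypothesis el : elem F h K d0.

(** Inverse function argument: points near the image of [x0] have preimages near [x0] by
    [qmap_surj], and the preimages of y + t e_j and y differ by t tau up to a small multiple of t,
    where tau is DF(x0)^-1 e_j. *)
Lemma sdf_transfer g w x0 r0 j : refT x0 -> sdf g x0 -> 0 < r0 ->
  (forall x, `|x - x0| < r0 -> w (qmap F x) = g x) -> exists d, sdiff w j (qmap F x0) d.
Proof.
move=> hx [G0 [G1 hg]] r00 wg; pose tau := qinv F x0 (e_ R j).
have h0 := el_h el; have d00 := el_d el; have K0 : 0 < K by apply: lt_le_trans (el_K el).
exists (G0 * tau.1 + G1 * tau.2) => e e0.
pose L := 2 * K / (d0 * h); have L0 : 0 <= L by rewrite divr_ge0 ?mulr_ge0// ltW.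
have [d [dp d1 de]] := @small_eps (L + (`|G0| + `|G1|) * L ^+ 2) e ltac:(by rewrite addr_ge0// mulr_ge0 ?addr_ge0 ?exprn_ge0) e0.
have [r1 r10 hr1] := hg _ dp.
have [r2 r20 hr2] := sdg_qval (F 0) x0 dp; have [r3 r30 hr3] := sdg_qval (F 1) x0 dp.
have [r4 r40 hr4] := open_ptP (@open_refT R) hx.
pose r := Num.min (Num.min r0 r1) (Num.min (Num.min r2 r3) (Num.min r4 1)) / 2.
have rp : 0 < r by rewrite divr_gt0// !lt_min r00 r10 r20 r30 r40 ltr01.
have hr x : `|x - x0| <= r -> [/\ `|x - x0| < r0, `|x - x0| < r1, `|x - x0| < r2, `|x - x0| < r3 & refTc x].
  have : r < Num.min (Num.min r0 r1) (Num.min (Num.min r2 r3) (Num.min r4 1)) by move: rp; rewrite /r; lra.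
  rewrite !lt_min => /andP[/andP[a0 a1] /andP[/andP[a2 a3] /andP[a4 _]]] xr.
  by split; [exact: le_lt_trans a0|exact: le_lt_trans a1|exact: le_lt_trans a2|exact: le_lt_trans a3|
    apply/refTW/hr4/(le_lt_trans xr)].
have r1' : r <= 1 by rewrite /r ler_pdivrMr// mul1r !ge_min; apply/orP; right; apply/orP; right; apply/orP; right; lra.
clearbody r; pose s := d0 * h * r / (4 * K).
have s0 : 0 < s.
  have a1 := mulr_gt0 (mulr_gt0 d00 h0) rp.
  have a2 := mulr_gt0 (ltr0n R 4) K0.
  exact: divr_gt0 a1 a2.
exists (s / 2); first by rewrite divr_gt0.
move=> y t ys ts.
have [||x' x'r x'y] := @qmap_surj _ _ _ _ _ el x0 y r (refTW hx); first by rewrite rp.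
  by apply: ltW; apply: lt_trans ys _; rewrite -/s; lra.
have te : `|t *: e_ R j| = `|t| by rewrite normrZ norm_e mulr1.
have [||x xr xy] := @qmap_surj _ _ _ _ _ el x0 (t *: e_ R j + y) r (refTW hx); first by rewrite rp.
  by rewrite -addrA; apply: le_trans (ler_normD _ _) _; rewrite te -/s; lra.
have [x0r xr1 xr2 xr3 xc] := hr x xr; have [x'0r x'r1 x'r2 x'r3 x'c] := hr x' x'r.
have Ft : qmap F x - qmap F x' = t *: e_ R j by rewrite xy x'y addrK.
have dx : `|x - x'| <= L * `|t| by rewrite -te -Ft; exact: (qmap_colip el).
rewrite -xy -x'y !wg//.
(* Deviation from the linearised displacement: DF(x0) maps it to the linearisation error of the map,
   which is at most [d] times |x - x'|. *)
pose D := x - x' - t *: tau.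
have hD : `|D| <= L * (d * `|x - x'|).
  have -> : D = qinv F x0 (qact F x0 (x - x') - t *: e_ R j).
    rewrite -qinv_sub qinvK ?gt_eqF ?(qdet_gt0 el (refTW hx))//; congr (_ - _).
    by rewrite /tau /qinv; apply: ptP; pt_simp; ring.
  apply: le_trans (qinv_bnd el _ (refTW hx)) _; rewrite -/L ler_wpM2l// -Ft -normrN opprB.
  by rewrite ler_normpt /=; apply/andP; split; [exact: hr2|exact: hr3].
rewrite [X in `|X|](_ : _ = (g x - g x' - (G0 * (x.1 - x'.1) + G1 * (x.2 - x'.2))) + (G0 * D.1 + G1 * D.2)); last first.
  by rewrite /D; pt_simp; ring.
have [n1 n2] := normpt_co D.
apply: (@le_trans _ _ (d * `|x - x'| + (`|G0| * (L * (d * `|x - x'|)) + `|G1| * (L * (d * `|x - x'|))))).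
  apply: ltr_sum2b; first exact: hr1.
  by apply: ltr_sum2b; apply: ltr_prodb => //; [apply: le_trans n1 hD|apply: le_trans n2 hD].
apply: (@le_trans _ _ (d * (L * `|t|) + (`|G0| * (L * (d * (L * `|t|))) + `|G1| * (L * (d * (L * `|t|)))))).
  by rewrite !lerD// ?ler_wpM2l// ?ltW.
rewrite [leLHS](_ : _ = d * (L + (`|G0| + `|G1|) * L ^+ 2) * `|t|); last by ring.
by rewrite ler_wpM2r.
Qed.

End Transfer.
End StrictDifferentiability.

(** * Lipschitz functions on finite closed covers *)

Section ClosedCover.
Variable R : realType.
Local Notation pt := (pt R).

Section Line.
Variables (I : finType) (C : I -> set R) (f : R -> R) (L : R).
Hypothesis (Ccl : forall k x, ~ C k x -> exists2 r, 0 < r & forall y, `|y - x| < r -> ~ C k y).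

(** Induction on the number of sets: jump from [a] to the last point of a set containing it, then
    continue with the remaining sets. Continuity of [f] is not assumed; it is replaced by the fact
    that consecutive sets share a point. *)
Lemma cover_lip_line (P : {set I}) a b : a <= b ->
  (forall t, a <= t <= b -> exists2 k, k \in P & C k t) ->
  (forall k s t, C k s -> C k t -> a <= s <= b -> a <= t <= b -> `|f s - f t| <= L * `|s - t|) ->
  `|f b - f a| <= L * (b - a).
Proof.
have [n] := ubnP #|P|; elim: n P a => // n IH P a Pn ab cov fL.
have [k kP ka] := cov a ltac:(by rewrite lexx ab).
pose S := [set t : R | C k t /\ a <= t <= b].
have hS : has_sup S by split; [exists a; split => //; rewrite lexx|exists b => t [_ /andP[]]].
have aS : a <= sup S by apply: sup_upper_bound => //; split => //; rewrite lexx.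
have Sb : sup S <= b by apply: sup_le_ub; [exact: hS.1|move=> t [_ /andP[]]].
have kS : C k (sup S).
  apply: contrapT => /Ccl[r r0 hr].
  have [t [kt tab] st] := sup_adherent r0 hS; apply: (hr t) => //.
  rewrite distrC ger0_norm ?subr_ge0; last by apply: (sup_upper_bound hS); split.
  by rewrite ltrBlDr -ltrBlDl.
have fa : `|f (sup S) - f a| <= L * (sup S - a).
  have := fL k (sup S) a kS ka; rewrite aS Sb lexx ab => /(_ isT isT).
  by rewrite [X in _ <= L * X]ger0_norm// subr_ge0.
have [bS|bS] := eqVneq (sup S) b; first by rewrite -bS.
have {}bS : sup S < b by rewrite lt_neqAle bS.
have fb : `|f b - f (sup S)| <= L * (b - sup S).
  apply: (IH (P :\ k)) => //.
  - by move: Pn; rewrite (cardsD1 k) kP.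
  (* Beyond [sup S] the set [C k] is never met, so the other sets cover; being finitely many and
     closed, they cover [sup S] itself as well. *)
  - have cv t : sup S < t <= b -> exists2 l, l \in P :\ k & C l t.
      move=> /andP[st tb]; have [l lP lt] := cov t ltac:(by rewrite tb (le_trans aS (ltW st))).
      exists l => //; rewrite !inE lP andbT; apply/eqP => lk.
      have : t <= sup S by apply: (sup_upper_bound hS); split; [rewrite -lk|rewrite tb (le_trans aS (ltW st))].
      by rewrite leNgt st.
    move=> t /andP[]; rewrite le_eqVlt => /predU1P[<- _|st tb]; last by apply: cv; rewrite st.
    apply: contrapT => nC.
    have hr l : exists r, 0 < r /\ (l \in P :\ k -> forall y, `|y - sup S| < r -> ~ C l y).
      have [lP|lP] := boolP (l \in P :\ k); last by exists 1.
      have [r r0 h] : exists2 r, 0 < r & forall y, `|y - sup S| < r -> ~ C l y.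
        by apply: Ccl => lS; apply: nC; exists l.
      by exists r.
    have /choice[r hr'] := hr.
    pose m := \big[Num.min/b - sup S]_l r l.
    have m0 : 0 < m by apply/bigmin_gtP; rewrite subr_gt0; split => // l _; have [] := hr' l.
    have mb : m <= b - sup S by exact: bigmin_le_id.
    have [|l lP lC] := cv (sup S + m / 2); first by apply/andP; split; lra.
    have [_ /(_ lP) h] := hr' l; apply: (h _ _ lC).
    rewrite addrAC subrr add0r ger0_norm ?divr_ge0 ?ltW//.
    have : m <= r l by exact: bigmin_le_cond.
    lra.
  - move=> l s t ls lt /andP[s1 s2] /andP[t1 t2]; apply: (fL l) => //.
      by rewrite s2 (le_trans aS).
    by rewrite t2 (le_trans aS).
rewrite -(subrK (f (sup S)) (f b)) -addrA (_ : L * (b - a) = L * (b - sup S) + L * (sup S - a)); last by ring.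
by apply: le_trans (ler_normD _ _) _; rewrite lerD.
Qed.

End Line.

Lemma closed_ptP (C : set pt) : closed C -> forall x, ~ C x -> exists2 r, 0 < r & forall y, `|y - x| < r -> ~ C y.
Proof. by move=> cC x nx; apply: (open_ptP (closed_openC cC) nx). Qed.

(* A function that is Lipschitz on each of finitely many closed sets covering a segment is
   Lipschitz along the segment: follow it from one set to the next. *)
Lemma cover_lip (I : finType) (C : I -> set pt) (f : pt -> R) (L : R) (x y : pt) : 0 <= L ->
  (forall k, closed (C k)) ->
  (forall t : R, 0 <= t <= 1 -> exists k, C k ((1 - t) *: x + t *: y)) ->
  (forall k u v, C k u -> C k v -> `|f u - f v| <= L * `|u - v|) ->
  `|f x - f y| <= L * `|x - y|.
Proof.
move=> L0 cC cov fL; pose g (t : R) : pt := (1 - t) *: x + t *: y.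
have gs s t : `|g s - g t| = `|s - t| * `|x - y|.
  rewrite -normrZ -[RHS]normrN; congr `|_|; rewrite /g; apply: ptP; pt_simp; ring.
have [xy|xy] := eqVneq `|x - y| 0.
  have -> : x = y by apply/eqP; rewrite -subr_eq0 -normr_eq0 xy.
  by rewrite !subrr normr0 mulr_ge0.
have xy0 : 0 < `|x - y| by rewrite lt_def xy normr_ge0.
have g0 : g 0 = x by rewrite /g subr0 scale1r scale0r addr0.
have g1 : g 1 = y by rewrite /g subrr scale1r scale0r add0r.
suff : `|(f \o g) 1 - (f \o g) 0| <= L * `|x - y| * (1 - 0) by rewrite /= g0 g1 distrC subr0 mulr1.
apply: (@cover_lip_line _ (fun k => [set t | C k (g t)]) (f \o g) (L * `|x - y|) _ [set: I]) => //.
- move=> k t /(closed_ptP (cC k))[r r0 hr]; exists (r / `|x - y|); first by rewrite divr_gt0.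
  by move=> s; rewrite ltr_pdivlMr// -gs => /hr.
- by move=> t /cov[k hk]; exists k => //; rewrite inE.
- by move=> k s t hs ht _ _; apply: le_trans (fL _ _ _ hs ht) _; rewrite gs mulrA mulrAC.
Qed.

End ClosedCover.

(** * The Piola map *)

Section ReferenceEstimate.
Variable R : realType.
Local Notation pt := (pt R).
Implicit Types (x y z : pt) (a b j : 'I_2) (m l : 'I_3).

Lemma closed_refTc : closed (@refTc R).
Proof.
rewrite -openC; apply: open_ptPI => x /= /refTcP nx.
have [k bk] : exists k, bary k x < 0.
  by apply: contrapT => h; apply: nx => k; rewrite leNgt; apply/negP => bk; apply: h; exists k.
exists (- bary k x / 2); first by rewrite divr_gt0// oppr_gt0.
move=> y yx /refTcP/(_ k); have := bary_lip k y x; rewrite ler_norml => /andP[_]; lra.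
Qed.

Lemma closed_subT m : closed (@subT R m).
Proof.
rewrite -openC; apply: open_ptPI => x /= nx.
have [bm|bm] := ltP (bary m x) 0.
  exists (- bary m x / 2); first by rewrite divr_gt0// oppr_gt0.
  move=> y yx [hm _]; have := bary_lip m y x; rewrite ler_norml => /andP[_]; lra.
have [k bk] : exists k, bary k x < bary m x.
  by apply: contrapT => h; apply: nx; split => // k; rewrite leNgt; apply/negP => bk; apply: h; exists k.
exists ((bary m x - bary k x) / 4); first by rewrite divr_gt0// subr_gt0.
move=> y yx [_ /(_ k)]; have := bary_lip m y x; have := bary_lip k y x; rewrite !ler_norml => /andP[? ?] /andP[? ?]; lra.
Qed.

Lemma eq_ler (s t : R) : s = t -> s <= t.
Proof. by move=> ->. Qed.

Section El.
Variables (F : 'I_2 -> quad R) (h K d0 : R).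
Hypothesis el : elem F h K d0.
Let h0 := el_h el.
Let d00 := el_d el.
Let K0 : 0 < K. Proof. by apply: lt_le_trans (el_K el). Qed.

Definition pio a b x : R := qd (F a) b x / qdet F x.
Definition pact (p : 'I_2 -> pt -> R) a x : R := pio a 0 x * p 0 x + pio a 1 x * p 1 x.
Definition KA : R := 12 * K ^+ 3 / d0 ^+ 2.

Let KA0 : 0 < KA. Proof. by rewrite /KA divr_gt0 ?mulr_gt0 ?exprn_gt0. Qed.

Lemma pio_bnd a b x : refTc x -> `|pio a b x| <= K / (d0 * h).
Proof.
move=> hx; have d0' := qdet_gt0 el hx.
rewrite (_ : K / (d0 * h) = (K * h) / (d0 * h ^+ 2)); last by field; rewrite !gt_eqF.
apply: ltr_prodb; first exact: (el_J el).
by rewrite normfV gtr0_norm// lef_pV2 ?posrE ?(el_det el)// mulr_gt0// exprn_gt0.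
Qed.

(** The entries are of size 1/h, yet their Lipschitz constant is free of [h]: DF varies by O(h^2)
    and its determinant by O(h^3), against a determinant of order h^2. The 12 in [KA] is 4 + 8, from
    the two terms of the quotient rule. *)
Lemma pio_lip a b x y : refTc x -> refTc y -> `|pio a b x - pio a b y| <= KA * `|x - y|.
Proof.
move=> hx hy; have dx := qdet_gt0 el hx; have dy := qdet_gt0 el hy.
set D := `|x - y|; have D0 : 0 <= D by exact: normr_ge0.
have hJ c k z : refTc z -> `|qd (F c) k z| <= K * h by move=> hz; exact: (el_J el).
have hJl c k : `|qd (F c) k x - qd (F c) k y| <= 2 * (K * h ^+ 2) * D by apply: qd_lip => j; exact: (el_H el).
have -> : pio a b x - pio a b y = ((qd (F a) b x - qd (F a) b y) * qdet F y +
   qd (F a) b y * (qdet F y - qdet F x)) / (qdet F x * qdet F y).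
  by rewrite /pio; field; rewrite !gt_eqF.
have -> : KA * D = ((2 * (K * h ^+ 2) * D) * ((K * h) * (K * h) + (K * h) * (K * h)) +
    (K * h) * (4 * ((K * h) * (2 * (K * h ^+ 2) * D)))) / ((d0 * h ^+ 2) * (d0 * h ^+ 2)).
  by rewrite /KA; field; rewrite !gt_eqF.
apply: ltr_prodb.
  apply: ltr_sum2b; apply: ltr_prodb; rewrite ?hJ ?hJl//.
    by rewrite /qdet; apply: ltr_sum2b; rewrite ?normrN; apply: ltr_prodb; exact: hJ.
  rewrite -normrN opprB (_ : qdet F x - qdet F y = (qd (F 0) 0 x - qd (F 0) 0 y) * qd (F 1) 1 x +
    qd (F 0) 0 y * (qd (F 1) 1 x - qd (F 1) 1 y) - (qd (F 0) 1 x - qd (F 0) 1 y) * qd (F 1) 0 x -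
    qd (F 0) 1 y * (qd (F 1) 0 x - qd (F 1) 0 y)); last by rewrite /qdet; ring.
  set s := 2 * (K * h ^+ 2) * D in hJl *.
  have -> : 4 * (K * h * s) = s * (K * h) + (K * h) * s + s * (K * h) + (K * h) * s by ring.
  by do 3!(apply: ltr_sum2b; rewrite ?normrN; last by apply: ltr_prodb; rewrite ?hJ ?hJl//); apply: ltr_prodb; rewrite ?hJ ?hJl.
have e0 : 0 < d0 * h ^+ 2 by rewrite mulr_gt0 ?exprn_gt0.
rewrite normfV normrM !gtr0_norm// lef_pV2 ?posrE ?mulr_gt0//.
by apply: ler_pM; rewrite ?(ltW e0) ?(el_det el).
Qed.

Section Functions.
Variables (p u : 'I_2 -> pt -> R) (P U : 'I_3 -> 'I_2 -> quad R) (N : R).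
Hypotheses (hp : forall m a x, subT m x -> p a x = qval (P m a) x)
  (hu : forall m a x, subT m x -> u a x = qval (U m a) x)
  (hn : forall a x, ctnodes x -> u a x = pact p a x)
  (hN : forall m a, qbnd N (P m a)).

Let N0 : 0 <= N.
Proof. by have [[+ _ _] _] := hN 0 0; apply: le_trans. Qed.

Let p_bnd a x : refTc x -> `|p a x| <= 11 * N.
Proof. by move=> hx; have [m hm] := subT_cover hx; rewrite (hp a hm); exact: qval_bnd. Qed.

Let p_lip m a x y : subT m x -> subT m y -> `|p a x - p a y| <= 10 * N * `|x - y|.
Proof.
by move=> hx hy; rewrite (hp a hx) (hp a hy); apply: qval_lip => //; [exact: subT_refTc hx|exact: subT_refTc hy].
Qed.

Let ctr : pt := ctcenter R.
Let ctr_in : refTc ctr := refTW (ctcenter_refT R).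

(* [pact p - u] is the remainder [r] of freezing the Piola matrix at the centre, plus a
   quadratic whose nodal values are those of [- r]. *)
Let r a x : R := (pio a 0 x - pio a 0 ctr) * p 0 x + (pio a 1 x - pio a 1 ctr) * p 1 x.

Let r_bnd a x : refTc x -> `|r a x| <= 22 * KA * N.
Proof.
move=> hx; rewrite (_ : 22 * KA * N = KA * (11 * N) + KA * (11 * N)); last by ring.
have hl b : `|pio a b x - pio a b ctr| <= KA.
  by apply: le_trans (pio_lip _ _ hx ctr_in) _; rewrite ler_piMr ?(ltW KA0)// refTc_norm.
by apply: ltr_sum2b; apply: ltr_prodb; rewrite ?p_bnd.
Qed.

Let r_lip m a x y : subT m x -> subT m y -> `|r a x - r a y| <= 42 * KA * N * `|x - y|.
Proof.
move=> hx hy; have hx' := subT_refTc hx; have hy' := subT_refTc hy.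
rewrite (_ : r a x - r a y = (pio a 0 x - pio a 0 y) * p 0 x + (pio a 0 y - pio a 0 ctr) * (p 0 x - p 0 y) +
  ((pio a 1 x - pio a 1 y) * p 1 x + (pio a 1 y - pio a 1 ctr) * (p 1 x - p 1 y))); last by rewrite /r; ring.
set D := `|x - y|.
rewrite (_ : 42 * KA * N * D = (KA * D) * (11 * N) + KA * (10 * N * D) +
  ((KA * D) * (11 * N) + KA * (10 * N * D))); last by ring.
have hl b : `|pio a b y - pio a b ctr| <= KA.
  by apply: le_trans (pio_lip _ _ hy' ctr_in) _; rewrite ler_piMr ?(ltW KA0)// refTc_norm.
by do !apply: ltr_sum2b; apply: ltr_prodb; rewrite ?p_bnd ?pio_lip//; exact: p_lip hx hy.
Qed.

Let Z m a := qadd (qadd (qscale (pio a 0 ctr) (P m 0)) (qscale (pio a 1 ctr) (P m 1))) (qscale (-1) (U m a)).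

Let pact_u m a x : subT m x -> pact p a x - u a x = r a x + qval (Z m a) x.
Proof.
move=> hx; rewrite /Z !qval_add !qval_scale -(hu a hx) -!(hp _ hx) /pact /r; ring.
Qed.

Let Z_bnd m a : (forall x, subT m x -> `|qval (Z m a) x| <= 220 * (22 * KA * N)) /\
  (forall x y, subT m x -> subT m y -> `|qval (Z m a) x - qval (Z m a) y| <= 1200 * (22 * KA * N) * `|x - y|).
Proof.
apply: qval_nodes => k l.
set x := mid _ _; have hx : subT m x by apply: subT_mid; exact: ctsub_subT.
have := pact_u a hx; rewrite (hn a (ctsub_ctnodes R m k l)) subrr => /eqP.
by rewrite eq_sym addrC addr_eq0 => /eqP ->; rewrite normrN r_bnd//; exact: subT_refTc hx.
Qed.

(** The crude factor 500 * 500 dominates 22 + 220 * 22 here and 42 + 1200 * 22 in [pact_u_lip]: in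
    both, the first number is due to [r] and the second to [Z]. *)
Lemma pact_u_bnd a x : refTc x -> `|pact p a x - u a x| <= 500 * 500 * KA * N.
Proof.
move=> hx; have [m hm] := subT_cover hx; rewrite (pact_u a hm).
apply: (@le_trans _ _ (22 * KA * N + 220 * (22 * KA * N))).
  by apply: ltr_sum2b; [exact: r_bnd|exact: (Z_bnd m a).1].
have : 0 <= KA * N by rewrite mulr_ge0// ltW.
lra.
Qed.

Lemma pact_u_lip a x y : refTc x -> refTc y ->
  `|(pact p a x - u a x) - (pact p a y - u a y)| <= 500 * 500 * KA * N * `|x - y|.
Proof.
move=> hx hy; apply: (@cover_lip _ _ (fun m => subT m) (fun x => pact p a x - u a x)).
- by have := mulr_ge0 (ltW KA0) N0; lra.
- by move=> m; exact: closed_subT.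
- by move=> t ht; apply/subT_cover/refTc_convex.
move=> m {}x {}y {}hx {}hy; rewrite (pact_u a hx) (pact_u a hy).
rewrite (_ : _ - _ = (r a x - r a y) + (qval (Z m a) x - qval (Z m a) y)); last by ring.
apply: (@le_trans _ _ (42 * KA * N * `|x - y| + 1200 * (22 * KA * N) * `|x - y|)).
  by apply: ltr_sum2b; [exact: r_lip hx hy|exact: (Z_bnd m a).2].
rewrite -mulrDl ler_wpM2r//.
have : 0 <= KA * N by rewrite mulr_ge0// ltW.
lra.
Qed.


(* The gradient of [pact p] composed with the inverse of [qmap F], with all coefficients frozen at [z]. *)
Definition slope (Q : 'I_2 -> quad R) z a j : R :=
  let t := qinv F z (e_ R j) in
  pio a 0 z * (qd (Q 0) 0 z * t.1 + qd (Q 0) 1 z * t.2) +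
  pio a 1 z * (qd (Q 1) 0 z * t.1 + qd (Q 1) 1 z * t.2).

(** The slopes form the matrix S = A DQ DF^-1, with A the Piola matrix at [z]. Hence DQ = A^-1 S DF,
    where A^-1 is the adjugate of DF ([adj]); both outer factors are O(h), which gives the h^2. *)
Lemma slope_max (Q : 'I_2 -> quad R) z mu : refTc z -> (forall a j, `|slope Q z a j| <= mu) ->
  forall b c, `|qd (Q b) c z| <= 4 * K ^+ 2 * h ^+ 2 * mu.
Proof.
move=> hz hM b c; have d := gt_eqF (qdet_gt0 el hz).
pose adj b a : R := if b == a then qd (F (if a == 0 then 1 else 0)) (if a == 0 then 1 else 0) z else - qd (F b) a z.
have hJ b' c' : `|qd (F b') c' z| <= K * h by exact: (el_J el).
have hadj b' c' : `|adj b' c'| <= K * h by rewrite /adj; case: ifP => _; rewrite ?normrN hJ.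
have -> : qd (Q b) c z = adj b 0 * (slope Q z 0 0 * qd (F 0) c z + slope Q z 0 1 * qd (F 1) c z) +
    adj b 1 * (slope Q z 1 0 * qd (F 0) c z + slope Q z 1 1 * qd (F 1) c z).
  move: d; rewrite /slope /pio /qinv /adj /e_ /qdet.
  by case: (ord2P b) => ->; case: (ord2P c) => -> /= /negbT d; field.
have -> : 4 * K ^+ 2 * h ^+ 2 * mu = (K * h) * (mu * (K * h) + mu * (K * h)) + (K * h) * (mu * (K * h) + mu * (K * h)) by ring.
by apply: ltr_sum2b; (apply: ltr_prodb; first exact: hadj); apply: ltr_sum2b; apply: ltr_prodb.
Qed.

Let Lam : R := 2 * K / (d0 * h).
Let Lam0 : 0 <= Lam. Proof. by rewrite /Lam divr_ge0 ?mulr_ge0// ltW. Qed.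

(** The four error terms come, in this order, from the variation of the gradient of [p], from that
    of DF, from that of the Piola matrix between x and z against an increment of [p], and from that
    between x and x' against a value of [p]. The last has no factor [dl]: only a small [h] makes it
    negligible. *)
Lemma slope_err m z x x' a j (t G dl : R) : refTc z -> subT m x -> subT m x' ->
  `|x - z| <= dl -> `|x' - z| <= dl -> 0 <= t -> qmap F x - qmap F x' = t *: e_ R j ->
  (forall b c, `|qd (P m b) c z| <= G) ->
  `|pact p a x - pact p a x' - slope (P m) z a j * t| <=
  (8 * N * dl * Lam ^+ 2 + 8 * G * K * Lam ^+ 3 * h ^+ 2 * dl + 20 * KA * dl * N * Lam + 22 * KA * N * Lam) * t.
Proof.
move=> hz hx hx' xz x'z t0 Ft hG; have hxc := subT_refTc hx; have hxc' := subT_refTc hx'.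
have dl0 : 0 <= dl by apply: le_trans xz.
have D1 : `|x - x'| <= Lam * t.
  by apply: le_trans (qmap_colip el hxc hxc') _; rewrite -/Lam Ft normrZ norm_e mulr1 ger0_norm.
pose tau := qinv F z (e_ R j); pose D := x - x' - t *: tau.
have hm : `|mid x x' - z| <= dl.
  rewrite (_ : mid x x' - z = (2^-1 : R) *: ((x - z) + (x' - z))); last first.
    by apply: ptP; rewrite /mid; pt_simp; field.
  rewrite normrZ ger0_norm ?invr_ge0// ler_pdivrMl//; apply: le_trans (ler_normD _ _) _; lra.
have hD : `|D| <= Lam * (4 * K * h ^+ 2 * dl * (Lam * t)).
  have -> : D = qinv F z (qact F z (x - x') - qact F (mid x x') (x - x')).
    rewrite -qinv_sub qinvK ?gt_eqF ?(qdet_gt0 el hz)// -qmap_sub Ft; congr (_ - _).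
    by rewrite /tau /qinv; apply: ptP; pt_simp; ring.
  apply: le_trans (qinv_bnd el _ hz) _; rewrite -/Lam ler_wpM2l//.
  apply: le_trans (qact_bndB el _ _ _) _; apply: ler_pM => //.
    by rewrite !mulr_ge0// ?exprn_ge0// ltW.
  by rewrite distrC; apply: ler_wpM2l => //; rewrite !mulr_ge0// ?exprn_ge0// ltW.
have hA b y : refTc y -> `|pio a b y| <= Lam / 2.
  by move=> hy; apply: le_trans (pio_bnd _ _ hy) _; rewrite /Lam; apply: eq_ler; field; rewrite !gt_eqF.
have [n1 n2] := normpt_co D; have [k1 k2] := normpt_co (x - x').
pose g b (w : pt) := qd (P m b) 0 z * w.1 + qd (P m b) 1 z * w.2.
have hp' b : `|p b x - p b x' - g b (x - x')| <= 8 * N * dl * (Lam * t).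
  rewrite (hp b hx) (hp b hx') qval_sub /g.
  rewrite [X in `|X|](_ : _ = (qd (P m b) 0 (mid x x') - qd (P m b) 0 z) * (x - x').1 +
    (qd (P m b) 1 (mid x x') - qd (P m b) 1 z) * (x - x').2); last by rewrite /=; ring.
  have hq c : `|qd (P m b) c (mid x x') - qd (P m b) c z| <= 4 * N * dl.
    apply: le_trans (qd_lip _ _ (fun k => qh_bnd c k (hN m b))) _.
    by rewrite (_ : 4 * N * dl = 2 * (2 * N) * dl); [apply: ler_wpM2l; rewrite ?mulr_ge0|ring].
  have -> : 8 * N * dl * (Lam * t) = 4 * N * dl * (Lam * t) + 4 * N * dl * (Lam * t) by ring.
  by apply: ltr_sum2b; apply: ltr_prodb => //; [apply: le_trans k1 _|apply: le_trans k2 _].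
have hg b : `|g b D| <= 2 * G * (Lam * (4 * K * h ^+ 2 * dl * (Lam * t))).
  rewrite -mulrA [leRHS]mulrDl mul1r.
  by apply: ltr_sum2b; apply: ltr_prodb => //; [apply: le_trans n1 _|apply: le_trans n2 _].
have hl b : `|p b x - p b x'| <= 10 * N * (Lam * t).
  by apply: le_trans (p_lip b hx hx') _; apply: ler_wpM2l => //; rewrite mulr_ge0.
have pz b : `|pio a b x - pio a b z| <= KA * dl.
  by apply: le_trans (pio_lip _ _ hxc hz) _; apply: ler_wpM2l => //; exact: ltW.
have px b : `|pio a b x - pio a b x'| <= KA * (Lam * t).
  by apply: le_trans (pio_lip _ _ hxc hxc') _; apply: ler_wpM2l => //; exact: ltW.
pose T b := pio a b z * (p b x - p b x' - g b (x - x')) + pio a b z * g b D +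
  (pio a b x - pio a b z) * (p b x - p b x') + (pio a b x - pio a b x') * p b x'.
have -> : pact p a x - pact p a x' - slope (P m) z a j * t = T 0 + T 1.
  by rewrite /T /g /D /slope -/tau /pact; pt_simp; ring.
have hT b : `|T b| <= Lam / 2 * (8 * N * dl * (Lam * t)) + Lam / 2 * (2 * G * (Lam * (4 * K * h ^+ 2 * dl * (Lam * t)))) +
  (KA * dl) * (10 * N * (Lam * t)) + KA * (Lam * t) * (11 * N).
  by do 3!(apply: ltr_sum2b; last by apply: ltr_prodb; rewrite ?hA ?p_bnd); apply: ltr_prodb; rewrite ?hA.
apply: le_trans (ltr_sum2b (hT 0) (hT 1)) _; by apply: eq_ler; field.
Qed.

End Functions.

End El.
End ReferenceEstimate.

(** * Persistence of the largest slope near a point *)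

Section SlopeLowerBound.
Variable R : realType.
Local Notation pt := (pt R).
Implicit Types (x y z : pt) (a b j : 'I_2) (m l : 'I_3).
Variables (F : 'I_2 -> quad R) (h K d0 : R).
Hypothesis el : elem F h K d0.
Let h0 := el_h el.
Let d00 := el_d el.
Let K0 : 0 < K. Proof. by apply: lt_le_trans (el_K el). Qed.

(** Radius on which the first error term of [slope_err] takes less than half of the error allowed in
    [slope_dominates]; it is also small enough for the ball to stay in the subtriangle
    ([dlt_bnd]). *)
Definition dlt : R := d0 ^+ 2 / (500 * 500 * K ^+ 4).

(** The determinant at one point is bounded below by [el_det] and above through its entries; this
    makes [dlt] at most 1/40. *)
Lemma d0_le : d0 <= 2 * K ^+ 2.
Proof.
have hc := refTW (ctcenter_refT R); have hJ a b : `|qd (F a) b (ctcenter R)| <= K * h by exact: (el_J el).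
have h2 : 0 < h ^+ 2 by rewrite exprn_gt0.
rewrite -(ler_pM2r h2); apply: le_trans (el_det el hc) _; apply: le_trans (ler_norm _) _.
rewrite (_ : 2 * K ^+ 2 * h ^+ 2 = (K * h) * (K * h) + (K * h) * (K * h)); last by ring.
by rewrite /qdet; apply: ltr_sum2b; rewrite ?normrN; apply: ltr_prodb.
Qed.

Lemma dlt_bnd : 0 < dlt <= 40^-1.
Proof.
have K4 : 0 < K ^+ 4 by rewrite exprn_gt0.
have e0 : 0 < 500 * 500 * K ^+ 4 by lra.
apply/andP; split; first by rewrite /dlt divr_gt0 ?exprn_gt0.
rewrite /dlt ler_pdivrMr//; have : d0 ^+ 2 <= (2 * K ^+ 2) ^+ 2.
  by apply: lerXn2r; rewrite ?nnegrE ?(ltW d00) ?d0_le// mulr_ge0// exprn_ge0// ltW.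
by rewrite exprMn -exprM; lra.
Qed.

(* [gpt m l] is a point at which the slope is the largest; the error of freezing the slope at
   this point is at most half of it in the ball of radius [dlt]. *)
Lemma slope_dominates (p : 'I_2 -> pt -> R) (P : 'I_3 -> 'I_2 -> quad R) :
  h <= d0 ^+ 3 / (2000 * 2000 * K ^+ 6) ->
  (forall m a x, subT m x -> p a x = qval (P m a) x) ->
  (forall a, p a (ctcenter R) = 0) ->
  exists G, [/\ 0 <= G, forall m a, qbnd (400 * G) (P m a) &
    exists m l a j s, G <= 4 * K ^+ 2 * h ^+ 2 * `|s| /\ forall x x' t, 0 <= t ->
      `|x - gpt R m l| <= dlt -> `|x' - gpt R m l| <= dlt -> qmap F x - qmap F x' = t *: e_ R j ->
      `|pact F p a x - pact F p a x' - s * t| <= `|s| / 2 * t].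
Proof.
move=> hs hp hc; have /andP[dl0 dl1] := dlt_bnd.
pose I := ('I_3 * 'I_3 * ('I_2 * 'I_2))%type.
pose f (i : I) := `|qd (P i.1.1 i.2.1) i.2.2 (gpt R i.1.1 i.1.2)|.
have [[[m l] [b c]] _ hmax] := @arg_maxP _ _ I (0, 0, (0, 0)) predT f isT.
pose G := f (m, l, (b, c)); have G0 : 0 <= G by exact: normr_ge0.
have hG m' l' b' c' : `|qd (P m' b') c' (gpt R m' l')| <= G by exact: (hmax (m', l', (b', c'))).
have hN m' a : qbnd (400 * G) (P m' a).
  apply: (@qbnd_grad _ _ _ m') => [|l' j]; last exact: hG.
  by rewrite -(hp m' a _ (ctcenter_subT R m')) hc.
exists G; split => //.
set z := gpt R m l; have zs : subT m z by apply: (@inT_subT _ m); apply: (@gpt_inT _ m l); rewrite subrr normr0 invr_ge0.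
have hz := subT_refTc zs.
have [[a j] _ hmx] := @arg_maxP _ _ ('I_2 * 'I_2)%type (0, 0) predT (fun i => `|slope F (P m) z i.1 i.2|) isT.
have hGs : G <= 4 * K ^+ 2 * h ^+ 2 * `|slope F (P m) z a j|.
  by apply: (slope_max el hz) => a' j'; exact: (hmx (a', j')).
exists m, l, a, j, (slope F (P m) z a j); split => // x x' t t0 xz x'z Ft.
have sx y : `|y - z| <= dlt -> subT m y by move=> yz; apply: (@inT_subT _ m); apply: (@gpt_inT _ m l); exact: le_trans yz dl1.
apply: le_trans (slope_err el hp hN a hz (sx _ xz) (sx _ x'z) xz x'z t0 Ft (hG m l)) _.
(* By [slope_max] the slope is at least G / (4 K^2 h^2), and half of it is the error allowed. *)
apply: ler_wpM2r => //; apply: (@le_trans _ _ (G / (8 * K ^+ 2 * h ^+ 2))); last first.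
  rewrite ler_pdivrMr ?mulr_gt0 ?exprn_gt0//; apply: le_trans hGs _.
  by apply: eq_ler; field.
(* Relative to G / (K^2 h^2), the last three terms of [slope_err] are bounded by multiples of [eta],
   and the hypothesis on [h] says that [eta] is at most 1 / (2000 * 2000). *)
pose eta := h * K ^+ 6 / d0 ^+ 3.
have eta0 : 0 <= eta by rewrite /eta divr_ge0 ?mulr_ge0 ?exprn_ge0// ltW.
have eta1 : eta * (2000 * 2000) <= 1.
  have K6 : 0 < 2000 * 2000 * K ^+ 6 by have : 0 < K ^+ 6 by [rewrite exprn_gt0]; lra.
  move: hs; rewrite (ler_pdivlMr _ _ K6) => hs.
  have d3 : 0 < d0 ^+ 3 by rewrite exprn_gt0.
  rewrite /eta mulrAC (ler_pdivrMr _ _ d3) mul1r; apply: le_trans hs.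
  apply: eq_ler; ring.
have ed : eta * dlt <= eta * 40^-1 by rewrite ler_wpM2l.
have e1 : 8 * (400 * G) * dlt * (2 * K / (d0 * h)) ^+ 2 = G / (K ^+ 2 * h ^+ 2) * (128 * 100 / (500 * 500)).
  by rewrite /dlt; field; rewrite !gt_eqF.
have e2 : 8 * G * K * (2 * K / (d0 * h)) ^+ 3 * h ^+ 2 * dlt = G / (K ^+ 2 * h ^+ 2) * (64 * (eta * dlt)).
  by rewrite /eta; field; rewrite !gt_eqF.
have e3 : 20 * KA K d0 * dlt * (400 * G) * (2 * K / (d0 * h)) = G / (K ^+ 2 * h ^+ 2) * (192 * 1000 * (eta * dlt)).
  by rewrite /eta /KA; field; rewrite !gt_eqF.
have e4 : 22 * KA K d0 * (400 * G) * (2 * K / (d0 * h)) = G / (K ^+ 2 * h ^+ 2) * (2112 * 100 * eta).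
  by rewrite /eta /KA; field; rewrite !gt_eqF.
rewrite e1 e2 e3 e4 -!mulrDr.
rewrite [leRHS](_ : _ = G / (K ^+ 2 * h ^+ 2) * 8^-1); last by field; rewrite !gt_eqF.
apply: ler_wpM2l; first by rewrite divr_ge0// mulr_ge0// exprn_ge0// ltW.
lra.
Qed.

End SlopeLowerBound.

(** * From weak Sobolev bounds to pointwise bounds on an element *)

Section PointwiseBounds.
Variable R : realType.
Local Notation pt := (pt R).
Local Notation mpt := (mpt R).
Local Notation mu2 := (mu2 R).
Local Notation refT := (@refT R).
Local Notation refTc := (@refTc R).
Implicit Types (x y z : pt) (a b j k : 'I_2) (c : quad R) (phi : pt -> R).

Lemma refT_limit (g : pt -> R) B x : refTc x ->
  (forall e, 0 < e -> exists2 r, 0 < r & forall y, `|y - x| < r -> `|g y - g x| <= e) ->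
  (forall y, refT y -> g y <= B) -> g x <= B.
Proof.
move=> hx gc hB; apply/ler_addgt0Pr => e e0; have [r r0 hr] := gc e e0.
pose t := Num.min 1 (r / 2).
have t0 : 0 < t by rewrite lt_min ltr01 divr_gt0.
have t1 : t <= 1 by rewrite ge_min lexx.
have tr : t < r by rewrite gt_min; apply/orP; right; lra.
pose y := (1 - t) *: x + t *: ctcenter R.
have hy : refT y.
  apply/refTP => k; rewrite bary_convex ltr_wpDl//.
    by rewrite mulr_ge0 ?subr_ge0//; move/refTcP : hx.
  by rewrite mulr_gt0//; move/refTP: (ctcenter_refT R).
have h1 : t * `|ctcenter R - x| < r.
  apply: le_lt_trans tr; rewrite ler_piMr ?(ltW t0)//; apply: refTc_norm => //.
  exact/refTW/ctcenter_refT.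
have := hB y hy; have := hr y.
rewrite (_ : y - x = t *: (ctcenter R - x)); last by rewrite /y; apply: ptP; pt_simp; ring.
by rewrite normrZ (gtr0_norm t0) => /(_ h1); rewrite ler_norml => /andP[? ?]; lra.
Qed.

(** The partial derivative as a [quad] again, so that statements about [qval] can be iterated to
    second derivatives. *)
Definition qder c j : quad R := Quad (if j == 0 then q1 c else q2 c) (qh c j 0) (qh c j 1) 0 0 0.

Lemma qval_der c j x : qval (qder c j) x = qd c j x.
Proof. by rewrite /qval /qd /=; ring. Qed.

Lemma qd_der c j k x : qd (qder c j) k x = qh c j k.
Proof.
have z a b : qh (qder c j) a b = 0 by rewrite /qh; do !case: ifP => _ //=; rewrite mulr0.
by rewrite /qd !z !mul0r !addr0; case: (ord2P k) => ->.
Qed.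

Lemma qbnd_ex c : exists2 N, 0 <= N & qbnd N c.
Proof.
exists (`|q0 c| + `|q1 c| + `|q2 c| + `|q11 c| + `|q12 c| + `|q22 c|); first by rewrite !addr_ge0.
have := normr_ge0 (q0 c); have := normr_ge0 (q1 c); have := normr_ge0 (q2 c).
have := normr_ge0 (q11 c); have := normr_ge0 (q12 c); have := normr_ge0 (q22 c).
by move=> *; do !split; lra.
Qed.

Lemma bmf_qval c : bmf (qval c \_ refT).
Proof.
have mU : measurable (refT : set mpt) by apply: measurable_openpt; exact: open_refT.
split.
  apply: (measurable_restr (qval c) mU).2; apply: measurable_funTS.
  by apply: continuous_measurable_funpt; exact: qval_continuous.
have [N N0 hN] := qbnd_ex c; exists (11 * N) => x; rewrite /patch; case: ifPn => [/set_mem hx|_].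
  by apply: qval_bnd => //; exact: refTW.
by rewrite normr0 mulr_ge0.
Qed.

Lemma qval_ibp c j phi : testfun refT phi ->
  I2 (fun x => (qval c \_ refT) x * pd j phi x) = - I2 (fun x => (qval (qder c j) \_ refT) x * phi x).
Proof.
have [N N0 hN] := qbnd_ex c.
apply: (@ibp_smooth _ _ _ _ _ (10 * N)); [exact: open_refT|by rewrite mulr_ge0|exact: bmf_qval|exact: bmf_qval| |].
  by move=> x y hx hy; apply: qval_lip => //; exact: refTW.
by move=> x _; rewrite qval_der; exact: qd_derive.
Qed.

(** The weak derivative provided by [Winf_le] and the classical one of a polynomial represent the
    same distribution, so an almost everywhere bound on the former holds for the latter at every
    point, up to the boundary. *)
Lemma weak_pointwise c c' (s : seq 'I_2) B :
  (forall phi, testfun refT phi -> I2 (fun x => (qval c \_ refT) x * pds s phi x) =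
     (-1) ^+ size s * I2 (fun x => (qval c' \_ refT) x * phi x)) ->
  (forall phi, testfun refT phi -> bsf (pds s phi)) ->
  Winf_le refT (size s) (qval c) B -> forall x, refTc x -> `|qval c' x| <= `|B|.
Proof.
move=> hI hs /(_ s erefl)[g [[_ lg hg] gB]] x hx.
apply: (@refT_limit (fun x => `|qval c' x|)) => //.
  move=> e e0; have [r r0 hr] := sdf_cont (sdf_qval c' x) e0; exists r => // y /hr.
  by apply: le_trans; exact: ler_dist_dist.
move=> y hy; apply: (@ae_bound_pointwise _ refT g) gB hy => //.
- exact: open_refT.
- exact: bmf_qval.
- by move=> e e0; exact: sdf_cont (sdf_qval c' y) e0.
move=> phi tphi; have := hg phi tphi.
rewrite (integral_restr (bmf_qval c) (hs phi tphi)) hI// EFinM.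
move/(congr1 (mule ((-1) ^+ size s)%:E)); rewrite !muleA -!EFinM -expr2 sqrr_sign mul1r mul1e.
by move=> ->.
Qed.

Lemma Winf1_qd c B : Winf_le refT 1 (qval c) B -> forall j x, refTc x -> `|qd c j x| <= `|B|.
Proof.
move=> h j x hx; rewrite -qval_der; apply: (@weak_pointwise c _ [:: j]) h _ hx => phi tphi /=.
  by rewrite expr1 mulN1r qval_ibp.
by apply: testfun_bsf; exact: testfun_pd tphi.
Qed.

Lemma Winf2_qh c B : Winf_le refT 2 (qval c) B -> forall j k, `|qh c j k| <= `|B|.
Proof.
move=> h j k; rewrite -(qd_der c j k (ctcenter R)) -qval_der.
apply: (@weak_pointwise c _ [:: j; k]) h _ (refTW (ctcenter_refT R)) => phi tphi /=.
  by rewrite sqrrN expr1n mul1r qval_ibp ?qval_ibp ?opprK//; exact: testfun_pd.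
by apply: (@testfun_bsf _ refT); apply: testfun_pd; exact: testfun_pd.
Qed.

Lemma det2E (A : 'M[R]_2) : \det A = A 0 0 * A 1 1 - A 0 1 * A 1 0.
Proof.
rewrite (expand_det_row _ 0) big_ord_recl big_ord1 /cofactor !det_mx11 !mxE /= expr0 expr1.
rewrite mul1r mulN1r mulrN; congr (A _ _ * A _ _ - A _ _ * A _ _); exact: val_inj.
Qed.

Section MeshElement.
Variables (Omega : set pt) (C0 sigma c1 c2 : R) (M : isomesh R) (i : 'I_(ntri M)).
Hypotheses (hc1 : 0 < c1) (hM : isoparametric_mesh Omega C0 sigma c1 c2 M).

Lemma tF_affine x : tF i x = vert i 2%:R + (x.1 *: (vert i 0 - vert i 2%:R) + x.2 *: (vert i 1 - vert i 2%:R)).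
Proof. by rewrite /tF sum_I3 /bary; apply: ptP; pt_simp; ring. Qed.

Lemma hT_ge0 : 0 <= hT i.
Proof.
rewrite /hT /diam; set S := [set d | _].
have S0 d : S d -> 0 <= d by move=> [x [y [_ _ ->]]]; exact: enorm_ge0.
(* Without a supremum, [sup] returns 0. *)
have [hS|hS] := pselect (has_sup S); last by rewrite sup_out.
by have [d Sd] := hS.1; apply: le_trans (S0 _ Sd) _; exact: sup_upper_bound.
Qed.

(** [C0] is an arbitrary real number, and [elem] asks for a constant at least 1. *)
Definition Kc : R := Num.max `|C0| 1.

Lemma eF_quad : exists F : 'I_2 -> quad R, forall x, eF i x = qmap F x.
Proof.
have [_ hg _] := hM.
have h a : exists c, forall x, co a (eF i x) = qval c x.
  have [c hc] := polyP2_quad (gh_poly hg i a).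
  have [d hd] := quad_affine c (vert i 2%:R) (vert i 0 - vert i 2%:R) (vert i 1 - vert i 2%:R).
  by exists d => x; rewrite hd -tF_affine -hc.
have [c0 h0] := h 0; have [d0 h1] := h 1.
by exists (fun a => if a == 0 then c0 else d0) => x; rewrite /qmap /= -h0 -h1 /co /=; case: (eF i x).
Qed.

Lemma mesh_elem : hT i <= c1 / (16 * Kc ^+ 2) ->
  exists F : 'I_2 -> quad R, [/\ forall x, eF i x = qmap F x, elem F (hT i) Kc c1 &
    forall x, Jac (eF i) x = \matrix_(a, b) qd (F a) b x].
Proof.
move=> hs; have [F hF] := eF_quad; exists F.
have [_ _ he] := hM.
have hco a : (fun y => co a (eF i y)) = qval (F a).
  by apply/funext => y; rewrite hF /co; case: (ord2P a) => ->.
have hJ x : Jac (eF i) x = \matrix_(a, b) qd (F a) b x.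
  by apply/matrixP => a b; rewrite !mxE hco pd_qval.
have Kc1 : 1 <= Kc by rewrite /Kc le_max lexx orbT.
have KC : `|C0| <= Kc by rewrite /Kc le_max lexx.
have hT0 := hT_ge0.
have h1 a b x : refTc x -> `|qd (F a) b x| <= Kc * hT i.
  move=> hx; have := eF_Winf he i (leqnSn 1) a; rewrite hco => /Winf1_qd/(_ b x hx).
  by move/le_trans; apply; rewrite expr1 normrM (ger0_norm hT0) ler_wpM2r.
have h2 a b j : `|qh (F a) b j| <= Kc * hT i ^+ 2.
  have := eF_Winf he i (leqnn 2) a; rewrite hco => /Winf2_qh/(_ b j).
  move/le_trans; apply; rewrite normrM (ger0_norm (sqr_ge0 _)); apply: ler_wpM2r => //.
  exact: sqr_ge0.
split => //; split => //.
(* With a zero diameter F_T would be constant, against the existence of its left inverse. *)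
- rewrite lt_def hT0 andbT; apply/eqP => h0.
  have [Finv hc _] := eFinv_Winf he i.
  pose y : pt := (4^-1, 4^-1).
  have hy : refT y by apply/refTE; rewrite /y /=; split; lra.
  have e : eF i y = eF i (ctcenter R).
    have q0 a : qval (F a) y = qval (F a) (ctcenter R).
      apply/eqP; rewrite -subr_eq0 qval_sub.
      have hm : refTc (mid y (ctcenter R)) by apply: refTc_mid; apply: refTW => //; exact: ctcenter_refT.
      have z b : qd (F a) b (mid y (ctcenter R)) = 0.
        by apply/eqP; rewrite -normr_le0; apply: le_trans (h1 a b _ hm) _; rewrite h0 mulr0.
      by rewrite !z !mul0r addr0.
    by rewrite !hF /qmap !q0.
  have := congr1 Finv e; rewrite !hc ?inE//; last exact: ctcenter_refT.
  by move=> /(congr1 fst) /=; lra.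
(* The determinant is bounded below on the open triangle; continuity extends the bound to the closed
   one. *)
- move=> x hx; rewrite -lerN2; apply: (@refT_limit (fun x => - qdet F x)) => //.
    move=> e e0; have sd : sdf (fun x => qdet F x) x.
      rewrite /qdet; under eq_fun do rewrite -mulNr -mulN1r.
      apply: sdfD; first by apply: sdfM; exact: sdf_qd.
      apply: sdfM; last exact: sdf_qd.
      exists (-1 * qh (F 0) 1 0), (-1 * qh (F 0) 1 1) => e' e0'; exists 1 => // y z _ _.
      rewrite [X in `|X|](_ : _ = 0) ?normr0 ?mulr_ge0 ?(ltW e0')//.
      by rewrite /qd; ring.
    have [r r0 hr] := sdf_cont sd e0; exists r => // y /hr.
    by rewrite -opprD normrN.
  move=> y hy; rewrite lerN2; have := eF_det he i hy.
  by rewrite hJ det2E !mxE => /andP[].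
Qed.

End MeshElement.
End PointwiseBounds.

(** * The estimate on an element *)

Section ElementPlane.
Variable R : realType.
Local Notation pt := (pt R).
Local Notation mpt := (mpt R).
Local Notation mu2 := (mu2 R).
Local Notation refT := (@refT R).
Local Notation refTc := (@refTc R).
Local Notation ctr := (ctcenter R).
Implicit Types (x y z : pt) (a b j : 'I_2) (m k l : 'I_3).

Lemma open_inT m : open (@inT R m).
Proof.
apply: open_ptPI => x [h0 h].
pose g k : R := if k == m then bary m x / 2 else (bary k x - bary m x) / 4.
have g0 k : 0 < g k.
  by rewrite /g; case: (eqVneq k m) => [_|/h hk]; rewrite divr_gt0// subr_gt0.
exists (\big[Num.min/1]_k g k); first by apply/bigmin_gtP; split.
move=> y hy; have hg k : `|y - x| < g k by apply: lt_le_trans hy _; exact: bigmin_le_cond.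
have hb k := bary_lip k y x; split.
  have := hg m; rewrite /g eqxx; have := hb m; rewrite ler_norml => /andP[? ?] ?; lra.
move=> k km; have := hg k; rewrite /g (negPf km); have := hb k; have := hb m.
rewrite !ler_norml => /andP[? ?] /andP[? ?] ?; lra.
Qed.

(** In a closed subtriangle [subT m] a point is interior unless the least barycentric coordinate is
    0 or is attained twice; in the latter case the point lies on a segment from the centre to a
    vertex. *)
Lemma refTc_split x : refTc x -> [\/ exists m, inT m x, exists l, seg ctr (refv R l) x |
  exists m, bary m x = 0].
Proof.
move=> hx; have [m [m0 hm]] := subT_cover hx.
have [bm|bm] := eqVneq (bary m x) 0; first by apply: Or33; exists m.
have {}m0 : 0 < bary m x by rewrite lt_def bm.
have [h|h] := pselect (forall k, k != m -> bary m x < bary k x); first by apply: Or31; exists m.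
apply: Or32; have [k km bk] : exists2 k, k != m & bary k x = bary m x.
  apply: contrapT => nk; apply: h => k km; rewrite lt_neqAle hm andbT.
  by apply/eqP => e; apply: nk; exists k.
have [l lm lk] : exists2 l, l != m & l != k.
  by move: km; case: (ord3P m) => ->; case: (ord3P k) => ->// _;
    [exists 2%:R|exists 1|exists 2%:R|exists 0|exists 1|exists 0].
(* The two least coordinates are equal, so the centre has weight three times their common value. *)
exists l, (1 - 3 * bary m x).
have bl := hm l; move: (bary_sum x); rewrite sum_I3 => bs.
split; rewrite ?subKr.
- by move: bs bk bl lm lk km hm m0; case: (ord3P m) => ->; case: (ord3P k) => -> //;
    case: (ord3P l) => -> // bs bk bl _ _ _ _ m0; lra.
- lra.
- move: bs bk bl lm lk km {hm bm h} m0; case: (ord3P m) => ->; case: (ord3P k) => -> //;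
    case: (ord3P l) => -> //; rewrite /bary /ctcenter /refv /= => bs bk bl _ _ _ m0; pt_lra.
Qed.

Lemma bary0_seg m x : refTc x -> bary m x = 0 -> exists k l, [/\ k != m, l != m & seg (refv R k) (refv R l) x].
Proof.
move=> /refTcE[x1 x2 x12]; case: (ord3P m) => ->; rewrite /bary /= => e.
- exists 2%:R, 1; split => //; exists x.2; split => //; first lra.
  by rewrite /refv /=; pt_lra.
- exists 2%:R, 0; split => //; exists x.1; split => //; first lra.
  by rewrite /refv /=; pt_lra.
- exists 0, 1; split => //; exists x.2; split => //; first lra.
  by rewrite /refv /=; pt_lra.
Qed.

Lemma bmf_lip_on (U : set pt) (f : pt -> R) (L B : R) : open U ->
  (forall x y, U x -> U y -> `|f x - f y| <= L * `|x - y|) -> (forall x, U x -> `|f x| <= B) ->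
  bmf (f \_ U).
Proof.
move=> oU fL fB; have mU := measurable_openpt oU; split; last first.
  exists `|B| => x; rewrite /patch; case: ifPn => [/set_mem/fB h|_]; last by rewrite normr0.
  exact: le_trans h (ler_norm _).
apply: (measurable_restr f mU).2.
apply: (measurability _ (RGenOInfty.measurableE R)) => _ [_ [t ->] <-].
apply: measurable_openpt; apply: open_ptPI => x [Ux]; rewrite /= in_itv /= andbT => fx.
have [r r0 rU] := open_ptP oU Ux.
have [e [e0 _ he]] := @small_eps _ `|L| ((f x - t) / 2) (normr_ge0 _) ltac:(by rewrite divr_gt0// subr_gt0).
exists (Num.min r e); first by rewrite lt_min r0.
move=> y; rewrite lt_min => /andP[/rU Uy ye]; split => //=; rewrite in_itv /= andbT.
have h1 : L * `|y - x| <= (f x - t) / 2.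
  apply: le_trans he; apply: (@le_trans _ _ (`|L| * e)); last by rewrite mulrC.
  by apply: le_trans (ler_wpM2l (normr_ge0 L) (ltW ye)); apply: ler_wpM2r => //; exact: ler_norm.
by have := fL y x Uy Ux; rewrite ler_norml => /andP[? _]; lra.
Qed.

Section Element.
Variables (F : 'I_2 -> quad R) (h K d0 : R).
Hypothesis el : elem F h K d0.
Let h0 := el_h el.
Let d00 := el_d el.
Let K0 : 0 < K. Proof. by apply: lt_le_trans (el_K el). Qed.
Local Notation U := (qmap F @` refT).

Lemma open_elem : open U.
Proof.
apply: open_ptPI => _ [x hx <-]; have [r r0 hr] := open_ptP (@open_refT R) hx.
pose s := Num.min (r / 2) 1; have s0 : 0 < s by rewrite lt_min divr_gt0//= ltr01.
have e0 : 0 < d0 * h * s / (4 * K).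
  have a1 := mulr_gt0 (mulr_gt0 d00 h0) s0; have a2 := mulr_gt0 (ltr0n R 4) K0.
  exact: divr_gt0 a1 a2.
exists (d0 * h * s / (4 * K)) => // y yx.
have [|x' x's <-] := qmap_surj el (refTW hx) _ (ltW yx); first by rewrite s0 ge_min lexx orbT.
exists x' => //; apply: hr; apply: le_lt_trans x's _; rewrite gt_min; apply/orP; left; lra.
Qed.

Lemma elem_box : U `<=` box (qmap F ctr) (3 * K * h).
Proof.
move=> _ [x hx <-]; apply/boxP; have hc := refTW (ctcenter_refT R).
apply: le_lt_trans (qmap_lip el hc (refTW hx)) _.
have := refTc_norm hc (refTW hx); have := mulr_gt0 K0 h0; nra.
Qed.

Lemma qmap_seg_null (p q : pt) : refTc p -> refTc q -> mu2.-negligible (qmap F @` seg p q : set mpt).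
Proof.
move=> hp hq; pose g (t : R) : pt := (1 - t) *: p + t *: q.
have L0 : 0 <= 2 * K * h * `|p - q| by rewrite !mulr_ge0// ltW.
have := @lip_curve_null _ (qmap F \o g) _ L0.
rewrite (_ : _ @` [set t | _] = qmap F @` seg p q); last first.
  apply/seteqP; split => [_ [t /andP[t0 t1] <-]|_ [_ [t [t0 t1 ->]] <-]].
    by exists (g t) => //; exists t.
  by exists t => //; rewrite /= t0.
apply => s t hs ht; apply: le_trans (qmap_lip el _ _) _; try exact: refTc_convex.
rewrite -(mulrA (2 * K * h)); apply: ler_wpM2l; first by rewrite !mulr_ge0// ltW.
have -> : g s - g t = (t - s) *: (p - q) by rewrite /g; apply: ptP; pt_simp; ring.
by rewrite normrZ mulrC (distrC t).
Qed.

(** The images of the three segments from the centre to the vertices are null; [inord] only serves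
    to index them by [nat]. *)
Lemma qmap_ae : {ae mu2, forall x : mpt, (U : set mpt) x -> exists m z, inT m z /\ x = qmap F z :> pt}.
Proof.
have hc := refTW (ctcenter_refT R).
have hN := negligible_bigcup (fun n => qmap_seg_null hc (@refv_refTc R (inord n))).
apply: negligibleS hN => x /=; rewrite not_implyE => -[[z hz zx] hn].
have [[m hm]|[l hl]|[m bm]] := refTc_split (refTW hz).
- by exfalso; apply: hn; exists m, z.
- by exists (nat_of_ord l) => //; rewrite /= inord_val; exists z.
- by have /refTP/(_ m) := hz; rewrite bm ltxx.
Qed.

Lemma ae_dq (f : pt -> R) (q : 'I_3 -> pt -> R) : (forall m z, inT m z -> sdf (q m) z) ->
  (forall m z, inT m z -> f (qmap F z) = q m z) ->
  forall j, {ae mu2, forall x : mpt, (U : set mpt) x -> exists d, dq f j (- step R n) x @[n --> \oo] --> (d : R)}.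
Proof.
move=> hq fq j; apply: filterS (qmap_ae) => x hx /hx[m [z [hz ->]]].
have [r r0 hr] := open_ptP (open_inT (m := m)) hz.
have [d hd] := sdf_transfer el j (inT_refT hz) (hq m z hz) r0 (fun y yr => fq m y (hr y yr)).
exists d; apply: dq_cvg; first exact: sdiff_is_derive hd.
  by move=> n; rewrite oppr_eq0 gt_eqF// step_gt0.
by rewrite -oppr0; apply: cvgN; exact: step_cvg0.
Qed.

Lemma elem_lip (f : pt -> R) B : 0 <= B -> (forall x y, refT x -> refT y -> `|f (qmap F x) - f (qmap F y)| <= B * `|x - y|) ->
  forall x y, U x -> U y -> `|f x - f y| <= (B * (2 * K / (d0 * h))) * `|x - y|.
Proof.
move=> B0 fB _ _ [x hx <-] [y hy <-]; apply: le_trans (fB _ _ hx hy) _.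
by rewrite -mulrA; apply: ler_wpM2l => //; apply: (qmap_colip el); exact: refTW.
Qed.

(** The element lies in a square of side 6 K h, and a Lipschitz constant [B] on the reference
    triangle becomes 2 K B / (d0 h) on the element by [qmap_colip]; the weight [h] in front of the
    gradient cancels this 1/h. *)
Lemma upper_estimate (e : pt -> pt) (q : 'I_2 -> 'I_3 -> pt -> R) B : 0 <= B ->
  (forall a m z, inT m z -> sdf (q a m) z) ->
  (forall a m z, inT m z -> co a (e (qmap F z)) = q a m z) ->
  (forall a x, refT x -> `|co a (e (qmap F x))| <= B) ->
  (forall a x y, refT x -> refT y -> `|co a (e (qmap F x)) - co a (e (qmap F y))| <= B * `|x - y|) ->
  (vL2n U e + h%:E * gradL2n U e <= ((12 * K + 24 * K ^+ 2 / d0) * B * h)%:E)%E.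
Proof.
move=> B0 hq eq eB eL; have oU := open_elem.
have L0 : 0 <= B * (2 * K / (d0 * h)) by rewrite mulr_ge0// divr_ge0 ?mulr_ge0// ltW.
set L := B * (2 * K / (d0 * h)) in L0 *.
have r0 : 0 < 3 * K * h by rewrite !mulr_gt0.
have eL' a := @elem_lip (fun x => co a (e x)) _ B0 (eL a).
have eB' a x : U x -> `|co a (e x)| <= B by move=> [z hz <-]; exact: eB.
have bf a : bmf ((fun x => co a (e x)) \_ U) := bmf_lip_on oU (eL' a) (eB' a).
pose J x : 'M[R]_2 := \matrix_(a, j) wd ((fun x => co a (e x)) \_ U) j L x.
have hJ : weak_grad U e J.
  move=> a j; rewrite (_ : (fun x => J x a j) = wd ((fun x => co a (e x)) \_ U) j L); last first.
    by apply/funext => x; rewrite mxE.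
  by apply: weak_deriv_lip => //; first exact: eL'; apply: (@ae_dq (fun x => co a (e x)) (q a)); [exact: hq|exact: eq].
have h1 : (vL2n U e <= ((2 * B) * (2 * (3 * K * h)))%:E)%E.
  apply: L2n_le elem_box _ => //; first by rewrite mulr_ge0.
  move=> x Ux; rewrite ger0_norm ?enorm_ge0//; apply: enorm_le.
  by rewrite ler_normpt; have := eB' 0 x Ux; have := eB' 1 x Ux; rewrite /co /= => -> ->.
have h2 : (gradL2n U e <= ((2 * L) * (2 * (3 * K * h)))%:E)%E.
  apply: le_trans (ereal_inf_lbound _) _; first by exists J; [exact: hJ|reflexivity].
  apply: L2n_le elem_box _ => //; first by rewrite mulr_ge0.
  move=> x Ux; rewrite ger0_norm ?frob_ge0//; apply: frob_le => // a j.
  by rewrite mxE; exact: wd_le.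
apply: le_trans (leeD h1 (lee_wpmul2l _ h2)) _; first by rewrite lee_fin ltW.
rewrite -EFinM -EFinD lee_fin; apply: eq_ler; rewrite /L; field.
by rewrite !gt_eqF.
Qed.

(** The image of the ball of radius [dlt] around [z] contains a square of half-side rho = d0 h dlt /
    (4 K) by [qmap_surj], on which the component [a] of [v] has a slope of size at least |s| / 2 in
    direction [j]; then [L2_lower] applies. [J] is any weak gradient, as the infimum in [gradL2n]
    demands. *)
Lemma lower_estimate (v : pt -> pt) (J : pt -> 'M[R]_2) (L B G s : R) a j z :
  weak_grad U v J ->
  (forall x, refT x -> `|co a (v (qmap F x))| <= B) -> 0 <= L ->
  (forall x y, refT x -> refT y -> `|co a (v (qmap F x)) - co a (v (qmap F y))| <= L * `|x - y|) ->
  0 <= G -> G <= 4 * K ^+ 2 * h ^+ 2 * `|s| ->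
  (forall x, `|x - z| <= dlt K d0 -> refT x) ->
  (forall x x' t, 0 <= t -> `|x - z| <= dlt K d0 -> `|x' - z| <= dlt K d0 ->
    qmap F x - qmap F x' = t *: e_ R j ->
    `|co a (v (qmap F x)) - co a (v (qmap F x')) - s * t| <= `|s| / 2 * t) ->
  ((G * (d0 * dlt K d0 * (bump0 R ^+ 2 / 4) / (32 * K ^+ 3)) / h)%:E <= mL2n U J)%E.
Proof.
move=> hJ vB L0 vL G0 Gs zr hs; have oU := open_elem; have /andP[dl0 dl1] := dlt_bnd el.
set dl := dlt K d0 in dl0 dl1 zr hs *; set beta := bump0 R ^+ 2 / 4.
have vB' x : U x -> `|co a (v x)| <= B by move=> [y hy <-]; exact: vB.
have bf := bmf_lip_on oU (@elem_lip (fun x => co a (v x)) _ L0 vL) vB'.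
pose rho := d0 * h * dl / (4 * K).
have rho0 : 0 < rho.
  have a1 := mulr_gt0 (mulr_gt0 d00 h0) dl0; have a2 := mulr_gt0 (ltr0n R 4) K0.
  exact: divr_gt0 a1 a2.
have zz : refT z by apply: zr; rewrite subrr normr0 ltW.
have hb y : box (qmap F z) rho y -> exists2 x, `|x - z| <= dl & qmap F x = y.
  move=> /boxP; rewrite distrC => /ltW yz; apply: (qmap_surj el (refTW zz) _ yz).
  by rewrite dl0; apply: le_trans dl1 _; lra.
pose sg : R := if 0 <= s then 1 else -1.
have sgs : sg * s = `|s|.
  rewrite /sg; case: ifPn => s0; first by rewrite mul1r ger0_norm.
  by rewrite mulN1r ler0_norm//; apply: ltW; rewrite ltNge.
have sg1 : `|sg| = 1 by rewrite /sg; case: ifP => _; rewrite ?normrN normr1.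
apply: (@le_trans _ _ (L2n U (fun x => J x a j))); last first.
  apply: L2n_mono => // x _; rewrite [leRHS]ger0_norm ?frob_ge0//; exact: frob_co.
apply: (@le_trans _ _ (((`|s| / 2) * rho * beta)%:E)); last first.
  apply: (L2_lower oU bf (hJ a j) rho0 _ _ sg1); first by rewrite divr_ge0.
    by move=> y /hb[x xz <-]; exists x => //; exact: zr.
  move=> y t t0 /hb[x xz xy] /hb[x' x'z x'y]; rewrite -x'y -xy.
  have Ft : qmap F x - qmap F x' = t *: e_ R j by rewrite xy x'y; apply: ptP; pt_simp; ring.
  have := hs x x' t (ltW t0) xz x'z Ft; set D := co a (v (qmap F x)) - _.
  have e1 : sg * (D - s * t) = sg * D - `|s| * t by rewrite mulrBr mulrA sgs.
  have e2 : `|sg * (D - s * t)| = `|D - s * t| by rewrite normrM sg1 mul1r.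
  by rewrite -e2 e1 ler_norml => /andP[+ _]; lra.
rewrite lee_fin; have b0 : 0 <= beta by rewrite divr_ge0// sqr_ge0.
have -> : G * (d0 * dl * beta / (32 * K ^+ 3)) / h = (G / (8 * K ^+ 2 * h ^+ 2)) * (rho * beta).
  by rewrite /rho; field; rewrite !gt_eqF.
rewrite -[leRHS]mulrA; apply: ler_wpM2r; first by rewrite mulr_ge0// ltW.
have e0 : 0 < 8 * K ^+ 2 * h ^+ 2 by rewrite !mulr_gt0 ?exprn_gt0.
by rewrite (ler_pdivrMr _ _ e0); apply: le_trans Gs _; apply: eq_ler; field.
Qed.

End Element.
End ElementPlane.

(** * Comparison of both sides on one element *)

Section ElementEstimate.
Variable R : realType.
Local Notation pt := (pt R).
Local Notation refT := (@refT R).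
Local Notation refTc := (@refTc R).
Local Notation ctr := (ctcenter R).
Implicit Types (x y z : pt) (a b j : 'I_2) (m k l : 'I_3).

Lemma qbndW (N N' : R) c : N <= N' -> qbnd N c -> qbnd N' c.
Proof. by move=> NN [[? ? ?] [? ? ?]]; do !split; exact: le_trans NN. Qed.

Lemma pw_quad (f : pt -> R) (P : 'I_3 -> quad R) : (forall m x, subT m x -> f x = qval (P m) x) ->
  exists L, [/\ 0 <= L, forall x, refTc x -> `|f x| <= L &
    forall x y, refTc x -> refTc y -> `|f x - f y| <= L * `|x - y|].
Proof.
move=> hf; have /choice[N hN] : forall m, exists N, 0 <= N /\ qbnd N (P m).
  by move=> m; have [N N0 hN] := qbnd_ex (P m); exists N.
pose S := \sum_m N m; have S0 : 0 <= S by apply: sumr_ge0 => m _; have [] := hN m.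
have hS m : qbnd S (P m).
  apply: (@qbndW (N m)); last by have [] := hN m.
  rewrite /S (bigD1 m)//= lerDl; apply: sumr_ge0 => k _; by have [] := hN k.
exists (11 * S); split; first by rewrite mulr_ge0.
  by move=> x /subT_cover[m hm]; rewrite (hf m _ hm); apply: qval_bnd => //; exact: subT_refTc hm.
move=> x y hx hy; apply: (@cover_lip _ _ (fun m => subT m)); first by rewrite mulr_ge0.
- exact: closed_subT.
- by move=> t ht; apply/subT_cover/refTc_convex.
move=> m {}x {}y {}hx {}hy; rewrite (hf m x hx) (hf m y hy).
apply: le_trans (qval_lip (hS m) (subT_refTc hx) (subT_refTc hy)) _; apply: ler_wpM2r => //; lra.
Qed.

(** Quotient of the factor of G h in the upper estimate by the factor of G / h in the lower one; 400
    G bounds the coefficients of the shifted field. *)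
Definition Cest (K d0 : R) : R := (12 * K + 24 * K ^+ 2 / d0) * (500 * 500 * KA K d0 * 400) /
  (d0 * dlt K d0 * (bump0 R ^+ 2 / 4) / (32 * K ^+ 3)).

Lemma Cest_gt0 (K d0 : R) : 0 < K -> 0 < d0 -> 0 < Cest K d0.
Proof.
move=> K0 d00; have b0 := @bump0_gt0 R.
have K4 : 0 < 500 * 500 * K ^+ 4 by have : 0 < K ^+ 4 by [rewrite exprn_gt0]; lra.
have dl0 : 0 < dlt K d0 by rewrite /dlt divr_gt0 ?exprn_gt0.
have a0 : 0 < 12 * K + 24 * K ^+ 2 / d0 by rewrite addr_gt0 ?mulr_gt0 ?invr_gt0 ?exprn_gt0.
have a1 : 0 < KA K d0 by rewrite /KA divr_gt0 ?mulr_gt0 ?exprn_gt0.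
have a2 : 0 < 500 * 500 * KA K d0 * 400 by lra.
have a3 : 0 < 32 * K ^+ 3 by rewrite mulr_gt0 ?exprn_gt0.
have a4 : 0 < d0 * dlt K d0 * (bump0 R ^+ 2 / 4).
  exact: (mulr_gt0 (mulr_gt0 d00 dl0) (divr_gt0 (exprn_gt0 2 b0) (ltr0n R 4))).
exact: divr_gt0 (mulr_gt0 a0 a2) (divr_gt0 a4 a3).
Qed.

Variables (F : 'I_2 -> quad R) (h K d0 : R).
Hypothesis el : elem F h K d0.
Let h0 := el_h el.
Let d00 := el_d el.
Let K0 : 0 < K. Proof. by apply: lt_le_trans (el_K el). Qed.
Local Notation U := (qmap F @` refT).

Lemma sdf_pact (P : 'I_2 -> quad R) a z : refTc z -> sdf (pact F (fun b => qval (P b)) a) z.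
Proof.
move=> hz; have sd : sdf (fun x => qdet F x) z.
  rewrite /qdet; under eq_fun do rewrite -mulNr.
  apply: sdfD; apply: sdfM; try exact: sdf_qd.
  exists (- qh (F 0) 1 0), (- qh (F 0) 1 1) => e e0; exists 1 => // x y _ _.
  rewrite [X in `|X|](_ : _ = 0) ?normr0 ?mulr_ge0 ?(ltW e0)//.
  by rewrite /qd; ring.
have sp b : sdf (pio F a b) z.
  by apply: sdfM; [exact: sdf_qd|apply: sdfV => //; rewrite gt_eqF// (qdet_gt0 el hz)].
by apply: sdfD; apply: sdfM; [exact: sp|exact: sdf_qval|exact: sp|exact: sdf_qval].
Qed.

(** Both sides are measured by the same number, the [G] of [slope_dominates]: the left-hand side is
    at most a constant times G h, and the gradient of [v] is at least a constant times G / h. *)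
Lemma element_estimate (v w vh wh : pt -> pt) (V W : 'I_3 -> 'I_2 -> quad R) :
  h <= d0 ^+ 3 / (2000 * 2000 * K ^+ 6) ->
  (forall m a x, subT m x -> co a (vh x) = qval (V m a) x) ->
  (forall m a x, subT m x -> co a (wh x) = qval (W m a) x) ->
  (forall a x, refT x -> co a (v (qmap F x)) = pact F (fun b y => co b (vh y)) a x) ->
  (forall x, refT x -> w (qmap F x) = wh x) ->
  (forall a x, ctnodes x -> co a (wh x) = pact F (fun b y => co b (vh y)) a x) ->
  (vL2n U (fun x => (v x - w x)%R) + h%:E * gradL2n U (fun x => (v x - w x)%R) <=
    (Cest K d0 * h ^+ 2)%:E * gradL2n U v)%E.
Proof.
move=> hs hV hW hv hw hn; have hc := refTW (ctcenter_refT R).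
pose c a := pact F (fun b y => co b (vh y)) a ctr.
(* The subtracted term is the adjugate of DF applied to [c], written out; the Piola matrix maps it
   to the constant [c] ([pE]). *)
pose p a x : R := if a == 0 then co 0 (vh x) - (qd (F 1) 1 x * c 0 - qd (F 0) 1 x * c 1)
  else co 1 (vh x) - (qd (F 0) 0 x * c 1 - qd (F 1) 0 x * c 0).
pose P m a := if a == 0 then qadd (V m 0) (qadd (qscale (- c 0) (qder (F 1) 1)) (qscale (c 1) (qder (F 0) 1)))
  else qadd (V m 1) (qadd (qscale (- c 1) (qder (F 0) 0)) (qscale (c 0) (qder (F 1) 0))).
pose u a x : R := co a (wh x) - c a.
pose Q m a := qadd (W m a) (Quad (- c a) 0 0 0 0 0).
have hp m a x : subT m x -> p a x = qval (P m a) x.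
  by move=> hx; rewrite /p /P; case: ifP => _; rewrite !qval_add !qval_scale !qval_der (hV m _ x hx); ring.
have hu m a x : subT m x -> u a x = qval (Q m a) x.
  by move=> hx; rewrite /u /Q qval_add (hW m _ x hx) /qval /=; ring.
have pE a x : refTc x -> pact F p a x = pact F (fun b y => co b (vh y)) a x - c a.
  move=> hx; have d := gt_eqF (qdet_gt0 el hx); move: d; rewrite /pact /pio /p /qdet /=.
  by case: (ord2P a) => -> /negbT d; field.
have p0 a : p a ctr = 0.
  have d := gt_eqF (qdet_gt0 el hc); move: d; rewrite /p /c /pact /pio /qdet /=.
  by case: (ord2P a) => -> /= /negbT d; field.
have hn' a x : ctnodes x -> u a x = pact F p a x.
  by move=> hx; rewrite pE ?/u ?hn//; exact: ctnodes_refTc.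
have [G [G0 hN [m [l [a [j [s [Gs hsl]]]]]]]] := slope_dominates el hs hp p0.
have vE b x : refT x -> co b (v (qmap F x)) = pact F p b x + c b.
  by move=> hx; rewrite pE ?subrK ?hv//; exact: refTW.
have eE b x : refT x -> co b (v (qmap F x) - w (qmap F x)) = pact F p b x - u b x.
  by move=> hx; rewrite coB vE// hw// /u; ring.
set B := 500 * 500 * KA K d0 * (400 * G).
have KA0 : 0 < KA K d0 by rewrite /KA divr_gt0 ?mulr_gt0 ?exprn_gt0.
have B0 : 0 <= B by have := mulr_ge0 (ltW KA0) G0; rewrite /B; lra.
have up : (vL2n U (fun x => (v x - w x)%R) + h%:E * gradL2n U (fun x => (v x - w x)%R) <=
    ((12 * K + 24 * K ^+ 2 / d0) * B * h)%:E)%E.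
  apply: (@upper_estimate _ _ _ _ _ el _ (fun b m z => pact F (fun b => qval (P m b)) b z + qval (qscale (-1) (Q m b)) z)) => //.
  - by move=> b m' z hz; apply: sdfD; [apply: sdf_pact; exact/refTW/(inT_refT hz)|exact: sdf_qval].
  - move=> b m' z hz; have sz := inT_subT hz.
    by rewrite eE ?qval_scale ?mulN1r -?(hu _ _ _ sz) ?/pact -?(hp _ _ _ sz)//; exact: inT_refT hz.
  - by move=> b x hx; rewrite eE//; apply: (pact_u_bnd el hp hu hn' hN); exact: refTW.
  - by move=> b x y hx hy; rewrite !eE//; apply: (pact_u_lip el hp hu hn' hN); exact: refTW.
have [L [L0 wB wL]] := pw_quad (fun m => hu m a).
have Cp := Cest_gt0 K0 d00.
have Ch : 0 < Cest K d0 * h ^+ 2 by rewrite mulr_gt0// exprn_gt0.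
have low J : weak_grad U v J ->
    ((G * (d0 * dlt K d0 * (bump0 R ^+ 2 / 4) / (32 * K ^+ 3)) / h)%:E <= mL2n U J)%E.
  move=> hJ; apply: (@lower_estimate _ _ _ _ _ el v J (B + L) (B + L + `|c a|) G s a j (gpt R m l)) => //.
  - move=> x hx; rewrite vE// -[pact F p a x](subrK (u a x)); apply: ltr_sum2b => //.
    by apply: ltr_sum2b; [apply: (pact_u_bnd el hp hu hn' hN)|apply: wB]; exact: refTW.
  - by rewrite addr_ge0.
  - move=> x y hx hy; rewrite !vE//.
    rewrite (_ : _ - _ = ((pact F p a x - u a x) - (pact F p a y - u a y)) + (u a x - u a y)); last by ring.
    rewrite mulrDl; apply: ltr_sum2b; last by apply: wL; exact: refTW.
    by apply: (pact_u_lip el hp hu hn' hN); exact: refTW.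
  - by move=> x xz; apply: (@inT_refT _ m); apply: (@gpt_inT _ m l); apply: le_trans xz _; have /andP[] := dlt_bnd el.
  - move=> x x' t t0 xz x'z Ft; have hr y : `|y - gpt R m l| <= dlt K d0 -> refT y.
      by move=> yz; apply: (@inT_refT _ m); apply: (@gpt_inT _ m l); apply: le_trans yz _; have /andP[] := dlt_bnd el.
    rewrite !vE; [|exact: hr|exact: hr].
    by rewrite (_ : _ - _ - _ = pact F p a x - pact F p a x' - s * t); [exact: hsl|ring].
apply: (le_trans up).
have low' : ((G * (d0 * dlt K d0 * (bump0 R ^+ 2 / 4) / (32 * K ^+ 3)) / h)%:E <= gradL2n U v)%E.
  by apply: le_ereal_inf_tmp => _ [J hJ ->]; exact: low.
apply: (@le_trans _ _ ((Cest K d0 * h ^+ 2)%:E * (G * (d0 * dlt K d0 * (bump0 R ^+ 2 / 4) / (32 * K ^+ 3)) / h)%:E)%E); last first.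
  by apply: lee_wpmul2l => //; rewrite lee_fin ltW.
rewrite -EFinM lee_fin; apply: eq_ler; rewrite /B /Cest; field.
have /andP[dl0 _] := dlt_bnd el; have b0 := @bump0_gt0 R.
by rewrite !gt_eqF.
Qed.

End ElementEstimate.

(** * Gluing the elements *)

Section EdgeGeometry.
Variable R : realType.
Local Notation pt := (pt R).
Local Notation refT := (@refT R).
Local Notation refTc := (@refTc R).
Local Notation refv := (@refv R).
Implicit Types (x y z p q : pt) (a b j : 'I_2) (m k l : 'I_3).

Definition cross x y : R := x.1 * y.2 - x.2 * y.1.

Lemma crossD x y z : cross x (y + z) = cross x y + cross x z.
Proof. by rewrite /cross /=; ring. Qed.

Lemma crossZ x y (t : R) : cross x (t *: y) = t * cross x y.
Proof. by rewrite /cross; pt_simp; ring. Qed.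

Lemma crossxx x : cross x x = 0.
Proof. by rewrite /cross; ring. Qed.

Lemma cross_bnd x y : `|cross x y| <= 2 * `|x| * `|y|.
Proof.
have [x1 x2] := normpt_co x; have [y1 y2] := normpt_co y.
rewrite (_ : 2 * `|x| * `|y| = `|x| * `|y| + `|x| * `|y|); last by ring.
by apply: ltr_sum2b; rewrite ?normrN; apply: ltr_prodb.
Qed.

(** Lagrange interpolation at the two ends and the midpoint: along an edge F_T is determined by
    three nodal values, which is how neighbouring elements are compared. *)
Lemma quad_line (c : quad R) p q (t : R) : qval c ((1 - t) *: p + t *: q) =
  (1 - t) * (1 - 2 * t) * qval c p + 4 * t * (1 - t) * qval c (mid p q) + t * (2 * t - 1) * qval c q.
Proof. by rewrite /qval /mid; pt_simp; field. Qed.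

Lemma ord3_cases k l m : k != l -> k != m -> l != m -> forall i, [\/ i = k, i = l | i = m].
Proof.
by case: (ord3P k) => ->; case: (ord3P l) => ->; case: (ord3P m) => -> //= _ _ _ i; case: (ord3P i) => ->;
  first [exact: Or31|exact: Or32|exact: Or33].
Qed.

Lemma refv_dist k l : `|refv k - refv l| <= 1.
Proof. by apply: refTc_norm; exact: refv_refTc. Qed.

(** For distinct indices this is 1 or -1, the orientation of the reference vertices in the order k,
    l, m. *)
Definition orient k l m : R := cross (refv l - refv k) (refv m - refv k).

Lemma orientE k l m : k != l -> k != m -> l != m -> orient k l m ^+ 2 = 1.
Proof.
by rewrite /orient /cross /Defs.refv; case: (ord3P k) => ->; case: (ord3P l) => ->; case: (ord3P m) => -> //= _ _ _; ring.
Qed.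

Section El.
Variables (F : 'I_2 -> quad R) (h K d0 : R).
Hypotheses (el : elem F h K d0) (hs : 64 * K ^+ 2 * h <= d0).
Let h0 := el_h el.
Let d00 := el_d el.
Let K0 : 0 < K. Proof. by apply: lt_le_trans (el_K el). Qed.

(** DF still preserves orientation when its two arguments are mapped at different points: the
    determinant at [p] is at least d0 h^2, and replacing [p] by [q] for one of them costs at most 32
    K^2 h^3, which [hs] bounds by half of it. *)
Lemma qact_cross p q x y : refTc p -> `|x| <= 1 -> `|y| <= 1 -> `|p - q| <= 2 -> cross x y ^+ 2 = 1 ->
  d0 / 2 * h ^+ 2 <= cross x y * cross (qact F p x) (qact F q y).
Proof.
move=> hp x1 y1 pq cc.
have -> : cross (qact F p x) (qact F q y) = qdet F p * cross x y + cross (qact F p x) (qact F q y - qact F p y).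
  by rewrite /cross /qact /qdet /=; ring.
set B := cross _ (_ - _).
rewrite (_ : cross x y * (_ + _) = qdet F p * cross x y ^+ 2 + cross x y * B); last by ring.
rewrite cc mulr1.
have c1 : `|cross x y| = 1.
  by apply/eqP; rewrite -sqrp_eq1 ?normr_ge0// -normrX cc normr1.
have e1 : `|cross x y * B| <= d0 / 2 * h ^+ 2.
  rewrite /B normrM c1 mul1r; apply: le_trans (cross_bnd _ _) _.
  have a1 : `|qact F p x| <= 2 * K * h.
    by apply: le_trans (qact_bnd el _ hp) _; rewrite ler_piMr// !mulr_ge0// ltW.
  have a2 : `|qact F q y - qact F p y| <= 4 * K * h ^+ 2 * 2.
    apply: le_trans (qact_bndB el _ _ _) _; rewrite distrC.
    have b0 : 0 <= 4 * K * h ^+ 2 by rewrite !mulr_ge0// ?exprn_ge0// ltW.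
    by rewrite -mulrA; apply: ler_wpM2l => //; rewrite -[2]mulr1 ler_pM.
  apply: (@le_trans _ _ (2 * (2 * K * h) * (4 * K * h ^+ 2 * 2))).
    by apply: ler_pM => //; rewrite ?mulr_ge0// ler_wpM2l.
  rewrite (_ : 2 * (2 * K * h) * (4 * K * h ^+ 2 * 2) = (64 * K ^+ 2 * h) / 2 * h ^+ 2); last by field.
  by apply: ler_wpM2r; [rewrite exprn_ge0// ltW|apply: ler_wpM2r; rewrite ?invr_ge0].
have := el_det el hp; move: e1; rewrite ler_norml => /andP[? _] ?; lra.
Qed.

Section Edge.
Variables (k l m : 'I_3) (P Q : pt).
Hypotheses (kl : k != l) (km : k != m) (lm : l != m).
Hypothesis line : forall t : R, qmap F ((1 - t) *: refv k + t *: refv l) = (1 - t) *: P + t *: Q.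

Let emid : pt := mid (refv k) (refv l).

(* Moving [x] parallel to an edge onto the line carrying the other edge, where [qmap F] is affine. *)
Lemma edge_sign x : `|x - emid| <= 5 / 4 -> `|bary m x| <= 1 ->
  exists2 c, 0 < c & orient k l m * cross (Q - P) (qmap F x - P) = c * bary m x.
Proof.
move=> xe bx; pose t := bary l x; pose x'' : pt := (1 - t) *: refv k + t *: refv l.
have dx : x - x'' = bary m x *: (refv m - refv k).
  rewrite {1}(bary_refv x) /x'' /t.
  have := bary_sum x; rewrite !sum_I3 => bs.
  have -> : 1 - bary l x = bary k x + bary m x.
    by move: kl km lm; case: (ord3P k) => ->; case: (ord3P l) => ->; case: (ord3P m) => -> //= _ _ _; lra.
  by move: kl km lm; case: (ord3P k) => ->; case: (ord3P l) => ->; case: (ord3P m) => -> //= _ _ _;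
    apply: ptP; pt_simp; ring.
have QP : Q - P = qact F emid (refv l - refv k).
  have := line 0; have := line 1; rewrite subrr subr0 !scale0r !scale1r !addr0 !add0r => <- <-.
  by rewrite qmap_sub; congr qact; apply: ptP; rewrite /emid /mid; pt_simp; ring.
have FP : qmap F x - P = t *: (Q - P) + bary m x *: qact F (mid x x'') (refv m - refv k).
  rewrite -(subrK (qmap F x'') (qmap F x)) qmap_sub dx line /qact.
  by apply: ptP; pt_simp; ring.
have hm : refTc emid by apply: refTc_mid; exact: refv_refTc.
have pq : `|emid - mid x x''| <= 2.
  have -> : emid - mid x x'' = (2^-1 : R) *: ((bary m x *: (refv m - refv k)) - 2 *: (x - emid)).
    by rewrite -dx; apply: ptP; rewrite /mid; pt_simp; field.
  rewrite normrZ ger0_norm ?invr_ge0// ler_pdivrMl//; apply: le_trans (ler_normB _ _) _.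
  rewrite !normrZ (ger0_norm (ler0n _ 2)).
  have : `|bary m x| * `|refv m - refv k| <= 1 by rewrite -[leRHS]mulr1 ler_pM// refv_dist.
  by lra.
have := qact_cross hm (refv_dist l k) (refv_dist m k) pq (orientE kl km lm).
rewrite -QP -/(orient k l m) => hc.
exists (orient k l m * cross (Q - P) (qact F (mid x x'') (refv m - refv k))).
  by apply: lt_le_trans hc; rewrite mulr_gt0 ?divr_gt0 ?exprn_gt0.
by rewrite FP crossD !crossZ crossxx; ring.
Qed.

Lemma edge_side x : refTc x -> 0 <= orient k l m * cross (Q - P) (qmap F x - P).
Proof.
move=> hx; have hm : refTc emid by apply: refTc_mid; exact: refv_refTc.
have /refTcP hb := hx.
have b1 : bary m x <= 1.
  by have := bary_sum x; rewrite sum_I3; have := hb 0; have := hb 1; have := hb 2%:R; case: (ord3P m) => ->; lra.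
have [||c c0 ->] := @edge_sign x.
- by apply: le_trans (refTc_norm hx hm) _; lra.
- by rewrite ger0_norm.
by rewrite mulr_ge0// ltW.
Qed.

(** The preimage given by [qmap_surj] may lie outside the triangle. The side of the edge line on
    which [z] lies decides this by [edge_sign], the other two barycentric coordinates being positive
    near [x0]. *)
Lemma edge_surj x0 : refTc x0 -> bary m x0 = 0 -> 0 < bary k x0 -> 0 < bary l x0 ->
  exists2 r, 0 < r & forall z, `|z - qmap F x0| < r -> exists x, [/\ qmap F x = z,
    0 <= orient k l m * cross (Q - P) (z - P) -> refTc x &
    0 < orient k l m * cross (Q - P) (z - P) -> refT x].
Proof.
move=> hx bm bk bl; have hm : refTc emid by apply: refTc_mid; exact: refv_refTc.
pose s := Num.min (8^-1) (Num.min (bary k x0 / 4) (bary l x0 / 4)).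
have s0 : 0 < s by rewrite !lt_min invr_gt0 ltr0n !divr_gt0.
have [s1 [s2 s3]] : s <= 8^-1 /\ s <= bary k x0 / 4 /\ s <= bary l x0 / 4.
  by rewrite /s !ge_min !lexx !orbT.
clearbody s.
have e0 : 0 < d0 * h * s / (4 * K).
  have a1 := mulr_gt0 (mulr_gt0 d00 h0) s0; have a2 := mulr_gt0 (ltr0n R 4) K0.
  exact: divr_gt0 a1 a2.
exists (d0 * h * s / (4 * K)) => // z /ltW hz.
have [|x xs xz] := qmap_surj el hx _ hz; first by rewrite s0; lra.
exists x; have hb i : `|bary i x - bary i x0| <= 2 * s.
  by apply: le_trans (bary_lip _ _ _) _; rewrite ler_wpM2l.
have xk : 0 < bary k x by have := hb k; rewrite ler_norml => /andP[? _]; lra.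
have xl : 0 < bary l x by have := hb l; rewrite ler_norml => /andP[? _]; lra.
have [||c c0 e] := @edge_sign x.
- rewrite -(subrK x0 x) -addrA; apply: le_trans (ler_normD _ _) _.
  have := refTc_norm hx hm; lra.
- by have := hb m; rewrite bm subr0; lra.
split => //; rewrite -xz e.
- rewrite pmulr_rge0// => bx; apply/refTcP => i.
  by case: (ord3_cases kl km lm i) => -> //; exact: ltW.
- rewrite pmulr_rgt0// => bx; apply/refTP => i.
  by case: (ord3_cases kl km lm i) => -> //; exact: ltW.
Qed.

End Edge.

Section Vertices.
Variable V : 'I_3 -> pt.
Hypothesis FV : forall k, qmap F (refv k) = V k.

(** The affine map onto the straight triangle as a quadratic without second order part, so that all
    results on [elem] apply to straight triangles as well. *)
Definition affq a : quad R := Quad (co a (V 2%:R)) (co a (V 0 - V 2%:R)) (co a (V 1 - V 2%:R)) 0 0 0.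

Lemma affqE x : qmap affq x = V 2%:R + (x.1 *: (V 0 - V 2%:R) + x.2 *: (V 1 - V 2%:R)).
Proof. by rewrite /qmap /qval /affq /co /=; apply: ptP; pt_simp; ring. Qed.

(** By the midpoint rule the columns of the affine map are columns of DF at the midpoints of two
    edges, so [qact_cross] bounds its determinant from below, at the price of a factor 2. *)
Lemma affq_elem : elem affq h K (d0 / 2).
Proof.
have K1 := el_K el.
pose p0 : pt := mid (refv 0) (refv 2%:R); pose p1 : pt := mid (refv 1) (refv 2%:R).
have h0' : refTc p0 by apply: refTc_mid; exact: refv_refTc.
have h1' : refTc p1 by apply: refTc_mid; exact: refv_refTc.
have e0 : V 0 - V 2%:R = qact F p0 (1, 0).
  by rewrite -!FV qmap_sub; congr qact; rewrite /Defs.refv /=; apply: ptP; pt_simp; ring.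
have e1 : V 1 - V 2%:R = qact F p1 (0, 1).
  by rewrite -!FV qmap_sub; congr qact; rewrite /Defs.refv /=; apply: ptP; pt_simp; ring.
have hd a b x : qd (affq a) b x = qd (F a) b (if b == 0 then p0 else p1).
  by case: (ord2P a) => ->; case: (ord2P b) => ->; rewrite /= [LHS]/qd /qh /affq e0 e1 /qact /co /=; ring.
split => //.
- by rewrite divr_gt0.
- have K2 : 0 < 16 * K ^+ 2 by rewrite mulr_gt0// exprn_gt0.
  by rewrite (ler_pdivlMr _ _ K2); have := hs; have := d00; lra.
- by move=> a b x hx; rewrite hd; case: ifP => _; exact: (el_J el).
- move=> a b j; rewrite (_ : qh _ _ _ = 0) ?normr0; last by rewrite /qh /affq /=; do !case: ifP => _; rewrite ?mulr0.
  by rewrite mulr_ge0 ?exprn_ge0// ltW.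
move=> x hx; rewrite /qdet !hd /=.
have pq : `|p0 - p1| <= 2 by apply: le_trans (refTc_norm h0' h1') _; lra.
have n1 : `|((1 : R), (0 : R)) : pt| <= 1 by rewrite ler_normpt /= normr1 normr0 lexx ler01.
have n2 : `|((0 : R), (1 : R)) : pt| <= 1 by rewrite ler_normpt /= normr1 normr0 lexx ler01.
have := @qact_cross p0 p1 (1, 0) (0, 1) h0' n1 n2 pq.
rewrite /cross /qact /= => /(_ ltac:(ring)).
by move/le_trans; apply; apply: eq_ler; ring.
Qed.

End Vertices.
End El.

(** On the segment from [a] to [b] let [c] and [d] have parameters s and t in [0, 1]. Both 0 and 1
    are convex combinations of s and t, which forces one of them to be 0 and the other 1. *)
Lemma seg_eq (a b c d : pt) : a != b -> seg a b = seg c d -> (c = a /\ d = b) \/ (c = b /\ d = a).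
Proof.
move=> ab e.
have sl p q : seg p q p by exists 0; split => //; rewrite subr0 scale1r scale0r addr0.
have sr p q : seg p q q by exists 1; split => //; rewrite subrr scale1r scale0r add0r.
have [s [s0 s1 cE]] : seg a b c by rewrite e.
have [t [t0 t1 dE]] : seg a b d by rewrite e.
have [p [p0 p1 aE]] : seg c d a by rewrite -e.
have [q [q0' q1' bE]] : seg c d b by rewrite -e.
have ab0 (u : R) : u *: (b - a) = 0 -> u = 0.
  by move/eqP; rewrite scaler_eq0 subr_eq0 (eq_sym b) (negPf ab) orbF => /eqP.
have ep : (1 - p) * s + p * t = 0.
  apply: ab0; apply/eqP; rewrite -[X in _ == X](subrr a) {2}aE cE dE; apply/eqP.
  by apply: ptP; pt_simp; ring.
have eq : (1 - q) * s + q * t = 1.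
  apply/eqP; rewrite -subr_eq0; apply/eqP; apply: ab0; apply/eqP; rewrite -[X in _ == X](subrr b) {2}bE cE dE; apply/eqP.
  by apply: ptP; pt_simp; ring.
have st : (s = 0 /\ t = 1) \/ (s = 1 /\ t = 0).
  have m1 : (1 - p) * s = 0 by apply/eqP; have : 0 <= (1 - p) * s by [rewrite mulr_ge0// subr_ge0]; have : 0 <= p * t by [rewrite mulr_ge0]; lra.
  have m2 : p * t = 0 by lra.
  have [p00|p00] := eqVneq p 0.
    have s00 : s = 0 by move: m1; rewrite p00; lra.
    left; split => //; move: eq; rewrite s00; nra.
  have t00 : t = 0 by apply/eqP; move/eqP: m2; rewrite mulf_eq0 (negPf p00).
  right; split => //; move: eq; rewrite t00; nra.
case: st => -[hs ht]; [left|right]; rewrite cE dE hs ht; split; apply: ptP; pt_simp; ring.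
Qed.

End EdgeGeometry.

(** * The glued function: well-definedness, vanishing on the boundary, membership in H^1_0 *)

Section Glue.
Variable R : realType.
Local Notation pt := (pt R).
Local Notation mpt := (mpt R).
Local Notation mu2 := (mu2 R).
Local Notation refT := (@refT R).
Local Notation refTc := (@refTc R).
Local Notation refv := (@refv R).
Local Notation ctr := (ctcenter R).
Implicit Types (x y z p q : pt) (a b : 'I_2) (k l m : 'I_3).

Lemma closed_finU (I : finType) (C : I -> set pt) : (forall i, closed (C i)) ->
  closed [set x | exists i, C i x].
Proof.
move=> cC; rewrite -openC; apply: open_ptPI => x nx.
have /choice[r hr] : forall i, exists r, 0 < r /\ forall y, `|y - x| < r -> ~ C i y.
  move=> i; have [|r r0 h] := @closed_ptP _ _ (cC i) x; last by exists r.
  by move=> Cx; apply: nx; exists i.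
exists (\big[Num.min/1]_i r i); first by apply/bigmin_gtP; split => // i _; have [] := hr i.
move=> y hy [i]; have [_] := hr i; apply; apply: lt_le_trans hy _; exact: bigmin_le_cond.
Qed.

Lemma compact_refTc : compact refTc.
Proof.
apply: (@closed_bounded_compact _ _ 1); first exact: closed_refTc.
by move=> x /refTc_co[? ?]; rewrite ler_normpt; apply/andP.
Qed.

Lemma closed_qmap (F : 'I_2 -> quad R) : closed (qmap F @` refTc).
Proof.
apply: compact_closed; first exact: norm_hausdorff.
apply: continuous_compact compact_refTc; apply: continuous_subspaceT.
by apply: continuous_pair; exact: qval_continuous.
Qed.

Lemma hatV_quad (vh : pt -> pt) : hatV vh ->
  exists W : 'I_3 -> 'I_2 -> quad R, forall m a x, subT m x -> co a (vh x) = qval (W m a) x.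
Proof.
move=> [_ h].
have /choice[W hW] : forall i : 'I_3 * 'I_2, exists c : quad R, forall x, subT i.1 x -> co i.2 (vh x) = qval c x.
  move=> [m a]; have [p hp hv] := h m; have [c hc] := polyP2_quad (hp a).
  by exists c => x hx; rewrite hv ?inE ?hc//; exact: subT_ctri.
by exists (fun m a => W (m, a)) => m a x; exact: (hW (m, a)).
Qed.

Lemma mid_id p : mid p p = p.
Proof. by apply: ptP; rewrite /mid; pt_simp; field. Qed.

Variables (Omega : set pt) (C0 sigma c1 c2 : R) (M : isomesh R).
Local Notation K := (Kc C0).
Hypotheses (hA : affine_mesh Omega C0 sigma M) (hG : isoparametric_map Omega C0 M)
  (hE : element_maps C0 c1 c2 M).
Variable Fq : 'I_(ntri M) -> 'I_2 -> quad R.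
Hypotheses (hF : forall i x, eF i x = qmap (Fq i) x) (elF : forall i, elem (Fq i) (hT i) K c1)
  (hs : forall i : 'I_(ntri M), 128 * K ^+ 2 * hT i <= c1).
Implicit Types (i j : 'I_(ntri M)).

Let hs1 i : 64 * K ^+ 2 * hT i <= c1.
Proof.
have := hs i; have : 0 <= K ^+ 2 * hT i by rewrite mulr_ge0 ?exprn_ge0 ?hT_ge0// (le_trans _ (el_K (elF i))).
lra.
Qed.

(** The straight triangles are elements with determinant constant c1 / 2, hence the 128 in the
    hypothesis. *)
Let hs2 i : 64 * K ^+ 2 * hT i <= c1 / 2.
Proof. by have := hs i; lra. Qed.

Lemma tF_line i (t : R) x y : tF i ((1 - t) *: x + t *: y) = (1 - t) *: tF i x + t *: tF i y.
Proof. by rewrite !tF_affine; apply: ptP; pt_simp; ring. Qed.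

Lemma tF_refv i k : tF i (refv k) = vert i k.
Proof.
rewrite tF_affine; case: (ord3P k) => ->; rewrite /Defs.refv /=; apply: ptP; pt_simp; ring.
Qed.

Lemma eF_refv i k : eF i (refv k) = vert i k.
Proof. by rewrite /eF tF_refv -[X in gh i X]mid_id (gh_nodes hG) mid_id (g_vertex hG). Qed.

Let FV i k : qmap (Fq i) (refv k) = vert i k.
Proof. by rewrite -hF eF_refv. Qed.

Lemma eF_mid i k l : eF i (mid (refv k) (refv l)) = gmap M (mid (vert i k) (vert i l)).
Proof. by rewrite /eF mid_convex tF_line !tF_refv -mid_convex (gh_nodes hG). Qed.

Let elT i : elem (affq (vert i)) (hT i) K (c1 / 2) := affq_elem (elF i) (hs1 i) (FV i).

Lemma tF_qmap i x : tF i x = qmap (affq (vert i)) x.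
Proof. by rewrite affqE tF_affine. Qed.

Lemma ctriE i : ctri (vert i) = qmap (affq (vert i)) @` refTc.
Proof.
apply/seteqP; split => [_ [l [l0 l1 ->]]|_ [x /refTcP hx <-]].
  exists (\sum_k l k *: refv k); first by exists l.
  by rewrite -tF_qmap /tF; apply: eq_bigr => k _; rewrite bary_comb.
by rewrite -tF_qmap; exists (fun k => bary k x); split => //; exact: bary_sum.
Qed.

Lemma tTE i : tT i = qmap (affq (vert i)) @` refT.
Proof.
apply/seteqP; split => [_ [l [l0 l1 ->]]|_ [x /refTP hx <-]].
  exists (\sum_k l k *: refv k); first by exists l.
  by rewrite -tF_qmap /tF; apply: eq_bigr => k _; rewrite bary_comb.
by rewrite -tF_qmap; exists (fun k => bary k x); split => //; exact: bary_sum.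
Qed.

Lemma eTE i : eT i = qmap (Fq i) @` refT.
Proof.
rewrite /eT tTE; apply/seteqP; split => [_ [_ [x hx <-] <-]|_ [x hx <-]].
  by exists x => //; rewrite -hF /eF tF_qmap.
by exists (qmap (affq (vert i)) x); [exists x|rewrite -hF /eF tF_qmap].
Qed.

Lemma tF_ctri i x : refTc x -> ctri (vert i) (tF i x).
Proof. by move=> hx; rewrite ctriE tF_qmap; exists x. Qed.

Lemma eF_inj i j x y : refTc x -> refTc y -> eF i x = eF j y -> tF i x = tF j y.
Proof. by move=> hx hy; apply: (gh_inj hG); exact: tF_ctri. Qed.

Lemma tF_inj i x y : refTc x -> refTc y -> tF i x = tF i y -> x = y.
Proof. by move=> hx hy; rewrite !tF_qmap; exact: (qmap_inj (elT i)). Qed.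

Lemma closed_ctri i : closed (ctri (vert i)).
Proof. by rewrite ctriE; exact: closed_qmap. Qed.

Definition meshY : set pt := [set y | exists i, (qmap (Fq i) @` refTc) y].

(** The closure of the complement of the mesh, which contains the points off the mesh as well as its
    boundary. *)
Definition bdpt p := forall r, 0 < r -> exists2 q, `|q - p| < r & ~ meshY q.

Lemma closed_meshY : closed meshY.
Proof. by apply: closed_finU => i; exact: closed_qmap. Qed.

Lemma bdptN p : ~ bdpt p -> exists2 r, 0 < r & forall q, `|q - p| < r -> meshY q.
Proof.
move=> nb; apply: contrapT => h; apply: nb => r r0; apply: contrapT => h'; apply: h.
by exists r => // q qr; apply: contrapT => nq; apply: h'; exists q.
Qed.

Lemma closed_bdpt : closed bdpt.
Proof.
rewrite -openC; apply: open_ptPI => x /bdptN[r r0 hr]; exists (r / 2); first by rewrite divr_gt0.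
move=> y yx /(_ (r / 2))[|q qy]; first by rewrite divr_gt0.
apply; apply: hr; rewrite -(subrK y q) -addrA; apply: le_lt_trans (ler_normD _ _) _; lra.
Qed.

Lemma interior_bdpt i x : refT x -> ~ bdpt (qmap (Fq i) x).
Proof.
move=> hx; have [r r0 hr] := open_ptP (open_elem (elF i)) (ex_intro2 _ _ x hx erefl : (qmap (Fq i) @` refT) _).
move=> /(_ r r0)[q qr]; apply; have [z hz <-] := hr q qr.
by exists i, z => //; exact: refTW.
Qed.

Lemma on_edge x k l m : k != l -> k != m -> l != m -> bary m x = 0 ->
  x = (1 - bary l x) *: refv k + bary l x *: refv l.
Proof.
move=> kl km lm bm; have := bary_sum x; rewrite {2}(bary_refv x) !sum_I3; move: bm.
move: kl km lm; case: (ord3P k) => ->; case: (ord3P l) => ->; case: (ord3P m) => -> //= _ _ _ -> bs;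
  [have -> : 1 - bary 1 x = bary 0 x by lra|have -> : 1 - bary 2%:R x = bary 0 x by lra|
   have -> : 1 - bary 0 x = bary 1 x by lra|have -> : 1 - bary 2%:R x = bary 1 x by lra|
   have -> : 1 - bary 0 x = bary 2%:R x by lra|have -> : 1 - bary 1 x = bary 2%:R x by lra];
  by apply: ptP; pt_simp; ring.
Qed.

Lemma bary_edge k l m (t : R) : k != l -> k != m -> l != m ->
  let x := (1 - t) *: refv k + t *: refv l in [/\ bary k x = 1 - t, bary l x = t & bary m x = 0].
Proof.
by case: (ord3P k) => ->; case: (ord3P l) => ->; case: (ord3P m) => -> //= _ _ _;
  split; rewrite /bary /Defs.refv; pt_simp; ring.
Qed.

Lemma qmap_line i k l (P Q : pt) : vert i k = P -> vert i l = Q ->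
  eF i (mid (refv k) (refv l)) = mid P Q ->
  forall t : R, qmap (Fq i) ((1 - t) *: refv k + t *: refv l) = (1 - t) *: P + t *: Q.
Proof.
move=> hP hQ; rewrite hF => /[dup] /(congr1 fst) m1 /(congr1 snd) m2 t.
have /(congr1 fst) a1 := FV i k; have /(congr1 snd) a2 := FV i k.
have /(congr1 fst) b1 := FV i l; have /(congr1 snd) b2 := FV i l.
move: m1 m2 a1 a2 b1 b2; rewrite hP hQ /qmap /= => m1 m2 a1 a2 b1 b2.
by apply: ptP; rewrite /= quad_line ?m1 ?m2 ?a1 ?a2 ?b1 ?b2 /mid; pt_simp; field.
Qed.

Section Function.
Variable vt : pt -> pt.
Hypothesis hvt : tVh M vt.

(** [vt] composed with the inverse of G_h, by choice of an element and of a preimage. Two choices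
    give the same point of the straight mesh by [gh_inj], hence the same value ([meshfnE]). *)
Definition meshfn y : pt :=
  if pselect (exists p : 'I_(ntri M) * pt, refTc p.2 /\ eF p.1 p.2 = y) is left h
  then vt (tF (projT1 (cid h)).1 (projT1 (cid h)).2) else 0.

Lemma meshfnE i x : refTc x -> meshfn (qmap (Fq i) x) = vt (tF i x).
Proof.
move=> hx; rewrite /meshfn; case: pselect => [h|[]]; last by exists (i, x).
case: (cid h) => -[j z] /= [hz e]; congr vt; apply: eF_inj => //.
by rewrite e hF.
Qed.

Lemma meshfn0 y : ~ meshY y -> meshfn y = 0.
Proof.
move=> ny; rewrite /meshfn; case: pselect => // -[[i x] /= [hx e]]; exfalso; apply: ny.
by exists i, x => //; rewrite -hF.
Qed.

Lemma vt_lip i : exists2 L, 0 <= L & forall a x y, refTc x -> refTc y ->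
  `|co a (vt (tF i x)) - co a (vt (tF i y))| <= L * `|x - y|.
Proof.
have [wh hw wE] := hvt.2 i; have [W hW] := hatV_quad hw.
have /choice[L hL] : forall a, exists L, 0 <= L /\ forall x y, refTc x -> refTc y -> `|co a (wh x) - co a (wh y)| <= L * `|x - y|.
  by move=> a; have [L [L0 _ h]] := pw_quad (fun m => hW m a); exists L.
exists (L 0 + L 1); first by rewrite addr_ge0//; have [] := hL 0; have [] := hL 1.
move=> a x y hx hy; rewrite !wE//; have [_ /(_ x y hx hy)] := hL a => h; apply: le_trans h _.
apply: ler_wpM2r => //; have [a0 _] := hL 0; have [a1 _] := hL 1.
by case: (ord2P a) => ->; lra.
Qed.

(** One constant for all elements, but only for two points of the same element; crossing between
    elements has to wait for the vanishing on [bdpt]. *)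
Lemma meshfn_lip : exists2 L, 0 < L & forall i a x y, (qmap (Fq i) @` refTc) x -> (qmap (Fq i) @` refTc) y ->
  `|co a (meshfn x) - co a (meshfn y)| <= L * `|x - y|.
Proof.
have /choice[L hL] : forall i, exists L, 0 <= L /\ forall a x y, (qmap (Fq i) @` refTc) x -> (qmap (Fq i) @` refTc) y ->
    `|co a (meshfn x) - co a (meshfn y)| <= L * `|x - y|.
  move=> i; have [L L0 h] := vt_lip i.
  have D0 : 0 <= 2 * K / (c1 * hT i).
    have := el_h (elF i); have := el_d (elF i); have := el_K (elF i) => k1 ? ?.
    by rewrite divr_ge0 ?mulr_ge0// ?ltW// (lt_le_trans _ k1).
  exists (L * (2 * K / (c1 * hT i))); split; first by rewrite mulr_ge0.
  move=> a _ _ [x hx <-] [y hy <-]; rewrite !meshfnE//; apply: le_trans (h a x y hx hy) _.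
  by rewrite -mulrA; apply: ler_wpM2l => //; exact: (qmap_colip (elF i)).
have L0 i : 0 <= L i by have [] := hL i.
exists (1 + \sum_i L i); first by rewrite ltr_pwDl// sumr_ge0.
move=> i a x y hx hy; have [_ h] := hL i; apply: le_trans (h a x y hx hy) _.
apply: ler_wpM2r => //; rewrite (bigD1 i)//=.
have : 0 <= \sum_(j | j != i) L j by apply: sumr_ge0.
lra.
Qed.


Lemma bary_le1 k x : refTc x -> bary k x <= 1.
Proof.
move=> /refTcP hb; have := bary_sum x; rewrite sum_I3.
by have := hb 0; have := hb 1; have := hb 2%:R; case: (ord3P k) => ->; lra.
Qed.

Lemma refv_inj : injective refv.
Proof.
by move=> k l; case: (ord3P k) => ->; case: (ord3P l) => -> //; rewrite /Defs.refv /= => /eqP;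
  rewrite xpair_eqE ?oner_eq0 ?(eq_sym 0) ?oner_eq0 ?andbF.
Qed.

Lemma vert_neq i k l : k != l -> vert i k != vert i l.
Proof.
apply: contra => /eqP h; apply/eqP/refv_inj; apply: (@tF_inj i); [exact: refv_refTc|exact: refv_refTc|].
by rewrite !tF_refv.
Qed.

(** The other straight triangles are closed and stay away from the point, so near it the domain of
    [vt] is a half-plane bounded by the line of the edge, and [trace_zero] applies. *)
Lemma unshared_edge i k l m z : k != l -> k != m -> l != m -> refTc z ->
  bary m z = 0 -> 0 < bary k z -> 0 < bary l z ->
  (forall j, j != i -> ~ ctri (vert j) (tF i z)) -> vt (tF i z) = 0.
Proof.
move=> kl km lm hz bm bk bl nj; pose T := affq (vert i).
have lineT (t : R) : qmap T ((1 - t) *: refv k + t *: refv l) = (1 - t) *: vert i k + t *: vert i l.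
  by rewrite /T -!tF_qmap tF_line !tF_refv.
set P := vert i k in lineT; set Q := vert i l in lineT; set E := Q - P; set sg := orient R k l m.
have [r1 r10 hr1] := edge_surj (elT i) (hs2 i) kl km lm lineT hz bm bk bl.
rewrite -/T -tF_qmap in hr1; set x := tF i z in hr1 nj *.
pose C j : set pt := if j == i then set0 else ctri (vert j).
have cC : closed [set y | exists j, C j y].
  by apply: closed_finU => j; rewrite /C; case: ifP => _; [exact: closed0|exact: closed_ctri].
have [|r2 r20 hr2] := closed_ptP cC (x := x).
  by move=> [j]; rewrite /C; case: eqVneq => // /nj.
have onl : cross E (x - P) = 0.
  rewrite /x (on_edge kl km lm bm) tF_line !tF_refv -/P -/Q /E /cross; pt_simp; ring.
have shift w : cross E (w - P) = cross E (w - x).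
  by rewrite -[LHS]subr0 -onl /cross /=; ring.
have near w : `|w - x| < r2 -> tOmega M w -> exists2 w', refTc w' & qmap T w' = w.
  move=> wx /interior_subset[j _ cl]; have /closure_id ce : closed (ctri (vert j)) by exact: closed_ctri.
  have wj : ctri (vert j) w.
    rewrite ce; apply: (closure_subset _ cl); rewrite tTE ctriE => _ [p hp <-].
    by exists p => //; exact: refTW.
  have [ji|ji] := eqVneq j i; first by move: wj; rewrite ji ctriE.
  by exfalso; apply: (hr2 w wx); exists j; rewrite /C (negPf ji).
(* Normal to the edge, turned towards the triangle by the sign [sg]. It is nonzero because
   [edge_sign] is positive at the opposite vertex. *)
pose n (b : 'I_2) : R := if b == 0 then - sg * E.2 else sg * E.1.
have nE w : \sum_b n b * (co b w - co b x) = sg * cross E (w - x).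
  by rewrite sum_I2 /n /co /cross /=; ring.
have sg2 : sg ^+ 2 = 1 by exact: orientE.
have n0 : exists b, n b != 0.
  apply: contrapT => h; have h0 b : n b = 0 by apply/eqP; apply: contrapT => /negP hb; apply: h; exists b.
  have [||c c0 e] := edge_sign (elT i) (hs2 i) kl km lm lineT (x := refv m).
  - by apply: le_trans (refTc_norm (refv_refTc R m) (refTc_mid (refv_refTc R k) (refv_refTc R l))) _; lra.
  - by rewrite ger0_norm; [exact: bary_le1 (refv_refTc R m)|have /refTcP := refv_refTc R m].
  have := nE (qmap T (refv m)); rewrite sum_I2 !h0 !mul0r addr0 -shift e.
  have -> : bary m (refv m) = 1 by case: (ord3P m) => ->; rewrite /bary /Defs.refv /=; ring.
  by rewrite mulr1 => c0'; rewrite -c0' ltxx in c0.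
have [L L0 hL] := vt_lip i.
suff h b : co b (vt x) = 0 by apply: ptP; [exact: (h 0)|exact: (h 1)].
apply: (@trace_zero _ (tOmega M) vt b _ (Num.min r1 r2) x n) => //.
- exact: open_interior.
- exact: hvt.1.
- by rewrite lt_min r10.
- move=> w; rewrite lt_min => /andP[_ w2] Uw; rewrite nE -shift.
  by have [w' hw' <-] := near w w2 Uw; have := edge_side (elT i) (hs2 i) kl km lm lineT hw'.
- move=> w; rewrite lt_min => /andP[w1 _]; rewrite nE -shift => hw.
  have [w' [ew _ hw']] := hr1 w w1; have {}hw' := hw' hw; rewrite -ew.
  have := open_elem (elT i); rewrite openE => /(_ (qmap T w')) h.
  have : (qmap T @` refT)^° (qmap T w') by apply: h; exists w'.
  apply: interiorS => y hy; exists i => //; apply: subset_closure; rewrite tTE; exact: hy.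
move=> e e0; have D0 : 0 <= L * (2 * K / (c1 / 2 * hT i)).
  have := el_h (elT i); have := el_d (elT i); have := el_K (elT i) => k1 ? ?.
  have k0 : 0 <= K by apply: le_trans k1.
  have a1 : 0 <= 2 * K by rewrite mulr_ge0.
  have a2 : 0 <= c1 / 2 * hT i by apply/ltW/mulr_gt0.
  exact: mulr_ge0 L0 (divr_ge0 a1 a2).
have [d [d0 _ de]] := small_eps D0 e0; exists (Num.min r2 d); first by rewrite lt_min r20.
move=> w Uw; rewrite lt_min => /andP[w2 wd]; have [w' hw' ew] := near w w2 Uw.
rewrite -ew -tF_qmap; apply: le_trans (hL b _ _ hw' hz) _; apply: le_trans de.
apply: (@le_trans _ _ (L * (2 * K / (c1 / 2 * hT i) * `|w - x|))).
  by apply: ler_wpM2l => //; rewrite -ew /x tF_qmap; exact: (qmap_colip (elT i)).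
rewrite [leRHS]mulrC mulrA; apply: ler_wpM2l => //; exact: ltW.
Qed.

(* Two elements sharing an edge cover a neighbourhood of each interior point of that edge: the edge is
   straight, both maps are the identity on it, and the elements lie on opposite sides of it. *)
Lemma shared_edge i j k l m l1 l2 z : i != j -> k != l -> k != m -> l != m -> l1 != l2 ->
  vert j l1 = vert i k -> vert j l2 = vert i l ->
  ctri (vert i) `&` ctri (vert j) = tedge i k l ->
  refTc z -> bary m z = 0 -> 0 < bary k z -> 0 < bary l z -> ~ bdpt (qmap (Fq i) z).
Proof.
move=> ij kl km lm l12 e1 e2 eI hz bm bk bl; set P := vert i k; set Q := vert i l.
have [m1 l1m l2m] : exists2 m1, l1 != m1 & l2 != m1.
  by move: l12; case: (ord3P l1) => ->; case: (ord3P l2) => -> //= _;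
    first [by exists 0|by exists 1|by exists 2%:R].
(* Along an edge each map is the quadratic interpolant of [gmap] at the ends and the midpoint, data
   common to both elements; hence their images of the edge coincide, and the edge is an
   [interior_edge]. *)
have ev i' (a b : 'I_3) (P' Q' : pt) (t : R) : vert i' a = P' -> vert i' b = Q' ->
    eF i' ((1 - t) *: refv a + t *: refv b) =
    ((1 - t) * (1 - 2 * t)) *: P' + ((4 * t * (1 - t)) *: gmap M (mid P' Q') + (t * (2 * t - 1)) *: Q').
  move=> hP hQ; have := eF_mid i' a b; rewrite hP hQ => <-.
  have := eF_refv i' a; have := eF_refv i' b; rewrite hP hQ => <- <-.
  by rewrite !hF; apply: ptP; pt_simp; rewrite quad_line -![_ *: _ : R]/(_ * _); ring.
have gE i' (a b : 'I_3) (t : R) : gh i' ((1 - t) *: vert i' a + t *: vert i' b) = eF i' ((1 - t) *: refv a + t *: refv b).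
  by rewrite /eF tF_line !tF_refv.
have ie : interior_edge i k l.
  exists j, l1, l2; split => //; first by rewrite eq_sym.
  apply/seteqP; split => _ [_ [t [t0 t1 ->]] <-].
    exists ((1 - t) *: vert j l1 + t *: vert j l2); first by exists t.
    by rewrite !gE (ev _ _ _ P Q)// (ev _ _ _ P Q).
  exists ((1 - t) *: vert i k + t *: vert i l); first by exists t.
  by rewrite !gE (ev _ _ _ P Q)// (ev _ _ _ P Q).
have [st _] := interior_edges hE kl ie.
have mPQ : eF i (mid (refv k) (refv l)) = mid P Q.
  rewrite mid_convex (straight_edge_affine hE kl st); last by apply/andP; split; lra.
  by rewrite !eF_refv -mid_convex.
have li := qmap_line erefl erefl mPQ.
have lj : forall t : R, qmap (Fq j) ((1 - t) *: refv l1 + t *: refv l2) = (1 - t) *: P + t *: Q.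
  by apply: qmap_line => //; rewrite eF_mid e1 e2 -/P -/Q -[RHS]mPQ eF_mid.
have [r1 r10 hr1] := edge_surj (elF i) (hs1 i) kl km lm li hz bm bk bl.
set t := bary l z in bl; have zE := on_edge kl km lm bm; rewrite -/t in zE.
have bkt : bary k z = 1 - t by have [] := bary_edge t kl km lm; rewrite -zE.
pose zj := (1 - t) *: refv l1 + t *: refv l2.
have [bj1 bj2 bj3] := bary_edge t l12 l1m l2m; rewrite -/zj in bj1 bj2 bj3.
have hzj : refTc zj by apply: refTc_convex; rewrite ?(ltW bl) ?bary_le1//; exact: refv_refTc.
have [r2 r20 hr2] := edge_surj (elF j) (hs1 j) l12 l1m l2m lj hzj bj3 ltac:(by rewrite bj1 -bkt) ltac:(by rewrite bj2).
have yE : qmap (Fq j) zj = qmap (Fq i) z by rewrite [in RHS]zE li lj.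
rewrite yE in hr2; set y := qmap (Fq i) z in hr1 hr2 *; set E := Q - P in hr1 hr2.
have cy : cross E (y - P) = 0 by rewrite /y zE li /cross /E; pt_simp; ring.
set si := orient R k l m in hr1; set sj := orient R l1 l2 m1 in hr2.
have si2 : si ^+ 2 = 1 by exact: orientE.
have sj2 : sj ^+ 2 = 1 by exact: orientE.
have PQ : P != Q by exact: vert_neq.
(* Were both elements on the same side, a point slightly off the edge would belong to both; by
   injectivity of G_h its preimage would belong to both straight triangles, that is to the edge,
   where the cross product is 0. *)
have opp : sj = - si.
  have /orP[/eqP//|/eqP sij] : (sj == - si) || (sj == si).
    by rewrite orbC -eqf_sqr si2 sj2.
  exfalso; have [r [r0 rr1 rr2]] : exists r, [/\ 0 < r, r < r1 & r < r2].
    exists (Num.min r1 r2 / 2); have m0 : 0 < Num.min r1 r2 by rewrite lt_min r10.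
    have : Num.min r1 r2 <= r1 by rewrite ge_min lexx.
    have : Num.min r1 r2 <= r2 by rewrite ge_min lexx orbT.
    by split; lra.
  pose n : pt := (- E.2, E.1).
  have E0 : 0 < E.1 ^+ 2 + E.2 ^+ 2.
    rewrite lt_def addr_ge0 ?sqr_ge0// andbT paddr_eq0 ?sqr_ge0// !sqrf_eq0.
    apply: contraNN PQ => /andP[/eqP h1 /eqP h2]; rewrite eq_sym -subr_eq0; apply/eqP; exact: ptP.
  have [e [e0 _ he]] := @small_eps _ `|si *: n| r (normr_ge0 _) r0.
  pose p := y + e *: (si *: n).
  have py : `|p - y| <= r by rewrite /p addrC addKr normrZ gtr0_norm.
  have cp : 0 < si * cross E (p - P).
    have -> : cross E (p - P) = cross E (y - P) + e * si * (E.1 ^+ 2 + E.2 ^+ 2).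
      by rewrite /p /n /cross; pt_simp; ring.
    rewrite cy add0r (_ : _ * _ = si ^+ 2 * (e * (E.1 ^+ 2 + E.2 ^+ 2))); last by ring.
    by rewrite si2 mul1r mulr_gt0.
  have [x1 [x1p hx1 _]] := hr1 p (le_lt_trans py rr1); have {}hx1 := hx1 (ltW cp).
  have [x2 [x2p hx2 _]] := hr2 p (le_lt_trans py rr2).
  have {}hx2 : refTc x2 by apply: hx2; rewrite sij; exact: ltW cp.
  have ex : tF i x1 = tF j x2 by apply: eF_inj => //; rewrite !hF x1p x2p.
  have : (ctri (vert i) `&` ctri (vert j)) (tF i x1).
    by split; [exact: tF_ctri|rewrite ex; exact: tF_ctri].
  rewrite eI => -[t' [t0' t1' et]].
  have x1E : x1 = (1 - t') *: refv k + t' *: refv l.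
    apply: (@tF_inj i) => //; last by rewrite tF_line !tF_refv.
    by apply: refTc_convex; rewrite ?t0'//; exact: refv_refTc.
  move: cp; rewrite -x1p x1E li /cross /E; pt_simp.
  by rewrite [X in 0 < X](_ : _ = 0) ?ltxx//; ring.
move=> /(_ (Num.min r1 r2))[|p]; first by rewrite lt_min r10.
rewrite lt_min => /andP[p1 p2]; apply.
have [x1 [x1p hx1 _]] := hr1 p p1; have [x2 [x2p hx2 _]] := hr2 p p2.
have [s0|s0] := leP 0 (si * cross E (p - P)).
  by exists i, x1 => //; exact: hx1.
by exists j, x2 => //; apply: hx2; rewrite opp mulNr oppr_ge0 ltW.
Qed.

(** If another straight triangle contains the point, conformity leaves only a common edge, as a
    single common vertex cannot be interior to an edge; then [shared_edge] contradicts [bdpt].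
    Otherwise [unshared_edge] applies. *)
Lemma edge_case i k l m z : k != l -> k != m -> l != m -> refTc z ->
  bary m z = 0 -> 0 < bary k z -> 0 < bary l z -> bdpt (qmap (Fq i) z) -> vt (tF i z) = 0.
Proof.
move=> kl km lm hz bm bk bl hb.
have [[j ji xj]|nj] := pselect (exists2 j, j != i & ctri (vert j) (tF i z)); last first.
  by apply: (unshared_edge kl km lm hz bm bk bl) => j ji xj; apply: nj; exists j.
exfalso; have ij : i != j by rewrite eq_sym.
have xi := tF_ctri i hz.
have [e0|[a [b [ab e]]]|[a [a' [b [b' [aa bb et eI]]]]]] := am_conforming hA ij.
- by have : (ctri (vert i) `&` ctri (vert j)) (tF i z) by []; rewrite e0.
- have : (ctri (vert i) `&` ctri (vert j)) (tF i z) by [].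
  rewrite e /= -tF_refv => /tF_inj za; have {}za := za hz (refv_refTc R a).
  move: bk bl bm; rewrite za; move: kl km lm.
  by case: (ord3P k) => ->; case: (ord3P l) => ->; case: (ord3P m) => -> //= _ _ _;
    case: (ord3P a) => ->; rewrite /bary /Defs.refv /=; lra.
have : (ctri (vert i) `&` ctri (vert j)) (tF i z) by [].
rewrite eI => -[t [t0 t1 xt]].
have zE : z = (1 - t) *: refv a + t *: refv a'.
  apply: (@tF_inj i) => //; last by rewrite tF_line !tF_refv.
  by apply: refTc_convex; rewrite ?t0//; exact: refv_refTc.
have [a'' am am'] : exists2 m1, a != m1 & a' != m1.
  by move: aa; case: (ord3P a) => ->; case: (ord3P a') => -> //= _;
    first [by exists 0|by exists 1|by exists 2%:R].
have [ba ba' ba''] := bary_edge t aa am am'; rewrite -zE in ba ba' ba''.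
have [h1 h2] : 0 < bary a z /\ 0 < bary a' z.
  have ka : k != a'' by apply: contraTneq bk => ->; rewrite ba'' ltxx.
  have la : l != a'' by apply: contraTneq bl => ->; rewrite ba'' ltxx.
  move: kl ka la bk bl; case: (ord3_cases aa am am' k) => ->; case: (ord3_cases aa am am' l) => -> //;
    rewrite ?eqxx//; by split.
have vab : vert i a != vert i a' by exact: vert_neq.
have [[hb1 hb2]|[hb1 hb2]] := seg_eq vab et.
- exact: (shared_edge ij aa am am' bb hb1 hb2 eI hz ba'' h1 h2 hb).
- by apply: (shared_edge ij aa am am' _ hb2 hb1 eI hz ba'' h1 h2 hb); rewrite eq_sym.
Qed.


Lemma closed_set1pt p : closed [set p].
Proof. by apply: compact_closed; [exact: norm_hausdorff|exact: compact_set1]. Qed.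

(** Elements that miss [y] are closed and stay away from it; on those containing [y] the Lipschitz
    bound applies. *)
Lemma meshfn_near y a : meshY y -> co a (meshfn y) != 0 -> exists2 r, 0 < r &
  forall q, `|q - y| < r -> meshY q -> co a (meshfn q) != 0.
Proof.
move=> Yy ga; have [L L0 hL] := meshfn_lip.
pose C i : set pt := [set q | (qmap (Fq i) @` refTc) q /\ ~ (qmap (Fq i) @` refTc) y].
have cC : closed [set q | exists i, C i q].
  apply: closed_finU => i; have [h|h] := pselect ((qmap (Fq i) @` refTc) y).
    have -> : C i = set0 by apply/seteqP; split => // q [].
    exact: closed0.
  have -> : C i = qmap (Fq i) @` refTc by apply/seteqP; split => // q [].
  exact: closed_qmap.
have [|r r0 hr] := closed_ptP cC (x := y); first by move=> [i []].
have e0 : 0 < `|co a (meshfn y)| / L / 2 by rewrite !divr_gt0// normr_gt0.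
exists (Num.min r (`|co a (meshfn y)| / L / 2)); first by rewrite lt_min r0.
move=> q; rewrite lt_min => /andP[/hr nC qe] [i qi].
have yi : (qmap (Fq i) @` refTc) y by apply: contrapT => ny; apply: nC; exists i.
apply/eqP => q0; have := hL i a q y qi yi; rewrite q0 sub0r normrN.
move: qe; rewrite -mulrA -invfM ltr_pdivlMr ?mulr_gt0// => qe h; have := mulr_ge0 (ltW L0) (normr_ge0 (q - y)); lra.
Qed.

Lemma nonvertex_case j z : refTc z -> (forall l, z != refv l) -> bdpt (qmap (Fq j) z) -> vt (tF j z) = 0.
Proof.
move=> hz nv bq; have [[m hm]|[l hl]|[m bm]] := refTc_split hz.
- by exfalso; exact: interior_bdpt (inT_refT hm) bq.
- exfalso; have [t [t0 t1 ze]] := hl.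
  have [t1e|t1e] := eqVneq t 1.
    by move: (nv l); rewrite ze t1e subrr scale0r add0r scale1r eqxx.
  apply: (@interior_bdpt j z _ bq); apply/refTP => i'; rewrite ze bary_convex ltr_pwDl//.
    apply: mulr_gt0; last by move/refTP : (ctcenter_refT R).
    by rewrite subr_gt0 lt_neqAle t1e.
  by rewrite mulr_ge0//; move/refTcP: (refv_refTc R l).
have [k1 [l1 [km lm kl]]] : exists k1 l1, [/\ k1 != m, l1 != m & k1 != l1].
  by case: (ord3P m) => ->; [exists 1, 2%:R|exists 0, 2%:R|exists 0, 1].
have zE := on_edge kl km lm bm; have [bk bl _] := bary_edge (bary l1 z) kl km lm; rewrite -zE in bk bl.
have l0 : 0 < bary l1 z.
  rewrite lt_def; have /refTcP -> := hz; rewrite andbT; apply: contra (nv k1) => /eqP h.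
  by rewrite zE h subr0 scale1r scale0r addr0.
have k0 : 0 < bary k1 z.
  rewrite lt_def; have /refTcP -> := hz; rewrite andbT; apply: contra (nv l1); rewrite bk subr_eq0 => /eqP h.
  by rewrite zE -h subrr scale0r scale1r add0r.
exact: edge_case kl km lm hz bm k0 l0 bq.
Qed.

Lemma vertex_case i k : bdpt (vert i k) -> meshfn (vert i k) = 0.
Proof.
set y := vert i k => by_; apply: contrapT => ny.
have [a ga] : exists a, co a (meshfn y) != 0.
  apply: contrapT => h; apply: ny; apply: ptP; apply/eqP/negPn/negP => h'; apply: h; [by exists 0|by exists 1].
have Yy : meshY y by exists i; exists (refv k); [exact: refv_refTc|exact: FV].
have [r1 r10 hr1] := meshfn_near Yy ga.
(* The other vertices are finitely many and stay away from [y], so that [nonvertex_case] covers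
   every other mesh point nearby. *)
pose C (jl : 'I_(ntri M) * 'I_3) : set pt := [set q | q = vert jl.1 jl.2 /\ q != y].
have cC : closed [set q | exists jl, C jl q].
  apply: closed_finU => jl; have [h|h] := eqVneq (vert jl.1 jl.2) y.
    have -> : C jl = set0 by apply/seteqP; split => // q [->]; rewrite h eqxx.
    exact: closed0.
  have -> : C jl = [set vert jl.1 jl.2] by apply/seteqP; split => // q; [move=> []|move=> ->].
  exact: closed_set1pt.
have [|r2 r20 hr2] := closed_ptP cC (x := y); first by move=> [jl [_]]; rewrite eqxx.
pose r := Num.min r1 r2; have r0 : 0 < r by rewrite lt_min r10.
have punct q : `|q - y| < r -> q != y -> meshY q -> ~ bdpt q.
  rewrite lt_min => /andP[q1 q2] qy Yq bq; have [j [z hz zq]] := Yq.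
  have := hr1 q q1 Yq; rewrite -zq meshfnE//; apply/negP; rewrite negbK -zq in bq *.
  rewrite (nonvertex_case hz _ bq) /co; first by case: ifP.
  move=> l; apply: contraTneq isT => zl; exfalso; apply: (hr2 q q2); exists (j, l); split => //=.
  by rewrite -zq zl FV.
have rh : 0 < r / 2 by rewrite divr_gt0.
have [z zr nz] := by_ _ rh.
have zy : z != y by apply: contra_not_neq nz => ->.
(* A second mesh point near [y], obtained by moving from the vertex towards the centre of the
   element [i]. *)
have [y' [y'r Yy' y'y]] : exists y', [/\ `|y' - y| < r, meshY y' & y' != y].
  have [e [e0 e1 he]] := @small_eps _ (2 * K * hT i) (r / 2)
    ltac:(by rewrite mulr_ge0 ?hT_ge0// mulr_ge0// (le_trans _ (el_K (elF i)))) rh.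
  pose w := (1 - e) *: refv k + e *: ctr.
  have hw : refTc w.
    by apply: refTc_convex; [rewrite (ltW e0)|exact: refv_refTc|exact/refTW/ctcenter_refT].
  have wk : w - refv k = e *: (ctr - refv k) by rewrite /w; apply: ptP; pt_simp; ring.
  exists (qmap (Fq i) w); split; last 1 first.
  - apply/eqP; rewrite /y -FV => /(qmap_inj (elF i) hw (refv_refTc R k)) h.
    have := wk; rewrite h subrr => /esym/eqP; rewrite scaler_eq0 gt_eqF//= subr_eq0 => /eqP h'.
    by have := congr1 fst h'; rewrite /ctcenter /Defs.refv; case: (ord3P k) => -> /=; lra.
  - rewrite /y -FV; apply: le_lt_trans (qmap_lip (elF i) hw (refv_refTc R k)) _.
    rewrite wk normrZ (gtr0_norm e0); apply: (@le_lt_trans _ _ (e * (2 * K * hT i))).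
      rewrite [leRHS]mulrC; apply: ler_wpM2l.
        by rewrite mulr_ge0 ?hT_ge0// mulr_ge0// (le_trans _ (el_K (elF i))).
      apply: ler_piMr; first exact: ltW.
      by apply: refTc_norm; [exact/refTW/ctcenter_refT|exact: refv_refTc].
    by apply: le_lt_trans he _; lra.
  - by exists i; exists w.
(* Perturbing z keeps y off the segment from z to y'. *)
have [z' [z'r nz' cz']] : exists z', [/\ `|z' - y| < r, ~ meshY z' & cross (z' - y) (y' - y) != 0].
  have [c0|c0] := eqVneq (cross (z - y) (y' - y)) 0; last by exists z; split => //; lra.
  have [s s0 hs'] := closed_ptP closed_meshY nz.
  pose n : pt := (- (y' - y).2, (y' - y).1).
  have m0 : 0 < Num.min s (r / 2) by rewrite lt_min s0.
  have [e [e0 _ he]] := @small_eps _ `|n| (Num.min s (r / 2) / 2) (normr_ge0 _) ltac:(by rewrite divr_gt0).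
  have ms : Num.min s (r / 2) <= s by rewrite ge_min lexx.
  have mr : Num.min s (r / 2) <= r / 2 by rewrite ge_min lexx orbT.
  exists (z + e *: n); split.
  - rewrite (_ : z + e *: n - y = (z - y) + e *: n); last by rewrite addrAC.
    apply: le_lt_trans (ler_normD _ _) _; rewrite normrZ (gtr0_norm e0); lra.
  - by apply: hs'; rewrite addrC addKr normrZ (gtr0_norm e0); lra.
  - have -> : cross (z + e *: n - y) (y' - y) = cross (z - y) (y' - y) - e * ((y' - y).1 ^+ 2 + (y' - y).2 ^+ 2).
      by rewrite /cross /n; pt_simp; ring.
    rewrite c0 sub0r oppr_eq0 mulf_neq0 ?gt_eqF// lt_def addr_ge0 ?sqr_ge0// andbT paddr_eq0 ?sqr_ge0// !sqrf_eq0.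
    apply: contra y'y => /andP[/eqP h1 /eqP h2]; rewrite -subr_eq0; apply/eqP; exact: ptP.
pose g (t : R) : pt := (1 - t) *: z' + t *: y'.
have gy t : g t != y.
  apply: contra cz' => /eqP gt; have e1 : (1 - t) *: (z' - y) + t *: (y' - y) = 0.
    by rewrite -[RHS](subrr y) -{3}gt /g; apply: ptP; pt_simp; ring.
  have c1' : (1 - t) * cross (z' - y) (y' - y) = 0.
    rewrite -[RHS](_ : cross ((1 - t) *: (z' - y) + t *: (y' - y)) (y' - y) = 0); last by rewrite e1 /cross /=; ring.
    by rewrite /cross; pt_simp; ring.
  have c2' : t * cross (z' - y) (y' - y) = 0.
    rewrite -[RHS](_ : cross (z' - y) ((1 - t) *: (z' - y) + t *: (y' - y)) = 0); last by rewrite e1 /cross /=; ring.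
    by rewrite /cross; pt_simp; ring.
  apply/eqP; lra.
have gr t : 0 <= t <= 1 -> `|g t - y| < r.
  move=> /andP[t0 t1]; rewrite (_ : g t - y = (1 - t) *: (z' - y) + t *: (y' - y)); last first.
    by rewrite /g; apply: ptP; pt_simp; ring.
  apply: le_lt_trans (ler_normD _ _) _; rewrite !normrZ (ger0_norm t0) ger0_norm ?subr_ge0//.
  have [->|tn] := eqVneq t 0; first by rewrite subr0 mul1r mul0r addr0.
  have tp : 0 < t by rewrite lt_def tn.
  have : (1 - t) * `|z' - y| <= (1 - t) * r by apply: ler_wpM2l; [rewrite subr_ge0|exact: ltW].
  have : t * `|y' - y| < t * r by rewrite ltr_pM2l.
  lra.
have gs s t : `|g s - g t| = `|s - t| * `|z' - y'|.
  rewrite -normrZ -[RHS]normrN; congr `|_|; rewrite /g; apply: ptP; pt_simp; ring.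
have zy'0 : 0 < `|z' - y'|.
  rewrite normr_gt0 subr_eq0; apply: contra_not_neq nz' => ->; exact: Yy'.
(* Indicator of the mesh along the segment. The closed sets [meshY] and [bdpt] cover the segment
   and, by [punct], are disjoint on it, so the indicator is constant on each of them;
   [cover_lip_line] with constant 0 then forces equal values at the two ends. *)
pose f (t : R) : R := if `[< meshY (g t) >] then 1 else 0.
pose D (b : bool) : set R := if b then [set t | meshY (g t)] else [set t | bdpt (g t)].
have cg (V : set pt) : closed V -> forall t, ~ V (g t) -> exists2 r, 0 < r & forall s, `|s - t| < r -> ~ V (g s).
  move=> cV t /(closed_ptP cV)[s s0 h']; exists (s / `|z' - y'|); first by rewrite divr_gt0.
  by move=> u; rewrite ltr_pdivlMr// -gs => /h'.
have hf : `|f 1 - f 0| <= 0 * (1 - 0).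
  apply: (@cover_lip_line _ bool D f 0 _ [set: bool] 0 1 ler01).
  - by case; apply: cg; [exact: closed_meshY|exact: closed_bdpt].
  - move=> t _; have [h'|h'] := pselect (meshY (g t)); first by exists true; rewrite ?inE.
    by exists false; rewrite ?inE// /D /= => s s0; exists (g t) => //; rewrite subrr normr0.
  - move=> b s t hs' ht /gr s1 /gr t1; rewrite mul0r normr_le0 subr_eq0 /f.
    case: b hs' ht; rewrite /D /= => hs' ht; first by rewrite !asboolT.
    by rewrite !asboolF// => h'; [case: (punct _ t1 (gy t) h' ht)|case: (punct _ s1 (gy s) h' hs')].
move: hf; rewrite mul0r normr_le0 subr_eq0 /f /g subrr subr0 !scale0r !scale1r add0r addr0.
by rewrite (asboolT Yy') (asboolF nz') oner_eq0.
Qed.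

Lemma meshfn_bdpt y : bdpt y -> meshfn y = 0.
Proof.
move=> by_; have [[i [z hz zy]]|ny] := pselect (meshY y); last exact: meshfn0.
have [[l zl]|nl] := pselect (exists l, z = refv l).
  by move: by_; rewrite -zy zl FV; exact: vertex_case.
rewrite -zy meshfnE//; rewrite -zy in by_; apply: (nonvertex_case hz) => // l.
by apply/eqP => zl; apply: nl; exists l.
Qed.

Lemma elem_closure i : qmap (Fq i) @` refTc `<=` closure (eT i).
Proof.
move=> _ [z hz <-] B /nbhs_ballP[r /= r0 rB]; rewrite eTE.
have [e [e0 e1 he]] := @small_eps _ (2 * K * hT i) (r / 2)
  ltac:(by rewrite mulr_ge0 ?hT_ge0// mulr_ge0// (le_trans _ (el_K (elF i)))) ltac:(by rewrite divr_gt0).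
pose w := (1 - e) *: z + e *: ctr.
have hw : refT w.
  apply/refTP => k; rewrite bary_convex ltr_wpDl//; first by rewrite mulr_ge0 ?subr_ge0//; move/refTcP: hz.
  by rewrite mulr_gt0//; move/refTP: (ctcenter_refT R).
exists (qmap (Fq i) w); split; first by exists w.
apply: rB; rewrite -ball_normE /=; apply: le_lt_trans (qmap_lip (elF i) hz (refTW hw)) _.
have -> : z - w = e *: (z - ctr) by rewrite /w; apply: ptP; pt_simp; ring.
rewrite normrZ (gtr0_norm e0); apply: (@le_lt_trans _ _ (e * (2 * K * hT i))).
  rewrite [leRHS]mulrC; apply: ler_wpM2l.
    by rewrite mulr_ge0 ?hT_ge0// mulr_ge0// (le_trans _ (el_K (elF i))).
  apply: ler_piMr; first exact: ltW.
  by apply: refTc_norm => //; exact/refTW/ctcenter_refT.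
by apply: le_lt_trans he _; lra.
Qed.

Lemma Omegah_meshY : Omegah M `<=` meshY.
Proof.
move=> y /interior_subset[i _ cl]; exists i.
have /closure_id -> : closed (qmap (Fq i) @` refTc) by exact: closed_qmap.
by apply: (closure_subset _ cl); rewrite eTE => _ [z hz <-]; exists z => //; exact: refTW.
Qed.

Lemma meshfn_off y : ~ Omegah M y -> meshfn y = 0.
Proof.
move=> nU; have [/meshfn_bdpt//|/bdptN[r r0 hr]] := pselect (bdpt y).
exfalso; apply: nU; apply/nbhs_ballP; exists r => //= q; rewrite -ball_normE /= distrC => /hr[i hi].
by exists i => //; exact: elem_closure.
Qed.

(** The exceptional set consists of the images of the edges and of the segments from the centre to
    the vertices; these finitely many curves are indexed by [nat] through [pickle], to use the
    countable union of negligible sets. *)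
Lemma meshfn_ae : {ae mu2, forall x : mpt, (Omegah M : set mpt) x ->
  exists i m z, inT m z /\ x = qmap (Fq i) z :> pt}.
Proof.
pose T := ('I_(ntri M) * (option 'I_3 * 'I_3))%type.
pose vx (o : option 'I_3) : pt := if o is Some k then refv k else ctr.
have vxc o : refTc (vx o) by case: o => [k|]; [exact: refv_refTc|exact/refTW/ctcenter_refT].
pose S (n : nat) : set mpt := if unpickle n is Some t then
  let: (i, (o, l)) := (t : T) in qmap (Fq i) @` seg (vx o) (refv l) else set0.
have nS n : mu2.-negligible (S n).
  rewrite /S; case: unpickle => [[i [s l]]|]; last exact: negligible_set0.
  by apply: (qmap_seg_null (elF i)); [exact: vxc|exact: refv_refTc].
apply: negligibleS (negligible_bigcup nS) => x /=; rewrite not_implyE => -[Ux hn].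
have [i [z hz zx]] := Omegah_meshY Ux.
have hS o l : seg (vx o) (refv l) z -> (\bigcup_n S n) x.
  by move=> hs'; exists (pickle ((i, (o, l)) : T)) => //; rewrite /S pickleK; exists z.
have [[m hm]|[l hl]|[m bm]] := refTc_split hz.
- by exfalso; apply: hn; exists i, m, z.
- exact: (hS None l).
- by have [k [l [_ _ hkl]]] := bary0_seg hz bm; exact: (hS (Some k) l).
Qed.

Lemma meshfn_H10 : H10 (Omegah M) meshfn.
Proof.
have [L L0 hL] := meshfn_lip.
have /choice[D hD] : forall i, exists D, 0 <= D /\ forall y, (qmap (Fq i) @` refTc) y -> `|y| <= D.
  move=> i; have : compact (qmap (Fq i) @` refTc).
    apply: continuous_compact compact_refTc; apply: continuous_subspaceT.
    by apply: continuous_pair; exact: qval_continuous.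
  by move=> /compact_ptP[_ [D D0 h]]; exists D; split => //; exact: ltW.
apply: (@H10_lip _ _ _ L (\sum_i D i)) => //.
- exact: open_interior.
- move=> x /Omegah_meshY[i hi]; have [_ h] := hD i; apply: le_trans (h x hi) _.
  by rewrite (bigD1 i)//= lerDl sumr_ge0// => j _; have [] := hD j.
(* The segment from [x] to [y] may leave the mesh. The index [None] adds the closed set [bdpt], on
   which the function is 0, and together with the elements it covers the segment. *)
- move=> a x y; pose C (o : option 'I_(ntri M)) : set pt := if o is Some i then qmap (Fq i) @` refTc else bdpt.
  apply: (@cover_lip _ _ C (fun x => co a (meshfn x))); first exact: ltW.
  + by case=> [i|]; [exact: closed_qmap|exact: closed_bdpt].
  + move=> t _; set p := _ + _; have [[i hi]|np] := pselect (meshY p); first by exists (Some i).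
    by exists None => r r0; exists p => //; rewrite subrr normr0.
  + case=> [i|] u v hu hv; first exact: hL hu hv.
    by rewrite !meshfn_bdpt// subrr normr0 mulr_ge0// ltW.
- by move=> x; exact: meshfn_off.
apply: filterS meshfn_ae => x hx /hx[i [m [z [hz ->]]]] a j.
have [wh hw wE] := hvt.2 i; have [W hW] := hatV_quad hw.
have [r r0 hr] := open_ptP (open_inT (m := m)) hz.
apply: (sdf_transfer (elF i) (g := qval (W m a)) (r0 := r)) => //; first exact: inT_refT hz.
  exact: sdf_qval.
move=> y /hr hy; have hy' := refTW (inT_refT hy).
by rewrite meshfnE// wE// (hW m a _ (inT_subT hy)).
Qed.

End Function.
End Glue.

Theorem lemma4p5 (R : realType) (k : nat) (hk : (2 <= k)%N)
    (Omega : set (pt R)) (hOmega : smooth_domain k Omega)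
    (C0 sigma c1 c2 : R) (hc1 : 0 < c1) :
  exists h0 C : R, [/\ 0 < h0, 0 < C &
    forall M : isomesh R,
      isoparametric_mesh Omega C0 sigma c1 c2 M -> hmesh M <= h0 ->
      exists E : (pt R -> pt R) -> (pt R -> pt R),
        forall v : pt R -> pt R, Vh M v ->
          H10 (Omegah M) (E v) /\
          forall i : 'I_(ntri M),
            (vL2n (eT i) (fun x => (v x - E v x)%R)
               + (hT i)%:E * gradL2n (eT i) (fun x => (v x - E v x)%R)
             <= (C * hT i ^+ 2)%:E * gradL2n (eT i) v)%E].
Proof.
pose K := Kc C0; have K0 : 0 < K by rewrite /K /Kc lt_max ltr01 orbT.
have b0 : 0 < 128 * K ^+ 2 by rewrite mulr_gt0 ?exprn_gt0.
exists (Num.min (c1 / (128 * K ^+ 2)) (c1 ^+ 3 / (2000 * 2000 * K ^+ 6))), (Cest K c1); split.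
- have b1 : 0 < 2000 * 2000 * K ^+ 6 by have : 0 < K ^+ 6 by [rewrite exprn_gt0]; lra.
  by rewrite lt_min; apply/andP; split; [exact: divr_gt0|exact: divr_gt0 (exprn_gt0 3 hc1) b1].
- exact: Cest_gt0.
move=> M hM hm; have [hA hG hE] := hM.
have hi (i : 'I_(ntri M)) : hT i <= c1 / (128 * K ^+ 2) /\ hT i <= c1 ^+ 3 / (2000 * 2000 * K ^+ 6).
  have : hT i <= hmesh M by exact: (le_bigmax _ (fun i : 'I_(ntri M) => hT i) i).
  by move/le_trans/(_ hm); rewrite le_min => /andP[].
have h128 (i : 'I_(ntri M)) : 128 * K ^+ 2 * hT i <= c1.
  by have [+ _] := hi i; rewrite (ler_pdivlMr _ _ b0) mulrC.
have /choice[Fq hFq] : forall i : 'I_(ntri M), exists F : 'I_2 -> quad R, [/\ forall x, eF i x = qmap F x,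
    elem F (hT i) K c1 & forall x, Jac (eF i) x = \matrix_(a, b) qd (F a) b x].
  move=> i; apply: (mesh_elem hc1 hM); have b2 : 0 < 16 * K ^+ 2 by rewrite mulr_gt0 ?exprn_gt0.
  rewrite (ler_pdivlMr _ _ b2); apply: le_trans (h128 i); rewrite mulrC.
  by apply: ler_wpM2r; rewrite ?hT_ge0// ler_wpM2r ?exprn_ge0 ?ler_nat// ltW.
have hF (i : 'I_(ntri M)) x : eF i x = qmap (Fq i) x by have [] := hFq i.
have elF (i : 'I_(ntri M)) : elem (Fq i) (hT i) K c1 by have [] := hFq i.
(* Some [vt] with Psi vt = v is chosen for each [v] in [Vh]; any other [v] is sent to the zero
   function. *)
exists (fun v => if pselect (exists vt, tVh M vt /\ is_Psi M vt v) is left h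
  then @meshfn R M (projT1 (cid h)) else fun=> 0).
move=> v [vt0 hvt0 hpsi0]; case: pselect => [h|[]]; last by exists vt0.
case: (cid h) => /= vt [hvt [hpsi _]]; split; first exact: (meshfn_H10 hA hG hE hF elF h128 hvt).
move=> i; have [vT [[vh hvh vTE] nodes vE]] := hpsi i; have [wh hwh wE] := hvt.2 i.
have [V hV] := hatV_quad hvh; have [W hW] := hatV_quad hwh.
have [_ hs] := hi i; have [_ _ hJ] := hFq i.
have pE a x : refTc x -> co a (vT (eF i x)) = pact (Fq i) (fun b y => co b (vh y)) a x.
  move=> hx; rewrite vTE// /A_T hJ det2E !mxE /pact /pio /qdet /mxact !mxE.
  by case: (ord2P a) => ->; rewrite /co /=; ring.
rewrite (eTE hF); apply: (element_estimate (elF i) hs hV hW).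
- move=> a x hx; rewrite -hF vE; first exact/pE/refTW.
  by rewrite inE (eTE hF) hF; exists x.
- by move=> x /refTW hx; rewrite (meshfnE hG hF)// wE.
- move=> a x hx; have hc := ctnodes_refTc hx.
  by rewrite -pE// nodes// wE.
Qed.
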